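(* Let $f,g,h,U_1,U_2$ satisfy the standing hypotheses (a)–(e) listed in the context, with the constant $\mu\ge1$ appearing there. Let $V^{\pm}$ be the upper and lower value functions and $H^{\pm}$ the upper and lower Hamiltonians of the differential game (defined in the context). Then $V^+$ (respectively $V^-$) is the unique viscosity solution of the upper (respectively lower) Hamilton–Jacobi–Isaacs equation $$\begin{cases}V^{\pm}_t(t,x)+H^{\pm}(t,x,V^{\pm}_x(t,x))=0,&(t,x)\in[0,T]\times\mathbb{R}^n,\\ V^{\pm}(T,x)=h(x),&x\in\mathbb{R}^n,\end{cases}$$ uniqueness being within the class of continuous functions $W:[0,T]\times\mathbb{R}^n\to\mathbb{R}$ for which there is $K>0$ with $|W(t,x)-W(t,y)|\le K(\langle x\rangle\vee\langle y\rangle)^{\mu-1}|x-y|$ for all $t\in[0,T]$, $x,y\in\mathbb{R}^n$ (a class to which $V^\pm$ belong). Further, if the Isaacs condition $$H^+(t,x,p)=H^-(t,x,p),\qquad\forall(t,x,p)\in[0,T]\times\mathbb{R}^n\times\mathbb{R}^n$$ holds, then $$V^+(t,x)=V^-(t,x),\qquad\forall(t,x)\in[0,T]\times\mathbb{R}^n.$$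
   Context: Notation: $\langle x\rangle=\sqrt{1+|x|^2}$; $\langle\cdot,\cdot\rangle$ with two arguments is the Euclidean inner product; $a\vee b=\max\{a,b\}$. Hypotheses. $T>0$ is fixed. There are constants $L,c,\rho_1,\rho_2>0$, $\sigma_1,\sigma_2\ge0$, $\mu\ge1$, $\mu_0,\mu_1,\mu_2\in\mathbb{R}$ such that, for all $t\in[0,T]$, $x,y\in\mathbb{R}^n$, $u_1\in U_1$, $u_2\in U_2$: (a) $U_i\subseteq\mathbb{R}^{m_i}$ is closed and $0\in U_i$, $i=1,2$. (b) $f:[0,T]\times\mathbb{R}^n\times U_1\times U_2\to\mathbb{R}^n$ is continuous, $|f(t,x,u_1,u_2)|\le L(\langle x\rangle+|u_1|^{\sigma_1}+|u_2|^{\sigma_2})$, $|f(t,x,u_1,u_2)-f(t,y,u_1,u_2)|\le[(\langle x\rangle\vee\langle y\rangle)^{\mu_0}+(\langle x\rangle\vee\langle y\rangle)^{\mu_1}|u_1|^{\sigma_1}+(\langle x\rangle\vee\langle y\rangle)^{\mu_2}|u_2|^{\sigma_2}]\,|x-y|$, and $\langle f(t,x,u_1,u_2)-f(t,y,u_1,u_2),x-y\rangle\le L|x-y|^2$. (c) $g:[0,T]\times\mathbb{R}^n\times U_1\times U_2\to\mathbb{R}$ is continuous, $c|u_1|^{\rho_1}-L(\langle x\rangle^\mu+|u_2|^{\rho_2})\le g(t,x,u_1,u_2)\le L(\langle x\rangle^\mu+|u_1|^{\rho_1})-c|u_2|^{\rho_2}$, and $|g(t,x,u_1,u_2)-g(t,y,u_1,u_2)|\le[(\langle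 x\rangle\vee\langle y\rangle)^{\mu-1}+|u_1|^{\rho_1(\mu-1)/\mu}+|u_2|^{\rho_2(\mu-1)/\mu}]\,|x-y|$. (d) $h:\mathbb{R}^n\to\mathbb{R}$ is continuous, $|h(x)-h(y)|\le L(\langle x\rangle\vee\langle y\rangle)^{\mu-1}|x-y|$ and $|h(0)|\le L$. (e) $\sigma_i\mu<\rho_i$, $i=1,2$. Game. For $t\in[0,T]$, $\mathcal{U}_i^1[t,T]$ is the set of measurable $u_i:[t,T]\to U_i$ with $\int_t^T|u_i(s)|ds<\infty$, and $\mathcal{U}_i[t,T]=\mathcal{U}_i^\infty[t,T]$ is the set of essentially bounded measurable $u_i:[t,T]\to U_i$. For $u_i\in\mathcal{U}_i[t,T]$ and $x\in\mathbb{R}^n$, $y(\cdot)=y(\cdot;t,x,u_1,u_2)$ is the solution on $[t,T]$ of $\dot y(s)=f(s,y(s),u_1(s),u_2(s))$, $y(t)=x$, and $$J(t,x;u_1,u_2)=\int_t^Tg(s,y(s),u_1(s),u_2(s))ds+h(y(T)).$$ An Elliott–Kalton strategy for Player 1 is a map $\alpha_1:\mathcal{U}_2^1[t,T]\to\mathcal{U}_1^\infty[t,T]$ that is non-anticipating: for any $u_2,\bar u_2\in\mathcal{U}^1_2[t,T]$ and $\hat t\in[t,T]$, if $u_2=\bar u_2$ a.e. on $[t,\hat t]$ then $\alpha_1[u_2]=\alpha_1[\bar u_2]$ a.e. on $[t,\hat t]$. The set of these is $\mathcal{A}_1[t,T]$. Symmetrically, $\mathcal{A}_2[t,T]$ is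 the set of non-anticipating maps $\alpha_2:\mathcal{U}_1^1[t,T]\to\mathcal{U}_2^\infty[t,T]$. The upper and lower value functions are $$V^+(t,x)=\sup_{\alpha_2\in\mathcal{A}_2[t,T]}\inf_{u_1\in\mathcal{U}_1[t,T]}J(t,x;u_1,\alpha_2[u_1]),\qquad V^-(t,x)=\inf_{\alpha_1\in\mathcal{A}_1[t,T]}\sup_{u_2\in\mathcal{U}_2[t,T]}J(t,x;\alpha_1[u_2],u_2).$$ The upper and lower Hamiltonians are $$H^+(t,x,p)=\inf_{u_1\in U_1}\sup_{u_2\in U_2}[\langle p,f(t,x,u_1,u_2)\rangle+g(t,x,u_1,u_2)],\quad H^-(t,x,p)=\sup_{u_2\in U_2}\inf_{u_1\in U_1}[\langle p,f(t,x,u_1,u_2)\rangle+g(t,x,u_1,u_2)].$$ Viscosity solutions of $V_t+H(t,x,V_x)=0$, $V(T,\cdot)=h$: a continuous $V:[0,T]\times\mathbb{R}^n\to\mathbb{R}$ is a viscosity sub-solution if $V(T,\cdot)\le h$ and, for every continuously differentiable $\varphi$, whenever $(t_0,x_0)\in[0,T)\times\mathbb{R}^n$ is a local maximum of $V-\varphi$, then $\varphi_t(t_0,x_0)+H(t_0,x_0,\varphi_x(t_0,x_0))\ge0$; it is a viscosity super-solution if $V(T,\cdot)\ge h$ and, whenever $(t_0,x_0)\in[0,T)\times\mathbb{R}^n$ is a local minimum of $V-\varphi$, then $\varphi_t(t_0,x_0)+H(t_0,x_0,\varphi_x(t_0,x_0))\le0$; it is a viscosity solution if it is both. *)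

(* Defs.v *)
From HB Require Import structures.
From mathcomp Require Export all_boot all_order all_algebra.
From mathcomp Require Export all_classical all_reals all_analysis.

Set Implicit Arguments.
Unset Strict Implicit.
Unset Printing Implicit Defensive.

Import Order.TTheory GRing.Theory Num.Theory.
Import numFieldNormedType.Exports.

Local Open Scope classical_set_scope.
Local Open Scope ring_scope.

Section Euclidean.
Context {R : realType} {n : nat}.
Implicit Types x y : 'rV[R]_n.

Definition dotp x y : R := \sum_i x 0 i * y 0 i.

(* The library norm `|x| on 'rV[R]_n is the sup norm; the estimates below are
   in the Euclidean norm. Both norms induce the same topology. *)
Definition enorm x : R := Num.sqrt (dotp x x).

Definition japanese x : R := Num.sqrt (1 + enorm x ^+ 2).

Definition japanese_max x y : R := Num.max (japanese x) (japanese y).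

End Euclidean.

(* All functions are total; only their values on [0, T], U1 and U2 matter. *)
Record game (R : realType) (n m1 m2 : nat) := Game {
  horizon : R ;
  ctrl1 : set 'rV[R]_m1 ;
  ctrl2 : set 'rV[R]_m2 ;
  dyn : R -> 'rV[R]_n -> 'rV[R]_m1 -> 'rV[R]_m2 -> 'rV[R]_n ;
  running : R -> 'rV[R]_n -> 'rV[R]_m1 -> 'rV[R]_m2 -> R ;
  terminal : 'rV[R]_n -> R }.

Section StandingHypotheses.
Context {R : realType} {n m1 m2 : nat}.

Definition game_domain (G : game R n m1 m2) :
    set (R * 'rV[R]_n * 'rV[R]_m1 * 'rV[R]_m2) :=
  [set z | [/\ 0 <= z.1.1.1 <= horizon G, ctrl1 G z.1.2 & ctrl2 G z.2]].

(* The library's real power satisfies 0 `^ 0 = 1, which is the convention used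
   for |u|^s when the exponent s is zero. *)
Record standing_hypotheses (G : game R n m1 m2)
    (L c rho1 rho2 sigma1 sigma2 mu mu0 mu1 mu2 : R) : Prop := {
  horizon_gt0 : 0 < horizon G ;
  L_gt0 : 0 < L ;
  c_gt0 : 0 < c ;
  rho1_gt0 : 0 < rho1 ;
  rho2_gt0 : 0 < rho2 ;
  sigma1_ge0 : 0 <= sigma1 ;
  sigma2_ge0 : 0 <= sigma2 ;
  mu_ge1 : 1 <= mu ;
  ctrl1_closed : closed (ctrl1 G) ;
  ctrl2_closed : closed (ctrl2 G) ;
  ctrl1_0 : ctrl1 G 0 ;
  ctrl2_0 : ctrl2 G 0 ;
  dyn_continuous :
    {within game_domain G,
      continuous (fun z => dyn G z.1.1.1 z.1.1.2 z.1.2 z.2)} ;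
  dyn_growth : forall (t : R) x u1 u2,
    0 <= t <= horizon G -> ctrl1 G u1 -> ctrl2 G u2 ->
    enorm (dyn G t x u1 u2) <=
      L * (japanese x + enorm u1 `^ sigma1 + enorm u2 `^ sigma2) ;
  dyn_lipschitz : forall (t : R) x y u1 u2,
    0 <= t <= horizon G -> ctrl1 G u1 -> ctrl2 G u2 ->
    enorm (dyn G t x u1 u2 - dyn G t y u1 u2) <=
      (japanese_max x y `^ mu0
       + japanese_max x y `^ mu1 * enorm u1 `^ sigma1
       + japanese_max x y `^ mu2 * enorm u2 `^ sigma2) * enorm (x - y) ;
  dyn_one_sided_lipschitz : forall (t : R) x y u1 u2,
    0 <= t <= horizon G -> ctrl1 G u1 -> ctrl2 G u2 ->
    dotp (dyn G t x u1 u2 - dyn G t y u1 u2) (x - y) <= L * enorm (x - y) ^+ 2 ;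
  running_continuous :
    {within game_domain G,
      continuous (fun z => running G z.1.1.1 z.1.1.2 z.1.2 z.2)} ;
  running_lower : forall (t : R) x u1 u2,
    0 <= t <= horizon G -> ctrl1 G u1 -> ctrl2 G u2 ->
    c * enorm u1 `^ rho1 - L * (japanese x `^ mu + enorm u2 `^ rho2)
      <= running G t x u1 u2 ;
  running_upper : forall (t : R) x u1 u2,
    0 <= t <= horizon G -> ctrl1 G u1 -> ctrl2 G u2 ->
    running G t x u1 u2
      <= L * (japanese x `^ mu + enorm u1 `^ rho1) - c * enorm u2 `^ rho2 ;
  running_lipschitz : forall (t : R) x y u1 u2,
    0 <= t <= horizon G -> ctrl1 G u1 -> ctrl2 G u2 ->
    `|running G t x u1 u2 - running G t y u1 u2| <=
      (japanese_max x y `^ (mu - 1)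
       + enorm u1 `^ (rho1 * (mu - 1) / mu)
       + enorm u2 `^ (rho2 * (mu - 1) / mu)) * enorm (x - y) ;
  terminal_continuous : continuous (terminal G) ;
  terminal_lipschitz : forall x y,
    `|terminal G x - terminal G y| <=
      L * japanese_max x y `^ (mu - 1) * enorm (x - y) ;
  terminal_0 : `|terminal G 0| <= L ;
  sigma1_rho1 : sigma1 * mu < rho1 ;
  sigma2_rho2 : sigma2 * mu < rho2 }.

End StandingHypotheses.

Section Controls.
Context {R : realType}.
Local Notation leb := (@lebesgue_measure R).

(* A control on [t, T] is a total function, constrained on [t, T] only. *)
Definition measurable_control {m} (U : set 'rV[R]_m) (t T : R)
    (u : R -> 'rV[R]_m) : Prop :=
  (forall i, measurable_fun `[t, T] (fun s => u s 0 i)) /\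
  (forall s, t <= s <= T -> U (u s)).

Definition L1_controls {m} (U : set 'rV[R]_m) (t T : R) :
    set (R -> 'rV[R]_m) :=
  [set u | measurable_control U t T u /\
    (\int[leb]_(s in `[t, T]) (enorm (u s))%:E < +oo)%E].

Definition Linfty_controls {m} (U : set 'rV[R]_m) (t T : R) :
    set (R -> 'rV[R]_m) :=
  [set u | measurable_control U t T u /\
    exists M : R, {ae leb, forall s, t <= s <= T -> enorm (u s) <= M}].

Definition ae_eq_on {m} (t s : R) (u v : R -> 'rV[R]_m) : Prop :=
  {ae leb, forall r, t <= r <= s -> u r = v r}.

(* Elliott-Kalton strategies of a player with control set U against an opponent
   with control set U'. Taking that = T in the last clause, a.e. equal controls
   on [t, T] get a.e. equal responses, so the values of a control outside
   [t, T] play no role. *)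
Definition strategies {m m'} (U : set 'rV[R]_m) (U' : set 'rV[R]_m') (t T : R) :
    set ((R -> 'rV[R]_m') -> (R -> 'rV[R]_m)) :=
  [set alpha |
    (forall u, L1_controls U' t T u -> Linfty_controls U t T (alpha u)) /\
    (forall u v that, L1_controls U' t T u -> L1_controls U' t T v ->
       t <= that <= T ->
       ae_eq_on t that u v -> ae_eq_on t that (alpha u) (alpha v))].

End Controls.

Section Values.
Context {R : realType} {n m1 m2 : nat}.
Local Notation leb := (@lebesgue_measure R).
Variable G : game R n m1 m2.
Local Notation T := (horizon G).
Local Notation U1 := (ctrl1 G).
Local Notation U2 := (ctrl2 G).

(* Caratheodory solutions: the controls are only measurable in time, so the
   equation is understood in integrated form. *)
Definition is_trajectory (t : R) (x : 'rV[R]_n) (u1 : R -> 'rV[R]_m1)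
    (u2 : R -> 'rV[R]_m2) (y : R -> 'rV[R]_n) : Prop :=
  {within `[t, T], continuous y} /\
  forall i,
    leb.-integrable `[t, T] (fun r => (dyn G r (y r) (u1 r) (u2 r) 0 i)%:E) /\
    forall s, t <= s <= T ->
      y s 0 i = x 0 i + \int[leb]_(r in `[t, s]) dyn G r (y r) (u1 r) (u2 r) 0 i.

Definition trajectory t x u1 u2 : R -> 'rV[R]_n :=
  xget (cst 0) [set y | is_trajectory t x u1 u2 y].

Definition payoff t x u1 u2 : R :=
  let y := trajectory t x u1 u2 in
  \int[leb]_(s in `[t, T]) running G s (y s) (u1 s) (u2 s) + terminal G (y T).

(* The infima and suprema are taken in the extended reals: for a given strategy
   of the maximizing player the inner infimum may be -oo, and dually. *)
Definition upper_value (t : R) (x : 'rV[R]_n) : \bar R :=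
  ereal_sup [set ereal_inf [set (payoff t x u1 (alpha2 u1))%:E
                           | u1 in Linfty_controls U1 t T]
            | alpha2 in strategies U2 U1 t T].

Definition lower_value (t : R) (x : 'rV[R]_n) : \bar R :=
  ereal_inf [set ereal_sup [set (payoff t x (alpha1 u2) u2)%:E
                           | u2 in Linfty_controls U2 t T]
            | alpha1 in strategies U1 U2 t T].

Definition upper_hamiltonian (t : R) (x p : 'rV[R]_n) : \bar R :=
  ereal_inf [set ereal_sup [set (dotp p (dyn G t x u1 u2)
                                 + running G t x u1 u2)%:E
                           | u2 in U2]
            | u1 in U1].

Definition lower_hamiltonian (t : R) (x p : 'rV[R]_n) : \bar R :=
  ereal_sup [set ereal_inf [set (dotp p (dyn G t x u1 u2)
                                 + running G t x u1 u2)%:E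
                           | u1 in U1]
            | u2 in U2].

Definition isaacs_condition : Prop :=
  forall (t : R) x p, 0 <= t <= T ->
    upper_hamiltonian t x p = lower_hamiltonian t x p.

End Values.

Section Viscosity.
Context {R : realType} {n : nat}.
Implicit Types (V W : R -> 'rV[R]_n -> R) (phi : R * 'rV[R]_n -> R).

Definition C1 phi : Prop :=
  (forall z, differentiable phi z) /\ (forall v, continuous ('D_v phi)).

Definition time_derivative phi z : R := 'D_(1, 0) phi z.

Definition space_gradient phi z : 'rV[R]_n :=
  \row_i 'D_(0, delta_mx 0 i) phi z.

Definition slab (T : R) : set (R * 'rV[R]_n) := [set z | 0 <= z.1 <= T].

Definition continuous_on_slab (T : R) V : Prop :=
  {within slab T, continuous (fun z => V z.1 z.2)}.

(* Local extrema are relative to [0, T] x R^n, hence one-sided in time at 0. *)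
Definition local_max (T : R) V phi (z0 : R * 'rV[R]_n) : Prop :=
  \forall z \near within (slab T) (nbhs z0),
    V z.1 z.2 - phi z <= V z0.1 z0.2 - phi z0.

Definition local_min (T : R) V phi (z0 : R * 'rV[R]_n) : Prop :=
  \forall z \near within (slab T) (nbhs z0),
    V z0.1 z0.2 - phi z0 <= V z.1 z.2 - phi z.

Variables (T : R) (H : R -> 'rV[R]_n -> 'rV[R]_n -> \bar R) (h : 'rV[R]_n -> R).

Definition viscosity_subsolution V : Prop :=
  [/\ continuous_on_slab T V,
      forall x, V T x <= h x &
      forall phi, C1 phi -> forall (t0 : R) x0, 0 <= t0 < T ->
        local_max T V phi (t0, x0) ->
        (0 <= (time_derivative phi (t0, x0))%:E
              + H t0 x0 (space_gradient phi (t0, x0)))%E].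

Definition viscosity_supersolution V : Prop :=
  [/\ continuous_on_slab T V,
      forall x, h x <= V T x &
      forall phi, C1 phi -> forall (t0 : R) x0, 0 <= t0 < T ->
        local_min T V phi (t0, x0) ->
        ((time_derivative phi (t0, x0))%:E
              + H t0 x0 (space_gradient phi (t0, x0)) <= 0)%E].

Definition viscosity_solution V : Prop :=
  viscosity_subsolution V /\ viscosity_supersolution V.

Definition growth_class (mu : R) V : Prop :=
  continuous_on_slab T V /\
  exists2 K : R, 0 < K &
    forall (t : R) x y, 0 <= t <= T ->
      `|V t x - V t y| <= K * japanese_max x y `^ (mu - 1) * enorm (x - y).

(* The extended-real function V is finite on [0, T] x R^n, and there it is the
   unique viscosity solution in growth_class mu. *)
Definition unique_viscosity_solution (mu : R) (V : R -> 'rV[R]_n -> \bar R) :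
    Prop :=
  exists W, [/\ forall (t : R) x, 0 <= t <= T -> V t x = (W t x)%:E,
    growth_class mu W,
    viscosity_solution W &
    forall W', growth_class mu W' -> viscosity_solution W' ->
      forall (t : R) x, 0 <= t <= T -> W' t x = W t x].

End Viscosity.

(* Main.v *)
Require Import Defs.
From mathcomp Require Import all_boot all_order all_algebra.
From mathcomp Require Import all_classical all_reals all_analysis.
From mathcomp Require Import ring lra measurable_realfun.

(* V^- is reduced to V^+ by exchanging the players, which turns (f, g, h) into
   (f, -g, -h), V^- into -V^+ and H^-(p) into -H^+(-p).

   Coercivity of g in the controls, together with sigma_i mu < rho_i, bounds the
   energies (the integrals of |u_i|^rho_i) of near-optimal responses. V^+ is in the
   growth class because a strategy that is good at x is turned into one that is good
   at y: it answers the truncation of u at level |u|^rho_1 = Z^mu, with Z of the order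
   of <x>, and plays 0 whenever |u| exceeds that level; the excess energy of u then
   pays for the deviation of the path.

   Both inequalities of the dynamic programming principle hold at deterministic
   times. A strategy that makes the generator positive near a point is obtained from
   finitely many control values, since large controls of the opponent are
   dominated by coercivity; a path that leaves the neighbourhood pays for this with
   energy. This gives the viscosity inequalities.

   Uniqueness follows by doubling variables with a weight e^(-l t) <x>, raised to a power
   larger than mu, as penalty. Membership in the growth class bounds the gradients of the test
   functions at the maximum by a multiple of <x>^(mu-1), so that near-optimal
   controls have energy density at most C <x>^mu and the unbounded control
   sets do no harm. *)

Set Implicit Arguments.
Unset Strict Implicit.
Unset Printing Implicit Defensive.

Import Order.TTheory GRing.Theory Num.Theory.
Import numFieldNormedType.Exports.

Local Open Scope classical_set_scope.
Local Open Scope ring_scope.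

(** * Euclidean vectors and real powers *)

(** The obstacle is that the control sets are unbounded, so that compactness in the controls is
    missing; continuity of the Hamiltonians is never established. Each estimate keeps an explicit
    multiple of the energy in reserve instead, and [comparison] evaluates both equations at one
    common pair of controls. Strategies answer with essentially bounded controls, and the infima and
    suprema run over such controls. Every payoff that occurs therefore has bounded controls and a
    bounded path, and all integrands are bounded and measurable. Calculus along paths goes through
    the single lemma [chain_rule]. The one-sided Lipschitz constant of the drift does not depend on
    the controls, so two paths driven by the same controls separate by a fixed factor. This is why a
    strategy is moved from [x] to [y] by keeping the controls equal as long as the opponent stays
    moderate. Both viscosity inequalities come from [progress]. Its set [A] of allowed answers is
    all of [U2] for the supersolution and, with the players exchanged, a single control for the
    subsolution. *)

Section Euclid.
Context {R : realType} {n : nat}.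
Implicit Types (x y z : 'rV[R]_n) (a : R).

Lemma dotpC x y : dotp x y = dotp y x.
Proof. by apply: eq_bigr => i _; rewrite mulrC. Qed.

Lemma dotpDl x y z : dotp (x + y) z = dotp x z + dotp y z.
Proof.
by rewrite /dotp -big_split; apply: eq_bigr => i _; rewrite mxE mulrDl.
Qed.

Lemma dotpZl a x y : dotp (a *: x) y = a * dotp x y.
Proof. by rewrite /dotp mulr_sumr; apply: eq_bigr => i _; rewrite mxE mulrA. Qed.

Lemma dotpNl x y : dotp (- x) y = - dotp x y.
Proof. by rewrite -scaleN1r dotpZl mulN1r. Qed.

Lemma dotpDr x y z : dotp x (y + z) = dotp x y + dotp x z.
Proof. by rewrite dotpC dotpDl !(dotpC x). Qed.

Lemma dotpZr a x y : dotp x (a *: y) = a * dotp x y.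
Proof. by rewrite dotpC dotpZl dotpC. Qed.

Lemma dotpNr x y : dotp x (- y) = - dotp x y.
Proof. by rewrite dotpC dotpNl dotpC. Qed.

Lemma dotpBl x y z : dotp (x - y) z = dotp x z - dotp y z.
Proof. by rewrite dotpDl dotpNl. Qed.

Lemma dotpBr x y z : dotp x (y - z) = dotp x y - dotp x z.
Proof. by rewrite dotpDr dotpNr. Qed.

Lemma dotp0l x : dotp 0 x = 0.
Proof. by rewrite -(scale0r 0) dotpZl mul0r. Qed.

Lemma dotp0r x : dotp x 0 = 0.
Proof. by rewrite dotpC dotp0l. Qed.

Lemma dotpp_ge0 x : 0 <= dotp x x.
Proof. by apply: sumr_ge0 => i _; rewrite -expr2 sqr_ge0. Qed.

Lemma enorm_ge0 x : 0 <= enorm x.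
Proof. exact: sqrtr_ge0. Qed.

Lemma sqr_enorm x : enorm x ^+ 2 = dotp x x.
Proof. by rewrite sqr_sqrtr// dotpp_ge0. Qed.

Lemma enorm0 : enorm (0 : 'rV[R]_n) = 0.
Proof. by rewrite /enorm dotp0l sqrtr0. Qed.

Lemma enormN x : enorm (- x) = enorm x.
Proof. by rewrite /enorm dotpNl dotpNr opprK. Qed.

Lemma enormBC x y : enorm (x - y) = enorm (y - x).
Proof. by rewrite -enormN opprB. Qed.

Lemma enormZ a x : enorm (a *: x) = `|a| * enorm x.
Proof.
by rewrite /enorm dotpZl dotpZr mulrA -expr2 sqrtrM ?sqr_ge0// sqrtr_sqr.
Qed.

Lemma cauchy_schwarz x y : `|dotp x y| <= enorm x * enorm y.
Proof.
have h : dotp x y ^+ 2 <= dotp x x * dotp y y.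
  have [yy0|yy0] := eqVneq (dotp y y) 0.
    have y0 : y = 0.
      apply/rowP => i; rewrite mxE; apply/eqP; rewrite -sqrf_eq0.
      have := yy0; rewrite /dotp => /psumr_eq0P h.
      by rewrite expr2 h// => j _; rewrite -expr2 sqr_ge0.
    by rewrite y0 !dotp0r expr0n mulr0.
  have yp : 0 < dotp y y by rewrite lt_neqAle eq_sym yy0 dotpp_ge0.
  (* The square norm of this vector is [dotp y y] times the Cauchy-Schwarz defect. *)
  have := dotpp_ge0 (dotp y y *: x - dotp x y *: y).
  rewrite !(dotpBl, dotpBr, dotpZl, dotpZr) (dotpC y x) => h.
  rewrite -subr_ge0 -(pmulr_rge0 _ yp); apply: le_trans h _.
  by rewrite le_eqVlt; apply/orP; left; apply/eqP; ring.
rewrite -(@ler_sqr _ `|_|) ?nnegrE ?mulr_ge0 ?enorm_ge0//.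
by rewrite exprMn !sqr_enorm real_normK// num_real.
Qed.

Lemma dotp_le x y : dotp x y <= enorm x * enorm y.
Proof. exact: le_trans (ler_norm _) (cauchy_schwarz _ _). Qed.

Lemma ler_enormD x y : enorm (x + y) <= enorm x + enorm y.
Proof.
rewrite -(@ler_sqr _ (enorm _)) ?nnegrE ?addr_ge0 ?enorm_ge0// sqr_enorm.
rewrite dotpDl !dotpDr (dotpC y x) sqrrD !sqr_enorm.
have := dotp_le x y; lra.
Qed.

Lemma ler_enorm_dist x y : enorm x <= enorm y + enorm (x - y).
Proof. by have := ler_enormD y (x - y); rewrite addrC subrK. Qed.

Lemma coord_le_enorm x i : `|x 0 i| <= enorm x.
Proof.
rewrite -(@ler_sqr _ `|_|) ?nnegrE ?enorm_ge0// sqr_enorm real_normK ?num_real//.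
rewrite /dotp (bigD1 i)//= -expr2 lerDl; apply: sumr_ge0 => j _.
by rewrite -expr2 sqr_ge0.
Qed.

Lemma enorm_le_sum x : enorm x <= \sum_i `|x 0 i|.
Proof.
have s0 : 0 <= \sum_i `|x 0 i| by exact: sumr_ge0.
rewrite -(@ler_sqr _ (enorm _)) ?nnegrE ?enorm_ge0// sqr_enorm expr2 mulr_suml.
apply: ler_sum => i _; rewrite (le_trans (ler_norm _))// normrM.
apply: ler_wpM2l => //; rewrite (bigD1 i)//= lerDl.
exact: sumr_ge0.
Qed.

Lemma mxnorm_le_enorm x : `|x| <= enorm x.
Proof.
rewrite /Num.norm/= mx_normrE; apply/bigmax_le; first exact: enorm_ge0.
by move=> [i j] _ /=; rewrite (ord1 i) coord_le_enorm.
Qed.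

Lemma enorm_le_mxnorm x : enorm x <= n%:R * `|x|.
Proof.
apply: le_trans (enorm_le_sum x) _.
have -> : n%:R * `|x| = \sum_(i < n) `|x| by rewrite sumr_const card_ord mulr_natl.
apply: ler_sum => i _; rewrite {2}/Num.norm/= mx_normrE.
exact: (le_bigmax _ (fun ij : 'I_1 * 'I_n => `|x ij.1 ij.2|) (0, i)).
Qed.

Lemma enorm_eq0 x : enorm x = 0 -> x = 0.
Proof.
move=> x0; apply/eqP; rewrite -normr_eq0; apply/eqP/le_anti.
by rewrite normr_ge0 andbT -x0 mxnorm_le_enorm.
Qed.

Lemma japanese_ge1 x : 1 <= japanese x.
Proof. by rewrite /japanese -{1}(@sqrtr1 R) ler_sqrt ?lerDl ?sqr_ge0// addr_ge0 ?sqr_ge0. Qed.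

Lemma japanese_gt0 x : 0 < japanese x.
Proof. exact: lt_le_trans ltr01 (japanese_ge1 x). Qed.

Lemma sqr_japanese x : japanese x ^+ 2 = 1 + enorm x ^+ 2.
Proof. by rewrite sqr_sqrtr// addr_ge0 ?sqr_ge0. Qed.

Lemma enorm_le_japanese x : enorm x <= japanese x.
Proof.
rewrite -(@ler_sqr _ (enorm _)) ?nnegrE ?enorm_ge0 ?(ltW (japanese_gt0 _))//.
by rewrite sqr_japanese lerDr.
Qed.

Lemma japanese_le_enorm x : japanese x <= 1 + enorm x.
Proof.
rewrite -(@ler_sqr _ (japanese _)) ?nnegrE ?addr_ge0 ?enorm_ge0 ?(ltW (japanese_gt0 _))//.
by rewrite sqr_japanese sqrrD; have := enorm_ge0 x; nra.
Qed.

Lemma le_japanese x y : enorm x <= enorm y -> japanese x <= japanese y.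
Proof.
move=> xy; rewrite ler_sqrt ?addr_ge0 ?sqr_ge0// lerD2l.
by rewrite ler_sqr ?nnegrE ?enorm_ge0.
Qed.

(** [japanese x] is the Euclidean norm of the vector (1, x), hence 1-Lipschitz in [x]. *)
Lemma japanese_dist x y : japanese x <= japanese y + enorm (x - y).
Proof.
have xy := ler_enorm_dist x y.
have d0 := enorm_ge0 (x - y); have y0 := enorm_ge0 y; have x0 := enorm_ge0 x.
have jy := enorm_le_japanese y; have jy1 := japanese_ge1 y.
rewrite -(@ler_sqr _ (japanese _)) ?nnegrE ?addr_ge0 ?(ltW (japanese_gt0 _))//.
rewrite sqr_japanese sqrrD sqr_japanese; nra.
Qed.

Lemma japanese_max_ge1 x y : 1 <= japanese_max x y.
Proof. by rewrite /japanese_max le_max japanese_ge1. Qed.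

Lemma japanese_max_ge0 x y : 0 <= japanese_max x y.
Proof. exact: le_trans ler01 (japanese_max_ge1 x y). Qed.

Lemma japanese_maxC x y : japanese_max x y = japanese_max y x.
Proof. by rewrite /japanese_max maxC. Qed.

Lemma japanese_max_le x y a :
  japanese x <= a -> japanese y <= a -> japanese_max x y <= a.
Proof. by rewrite /japanese_max ge_max => -> ->. Qed.

Lemma coord_dotp x i : dotp x (delta_mx 0 i) = x 0 i.
Proof.
rewrite /dotp (bigD1 i)//= mxE !eqxx mulr1 big1 ?addr0// => j ji.
by rewrite mxE (negbTE ji) andbF mulr0.
Qed.

End Euclid.

Section Powers.
Context {R : realType}.
Implicit Types (a b : R).

Lemma powRDp a r s : 0 < a -> a `^ (r + s) = a `^ r * a `^ s.
Proof. by move=> a0; rewrite powRD// (gt_eqF a0) implybT. Qed.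

Lemma powR_ler r a b : 0 <= r -> 0 <= a -> a <= b -> a `^ r <= b `^ r.
Proof.
by move=> r0 a0 ab; apply: ge0_ler_powR; rewrite ?nnegrE// (le_trans a0).
Qed.

Lemma powR_ger r a b : r <= 0 -> 0 < a -> a <= b -> b `^ r <= a `^ r.
Proof.
move=> r0 a0 ab; have b0 : 0 < b by exact: lt_le_trans ab.
rewrite -[r]opprK (powRN a) (powRN b) lef_pV2 ?posrE.
- by apply: powR_ler => //; [lra | exact: ltW].
- exact: powR_gt0.
- exact: powR_gt0.
Qed.

Lemma powR_ge1 a r : 1 <= a -> 0 <= r -> 1 <= a `^ r.
Proof. by move=> a1 r0; rewrite -[leLHS](powRr0 a) ler_powR. Qed.

Lemma powRD_le a b m : 0 <= m -> 0 <= a -> 0 <= b ->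
  (a + b) `^ m <= 2 `^ m * (a `^ m + b `^ m).
Proof.
move=> m0 a0 b0.
have h2 : 0 <= 2 `^ m :> R by exact: powR_ge0.
have pa := powR_ge0 a m; have pb := powR_ge0 b m.
have [ab|/ltW ba] := lerP a b.
  apply: (@le_trans _ _ ((2 * b) `^ m)); first by apply: powR_ler => //; lra.
  by rewrite powRM// ler_wpM2l// lerDr.
apply: (@le_trans _ _ ((2 * a) `^ m)); first by apply: powR_ler => //; lra.
by rewrite powRM// ler_wpM2l// lerDl.
Qed.

Lemma powR_mulB1 a m : 1 <= m -> 0 <= a -> a `^ (m - 1) * a = a `^ m.
Proof. by move=> m1 a0; rewrite mulrC mulr_powRB1//; lra. Qed.

(** Young-type absorption: for large [a] the lower power loses against [e * a ^ r], and for bounded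
    [a] it is at most a constant. Condition (e) enters the energy estimates in this form. *)
Lemma absorb_powR (s m r e : R) : 0 <= s -> 1 <= m -> s * m < r -> 0 < e ->
  exists2 C, 0 <= C & forall a, 0 <= a -> (a `^ s) `^ m <= e * a `^ r + C.
Proof.
move=> s0 m1 smr e0.
have d0 : 0 < r - s * m by lra.
have m0 : 0 <= m by lra.
have e1 : 0 < e^-1 by rewrite invr_gt0.
(* The threshold solves [e * N ^ (r - s * m) = 1]. *)
pose N : R := e^-1 `^ ((r - s * m)^-1).
have N0 : 0 < N by apply: powR_gt0.
exists (N `^ (s * m)); first exact: powR_ge0.
move=> a a0; rewrite -powRrM.
have pa := powR_ge0 a r; have pN := powR_ge0 N (s * m).
have sm0 : 0 <= s * m by exact: mulr_ge0.
have [aN|/ltW Na] := lerP a N.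
  apply: (le_trans (powR_ler sm0 a0 aN)); rewrite lerDr mulr_ge0//; lra.
rewrite ler_wpDr//.
have ap : 0 < a by exact: lt_le_trans Na.
have -> : r = (s * m) + (r - s * m) by lra.
rewrite powRDp//.
have -> : e * (a `^ (s * m) * a `^ (r - s * m)) =
          a `^ (s * m) * (e * a `^ (r - s * m)) by ring.
rewrite ler_peMr ?powR_ge0// -ler_pdivrMl// mulr1.
apply: (@le_trans _ _ (N `^ (r - s * m))); last by rewrite powR_ler// ltW.
by rewrite /N -powRrM mulVf ?gt_eqF// powRr1// ltW.
Qed.

(* Homogeneous form of [absorb_powR]: all the terms scale like [Z]. *)
Lemma scaled_absorb (s m r e : R) : 0 <= s -> 1 <= m -> s * m < r -> 0 < e ->
  exists2 Z0, 1 <= Z0 & forall Z a, Z0 <= Z -> 0 <= a ->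
    a `^ s <= e * (Z + Z `^ (1 - m) * a `^ r).
Proof.
move=> s0 m1 smr e0.
have r0 : 0 < r by apply: le_lt_trans smr; apply: mulr_ge0 => //; lra.
have m0 : 0 < m by lra.
(* When [a ^ r = Z ^ m], the left side is [Z ^ th]. Since [th < 1] this is at most [e * Z] for
   [Z >= N]. Below that value of [a] the first term dominates, above it the second. *)
pose th := s * m / r.
have th1 : 0 < 1 - th by rewrite subr_gt0 ltr_pdivrMr// mul1r.
have th0 : 0 <= th by rewrite /th divr_ge0 ?mulr_ge0// ltW.
have e1 : 0 < e^-1 by rewrite invr_gt0.
pose N : R := e^-1 `^ ((1 - th)^-1).
exists (1 + N); first by rewrite lerDl powR_ge0.
move=> Z a NZ a0.
have N0 : 0 < N by apply: powR_gt0.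
have Z0 : 0 < Z by lra.
have Zth : Z `^ th <= e * Z.
  have -> : e * Z = Z `^ th * (e * Z `^ (1 - th)).
    rewrite mulrCA -powRDp//.
    by rewrite addrC subrK powRr1// ltW.
  rewrite ler_peMr ?powR_ge0// -ler_pdivrMl// mulr1.
  apply: (@le_trans _ _ (N `^ (1 - th))); last by rewrite powR_ler//; lra.
  by rewrite /N -powRrM mulVf ?gt_eqF// powRr1// ltW.
have pZ := powR_ge0 Z (1 - m); have pa := powR_ge0 a r.
have pZa : 0 <= Z `^ (1 - m) * a `^ r by exact: mulr_ge0.
have [aZ|Za] := lerP (a `^ r) (Z `^ m).
  apply: (@le_trans _ _ (e * Z)); last by rewrite ler_wpM2l ?lerDl// ltW.
  apply: le_trans Zth.
  have -> : a `^ s = (a `^ r) `^ (s / r).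
    by rewrite -powRrM mulrCA divff ?gt_eqF// mulr1.
  have -> : Z `^ th = (Z `^ m) `^ (s / r).
    by rewrite -powRrM /th mulrCA mulrA.
  by apply: powR_ler => //; rewrite divr_ge0// ltW.
apply: (@le_trans _ _ (e * (Z `^ (1 - m) * a `^ r))); last first.
  by rewrite ler_wpM2l ?lerDr// ltW.
have ap : 0 < a `^ r by exact: le_lt_trans (powR_ge0 _ _) Za.
have -> : a `^ s = a `^ r * (a `^ r) `^ (s / r - 1).
  rewrite mulrC -[X in _ * X]powRr1// -powRDp//.
  by rewrite subrK -powRrM mulrCA divff ?gt_eqF// mulr1.
rewrite mulrC mulrA ler_wpM2r//.
have sr : s / r <= 1.
  by rewrite ler_pdivrMr// mul1r (le_trans _ (ltW smr))// ler_peMr.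
have h1 : (a `^ r) `^ (s / r - 1) <= (Z `^ m) `^ (s / r - 1).
  apply: powR_ger (ltW Za); [lra | exact: powR_gt0].
apply: (le_trans h1).
have -> : (Z `^ m) `^ (s / r - 1) = Z `^ ((1 - m) + (th - 1)).
  by rewrite -powRrM; congr powR; rewrite /th; field; rewrite gt_eqF.
rewrite powRDp// mulrC ler_wpM2r//.
by rewrite powRDp// powR_inv1 ?(ltW Z0)// ler_pdivrMr.
Qed.

(** Compare [a ^ r] with [Z ^ m]: below, the power [(m - 1) / m] gives [Z ^ (m - 1)]; above, the
    missing factor [(a ^ r) ^ (- 1 / m)] is at most [1 / Z]. This splits the control terms in the
    Lipschitz bound for [g] at a free scale [Z]. *)
Lemma absorb_rootm (r m Z a : R) : 1 <= m -> 0 < Z -> 0 <= a ->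
  a `^ (r * (m - 1) / m) <= Z `^ (m - 1) + Z^-1 * a `^ r.
Proof.
move=> m1 Z0 a0; have m0 : 0 < m by lra.
have pa := powR_ge0 a r; have pZ := powR_ge0 Z (m - 1).
have iZ : 0 < Z^-1 by rewrite invr_gt0.
have -> : a `^ (r * (m - 1) / m) = (a `^ r) `^ ((m - 1) / m).
  by rewrite -powRrM mulrA.
have e0 : 0 <= (m - 1) / m by rewrite divr_ge0//; lra.
have [aZ|Za] := lerP (a `^ r) (Z `^ m).
  apply: (@le_trans _ _ (Z `^ (m - 1))); last by rewrite lerDl mulr_ge0// ltW.
  have -> : Z `^ (m - 1) = (Z `^ m) `^ ((m - 1) / m).
    by rewrite -powRrM; congr powR; field; rewrite gt_eqF.
  exact: powR_ler.
have ap : 0 < a `^ r by exact: le_lt_trans (powR_ge0 _ _) Za.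
have -> : (m - 1) / m = 1 + - m^-1 by field; rewrite gt_eqF.
rewrite (powRDp _ _ ap) powRr1// ler_wpDl// mulrC ler_wpM2r//.
have {1}-> : Z = (Z `^ m) `^ m^-1.
  by rewrite -powRrM divff ?gt_eqF// powRr1// ltW.
rewrite -powRN; apply: powR_ger (ltW Za); last exact: powR_gt0.
by rewrite oppr_le0 invr_ge0 ltW.
Qed.

End Powers.

(** * Integrals of bounded measurable functions *)

Section Integrals.
Context {R : realType}.
Local Notation leb := (@lebesgue_measure R).
Implicit Types (a b c M : R) (f g : R -> R).

Lemma ae_mono (P Q : R -> Prop) : (forall s, P s -> Q s) ->
  {ae leb, forall s, P s} -> {ae leb, forall s, Q s}.
Proof. by move=> PQ; apply: (@filterS _ _ (ae_filter_ringOfSetsType leb)). Qed.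

Lemma ae_mono2 (P Q S : R -> Prop) : (forall s, P s -> Q s -> S s) ->
  {ae leb, forall s, P s} -> {ae leb, forall s, Q s} -> {ae leb, forall s, S s}.
Proof. by move=> PQ; apply: (@filterS2 _ _ (ae_filter_ringOfSetsType leb)). Qed.

Lemma ae_true (P : R -> Prop) : (forall s, P s) -> {ae leb, forall s, P s}.
Proof. by move=> h; exact/aeW. Qed.

Definition ess_bounded_on a b f :=
  exists M, {ae leb, forall s, a <= s <= b -> `|f s| <= M}.

(** The class of all integrands below. It is closed under sums, products, nonnegative powers and
    measurable case distinctions, and on a compact interval it lies in L1, so integrability never
    has to be argued separately. *)
Definition bounded_measurable a b f :=
  measurable_fun `[a, b] f /\ ess_bounded_on a b f.

Local Notation bm := bounded_measurable.

Definition integral_on a b f : R := \int[leb]_(s in `[a, b]) f s.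

Local Notation int := integral_on.

Lemma mem_itvcc a b s : `[a, b]%classic s <-> a <= s <= b.
Proof. by rewrite /= in_itv. Qed.

Lemma lebesgue_itvcc a b : a <= b -> leb `[a, b]%classic = (b - a)%:E.
Proof.
move=> ab; rewrite lebesgue_measure_itv/= lte_fin.
by move: ab; rewrite le_eqVlt => /predU1P[->|->]; rewrite ?ltxx ?subrr.
Qed.

Lemma bounded_measurable_integrable a b f :
  bm a b f -> leb.-integrable `[a, b] (EFin \o f).
Proof.
move=> [mf [M hM]].
have mE : measurable_fun (`[a, b]%classic : set R) (EFin \o f) by exact/measurable_EFinP.
have [ba|ab] := ltP b a.
  by rewrite set_itv_ge ?bnd_simp -?ltNge//; exact: integrable_set0.
apply/integrableP; split => //.
apply: (@le_lt_trans _ _ (\int[leb]_(x in `[a, b]) (cst (`|M|%:E) x))%E).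
  apply: ae_ge0_le_integral => //.
  - by apply: measurableT_comp.
  - by move=> s _; rewrite lee_fin.
  - apply: (ae_mono _ hM) => s /= hs /mem_itvcc /hs h.
    by rewrite lee_fin (le_trans h) ?ler_norm.
by rewrite integral_cst//= lebesgue_itvcc// -EFinM ltry.
Qed.

Lemma bm_sub a b c d f : a <= c -> d <= b -> bm a b f -> bm c d f.
Proof.
move=> ac db [mf [M hM]]; split.
  apply: measurable_funS mf => //; apply: subset_itv; rewrite bnd_simp//.
exists M; apply: (ae_mono _ hM) => s hs /andP[cs sd]; apply: hs.
by rewrite (le_trans ac)// (le_trans sd).
Qed.

Lemma bm_dom a b f g : measurable_fun `[a, b] f -> bm a b g ->
  (forall s, a <= s <= b -> `|f s| <= `|g s|) -> bm a b f.
Proof.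
move=> mf [_ [M hM]] fg; split => //; exists M.
by apply: (ae_mono _ hM) => s hs abs; rewrite (le_trans (fg _ abs))// hs.
Qed.

Lemma bm_ext a b f g : (forall s, a <= s <= b -> f s = g s) ->
  bm a b f -> bm a b g.
Proof.
move=> fg [mf [M hM]]; split.
  by apply: eq_measurable_fun mf => s /set_mem /mem_itvcc /fg.
by exists M; apply: (ae_mono _ hM) => s hs abs; rewrite -fg// hs.
Qed.

Lemma bm_cst a b c : bm a b (fun=> c).
Proof. by split => //; exists `|c|; apply/aeW => s _. Qed.

Lemma bmD a b f g : bm a b f -> bm a b g -> bm a b (fun s => f s + g s).
Proof.
move=> [mf [M hM]] [mg [N hN]]; split; first exact: measurable_funD.
exists (M + N); apply: (ae_mono2 _ hM hN) => s {}hM {}hN abs.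
by rewrite (le_trans (ler_normD _ _))// lerD ?hM ?hN.
Qed.

Lemma bmM a b f g : bm a b f -> bm a b g -> bm a b (fun s => f s * g s).
Proof.
move=> [mf [M hM]] [mg [N hN]]; split; first exact: measurable_funM.
exists (M * N); apply: (ae_mono2 _ hM hN) => s {}hM {}hN abs.
by rewrite normrM ler_pM ?hM ?hN.
Qed.

Lemma bmZ a b c f : bm a b f -> bm a b (fun s => c * f s).
Proof. by move=> bf; apply: bmM bf; exact: bm_cst. Qed.

Lemma bmN a b f : bm a b f -> bm a b (fun s => - f s).
Proof.
by move=> /(bmZ (-1)); apply: bm_ext => s _; rewrite mulN1r.
Qed.

Lemma bmB a b f g : bm a b f -> bm a b g -> bm a b (fun s => f s - g s).
Proof. by move=> bf bg; apply: bmD bf _; exact: bmN. Qed.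

Lemma bm_sum a b k (f : 'I_k -> R -> R) :
  (forall i, bm a b (f i)) -> bm a b (fun s => \sum_i f i s).
Proof.
move=> bf; elim: k f bf => [|k IH] f bf.
  by apply: bm_ext (bm_cst a b 0) => s _; rewrite big_ord0.
apply: (@bm_ext _ _ (fun s => f ord0 s + \sum_i f (lift ord0 i) s)).
  by move=> s _; rewrite big_ord_recl.
by apply: bmD => //; apply: (IH (fun i => f (lift ord0 i))).
Qed.

Lemma bm_norm a b f : bm a b f -> bm a b (fun s => `|f s|).
Proof.
move=> bf; apply: (bm_dom _ bf) => [|s _]; last by rewrite normr_id.
by apply: measurableT_comp => //; case: bf.
Qed.

Lemma bm_powR a b f r : 0 <= r -> bm a b f -> (forall s, a <= s <= b -> 0 <= f s) ->
  bm a b (fun s => f s `^ r).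
Proof.
move=> r0 [mf [M hM]] f0; split.
  by apply: (measurableT_comp (measurable_powR _) mf).
exists (M `^ r); apply: (ae_mono _ hM) => s hs abs.
rewrite ger0_norm ?powR_ge0// powR_ler ?f0//.
by rewrite (le_trans (ler_norm _))// hs.
Qed.

Lemma bm_continuous a b f : {within `[a, b], continuous f} -> bm a b f.
Proof.
move=> cf; split.
  exact: subspace_continuous_measurable_fun.
have [ba|ab] := ltP b a.
  by exists 0; apply/aeW => s; have := ltW ba; lra.
have [M /= [_ hM]] : bounded_set (f @` `[a, b]).
  by apply: compact_bounded; apply: continuous_compact cf (@segment_compact _ a b).
exists (M + 1); apply/aeW => s abs; apply: hM; first by rewrite ltrDl.
by exists s => //; exact/mem_itvcc.
Qed.

Lemma bm_if a b (P : R -> bool) f g : measurable_fun `[a, b] P ->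
  bm a b f -> bm a b g -> bm a b (fun s => if P s then f s else g s).
Proof.
move=> mP [mf [M hM]] [mg [N hN]]; split.
  apply: (measurable_fun_if _ mP) => //.
  - by apply: measurable_funS mf => //; apply: subIsetl.
  - by apply: measurable_funS mg => //; apply: subIsetl.
exists (Num.max M N); apply: (ae_mono2 _ hM hN) => s {}hM {}hN abs.
by rewrite le_max; case: ifP => _; rewrite ?hM ?hN ?orbT.
Qed.

Lemma int_eq a b f g : (forall s, a <= s <= b -> f s = g s) ->
  int a b f = int a b g.
Proof. by move=> fg; apply: eq_Rintegral => s /set_mem /mem_itvcc /fg. Qed.

Lemma int_ae a b f g : measurable_fun `[a, b] f -> measurable_fun `[a, b] g ->
  {ae leb, forall s, a <= s <= b -> f s = g s} -> int a b f = int a b g.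
Proof.
move=> mf mg fg; congr fine; apply: ae_eq_integral => //.
- exact/measurable_EFinP.
- exact/measurable_EFinP.
- by apply: (ae_mono _ fg) => s h /mem_itvcc /h ->.
Qed.

Lemma intD a b f g : bm a b f -> bm a b g ->
  int a b (fun s => f s + g s) = int a b f + int a b g.
Proof.
by move=> bf bg; apply: RintegralD => //; exact: bounded_measurable_integrable.
Qed.

Lemma intZ a b c f : bm a b f -> int a b (fun s => c * f s) = c * int a b f.
Proof.
by move=> bf; apply: RintegralZl => //; exact: bounded_measurable_integrable.
Qed.

Lemma intB a b f g : bm a b f -> bm a b g ->
  int a b (fun s => f s - g s) = int a b f - int a b g.
Proof.
by move=> bf bg; apply: RintegralB => //; exact: bounded_measurable_integrable.
Qed.

Lemma intN a b f : bm a b f -> int a b (fun s => - f s) = - int a b f.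
Proof.
move=> bf; rewrite -mulN1r -intZ//.
by apply: int_eq => s _; rewrite mulN1r.
Qed.

Lemma int_sum a b k (f : 'I_k -> R -> R) : (forall i, bm a b (f i)) ->
  int a b (fun s => \sum_i f i s) = \sum_i int a b (f i).
Proof.
move=> bf; elim: k f bf => [|k IH] f bf.
  rewrite big_ord0 (@int_eq _ _ _ (fun=> 0)); last by move=> s _; rewrite big_ord0.
  by rewrite /int /integral_on Rintegral_cst// mul0r.
rewrite big_ord_recl -IH// -intD//; last exact: bm_sum.
by apply: int_eq => s _; rewrite big_ord_recl.
Qed.

Lemma int_cst a b c : a <= b -> int a b (fun=> c) = c * (b - a).
Proof. by move=> ab; rewrite /integral_on Rintegral_cst//= lebesgue_itvcc. Qed.

Lemma int_le a b f g : bm a b f -> bm a b g ->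
  (forall s, a <= s <= b -> f s <= g s) -> int a b f <= int a b g.
Proof.
move=> bf bg fg; apply: le_Rintegral => //.
- exact: bounded_measurable_integrable bf.
- exact: bounded_measurable_integrable bg.
Qed.

Lemma int_ge0 a b f : (forall s, a <= s <= b -> 0 <= f s) -> 0 <= int a b f.
Proof. by move=> f0; apply: Rintegral_ge0 => s /mem_itvcc /f0. Qed.

Lemma int_norm a b f : bm a b f -> `|int a b f| <= int a b (fun s => `|f s|).
Proof.
by move=> bf; apply: le_normr_Rintegral => //; exact: bounded_measurable_integrable.
Qed.

Lemma int_set1 a f : int a a f = 0.
Proof. by rewrite /integral_on set_itv1 Rintegral_set1. Qed.

Lemma int_split a b c f : a <= c <= b -> bm a b f ->
  int a b f = int a c f + int c b f.
Proof.
move=> /andP[ac cb] bf.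
have bi := bounded_measurable_integrable bf.
have h := @Rintegral_itvB _ f (BLeft a) (BRight b) c bi.
rewrite /integral_on -[X in _ + X]Rintegral_itv_obnd_cbnd.
  by rewrite -h ?bnd_simp// addrC subrK.
apply: integrableS bi => //.
by apply: subset_itv; rewrite bnd_simp.
Qed.

Lemma int_sub_le a b c d f : a <= c -> c <= d -> d <= b -> bm a b f ->
  (forall s, a <= s <= b -> 0 <= f s) -> int c d f <= int a b f.
Proof.
move=> ac cd db bf f0.
rewrite (@int_split a b c)//; last by rewrite ac (le_trans cd).
rewrite (@int_split c b d) ?cd//; last exact: bm_sub bf.
have h1 : 0 <= int a c f by apply: int_ge0 => s /andP[? ?]; apply: f0; lra.
have h2 : 0 <= int d b f by apply: int_ge0 => s /andP[? ?]; apply: f0; lra.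
lra.
Qed.

Lemma int_ess_bound a b f M : a <= b -> measurable_fun `[a, b] f ->
  {ae leb, forall s, a <= s <= b -> `|f s| <= M} ->
  `|int a b f| <= M * (b - a).
Proof.
move=> ab mf hM.
have bf : bm a b f by split => //; exists M.
apply: (le_trans (int_norm bf)).
have bi := bounded_measurable_integrable (bm_norm bf).
have bc := bounded_measurable_integrable (bm_cst a b M).
have [_] := integrableP _ _ _ bi => bfi.
rewrite -lee_fin /integral_on /Rintegral fineK; last exact: integrable_fin_num.
apply: (@le_trans _ _ (\int[leb]_(x in `[a, b]) (cst (`|M|%:E) x))%E).
  apply: ae_ge0_le_integral => //.
  - by case/integrableP: bi.
  - by move=> s _; rewrite lee_fin.
  - apply: (ae_mono _ hM) => s /= hs /mem_itvcc /hs h.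
    by rewrite lee_fin (le_trans h) ?ler_norm.
rewrite integral_cst//= lebesgue_itvcc// -EFinM lee_fin.
have [->|ab'] := eqVneq a b; first by rewrite subrr !mulr0.
(* An almost everywhere bound forces [M >= 0] only on an interval with nonempty interior, where
   [M < 0] would turn the interval into a null set. The one-point interval has just been treated. *)
suff M0 : 0 <= M by rewrite ger0_norm.
rewrite leNgt; apply/negP => M0.
have : leb `[a, b]%classic = 0%E.
  have [N [mN N0 hN]] := hM.
  apply: (@subset_measure0 _ _ _ leb _ N) => // s /mem_itvcc abs.
  apply: hN => /= /(_ abs) h.
  by have := le_trans (normr_ge0 (f s)) h; rewrite leNgt M0.
rewrite lebesgue_itvcc// => -[/eqP]; rewrite subr_eq0 => /eqP ba.
by move: ab'; rewrite ba eqxx.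
Qed.

(* With [l] half of the mean of [f], [f <= l + l^(1-m) f^m] integrates to
   a power mean inequality. *)
Lemma int_jensen a b f m : 1 <= m -> a < b -> bm a b f ->
  (forall s, a <= s <= b -> 0 <= f s) ->
  int a b f `^ m <= 2 `^ m * (b - a) `^ (m - 1) * int a b (fun s => f s `^ m).
Proof.
move=> m1 ab bf f0.
have m0 : 0 <= m by lra.
set I := int a b f; have I0 : 0 <= I by exact: int_ge0.
have bfm : bm a b (fun s => f s `^ m) by exact: bm_powR.
set P := int a b _; have P0 : 0 <= P by apply: int_ge0 => s _; exact: powR_ge0.
have ba : 0 < b - a by lra.
move: I0; rewrite le_eqVlt => /predU1P[I0|I0].
  rewrite -I0 powR0 ?gt_eqF//; last lra.
  by rewrite !mulr_ge0 ?powR_ge0.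
pose l := I / (2 * (b - a)).
have l0 : 0 < l by rewrite divr_gt0// mulr_gt0.
have hl : forall s, a <= s <= b -> f s <= l + l `^ (1 - m) * f s `^ m.
  move=> s abs; have fs0 := f0 _ abs.
  have pl : 0 <= l `^ (1 - m) by exact: powR_ge0.
  have [fl|lf] := lerP (f s) l.
    by rewrite ler_wpDr// mulr_ge0// powR_ge0.
  rewrite ler_wpDl ?(ltW l0)//.
  have fs : 0 < f s by lra.
  have -> : l `^ (1 - m) * f s `^ m = f s * (l `^ (1 - m) * f s `^ (m - 1)).
    by rewrite -(mulr_powRB1 fs0); [ring | lra].
  rewrite ler_peMr// (le_trans _ (_ : l `^ (1 - m) * l `^ (m - 1) <= _))//.
    by rewrite -powRDp// addrC subrKA subrr powRr0.
  by rewrite ler_wpM2l// powR_ler// ?(ltW l0) ?(ltW lf)//; lra.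
have hI : I <= I / 2 + l `^ (1 - m) * P.
  apply: (@le_trans _ _ (int a b (fun s => l + l `^ (1 - m) * f s `^ m))).
    by apply: int_le => //; apply: bmD (bm_cst _ _ _) (bmZ _ bfm).
  rewrite intD; [|exact: bm_cst|exact: bmZ].
  rewrite int_cst ?(ltW ab)// intZ// lerD2r /l.
  by rewrite le_eqVlt; apply/orP; left; apply/eqP; field; rewrite gt_eqF.
have lm : l `^ (m - 1) * l `^ (1 - m) = 1.
  by rewrite -powRDp// addrC subrKA subrr powRr0.
have h2 : l `^ (m - 1) * (I / 2) <= P.
  have h : I / 2 <= l `^ (1 - m) * P by lra.
  have := ler_wpM2l (powR_ge0 l (m - 1)) h.
  by rewrite [leRHS]mulrA lm mul1r.
have lE : I = l * 2 * (b - a) by rewrite /l; field; rewrite gt_eqF.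
have h3 : l `^ m * (b - a) <= P.
  apply: le_trans h2; rewrite -(@powR_mulB1 _ l) ?(ltW l0)// [in leRHS]lE.
  by rewrite le_eqVlt; apply/orP; left; apply/eqP; field.
clearbody l; rewrite {1}lE !powRM ?mulr_ge0 ?(ltW l0) ?(ltW ba)//.
rewrite -(@powR_mulB1 _ (b - a)) ?(ltW ba)//.
have -> : l `^ m * 2 `^ m * ((b - a) `^ (m - 1) * (b - a)) =
  2 `^ m * (b - a) `^ (m - 1) * (l `^ m * (b - a)) by ring.
by rewrite ler_wpM2l// mulr_ge0 ?powR_ge0.
Qed.

End Integrals.

(** * Gradients and the chain rule *)

Section VectorIntegrals.
Context {R : realType}.
Local Notation leb := (@lebesgue_measure R).
Local Notation bm := bounded_measurable.
Local Notation int := integral_on.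

Definition bounded_measurable_vec {k} (a b : R) (w : R -> 'rV[R]_k) :=
  forall i, bm a b (fun s => w s 0 i).

Local Notation vbm := bounded_measurable_vec.

Lemma vbm_sub k (a b c d : R) (w : R -> 'rV[R]_k) :
  a <= c -> d <= b -> vbm a b w -> vbm c d w.
Proof. by move=> ac db bw i; apply: bm_sub (bw i). Qed.

Lemma bm_dotp k (a b : R) (v w : R -> 'rV[R]_k) :
  vbm a b v -> vbm a b w -> bm a b (fun s => dotp (v s) (w s)).
Proof. by move=> bv bw; apply: bm_sum => i; exact: bmM. Qed.

Lemma bm_enorm k (a b : R) (w : R -> 'rV[R]_k) :
  vbm a b w -> bm a b (fun s => enorm (w s)).
Proof.
move=> bw; apply: (@bm_ext _ _ _ (fun s => dotp (w s) (w s) `^ 2^-1)).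
  by move=> s _; rewrite powR12_sqrt// dotpp_ge0.
by apply: bm_powR; rewrite ?invr_ge0//; [exact: bm_dotp | move=> *; exact: dotpp_ge0].
Qed.

Lemma vbmB k (a b : R) (v w : R -> 'rV[R]_k) :
  vbm a b v -> vbm a b w -> vbm a b (fun s => v s - w s).
Proof.
move=> bv bw i; apply: bm_ext (bmB (bv i) (bw i)) => s _.
by rewrite !mxE.
Qed.

Lemma vbm_cst k (a b : R) (v : 'rV[R]_k) : vbm a b (fun=> v).
Proof. by move=> i; exact: bm_cst. Qed.

Lemma int_dotp k (a b : R) (v : 'rV[R]_k) (w : R -> 'rV[R]_k) : vbm a b w ->
  int a b (fun s => dotp v (w s)) = \sum_i v 0 i * int a b (fun s => w s 0 i).
Proof.
move=> bw; rewrite int_sum; last by move=> i; exact: bmZ.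
by apply: eq_bigr => i _; rewrite intZ.
Qed.

(** A function with zero derivative is constant. Flatness is asked relative to [[a, b]], hence
    one-sided at the ends, because the function to which it is applied is controlled on that
    interval only. *)
Lemma flat_constant (F : R -> R) (a b : R) : a <= b ->
  (forall r, a <= r <= b -> forall e : R, 0 < e -> exists2 d : R, 0 < d &
     forall q, a <= q <= b -> `|q - r| < d -> `|F q - F r| <= e * `|q - r|) ->
  F b = F a.
Proof.
move=> ab hF.
(* Composition with this 1-Lipschitz retraction onto [[a, b]] gives a function with zero derivative
   on the whole line. *)
pose cl x := Num.max a (Num.min x b).
have clab x : a <= cl x <= b.
  rewrite /cl; apply/andP; split; first by rewrite le_max lexx.
  by rewrite ge_max ab ge_min lexx orbT.
have cl_lip x y : `|cl x - cl y| <= `|x - y|.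
  have h1 := ler_norm (x - y); have := ler_norm (y - x); rewrite distrC => h2.
  rewrite /cl; case: (leP x b) => xb; case: (leP y b) => yb;
    rewrite ?(max_idPr ab) ?subrr ?normr_ge0//;
    case: (leP a x) => ax; case: (leP a y) => ay;
    rewrite ?subrr ?normr_ge0// ler_norml; apply/andP; split; lra.
have : (F \o cl) b = (F \o cl) a.
  apply: is_derive_0_is_cst => x.
  have h : (fun h => h^-1 *: ((F \o cl) (h *: 1 + x) - (F \o cl) x)) @ 0^' --> (0 : R).
    apply/cvgrPdist_le => e e0.
    have [d d0 hd] := hF _ (clab x) _ e0.
    exists d => //= h; rewrite /ball_ /= sub0r normrN => hd' h0.
    rewrite sub0r normrN normrZ normfV ler_pdivrMl ?normr_gt0//.
    rewrite mulrC /= [h *: 1]mulr1.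
    have lh : `|cl (h + x) - cl x| <= `|h|.
      by apply: le_trans (cl_lip _ _) _; rewrite addrK.
    apply: (le_trans (hd _ (clab _) (le_lt_trans lh hd'))).
    by rewrite ler_wpM2l// ltW.
  apply: DeriveDef.
    by apply/cvg_ex; exists 0.
  exact: cvg_lim.
by rewrite /= /cl minxx (max_idPr _)// min_l// maxxx.
Qed.

End VectorIntegrals.
Notation vbm := bounded_measurable_vec (only parsing).

(** * Continuously differentiable functions carried with their gradients *)

Section Gradients.
Context {R : realType} {n : nat}.
Local Notation V := (R * 'rV[R]_n)%type.
Implicit Types (phi psi : V -> R).

(** The time derivative and the gradient are data, so that a test function built by the rules below
    comes with its derivatives already computed. [C1_gradP] and [C1_C1_grad] translate from and to
    the [C1] of the definition of viscosity solutions. *)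
Definition C1_grad phi (gt : V -> R) (gx : V -> 'rV[R]_n) : Prop :=
  [/\ continuous gt, forall i, continuous (fun z => gx z 0 i : R),
      forall z, differentiable phi z &
      forall z h, 'd phi z h = gt z * h.1 + dotp (gx z) h.2].

Lemma continuous_sum (T : topologicalType) k (f : 'I_k -> T -> R) :
  (forall i, continuous (f i)) -> continuous (fun z => \sum_i f i z).
Proof.
move=> cf; elim: k f cf => [|k IH] f cf.
  by rewrite (_ : (fun _ => _) = cst 0) ?funeqE// => [|z]; [exact: cst_continuous|rewrite big_ord0].
rewrite (_ : (fun _ => _) = (f ord0 \+ (fun z => \sum_i f (lift ord0 i) z))).
  by move=> z; apply: cvgD; [exact: cf | apply: IH => i; exact: cf].
by rewrite funeqE => z; rewrite big_ord_recl.
Qed.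

Lemma continuous_dotp (T : topologicalType) (f g : T -> 'rV[R]_n) :
  (forall i, continuous (fun z => f z 0 i)) ->
  (forall i, continuous (fun z => g z 0 i)) -> continuous (fun z => dotp (f z) (g z)).
Proof.
move=> cf cg; apply: continuous_sum => i z.
by apply: cvgM; [exact: cf | exact: cg].
Qed.

Lemma C1_grad_derive phi gt gx z v : C1_grad phi gt gx ->
  'D_v phi z = gt z * v.1 + dotp (gx z) v.2.
Proof. by case=> _ _ d e; rewrite deriveE// e. Qed.

Lemma C1_gradP phi gt gx : C1_grad phi gt gx ->
  [/\ C1 phi, forall z, time_derivative phi z = gt z &
      forall z, space_gradient phi z = gx z].
Proof.
move=> hc; have [c1 c2 d e] := hc; split.
- split => // v.
  rewrite (_ : 'D_v phi = (fun z => gt z * v.1 + dotp (gx z) v.2)); last first.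
    by rewrite funeqE => z; rewrite (C1_grad_derive _ _ hc).
  move=> z; apply: cvgD.
    by apply: cvgM; [exact: c1 | exact: cst_continuous].
  apply: (@continuous_dotp _ gx (fun=> v.2)) => // i.
  exact: cst_continuous.
- by move=> z; rewrite /time_derivative (C1_grad_derive _ _ hc) mulr1 dotp0r addr0.
- move=> z; apply/rowP => i; rewrite mxE (C1_grad_derive _ _ hc) mulr0 add0r.
  by rewrite coord_dotp.
Qed.

Lemma row_sum_coord (x : 'rV[R]_n) : x = \sum_i x 0 i *: delta_mx 0 i.
Proof. exact: row_sum_delta. Qed.

(** The differential is linear, and every direction is a combination of the time direction and the
    coordinate directions, along which it is given by the partial derivatives. *)
Lemma C1_C1_grad phi : C1 phi ->
  C1_grad phi (time_derivative phi) (space_gradient phi).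
Proof.
move=> [d c]; split => //.
- exact: c.
- move=> i; rewrite (_ : (fun _ => _) = 'D_(0, delta_mx 0 i) phi); first exact: c.
  by rewrite funeqE => z; rewrite mxE.
- move=> z [a v] /=.
  have -> : (a, v) = a *: (1, 0) + \sum_i v 0 i *: (0, delta_mx 0 i) :> V.
    have hs : \sum_i v 0 i *: ((0, delta_mx 0 i) : V) = (0, v) :> V.
      rewrite [in RHS](row_sum_coord v).
      elim/big_ind2: _ => [|x y x' y' -> ->|i _] //.
        by rewrite /GRing.add/= /add_pair /= addr0.
      by rewrite /GRing.scale/= /scale_pair/= scaler0.
    rewrite hs; rewrite /GRing.scale/= /scale_pair /GRing.add/= /add_pair/=.
    by rewrite scaler0 add0r addr0 [_%:A]mulr1.
  rewrite linearD linearZ linear_sum; congr (_ + _).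
    by rewrite /time_derivative deriveE// mulrC.
  apply: eq_bigr => i _; by rewrite linearZ /= mxE deriveE// mulrC.
Qed.

Lemma C1_grad_ext phi psi gt gt' gx gx' : C1_grad phi gt gx ->
  phi =1 psi -> gt =1 gt' -> gx =1 gx' -> C1_grad psi gt' gx'.
Proof. by move=> h /funext <- /funext <- /funext <-. Qed.

Lemma C1_grad_cst c : C1_grad (fun=> c) (fun=> 0) (fun=> 0).
Proof.
split => [z|i z|z|z h]; try exact: cst_continuous.
  exact: differentiable_cst.
by rewrite diff_cst dotp0l mul0r addr0.
Qed.

Lemma C1_gradD phi psi gt gt' gx gx' :
  C1_grad phi gt gx -> C1_grad psi gt' gx' ->
  C1_grad (fun z => phi z + psi z) (fun z => gt z + gt' z) (fun z => gx z + gx' z).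
Proof.
move=> [c1 c2 d e] [c1' c2' d' e']; split => [z|i z|z|z h].
- by apply: cvgD; [exact: c1 | exact: c1'].
- rewrite (_ : (fun _ => _) = (fun z => gx z 0 i + gx' z 0 i)).
    by apply: cvgD; [exact: c2 | exact: c2'].
  by rewrite funeqE => y; rewrite mxE.
- exact: differentiableD.
- have := @diffD _ _ _ phi psi z (d z) (d' z).
  move=> /(congr1 (fun f => f h)) /= ->.
  rewrite [LHS]/GRing.add/=.
  by rewrite e e' dotpDl mulrDl addrACA.
Qed.

Lemma C1_gradM phi psi gt gt' gx gx' :
  C1_grad phi gt gx -> C1_grad psi gt' gx' ->
  C1_grad (fun z => phi z * psi z) (fun z => phi z * gt' z + psi z * gt z)
    (fun z => phi z *: gx' z + psi z *: gx z).
Proof.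
move=> [c1 c2 d e] [c1' c2' d' e'].
have cp : continuous phi by move=> z; exact: differentiable_continuous.
have cq : continuous psi by move=> z; exact: differentiable_continuous.
split => [z|i z|z|z h].
- by apply: cvgD; apply: cvgM; [exact: cp | exact: c1' | exact: cq | exact: c1].
- rewrite (_ : (fun _ => _) = (fun z => phi z * gx' z 0 i + psi z * gx z 0 i)).
    by apply: cvgD; apply: cvgM; [exact: cp | exact: c2' | exact: cq | exact: c2].
  by rewrite funeqE => y; rewrite !mxE.
- exact: differentiableM.
- have := @diffM _ _ phi psi z (d z) (d' z).
  move=> /(congr1 (fun f => f h)) /= ->.
  rewrite [LHS]/GRing.add/= /GRing.scale/= e e' dotpDl !dotpZl; ring.
Qed.

Lemma C1_grad_comp (f f' : R -> R) phi gt gx : C1_grad phi gt gx ->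
  (forall z, is_derive (phi z) 1 f (f' (phi z))) ->
  continuous (fun z => f' (phi z)) ->
  C1_grad (fun z => f (phi z)) (fun z => f' (phi z) * gt z)
    (fun z => f' (phi z) *: gx z).
Proof.
move=> [c1 c2 d e] df cf.
have dF z : differentiable f (phi z) by apply/derivable1_diffP; case: (df z).
split => [z|i z|z|z h].
- by apply: cvgM; [exact: cf | exact: c1].
- rewrite (_ : (fun _ => _) = (fun z => f' (phi z) * gx z 0 i)).
    by apply: cvgM; [exact: cf | exact: c2].
  by rewrite funeqE => y; rewrite mxE.
- exact: (@differentiable_comp _ _ _ _ phi f).
- have := @diff_comp _ _ _ _ phi f z (d z) (dF z).
  move=> /(congr1 (fun f => f h)) /= ->.
  have fE : 'D_1 f (phi z) = f' (phi z) by exact: derive_val.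
  rewrite diff1E// e derive1E fE dotpZl /GRing.scale/=; ring.
Qed.

Lemma C1_grad_linear (f : {linear V -> R}) gt gx : continuous f ->
  (forall z, f z = gt * z.1 + dotp gx z.2) -> C1_grad f (fun=> gt) (fun=> gx).
Proof.
move=> cf fE; split => [z|i z|z|z h]; try exact: cst_continuous.
  exact: linear_differentiable.
by rewrite diff_lin.
Qed.

Lemma C1_grad_time : C1_grad (fun z => z.1) (fun=> 1) (fun=> 0).
Proof.
have @f : {linear V -> R}.
  by exists (fun z : V => z.1); do 2![eexists]; do ?[constructor].
apply: (@C1_grad_linear f) => [z|z]; first exact: cvg_fst.
by rewrite mul1r dotp0l addr0.
Qed.

Lemma C1_grad_coord i : C1_grad (fun z => z.2 0 i) (fun=> 0) (fun=> delta_mx 0 i).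
Proof.
have @f : {linear V -> R}.
  by exists (fun z : V => z.2 0 i); do 2![eexists]; do ?[constructor];
     rewrite ?mxE// => ? *; rewrite ?mxE//; move=> ?; rewrite !mxE.
apply: (@C1_grad_linear f) => [z|z]; last by rewrite mul0r add0r dotpC coord_dotp.
apply: (@continuous_comp _ _ _ snd (fun N : 'rV[R]_n => N 0 i)); first exact: cvg_snd.
exact: coord_continuous.
Qed.

Lemma C1_gradZ c phi gt gx : C1_grad phi gt gx ->
  C1_grad (fun z => c * phi z) (fun z => c * gt z) (fun z => c *: gx z).
Proof.
move=> h; apply: C1_grad_ext (C1_gradM (C1_grad_cst c) h) _ _ _ => z //=.
  by rewrite mulr0 addr0.
by rewrite scaler0 addr0.
Qed.

Lemma C1_gradN phi gt gx : C1_grad phi gt gx ->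
  C1_grad (fun z => - phi z) (fun z => - gt z) (fun z => - gx z).
Proof.
move=> h; apply: C1_grad_ext (C1_gradZ (-1) h) _ _ _ => z.
- by rewrite mulN1r.
- by rewrite mulN1r.
- by rewrite scaleN1r.
Qed.

Lemma C1_grad_sum k (phi : 'I_k -> V -> R) (gt : 'I_k -> V -> R)
    (gx : 'I_k -> V -> 'rV[R]_n) :
  (forall i, C1_grad (phi i) (gt i) (gx i)) ->
  C1_grad (fun z => \sum_i phi i z) (fun z => \sum_i gt i z) (fun z => \sum_i gx i z).
Proof.
move=> h; elim: k phi gt gx h => [|k IH] phi gt gx h.
  by apply: C1_grad_ext (C1_grad_cst 0) _ _ _ => z; rewrite big_ord0.
have := C1_gradD (h ord0) (IH _ _ _ (fun i => h (lift ord0 i))).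
by move=> /C1_grad_ext; apply => z; rewrite big_ord_recl.
Qed.

Lemma C1_grad_sqdist (a : 'rV[R]_n) :
  C1_grad (fun z => dotp (z.2 - a) (z.2 - a)) (fun=> 0) (fun z => 2 *: (z.2 - a)).
Proof.
have h i : C1_grad (fun z => z.2 0 i - a 0 i) (fun=> 0) (fun=> delta_mx 0 i).
  apply: C1_grad_ext (C1_gradD (C1_grad_coord i) (C1_grad_cst (- a 0 i))) _ _ _ => z //=.
    by rewrite addr0.
  by rewrite addr0.
have := C1_grad_sum (fun i => C1_gradM (h i) (h i)).
move=> /C1_grad_ext; apply => z.
- by apply: eq_bigr => i _; rewrite !mxE.
- by rewrite big1// => i _; rewrite !mulr0 addr0.
- rewrite [in RHS](row_sum_coord (z.2 - a)) scaler_sumr; apply: eq_bigr => i _.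
  by rewrite !mxE -scalerDl scalerA; congr (_ *: _); ring.
Qed.

(* The smoothed distance e^(-l t) sqrt(k + |x|^2), used to compare
   trajectories without Gronwall's lemma. *)
Definition damped_norm (l k : R) (z : V) : R :=
  expR (- l * z.1) * Num.sqrt (k + dotp z.2 z.2).

Lemma C1_grad_damped_norm (l k : R) : 0 < k ->
  C1_grad (damped_norm l k) (fun z => - l * damped_norm l k z)
    (fun z => (expR (- l * z.1) / Num.sqrt (k + dotp z.2 z.2)) *: z.2).
Proof.
move=> k0.
have hs : C1_grad (fun z => k + dotp z.2 z.2) (fun=> 0) (fun z => 2 *: z.2).
  apply: C1_grad_ext (C1_gradD (C1_grad_cst k) (C1_grad_sqdist 0)) _ _ _ => z;
    by rewrite ?subr0 ?addr0 ?add0r.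
have pos (z : V) : 0 < k + dotp z.2 z.2 by rewrite ltr_pwDl// dotpp_ge0.
have cs : continuous (fun z : V => k + dotp z.2 z.2).
  by case: hs => _ _ d _ z; exact: differentiable_continuous.
have hq := @C1_grad_comp Num.sqrt (fun r => (2 * Num.sqrt r)^-1) _ _ _ hs.
have {}hq := hq (fun z => is_derive1_sqrt (pos z)).
have {}hq : C1_grad (fun z => Num.sqrt (k + dotp z.2 z.2)) (fun=> 0)
    (fun z => (Num.sqrt (k + dotp z.2 z.2))^-1 *: z.2).
  apply: C1_grad_ext (hq _) _ _ _ => // [z|z|z].
  - apply: cvgV; first by rewrite gt_eqF// mulr_gt0// sqrtr_gt0.
    apply: cvgM; first exact: cst_continuous.
    apply: (@continuous_comp _ _ _ (fun z : V => k + dotp z.2 z.2) Num.sqrt); first exact: cs.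
    exact: sqrt_continuous.
  - by rewrite mulr0.
  - rewrite scalerA; congr (_ *: _); field.
    by rewrite gt_eqF// sqrtr_gt0.
have he : C1_grad (fun z => expR (- l * z.1)) (fun z => - l * expR (- l * z.1)) (fun=> 0).
  have hl := C1_gradZ (- l) C1_grad_time.
  have := @C1_grad_comp expR expR _ _ _ hl (fun z => is_derive_expR _).
  move=> h; apply: C1_grad_ext (h _) _ _ _ => // [z|z|z].
  - apply: (@continuous_comp _ _ _ (fun z : V => - l * z.1) expR); last exact: continuous_expR.
    by case: hl => _ _ d _; exact: differentiable_continuous.
  - by rewrite mulr1 mulrC.
  - by rewrite !scaler0.
apply: C1_grad_ext (C1_gradM he hq) _ _ _ => // z.
  by rewrite /damped_norm; ring.
by rewrite scaler0 addr0 scalerA.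
Qed.

Lemma C1_grad_expansion phi gt gx z (e : R) : C1_grad phi gt gx -> 0 < e ->
  exists2 d, 0 < d & forall h : V, `|h| < d ->
    `|phi (z + h) - phi z - (gt z * h.1 + dotp (gx z) h.2)| <= e * `|h|.
Proof.
move=> [_ _ d E] e0.
have := diff_locallyxC (d z); set k := 'o _ => hk.
have /(_ _ e0) := littleoP [littleo of k] => /nbhs_ballP[r /= r0 hr].
exists r => // h hlt; have := hr h; rewrite -ball_normE /= sub0r normrN => /(_ hlt).
rewrite hk -E; congr (`|_| <= _); ring.
Qed.

End Gradients.

(** * The chain rule along a path with bounded measurable velocity *)

Section ChainRule.
Context {R : realType} {n : nat}.
Local Notation leb := (@lebesgue_measure R).
Local Notation bm := bounded_measurable.
Local Notation int := integral_on.
Local Notation V := (R * 'rV[R]_n)%type.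

Lemma within_comp (A : set R) (W : topologicalType) (c : V -> W) (y : R -> 'rV[R]_n) :
  continuous c -> {within A, continuous y} ->
  {within A, continuous (fun r => c (r, y r))}.
Proof.
move=> cc cy x.
have cid := @continuous_subspaceT _ _ A (@id R) (fun z => cvg_id) x.
have h : continuous_at (x : subspace A) (fun r : subspace A => ((r : R), y r) : V).
  move=> S /= [[P Q] /= [hP hQ] hPQ].
  have h1 : nbhs (x : subspace A) ((@id R : subspace A -> R) @^-1` P) by exact: cid.
  have h2 : nbhs (x : subspace A) ((y : subspace A -> _) @^-1` Q) by exact: cy.
  by apply: filterS2 h1 h2 => r Pr Qr; apply: (hPQ (r, y r)).
exact: (cvg_comp _ _ h (cc _)).
Qed.

Lemma within_eps (f : R -> R) (a b : R) : {within `[a, b], continuous f} ->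
  forall r, a <= r <= b -> forall e : R, 0 < e -> exists2 d : R, 0 < d &
  forall q, a <= q <= b -> `|q - r| < d -> `|f q - f r| <= e.
Proof.
move=> cf r rab e e0.
have : `[a, b]%classic r by exact/mem_itvcc.
move/subspace_continuousP : cf => /(_ r) /[apply] /cvgrPdist_le /(_ _ e0).
move=> [d /= d0 hd]; exists d => // q qab qr.
by rewrite distrC; apply: hd; [rewrite /= distrC | exact/mem_itvcc].
Qed.

Lemma vbm_bound (a b : R) (w : R -> 'rV[R]_n) : vbm a b w ->
  exists2 B, 0 <= B & {ae leb, forall s, a <= s <= b -> enorm (w s) <= B}.
Proof.
move=> /bm_enorm [_ [B hB]]; exists `|B| => //.
apply: ae_mono hB => s h /h; rewrite ger0_norm ?enorm_ge0// => {}h.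
exact: le_trans (ler_norm B).
Qed.

Lemma int_increment (t T : R) (y w : R -> 'rV[R]_n) : vbm t T w ->
  (forall s, t <= s <= T -> forall i, y s 0 i = y t 0 i + int t s (fun r => w r 0 i)) ->
  forall p q, t <= p -> p <= q -> q <= T -> forall i,
    y q 0 i - y p 0 i = int p q (fun r => w r 0 i).
Proof.
move=> bw hy p q tp pq qT i.
rewrite (hy q) ?(hy p) ?tp ?(le_trans pq) ?(le_trans tp)//.
rewrite (@int_split _ t q p) ?tp//; last by apply: bm_sub (bw i).
by ring.
Qed.

Lemma lipschitz_increment (t T : R) (y w : R -> 'rV[R]_n) : vbm t T w ->
  (forall s, t <= s <= T -> forall i, y s 0 i = y t 0 i + int t s (fun r => w r 0 i)) ->
  exists2 C, 0 <= C & forall p q, t <= p <= T -> t <= q <= T ->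
    enorm (y q - y p) <= C * `|q - p|.
Proof.
move=> bw hy; have [B B0 hB] := vbm_bound bw.
exists (n%:R * B); first by rewrite mulr_ge0.
have main p q : t <= p -> p <= q -> q <= T -> enorm (y q - y p) <= n%:R * B * (q - p).
  move=> tp pq qT; apply: le_trans (enorm_le_sum _) _.
  have -> : n%:R * B * (q - p) = \sum_(i < n) (B * (q - p)).
    by rewrite sumr_const card_ord mulr_natl mulrnAl.
  apply: ler_sum => i _; rewrite !mxE (int_increment bw hy)//.
  apply: int_ess_bound => //; first by case: (bm_sub tp qT (bw i)).
  apply: ae_mono hB => s h /andP[ps sq].
  by apply: le_trans (coord_le_enorm _ _) (h _); rewrite (le_trans tp)// (le_trans sq).
move=> p q /andP[tp pT] /andP[tq qT].
have [pq|/ltW qp] := leP p q; first by rewrite ger0_norm ?subr_ge0// main.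
by rewrite enormBC distrC ger0_norm ?subr_ge0// main.
Qed.

(** No differentiability of [y] is used. The difference of [phi (s, y s)] and the integral of [psi]
    is flat at each [r]: with the gradient frozen at [(r, y r)], the integral of [g0 + v0 . w] is
    exactly the linear part of the increment of [phi], and both errors are of smaller order than
    [q - r]. *)
Lemma chain_rule (phi gt : V -> R) (gx : V -> 'rV[R]_n) (t T : R)
    (y w : R -> 'rV[R]_n) :
  t <= T -> C1_grad phi gt gx -> vbm t T w -> {within `[t, T], continuous y} ->
  (forall s, t <= s <= T -> forall i, y s 0 i = y t 0 i + int t s (fun r => w r 0 i)) ->
  bm t T (fun r => gt (r, y r) + dotp (gx (r, y r)) (w r)) /\
  phi (T, y T) = phi (t, y t) +
    int t T (fun r => gt (r, y r) + dotp (gx (r, y r)) (w r)).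
Proof.
move=> tT hc bw cy hy; have [c1 c2 _ _] := hc.
set psi := fun r => _.
have bgx : vbm t T (fun r => gx (r, y r)).
  by move=> i; apply: bm_continuous; exact: (within_comp (c2 i) cy).
have bgt : bm t T (fun r => gt (r, y r)).
  by apply: bm_continuous; exact: (within_comp c1 cy).
have bpsi : bm t T psi by apply: bmD bgt (bm_dotp bgx bw).
split => //.
have [B B0 hB] := vbm_bound bw.
have [C C0 hC] := lipschitz_increment bw hy.
suff : phi (T, y T) - int t T psi = phi (t, y t) - int t t psi.
  by rewrite int_set1; lra.
apply: (@flat_constant _ (fun s => phi (s, y s) - int t s psi)) => // r rtT e e0.
(* Half of [e] goes to the expansion of [phi], with [1 + C] a Lipschitz constant of
   [s |-> (s, y s)]; the other half goes to the variation of the gradient, with [B] the bound on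
   [w]. *)
pose e1 := e / 2 / (1 + C); pose e2 := e / 2 / (1 + B).
have C1 : 0 < 1 + C by lra.
have B1 : 0 < 1 + B by lra.
have e10 : 0 < e1 by rewrite !divr_gt0.
have e20 : 0 < e2 by rewrite !divr_gt0.
have [d1 d10 hd1] := C1_grad_expansion (r, y r) hc e10.
pose D (z : V) := `|gt z - gt (r, y r)| + \sum_i `|gx z 0 i - gx (r, y r) 0 i|.
have cD : continuous D.
  move=> z; apply: cvgD.
    by apply: cvg_norm; apply: cvgB; [exact: c1 | exact: cvg_cst].
  apply: continuous_sum => i {}z.
  by apply: cvg_norm; apply: cvgB; [exact: c2 | exact: cvg_cst].
have [d2 d20 hd2] := within_eps (within_comp cD cy) rtT e20.
have Dr : D (r, y r) = 0.
  by rewrite /D subrr normr0 add0r big1// => i _; rewrite subrr normr0.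
exists (Num.min (d1 / (1 + C)) d2); first by rewrite lt_min divr_gt0//= d20.
set d := Num.min _ _.
set g0 := gt (r, y r) in hd1 *; set v0 := gx (r, y r) in hd1 *.
have K p q : t <= p -> p <= q -> q <= T -> `|p - r| < d -> `|q - r| < d ->
    `|int p q psi - (g0 * (q - p) + dotp v0 (y q - y p))| <= e / 2 * (q - p).
  move=> tp pq qT pr qr.
  have bw' := vbm_sub tp qT bw.
  have bl : bm p q (fun s => g0 + dotp v0 (w s)).
    by apply: bmD (bm_cst _ _ _) (bm_dotp (vbm_cst _ _ _) bw').
  have -> : g0 * (q - p) + dotp v0 (y q - y p) = int p q (fun s => g0 + dotp v0 (w s)).
    rewrite intD; [|exact: bm_cst|exact: (bm_dotp (vbm_cst _ _ _) bw')].
    rewrite int_cst// int_dotp//; congr (_ + _); apply: eq_bigr => i _.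
    by rewrite -(int_increment bw hy)// !mxE.
  have bpq := bm_sub tp qT bpsi.
  rewrite -intB//; apply: int_ess_bound => //; first by case: (bmB bpq bl).
  apply: ae_mono hB => s hs /andP[ps sq].
  have stT : t <= s <= T by rewrite (le_trans tp)//= (le_trans sq).
  have ws := hs stT.
  have sr : `|s - r| < d2.
    move: pr qr; rewrite !lt_min => /andP[_ pr] /andP[_ qr].
    by move: pr qr; rewrite !ltr_norml => /andP[? ?] /andP[? ?]; apply/andP; split; lra.
  have := hd2 _ stT sr; rewrite Dr subr0 => hD.
  have {hD} : D (s, y s) <= e2 by exact: le_trans (ler_norm _) hD.
  rewrite /D -/g0 -/v0 => hD.
  have sum0 : 0 <= \sum_i `|gx (s, y s) 0 i - v0 0 i| by exact: sumr_ge0.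
  have n0 := normr_ge0 (gt (s, y s) - g0).
  have -> : psi s - (g0 + dotp v0 (w s)) =
      (gt (s, y s) - g0) + dotp (gx (s, y s) - v0) (w s).
    by rewrite /psi dotpBl; ring.
  apply: le_trans (ler_normD _ _) _.
  have h1 : `|dotp (gx (s, y s) - v0) (w s)| <= e2 * B.
    apply: le_trans (cauchy_schwarz _ _) _.
    apply: ler_pM; rewrite ?enorm_ge0//.
    apply: le_trans (enorm_le_sum _) _; under eq_bigr do rewrite !mxE.
    lra.
  have e2E : e2 * (1 + B) = e / 2 by rewrite /e2 divfK// gt_eqF.
  nra.
move=> q qtT qr.
have [/andP[tq qT] /andP[tr rT]] := (qtT, rtT).
pose h : V := (q - r, y q - y r).
have hn : `|h| <= (1 + C) * `|q - r|.
  rewrite prod_normE /= ge_max; have := hC _ _ rtT qtT => hq.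
  have a0 := normr_ge0 (q - r).
  apply/andP; split; first by nra.
  apply: le_trans (mxnorm_le_enorm _) _; apply: le_trans hq _.
  by rewrite ler_wpM2r// lerDr.
have hE : (r, y r) + h = (q, y q).
  by rewrite /h /GRing.add/= /add_pair/= addrC subrK addrC subrK.
have hlt : `|h| < d1.
  apply: (le_lt_trans hn); move: qr; rewrite lt_min => /andP[+ _].
  by rewrite ltr_pdivlMr// mulrC.
have := hd1 _ hlt; rewrite hE /= => hphi.
have hphi' : `|phi (q, y q) - phi (r, y r) - (g0 * (q - r) + dotp v0 (y q - y r))|
    <= e / 2 * `|q - r|.
  apply: (le_trans hphi); apply: le_trans (_ : e1 * ((1 + C) * `|q - r|) <= _).
    by rewrite ler_wpM2l// ltW.
  by rewrite mulrA /e1 divfK// gt_eqF.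
have rr : `|r - r| < d by rewrite subrr normr0 lt_min divr_gt0//= d20.
have [rq|/ltW qr'] := leP r q.
  have := K r q tr rq qT rr qr.
  have -> : int t q psi = int t r psi + int r q psi.
    by apply: int_split; [rewrite tr rq | exact: bm_sub bpsi].
  have nE : `|q - r| = q - r by rewrite ger0_norm ?subr_ge0.
  move=> h1; rewrite nE in hphi' *.
  have -> : phi (q, y q) - (int t r psi + int r q psi) - (phi (r, y r) - int t r psi)
    = (phi (q, y q) - phi (r, y r) - (g0 * (q - r) + dotp v0 (y q - y r)))
     - (int r q psi - (g0 * (q - r) + dotp v0 (y q - y r))) by ring.
  apply: le_trans (ler_normB _ _) _; lra.
have := K q r tq qr' rT qr rr.
have -> : int t r psi = int t q psi + int q r psi.
  by apply: int_split; [rewrite tq qr' | exact: bm_sub bpsi].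
have nE : `|q - r| = r - q by rewrite distrC ger0_norm ?subr_ge0.
move=> h1; rewrite nE in hphi' *.
have -> : phi (q, y q) - int t q psi - (phi (r, y r) - (int t q psi + int q r psi))
  = (phi (q, y q) - phi (r, y r) - (g0 * (q - r) + dotp v0 (y q - y r)))
   + (int q r psi - (g0 * (r - q) + dotp v0 (y r - y q))).
  by rewrite -(opprB (y q) (y r)) dotpNr; ring.
apply: le_trans (ler_normD _ _) _; lra.
Qed.

End ChainRule.

(** * Picard iteration *)

Section Measurability.
Context {R : realType}.
Local Notation leb := (@lebesgue_measure R).

(** [F] is continuous only relative to [D], and nothing is assumed on the measurability of [D].
    Since [gam] stays in [D], the set where [F] exceeds [c] along [gam] is a countable union of
    preimages of balls centred in a dense family. *)
Lemma measurable_comp_dense (M : pseudoMetricType R) (K : countType) (q : K -> M)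
    (D : set M) (F : M -> R) (a b : R) (gam : R -> M) :
  (forall x (e : R), 0 < e -> exists k, ball (q k) e x) ->
  {within D, continuous F} ->
  (forall s, a <= s <= b -> D (gam s)) ->
  (forall k (e : R), measurable (`[a, b]%classic `&` [set s | ball (q k) e (gam s)])) ->
  measurable_fun `[a, b] (F \o gam).
Proof.
move=> dq cF gD mball.
apply: (measurability _ (RGenOInfty.measurableE R)) => _ [_ [c ->] <-].
(* A ball is kept when [F > c] on its part inside [D]. Radii below [e / 2] suffice: such a ball
   containing [gam s] lies within distance [e] of [gam s]. *)
pose good (i : K * nat) :=
  forall z, D z -> ball (q i.1) (i.2.+1%:R^-1) z -> c < F z.
pose S (i : K * nat) : set R := if asbool (good i)
  then `[a, b]%classic `&` [set s | ball (q i.1) (i.2.+1%:R^-1) (gam s)] else set0.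
rewrite (_ : _ `&` _ = \bigcup_i S i); last first.
  apply/seteqP; split => s /=.
    move=> [/mem_itvcc sab]; rewrite in_itv/= andbT => cs.
    have Dg := gD _ sab.
    have : (F \o gam) s - c > 0 by rewrite subr_gt0.
    move/subspace_continuousP : cF => /(_ _ Dg) /cvgrPdist_lt /[apply].
    move=> /nbhs_ballP [e /= e0 he].
    have [j hj] : exists j : nat, j.+1%:R^-1 < e / 2.
      have e1 : 0 < (e / 2)^-1 by rewrite invr_gt0 divr_gt0.
      exists (Num.bound (e / 2)^-1); rewrite invf_plt ?posrE ?divr_gt0//.
      by apply: lt_trans (archi_boundP (ltW e1)) _; rewrite ltr_nat.
    have j0 : 0 < j.+1%:R^-1 :> R by rewrite invr_gt0.
    have [k hk] := dq (gam s) _ j0.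
    exists (k, j) => //; rewrite /S asboolT.
      by split => //=; exact/mem_itvcc.
    move=> z Dz /= bz.
    have : ball (gam s) e z.
      have : ball (gam s) (j.+1%:R^-1 + j.+1%:R^-1) z.
        by apply: ball_triangle bz; exact: ball_sym.
      have h2 : j.+1%:R^-1 + j.+1%:R^-1 <= e.
        by rewrite -mulr2n -[_ *+ 2]mulr_natr -ler_pdivlMr// ltW.
      exact: (le_ball h2).
    move=> /he /(_ Dz) hz; have : `|F (gam s) - F z| < F (gam s) - c := hz.
    by rewrite ltr_norml => /andP[_]; lra.
  move=> [[k j] _]; rewrite /S; case: asboolP => // hg [/= sab hb].
  split => //; rewrite in_itv/= andbT; apply: hg => //=.
  exact/gD/mem_itvcc.
apply: countable_bigcupT_measurable; first exact: countableP.
by move=> i; rewrite /S; case: asboolP.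
Qed.

Lemma rat_near (x e : R) : 0 < e -> exists p : rat, `|ratr p - x| < e.
Proof.
move=> e0; have xe : x - e < x + e by lra.
have [p] := rat_in_itvoo xe.
rewrite in_itv/= => /andP[h1 h2]; exists p.
by rewrite ltr_norml; apply/andP; split; lra.
Qed.

Lemma rat_row_near k (x : 'rV[R]_k) (e : R) : 0 < e ->
  exists p : 'rV[rat]_k, ball (map_mx ratr p : 'rV[R]_k) e x.
Proof.
move=> e0; have h i := rat_near (x 0 i) e0.
exists (\row_i projT1 (cid (h i))); split => // i j.
rewrite /ball/= !mxE (ord1 i) /=.
by case: cid => p.
Qed.

Lemma measurable_row_ball k (a b e : R) (u : R -> 'rV[R]_k) (p : 'rV[R]_k) :
  (forall i, measurable_fun `[a, b] (fun s => u s 0 i)) ->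
  measurable (`[a, b]%classic `&` [set s | ball p e (u s)]).
Proof.
move=> mu; have [e0|e0] := leP e 0.
  rewrite [X in _ `&` X](_ : _ = set0) ?setI0//.
  by apply/seteqP; split => // s /= [/lt_geF]; rewrite e0.
rewrite (_ : _ `&` _ = `[a, b]%classic `&`
    \bigcap_(i in [set: 'I_k]) (`[a, b]%classic `&` [set s | ball (p 0 i) e (u s 0 i)])).
  apply: measurableI => //; apply: fin_bigcap_measurable; first exact: finite_finset.
  move=> i _; rewrite /ball /=.
  have -> : [set s | `|p 0 i - u s 0 i| < e] =
      (fun s => u s 0 i) @^-1` [set x | `|p 0 i - x| < e] by [].
  by apply: mu => //; exact: (measurable_ball (p 0 i) e).
apply/seteqP; split => s /=.
  rewrite {1}/ball /=; move=> [sab [_ h]]; split => // i _; split => //=; exact: h.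
move=> [sab h]; split => //; split => // i j; rewrite (ord1 i).
by have [] := h j I.
Qed.

Lemma measurable_ball1 (a b e p : R) :
  measurable (`[a, b]%classic `&` [set s | ball p e s]).
Proof.
have [e0|e0] := leP e 0.
  rewrite [X in _ `&` X](_ : _ = set0) ?setI0//.
  apply/seteqP; split => // s /=; rewrite /ball/= => h.
  by have := le_lt_trans (normr_ge0 _) h; rewrite ltNge e0.
by apply: measurableI => //; exact: (measurable_ball p e).
Qed.

Lemma measurable_comp4 n m1 m2 (D : set (R * 'rV[R]_n * 'rV[R]_m1 * 'rV[R]_m2))
    (F : R * 'rV[R]_n * 'rV[R]_m1 * 'rV[R]_m2 -> R) (a b : R) y u1 u2 :
  {within D, continuous F} ->
  (forall s, a <= s <= b -> D (s, y s, u1 s, u2 s)) ->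
  (forall i, measurable_fun `[a, b] (fun s => y s 0 i)) ->
  (forall i, measurable_fun `[a, b] (fun s => u1 s 0 i)) ->
  (forall i, measurable_fun `[a, b] (fun s => u2 s 0 i)) ->
  measurable_fun `[a, b] (fun s => F (s, y s, u1 s, u2 s)).
Proof.
move=> cF hD my mu1 mu2.
pose q (k : rat * 'rV[rat]_n * 'rV[rat]_m1 * 'rV[rat]_m2) :
  (R * 'rV[R]_n * 'rV[R]_m1 * 'rV[R]_m2)%type :=
  (ratr k.1.1.1, map_mx ratr k.1.1.2, map_mx ratr k.1.2, map_mx ratr k.2).
apply: (@measurable_comp_dense _ _ q D F a b (fun s => (s, y s, u1 s, u2 s))) => //.
  move=> [[[x1 x2] x3] x4] e e0.
  have [k1 h1] := rat_near x1 e0; have [k2 h2] := rat_row_near x2 e0.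
  have [k3 h3] := rat_row_near x3 e0; have [k4 h4] := rat_row_near x4 e0.
  by exists (k1, k2, k3, k4).
move=> k e.
rewrite (_ : _ `&` _ = (`[a, b]%classic `&` [set s | ball (q k).1.1.1 e s]) `&`
   (`[a, b]%classic `&` [set s | ball (q k).1.1.2 e (y s)]) `&`
   (`[a, b]%classic `&` [set s | ball (q k).1.2 e (u1 s)]) `&`
   (`[a, b]%classic `&` [set s | ball (q k).2 e (u2 s)])); last first.
  apply/seteqP; split => s /=.
    by move=> [sab [[[h1 h2] h3] h4]]; split.
  by move=> [[[[? ?] [? ?]] [? ?]] [? ?]]; split.
apply: measurableI; last exact: measurable_row_ball.
apply: measurableI; last exact: measurable_row_ball.
apply: measurableI; last exact: measurable_row_ball.
exact: measurable_ball1.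
Qed.

End Measurability.

(** * Solutions for bounded, globally Lipschitz right-hand sides *)

Section Picard.
Context {R : realType} {n : nat}.
Local Notation bm := bounded_measurable.
Local Notation int := integral_on.

Lemma within_coord (A : set R) (y : R -> 'rV[R]_n) : {within A, continuous y} ->
  forall i, {within A, continuous (fun s => y s 0 i)}.
Proof.
move=> cy i x.
apply: (@continuous_comp (subspace A) _ _ y (fun M : 'rV[R]_n => M 0 i)).
  exact: cy.
exact: coord_continuous.
Qed.

Lemma lipschitz_within (a b C : R) (y : R -> 'rV[R]_n) :
  (forall p q, a <= p <= b -> a <= q <= b -> enorm (y q - y p) <= C * `|q - p|) ->
  {within `[a, b], continuous y}.
Proof.
move=> hC; apply/subspace_continuousP => x /mem_itvcc xab.
apply/cvgrPdist_le => e e0.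
exists (e / (1 + `|C|)) => /=; first by rewrite divr_gt0// ltr_wpDr.
move=> s /= hs /mem_itvcc sab.
apply: le_trans (mxnorm_le_enorm _) _; apply: le_trans (hC _ _ sab xab) _.
have C1 : 0 < 1 + `|C| by rewrite ltr_wpDr.
move: hs; rewrite ltr_pdivlMr// => hs.
have := ler_norm C; have := normr_ge0 (x - s); nra.
Qed.

Lemma coordB (x y : 'rV[R]_n) i : (x - y) 0 i = x 0 i - y 0 i.
Proof. by rewrite !mxE. Qed.

Lemma enormB_le_sum (x y : 'rV[R]_n) : enorm (x - y) <= \sum_i `|x 0 i - y 0 i|.
Proof.
by apply: le_trans (enorm_le_sum _) _; apply: ler_sum => i _; rewrite coordB.
Qed.

Lemma half_pow_ge0 k : 0 <= (2^-1 : R) ^+ k.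
Proof. by rewrite exprn_ge0// invr_ge0. Qed.

(** Stands in for a passage to the limit: since [k / 2 ^ k <= 1], a positive gap [a - b] would be
    contradicted by a large [k]. *)
Lemma le_geometric (a b c : R) : (forall k : nat, a <= b + c * 2^-1 ^+ k) -> a <= b.
Proof.
move=> h; rewrite leNgt; apply/negP => ba.
have c0 : 0 < c by have := h 0%N; rewrite expr0 mulr1; lra.
have [k hk] : exists k : nat, c / (a - b) < k%:R.
  by exists (Num.bound (c / (a - b))); apply: archi_boundP; rewrite divr_ge0//; lra.
have := h k; have h2 : (2^-1 : R) ^+ k * k%:R <= 1.
  rewrite exprVn mulrC ler_pdivrMr ?exprn_gt0// mul1r -natrX ler_nat.
  exact/ltnW/ltn_expl.
have e0 : 0 < (2^-1 : R) ^+ k by rewrite exprn_gt0// invr_gt0.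
move: hk; rewrite ltr_pdivrMr; last lra.
nra.
Qed.

(* The intervals [a k - 2 c 2^-k, a k + 2 c 2^-k] are nested. *)
Lemma geometric_limit (a : nat -> R) (c : R) : 0 <= c ->
  (forall k, `|a k.+1 - a k| <= c * 2^-1 ^+ k) ->
  exists l, forall k, `|l - a k| <= 2 * c * 2^-1 ^+ k.
Proof.
move=> c0 ha.
have hm k j : a k - 2 * c * 2^-1 ^+ k <= a (k + j)%N - 2 * c * 2^-1 ^+ (k + j) /\
    a (k + j)%N + 2 * c * 2^-1 ^+ (k + j) <= a k + 2 * c * 2^-1 ^+ k.
  elim: j => [|j [IH1 IH2]]; first by rewrite addn0.
  have := ha (k + j)%N; rewrite addnS exprS ler_norml => /andP[h1 h2].
  split; lra.
have e0 k : 0 <= 2 * c * (2^-1 : R) ^+ k.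
  by rewrite !mulr_ge0 ?half_pow_ge0//.
have hkj k j : a k - 2 * c * 2^-1 ^+ k <= a j + 2 * c * 2^-1 ^+ j.
  have [h1 _] := hm k j; have [_ h2] := hm j k.
  rewrite addnC in h2; have := e0 (k + j)%N; lra.
pose E := [set a k - 2 * c * 2^-1 ^+ k | k in [set: nat]].
have ub j : ubound E (a j + 2 * c * 2^-1 ^+ j) by move=> _ [k _ <-].
have E0 : E !=set0 by exists (a 0%N - 2 * c * 2^-1 ^+ 0), 0%N.
exists (sup E) => k; rewrite ler_norml; apply/andP; split.
  have : a k - 2 * c * 2^-1 ^+ k <= sup E.
    by apply: ub_le_sup; [exists (a 0%N + 2 * c * 2^-1 ^+ 0); exact: ub | exists k].
  lra.
have : sup E <= a k + 2 * c * 2^-1 ^+ k by apply: ge_sup => //; exact: ub.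
lra.
Qed.

(** The chain rule with a state of dimension 0 acts as the fundamental theorem of calculus. *)
Lemma int_expR (t s l : R) : t <= s -> 0 < l ->
  int t s (fun r => expR (l * (r - t))) <= l^-1 * expR (l * (s - t)).
Proof.
move=> ts l0.
have hl : C1_grad (fun z : R * 'rV[R]_0 => l * (z.1 - t)) (fun=> l) (fun=> 0).
  apply: C1_grad_ext (C1_gradZ l (C1_gradD C1_grad_time (C1_grad_cst (- t)))) _ _ _ => z //.
    by rewrite addr0 mulr1.
  by rewrite addr0 scaler0.
have he := @C1_grad_comp R 0 expR expR _ _ _ hl (fun z => is_derive_expR _).
have {}he := he _.
have /he {}he : continuous (fun z : R * 'rV[R]_0 => expR (l * (z.1 - t))).
  case: hl => _ _ d _ z.
  apply: (@continuous_comp _ _ _ (fun z : R * 'rV[R]_0 => l * (z.1 - t)) expR).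
    exact: differentiable_continuous.
  exact: continuous_expR.
have [||| ] := chain_rule (y := fun=> 0) (w := fun=> 0) ts he.
- exact: vbm_cst.
- by move=> x; exact: cvg_cst.
- by move=> q _ [].
move=> _ /=.
have bE : bm t s (fun r => expR (l * (r - t))).
  apply: bm_continuous; apply: continuous_subspaceT => x.
  apply: (@continuous_comp _ _ _ (fun x : R => l * (x - t)) expR); last exact: continuous_expR.
  by apply: cvgM; [exact: cvg_cst | apply: cvgB; [exact: cvg_id | exact: cvg_cst]].
rewrite (@int_eq _ _ _ (fun r => expR (l * (r - t)) * l + dotp (expR (l * (r - t)) *: 0) 0)
   (fun r => l * expR (l * (r - t)))); last first.
  by move=> q _; rewrite dotp0r addr0 mulrC.
rewrite intZ// => h.
rewrite ler_pdivlMl//; have := expR_ge0 (l * (t - t)); lra.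
Qed.

(** [F] is merely measurable in time, so the iteration runs on the integral equation. The iterates
    contract by one half in a supremum norm with weight [exp (- l (s - t))], which covers [[t, T]]
    in one go. *)
Lemma picard (t T Lam B : R) (F : R -> 'rV[R]_n -> 'rV[R]_n) (x : 'rV[R]_n) :
  t <= T -> 0 < Lam -> 0 <= B ->
  (forall y : R -> 'rV[R]_n, {within `[t, T], continuous y} ->
     forall i, measurable_fun `[t, T] (fun s => F s (y s) 0 i)) ->
  (forall s z, t <= s <= T -> enorm (F s z) <= B) ->
  (forall s z z', t <= s <= T -> enorm (F s z - F s z') <= Lam * enorm (z - z')) ->
  exists y : R -> 'rV[R]_n, {within `[t, T], continuous y} /\
    forall s, t <= s <= T -> forall i,
      y s 0 i = x 0 i + int t s (fun r => F r (y r) 0 i).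
Proof.
move=> tT L0 B0 mF bF lF.
have vF (y : R -> 'rV[R]_n) : {within `[t, T], continuous y} -> vbm t T (fun s => F s (y s)).
  move=> cy i; split; first exact: mF.
  exists B; apply: ae_true => s sab.
  exact: le_trans (coord_le_enorm _ _) (bF _ _ sab).
pose step (y : R -> 'rV[R]_n) : R -> 'rV[R]_n :=
  fun s => \row_i (x 0 i + int t s (fun r => F r (y r) 0 i)).
pose y_ k := iter k step (fun=> x).
have stepE y i s : step y s 0 i = x 0 i + int t s (fun r => F r (y r) 0 i).
  by rewrite mxE.
have steplip (y : R -> 'rV[R]_n) : {within `[t, T], continuous y} ->
    forall p q, t <= p <= T -> t <= q <= T ->
    enorm (step y q - step y p) <= n%:R * B * `|q - p|.
  move=> cy.
  have main p q : t <= p -> p <= q -> q <= T ->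
      enorm (step y q - step y p) <= n%:R * B * (q - p).
    move=> tp pq qT; apply: le_trans (enorm_le_sum _) _.
    have -> : n%:R * B * (q - p) = \sum_(i < n) (B * (q - p)).
      by rewrite sumr_const card_ord mulr_natl mulrnAl.
    apply: ler_sum => i _; rewrite !mxE.
    rewrite (@int_split _ t q p) ?tp//; last exact: bm_sub (vF _ cy i).
    rewrite addrA [X in `|X|]addrAC subrr add0r.
    apply: int_ess_bound => //; first by case: (bm_sub tp qT (vF _ cy i)).
    apply: ae_true => s /andP[ps sq].
    apply: le_trans (coord_le_enorm _ _) (bF _ _ _).
    by rewrite (le_trans tp)//= (le_trans sq).
  move=> p q /andP[tp pT] /andP[tq qT].
  have [pq|/ltW qp] := leP p q; first by rewrite ger0_norm ?subr_ge0// main.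
  by rewrite enormBC distrC ger0_norm ?subr_ge0// main.
have cy_ k : {within `[t, T], continuous (y_ k)}.
  elim: k => [|k IH]; first by move=> z; exact: cvg_cst.
  exact: lipschitz_within (steplip _ IH).
(* A state of dimension 0 is set aside because [l] below has to be positive. *)
have [N0|N0] := eqVneq (n%:R : R) 0.
  exists (fun=> x); split; first by move=> z; exact: cvg_cst.
  move=> s _ i; exfalso.
  move/eqP: N0; rewrite pnatr_eq0 => /eqP n0.
  by move: (ltn_ord i); rewrite [in X in (_ < X)%N -> _]n0.
have n0 : 0 < n%:R :> R by rewrite lt_neqAle eq_sym N0 ler0n.
(* One iteration multiplies the weighted distance by [n * Lam / l = 1 / 2]; the factor [n] is the
   cost of adding up coordinate bounds. *)
pose l := 2 * n%:R * Lam; have l0 : 0 < l by rewrite !mulr_gt0.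
pose c := n%:R * B * (T - t); have c0 : 0 <= c by rewrite !mulr_ge0// subr_ge0.
have hk k s : t <= s <= T ->
    \sum_i `|y_ k.+1 s 0 i - y_ k s 0 i| <= c * 2^-1 ^+ k * expR (l * (s - t)).
  elim: k s => [|k IH] s /andP[ts sT].
    rewrite expr0 mulr1; apply: (@le_trans _ _ c); last first.
      by rewrite ler_peMr// -expR0 ler_expR mulr_ge0 ?subr_ge0// ltW.
    have -> : c = \sum_(i < n) (B * (T - t)).
      by rewrite sumr_const card_ord /c mulr_natl mulrnAl.
    apply: ler_sum => i _; rewrite /y_ /= stepE addrAC subrr add0r.
    apply: (@le_trans _ _ (B * (s - t))); last by rewrite ler_wpM2l// lerB.
    apply: int_ess_bound => //; first by case: (bm_sub (lexx t) sT (vF _ (cy_ 0%N) i)).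
    apply: ae_true => r /andP[tr rs].
    apply: le_trans (coord_le_enorm _ _) (bF _ _ _).
    by rewrite tr (le_trans rs).
  have bexp : bm t s (fun r => expR (l * (r - t))).
    apply: bm_continuous; apply: continuous_subspaceT => z.
    apply: (@continuous_comp _ _ _ (fun x : R => l * (x - t)) expR); last exact: continuous_expR.
    by apply: cvgM; [exact: cvg_cst | apply: cvgB; [exact: cvg_id | exact: cvg_cst]].
  pose K := Lam * (c * 2^-1 ^+ k).
  have K0 : 0 <= K.
    by apply: mulr_ge0; [exact: ltW | exact: mulr_ge0 c0 (half_pow_ge0 _)].
  have hi i : `|y_ k.+2 s 0 i - y_ k.+1 s 0 i| <= K * (l^-1 * expR (l * (s - t))).
    rewrite /y_ !iterS !stepE -/(y_ k) -/(y_ k.+1).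
    rewrite opprD addrACA subrr add0r.
    have b1 := bm_sub (lexx t) sT (vF _ (cy_ k.+1) i).
    have b0 := bm_sub (lexx t) sT (vF _ (cy_ k) i).
    rewrite -intB//; apply: le_trans (int_norm (bmB b1 b0)) _.
    apply: (@le_trans _ _ (int t s (fun r => K * expR (l * (r - t))))).
      apply: int_le; [exact: bm_norm (bmB b1 b0)|exact: bmZ|].
      move=> r /andP[tr rs]; have rT : t <= r <= T by rewrite tr (le_trans rs).
      have := lF r (y_ k.+1 r) (y_ k r) rT; have := IH r rT.
      have := coord_le_enorm (F r (y_ k.+1 r) - F r (y_ k r)) i.
      have := enormB_le_sum (y_ k.+1 r) (y_ k r).
      rewrite coordB /K => h1 h2 h3 h4.
      apply: (le_trans h2); apply: (le_trans h4).
      by rewrite -mulrA ler_wpM2l ?(ltW L0)// (le_trans h1).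
    by rewrite intZ// ler_wpM2l// int_expR.
  apply: (@le_trans _ _ (\sum_(i < n) (K * (l^-1 * expR (l * (s - t)))))).
    by apply: ler_sum => i _; exact: hi.
  rewrite sumr_const card_ord -[leLHS]mulr_natl exprS /K /l.
  rewrite le_eqVlt; apply/orP; left; apply/eqP; field.
  by rewrite !gt_eqF.
pose c' := c * expR (l * (T - t)).
have c'0 : 0 <= c' by rewrite mulr_ge0 ?expR_ge0.
have hk' k s i : t <= s <= T -> `|y_ k.+1 s 0 i - y_ k s 0 i| <= c' * 2^-1 ^+ k.
  move=> stT; apply: (@le_trans _ _ (\sum_i `|y_ k.+1 s 0 i - y_ k s 0 i|)).
    by rewrite (bigD1 i)//= lerDl sumr_ge0.
  apply: (le_trans (hk _ _ stT)); rewrite /c' [leRHS]mulrAC.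
  have e0 : 0 <= c * (2^-1 : R) ^+ k by rewrite mulr_ge0 ?half_pow_ge0//.
  by rewrite ler_wpM2l// ler_expR ler_wpM2l ?(ltW l0)//; case/andP: stT; lra.
(* On [[t, T]] each coordinate is the limit given by [geometric_limit], characterised by its rate of
   convergence. Elsewhere the default 0 may occur. *)
pose y s : 'rV[R]_n := \row_i (xget 0 [set z | forall k, `|z - y_ k s 0 i| <= 2 * c' * 2^-1 ^+ k]).
have hy k s i : t <= s <= T -> `|y s 0 i - y_ k s 0 i| <= 2 * c' * 2^-1 ^+ k.
  move=> stT; rewrite mxE; case: xgetP => [z _ /(_ k)//|].
  have [z hz] := geometric_limit c'0 (fun k => hk' k s i stT).
  by move=> /(_ z) /(_ hz).
have ylip p q : t <= p <= T -> t <= q <= T -> enorm (y q - y p) <= n%:R * (n%:R * B) * `|q - p|.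
  move=> ptT qtT; apply: le_trans (enormB_le_sum _ _) _.
  have -> : n%:R * (n%:R * B) * `|q - p| = \sum_(i < n) (n%:R * B * `|q - p|).
    by rewrite sumr_const card_ord -[RHS]mulr_natl !mulrA.
  apply: ler_sum => i _.
  apply: (@le_geometric _ _ (4 * c')) => k.
  have h1 := hy k.+1 p i ptT; have h2 := hy k.+1 q i qtT.
  have h3 := le_trans (coord_le_enorm _ i) (steplip _ (cy_ k) p q ptT qtT).
  have e0 := mulr_ge0 c'0 (half_pow_ge0 k).
  rewrite coordB -/(y_ k.+1) in h3.
  move: h1 h2 h3; rewrite exprS !ler_norml => /andP[? ?] /andP[? ?] /andP[? ?].
  apply/andP; split; lra.
have cy : {within `[t, T], continuous y} := lipschitz_within ylip.
exists y; split => // s /andP[ts sT] i.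
have stT : t <= s <= T by rewrite ts.
have bi := bm_sub (lexx t) sT (vF _ cy i).
apply/eqP; rewrite -subr_eq0 -normr_le0.
(* The defect of the integral equation is at most the distance of [y s] from the next iterate plus
   the effect of replacing [y] by [y_ k] under the integral; both decay like [2 ^ (- k)]. *)
apply: (@le_geometric _ _ (2 * c' + Lam * (n%:R * (2 * c')) * (s - t))) => k; rewrite add0r.
have h1 := hy k.+1 s i stT.
have bk := bm_sub (lexx t) sT (vF _ (cy_ k) i).
have h2 : `|int t s (fun r => F r (y_ k r) 0 i) - int t s (fun r => F r (y r) 0 i)|
    <= Lam * (n%:R * (2 * c' * 2^-1 ^+ k)) * (s - t).
  rewrite -intB//; apply: int_ess_bound => //; first by case: (bmB bk bi).
  apply: ae_true => r /andP[tr rs]; have rT : t <= r <= T by rewrite tr (le_trans rs).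
  have := coord_le_enorm (F r (y_ k r) - F r (y r)) i; rewrite coordB => h.
  apply: (le_trans h); apply: (le_trans (lF _ _ _ rT)).
  rewrite ler_wpM2l ?(ltW L0)//; apply: le_trans (enormB_le_sum _ _) _.
  have -> : n%:R * (2 * c' * 2^-1 ^+ k) = \sum_(i < n) (2 * c' * 2^-1 ^+ k).
    by rewrite sumr_const card_ord -[RHS]mulr_natl.
  by apply: ler_sum => j _; rewrite distrC hy.
rewrite /y_ iterS stepE -/(y_ k) in h1.
have -> : y s 0 i - (x 0 i + int t s (fun r => F r (y r) 0 i)) =
  (y s 0 i - (x 0 i + int t s (fun r => F r (y_ k r) 0 i))) +
  (int t s (fun r => F r (y_ k r) 0 i) - int t s (fun r => F r (y r) 0 i)) by ring.
apply: le_trans (ler_normD _ _) _.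
have e0 := mulr_ge0 c'0 (half_pow_ge0 k).
move: h1; rewrite exprS; lra.
Qed.

End Picard.

(** * Path comparison and controls *)

Section PathComparison.
Context {R : realType} {n : nat}.
Local Notation bm := bounded_measurable.
Local Notation int := integral_on.

Lemma within_rowB (A : set R) (y z : R -> 'rV[R]_n) :
  {within A, continuous y} -> {within A, continuous z} ->
  {within A, continuous (fun s => y s - z s)}.
Proof. by move=> cy cz x; apply: cvgB; [exact: cy | exact: cz]. Qed.

(** With [S = sqrt (k + |y - z|^2)], the derivative of [exp (- l s) S] is at most [exp (- l s) q],
    because [S] divides the assumed bound. The constant [k > 0] keeps [S] smooth where the paths
    meet: [k = 1] with [z = 0] yields growth of [japanese], and [k -> 0] yields distances. *)
Lemma path_compare (t b l k : R) (y z w v : R -> 'rV[R]_n) (q : R -> R) :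
  t <= b -> 0 <= l -> 0 < k -> vbm t b w -> vbm t b v -> bm t b q ->
  {within `[t, b], continuous y} -> {within `[t, b], continuous z} ->
  (forall s, t <= s <= b -> forall i, y s 0 i = y t 0 i + int t s (fun r => w r 0 i)) ->
  (forall s, t <= s <= b -> forall i, z s 0 i = z t 0 i + int t s (fun r => v r 0 i)) ->
  (forall s, t <= s <= b -> 0 <= q s) ->
  (forall s, t <= s <= b -> dotp (w s - v s) (y s - z s) <=
     l * (k + enorm (y s - z s) ^+ 2) + q s * Num.sqrt (k + enorm (y s - z s) ^+ 2)) ->
  Num.sqrt (k + enorm (y b - z b) ^+ 2) <=
    expR (l * (b - t)) * (Num.sqrt (k + enorm (y t - z t) ^+ 2) + int t b q).
Proof.
move=> tb l0 k0 bw bv bq cy cz hy hz q0 hq.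
have hd : forall s, t <= s <= b -> forall i,
    (y s - z s) 0 i = (y t - z t) 0 i + int t s (fun r => (w r - v r) 0 i).
  move=> s /[dup] stb /andP[ts sb] i.
  have h1 := hy s stb i; have h2 := hz s stb i.
  have h3 : int t s (fun r => (w r - v r) 0 i) =
      int t s (fun r => w r 0 i) - int t s (fun r => v r 0 i).
    rewrite -intB; [|exact: bm_sub (lexx t) sb (bw i)|exact: bm_sub (lexx t) sb (bv i)].
    by apply: int_eq => r _; rewrite coordB.
  by rewrite h3 (coordB (y s)) (coordB (y t)) h1 h2; ring.
have [bc] := chain_rule tb (C1_grad_damped_norm l k0) (vbmB bw bv) (within_rowB cy cz) hd.
rewrite /damped_norm /=.
set S := fun s => Num.sqrt (k + dotp (y s - z s) (y s - z s)).
have Sp s : 0 < S s by rewrite sqrtr_gt0 ltr_pwDl// dotpp_ge0.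
rewrite -!/(S _) => hphi.
have SE s : Num.sqrt (k + enorm (y s - z s) ^+ 2) = S s by rewrite sqr_enorm.
rewrite !SE.
have e0 s : 0 < expR (- l * s) by exact: expR_gt0.
have hle : int t b (fun r => - l * (expR (- l * r) * S r) +
    dotp ((expR (- l * r) / S r) *: (y r - z r)) (w r - v r))
   <= int t b (fun r => expR (- l * t) * q r).
  apply: int_le => //; first exact: bmZ.
  move=> s /[dup] stb /andP[ts sb]; have := hq _ stb; rewrite SE => h.
  have S2 : k + enorm (y s - z s) ^+ 2 = S s ^+ 2.
    by rewrite sqr_enorm sqr_sqrtr// addr_ge0 ?dotpp_ge0// ltW.
  rewrite S2 in h.
  have {}h : dotp (y s - z s) (w s - v s) / S s <= l * S s + q s.
    by rewrite ler_pdivrMr// dotpC; apply: (le_trans h); rewrite expr2; nra.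
  rewrite dotpZl.
  apply: (@le_trans _ _ (expR (- l * s) * q s)).
    have -> : expR (- l * s) / S s * dotp (y s - z s) (w s - v s) =
      expR (- l * s) * (dotp (y s - z s) (w s - v s) / S s) by ring.
    have := ler_wpM2l (ltW (e0 s)) h; lra.
  rewrite ler_wpM2r ?q0// ler_expR; nra.
rewrite intZ// in hle.
have eb : expR (l * (b - t)) = expR (l * b) * expR (- l * t).
  by rewrite -expRD; congr expR; ring.
have eb1 : expR (l * b) * expR (- l * b) = 1.
  by rewrite -expRD mulNr addrN expR0.
have E0 : 0 < expR (l * b) by exact: expR_gt0.
have : expR (- l * b) * S b <= expR (- l * t) * (S t + int t b q) by lra.
move/(ler_wpM2l (ltW E0)); rewrite mulrA eb1 mul1r eb; by rewrite mulrA.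
Qed.

End PathComparison.

(** * Truncation of states *)

Section Clamp.
Context {R : realType} {n : nat}.

Definition clamp1 (r a : R) : R := Num.max (- r) (Num.min r a).

Lemma clamp1_props (r a b : R) : 0 <= r ->
  [/\ `|clamp1 r a - clamp1 r b| <= `|a - b|, `|clamp1 r a| <= `|a|,
      `|clamp1 r a| <= r & `|a| <= r -> clamp1 r a = a].
Proof.
move=> r0; have h1 := ler_norm (a - b); have := ler_norm (b - a); rewrite distrC => h2.
have h3 := ler_norm a; have := ler_norm (- a); rewrite normrN => h4.
rewrite /clamp1; split.
- case: (leP r a) => ra; case: (leP r b) => rb;
    rewrite ?(max_idPr (_ : - r <= r)) ?subrr ?normr_ge0//; try lra;
    do ?[case: (leP (- r) a) => aa]; do ?[case: (leP (- r) b) => bb];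
    rewrite ?subrr ?normr_ge0// ler_norml; apply/andP; split; lra.
- case: (leP r a) => ra; rewrite ?(max_idPr (_ : - r <= r)); try lra.
    by rewrite ger0_norm//; lra.
  by case: (leP (- r) a) => aa; rewrite ?lexx// ler_norml; apply/andP; split; lra.
- case: (leP r a) => ra; rewrite ?(max_idPr (_ : - r <= r)); try lra.
    by rewrite ger0_norm//; lra.
  by case: (leP (- r) a) => aa; rewrite ler_norml; apply/andP; split; lra.
- rewrite ler_norml => /andP[a1 a2].
  by rewrite (min_idPr a2) (max_idPr a1).
Qed.

(** Truncation to a cube rather than to a ball: it is 1-Lipschitz for the Euclidean norm coordinate
    by coordinate, and measurability is that of a minimum and a maximum. *)
Definition clamp (r : R) (x : 'rV[R]_n) : 'rV[R]_n := \row_i clamp1 r (x 0 i).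

Lemma enorm_le_coord (x y : 'rV[R]_n) :
  (forall i, `|x 0 i| <= `|y 0 i|) -> enorm x <= enorm y.
Proof.
move=> h; rewrite /enorm ler_sqrt ?dotpp_ge0//; apply: ler_sum => i _.
by rewrite -!expr2 -(real_normK (num_real (x 0 i))) -(real_normK (num_real (y 0 i)))
  ler_sqr ?nnegrE.
Qed.

Lemma clamp_props (r : R) (x y : 'rV[R]_n) : 0 <= r ->
  [/\ enorm (clamp r x - clamp r y) <= enorm (x - y), enorm (clamp r x) <= enorm x,
     enorm (clamp r x) <= n%:R * r & enorm x <= r -> clamp r x = x].
Proof.
move=> r0; split.
- apply: enorm_le_coord => i; rewrite !coordB !mxE.
  by have [] := clamp1_props (x 0 i) (y 0 i) r0.
- by apply: enorm_le_coord => i; rewrite mxE; have [] := clamp1_props (x 0 i) 0 r0.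
- apply: le_trans (enorm_le_sum _) _.
  have -> : n%:R * r = \sum_(i < n) r by rewrite sumr_const card_ord mulr_natl.
  by apply: ler_sum => i _; rewrite mxE; have [] := clamp1_props (x 0 i) 0 r0.
- move=> xr; apply/rowP => i; rewrite mxE.
  have [_ _ _ ->] := clamp1_props (x 0 i) 0 r0 => //.
  exact: le_trans (coord_le_enorm _ _) xr.
Qed.

End Clamp.

(** * Operations on controls *)

Section Controls.
Context {R : realType} {m : nat}.
Variable U : set 'rV[R]_m.
Hypothesis U0 : U 0.
Local Notation leb := (@lebesgue_measure R).
Local Notation bm := bounded_measurable.
Implicit Types u v : R -> 'rV[R]_m.

Lemma measurable_enorm (a b : R) u : (forall i, measurable_fun `[a, b] (fun s => u s 0 i)) ->
  measurable_fun `[a, b] (fun s => enorm (u s)).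
Proof.
move=> mu.
have h : measurable_fun `[a, b] (fun s => \sum_(i <- enum 'I_m) u s 0 i * u s 0 i).
  by apply: measurable_sum => i; exact: measurable_funM.
have {h} : measurable_fun `[a, b] (fun s => dotp (u s) (u s)).
  by apply: eq_measurable_fun h => s _; rewrite /dotp big_enum.
move=> h; apply: (@eq_measurable_fun _ _ _ _ _ (fun s => dotp (u s) (u s) `^ 2^-1)).
  by move=> s _; rewrite powR12_sqrt// dotpp_ge0.
exact: (measurableT_comp (measurable_powR _) h).
Qed.

Lemma Linfty_vbm (t b : R) u : Linfty_controls U t b u -> vbm t b u.
Proof.
move=> [[mu _] [M hM]] i; split; first exact: mu.
exists M; apply: ae_mono hM => s h stb.
exact: le_trans (coord_le_enorm _ _) (h stb).
Qed.

Lemma bm_control_pow (t b r : R) u : Linfty_controls U t b u -> 0 <= r ->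
  bm t b (fun s => enorm (u s) `^ r).
Proof.
move=> /Linfty_vbm hu r0; apply: bm_powR => //; first exact: bm_enorm.
by move=> s _; exact: enorm_ge0.
Qed.

Lemma measurable_control_sub (t b c d : R) u : t <= c -> d <= b ->
  measurable_control U t b u -> measurable_control U c d u.
Proof.
move=> tc db [mu hu]; split.
  move=> i; apply: measurable_funS (mu i) => //; apply: subset_itv; rewrite bnd_simp//.
by move=> s /andP[cs sd]; apply: hu; rewrite (le_trans tc)// (le_trans sd).
Qed.

Lemma Linfty_sub (t b c d : R) u : t <= c -> d <= b ->
  Linfty_controls U t b u -> Linfty_controls U c d u.
Proof.
move=> tc db [mu [M hM]]; split; first exact: measurable_control_sub mu.
exists M; apply: ae_mono hM => s h /andP[cs sd]; apply: h.
by rewrite (le_trans tc)// (le_trans sd).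
Qed.

Lemma Linfty_L1 (t b : R) u : Linfty_controls U t b u -> L1_controls U t b u.
Proof.
move=> hu; split; first by case: hu.
have /bounded_measurable_integrable/integrableP[_] := bm_enorm (Linfty_vbm hu).
apply: le_lt_trans; rewrite le_eqVlt; apply/orP; left; apply/eqP.
by apply: eq_integral => s _ /=; rewrite ger0_norm ?enorm_ge0.
Qed.

Lemma Linfty_cst (t b : R) (c : 'rV[R]_m) : U c -> Linfty_controls U t b (fun=> c).
Proof.
move=> Uc; split; first by split.
by exists (enorm c); apply: ae_true => s _.
Qed.

Lemma measurable_control_if (t b : R) (P : R -> bool) u v :
  measurable_fun `[t, b] P -> measurable_control U t b u -> measurable_control U t b v ->
  measurable_control U t b (fun s => if P s then u s else v s).
Proof.
move=> mP [mu hu] [mv hv]; split.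
  move=> i; rewrite (_ : (fun _ => _) = (fun s => if P s then u s 0 i else v s 0 i)).
    apply: (measurable_fun_if _ mP) => //.
    - by apply: measurable_funS (mu i) => //; exact: subIsetl.
    - by apply: measurable_funS (mv i) => //; exact: subIsetl.
  by apply/funext => s; case: ifP.
by move=> s stb; case: ifP => _; [exact: hu | exact: hv].
Qed.

Lemma Linfty_if (t b : R) (P : R -> bool) u v :
  measurable_fun `[t, b] P -> Linfty_controls U t b u -> Linfty_controls U t b v ->
  Linfty_controls U t b (fun s => if P s then u s else v s).
Proof.
move=> mP [mu [M hM]] [mv [N hN]]; split; first exact: measurable_control_if.
exists (Num.max M N); apply: ae_mono2 hM hN => s hM hN stb.
by rewrite le_max; case: ifP => _; rewrite ?hM ?hN ?orbT.
Qed.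

Lemma measurable_enorm_le (t b M : R) u : measurable_control U t b u ->
  measurable_fun `[t, b] (fun s => enorm (u s) <= M).
Proof.
move=> [mu _]; apply: measurable_fun_ler => //; exact: measurable_enorm.
Qed.

Lemma measurable_lt (t b r : R) : measurable_fun `[t, b] (fun s : R => s < r).
Proof. by apply: measurable_fun_ltr. Qed.

(** Large values are replaced by 0 and not projected: [U] contains 0 but need not be convex or
    star-shaped. *)
Definition truncation (M : R) u : R -> 'rV[R]_m :=
  fun s => if enorm (u s) <= M then u s else 0.

Lemma truncation_le (M : R) u s : 0 <= M -> enorm (truncation M u s) <= M.
Proof. by move=> M0; rewrite /truncation; case: ifP; rewrite ?enorm0. Qed.

Lemma Linfty_truncation (t b M : R) u : 0 <= M -> measurable_control U t b u ->
  Linfty_controls U t b (truncation M u).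
Proof.
move=> M0 mu; split.
  apply: measurable_control_if => //; first exact: measurable_enorm_le.
by exists M; apply: ae_true => s _; exact: truncation_le.
Qed.

Lemma Linfty_bounded_repr (t b : R) u : Linfty_controls U t b u ->
  exists2 M, 0 <= M & ae_eq_on t b u (truncation M u).
Proof.
move=> [_ [M hM]]; exists `|M| => //.
apply: ae_mono hM => s h stb; rewrite /truncation.
by rewrite (le_trans (h stb) (ler_norm M)).
Qed.

Lemma ae_eq_on_sym (t b : R) u v : ae_eq_on t b u v -> ae_eq_on t b v u.
Proof. by apply: ae_mono => s h stb; rewrite h. Qed.

Lemma ae_eq_on_trans (t b : R) u v w :
  ae_eq_on t b u v -> ae_eq_on t b v w -> ae_eq_on t b u w.
Proof. by apply: ae_mono2 => s h1 h2 stb; rewrite h1// h2. Qed.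

Lemma ae_eq_on_sub (t b c d : R) u v : t <= c -> d <= b ->
  ae_eq_on t b u v -> ae_eq_on c d u v.
Proof.
move=> tc db; apply: ae_mono => s h /andP[cs sd].
by apply: h; rewrite (le_trans tc)// (le_trans sd).
Qed.

Lemma ae_eq_on_refl (t b : R) u : ae_eq_on t b u u.
Proof. exact: ae_true. Qed.

End Controls.

(** * Trajectories *)

Lemma norm_le_sandwich (R : realType) (l k j a b g : R) :
  0 <= l -> 0 <= k -> 0 <= j -> 0 <= a -> 0 <= b ->
  k * a - l * (j + b) <= g -> g <= l * (j + a) - k * b -> `|g| <= l * (j + a + b).
Proof.
move=> l0 k0 j0 a0 b0 h1 h2.
have := mulr_ge0 k0 a0; have := mulr_ge0 k0 b0.
have := mulr_ge0 l0 a0; have := mulr_ge0 l0 b0.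
by rewrite ler_norml => *; apply/andP; split; lra.
Qed.

Section Trajectories.
Context {R : realType} {n m1 m2 : nat} (G : game R n m1 m2).
Context (L c rho1 rho2 sigma1 sigma2 mu mu0 mu1 mu2 : R).
Hypothesis hG : standing_hypotheses G L c rho1 rho2 sigma1 sigma2 mu mu0 mu1 mu2.
Local Notation leb := (@lebesgue_measure R).
Local Notation bm := bounded_measurable.
Local Notation int := integral_on.
Local Notation T := (horizon G).
Local Notation U1 := (ctrl1 G).
Local Notation U2 := (ctrl2 G).
Local Notation adm1 t b u := (Linfty_controls U1 t b u).
Local Notation adm2 t b u := (Linfty_controls U2 t b u).

Implicit Types (t b : R) (y : R -> 'rV[R]_n).

Definition drift (u1 : R -> 'rV[R]_m1) (u2 : R -> 'rV[R]_m2) (y : R -> 'rV[R]_n) :=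
  fun s => dyn G s (y s) (u1 s) (u2 s).

Definition cost (u1 : R -> 'rV[R]_m1) (u2 : R -> 'rV[R]_m2) (y : R -> 'rV[R]_n) :=
  fun s => running G s (y s) (u1 s) (u2 s).

(** The end time [b] is free so that paths can be cut and restarted. Integrability of the drift,
    part of [is_trajectory], follows for essentially bounded controls from [solution_vbm]. *)
Definition solution t b (x : 'rV[R]_n) u1 u2 y : Prop :=
  {within `[t, b], continuous y} /\
  forall s, t <= s <= b -> forall i,
    y s 0 i = x 0 i + int t s (fun r => drift u1 u2 y r 0 i).

Let L0 : 0 < L. Proof. exact: L_gt0 hG. Qed.

Lemma measurable_drift t b y u1 u2 i : 0 <= t -> b <= T ->
  (forall i, measurable_fun `[t, b] (fun s => y s 0 i)) ->
  measurable_control U1 t b u1 -> measurable_control U2 t b u2 ->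
  measurable_fun `[t, b] (fun s => drift u1 u2 y s 0 i).
Proof.
move=> t0 bT my [mu1' hu1] [mu2' hu2].
pose F (z : R * 'rV[R]_n * 'rV[R]_m1 * 'rV[R]_m2) : R :=
  dyn G z.1.1.1 z.1.1.2 z.1.2 z.2 0 i.
apply: (@measurable_comp4 _ _ _ _ (game_domain G) F t b y u1 u2) => //.
  move=> z; apply: (@continuous_comp (subspace (game_domain G)) _ _
    (fun z => dyn G z.1.1.1 z.1.1.2 z.1.2 z.2) (fun M : 'rV[R]_n => M 0 i)).
    exact: (dyn_continuous hG).
  exact: coord_continuous.
move=> s /[dup] stb /andP[ts sb]; split => /=; [|exact: hu1|exact: hu2].
by rewrite (le_trans t0)//= (le_trans sb).
Qed.

Lemma measurable_cost t b y u1 u2 : 0 <= t -> b <= T ->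
  (forall i, measurable_fun `[t, b] (fun s => y s 0 i)) ->
  measurable_control U1 t b u1 -> measurable_control U2 t b u2 ->
  measurable_fun `[t, b] (cost u1 u2 y).
Proof.
move=> t0 bT my [mu1' hu1] [mu2' hu2].
pose F (z : R * 'rV[R]_n * 'rV[R]_m1 * 'rV[R]_m2) : R :=
  running G z.1.1.1 z.1.1.2 z.1.2 z.2.
apply: (@measurable_comp4 _ _ _ _ (game_domain G) F t b y u1 u2) => //.
  exact: (running_continuous hG).
move=> s /[dup] stb /andP[ts sb]; split => /=; [|exact: hu1|exact: hu2].
by rewrite (le_trans t0)//= (le_trans sb).
Qed.

Lemma within_vbm t b (y : R -> 'rV[R]_n) : {within `[t, b], continuous y} -> vbm t b y.
Proof. by move=> cy i; apply: bm_continuous; exact: within_coord. Qed.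

Lemma bm_japanese t b (y : R -> 'rV[R]_n) : vbm t b y ->
  bm t b (fun s => japanese (y s)).
Proof.
move=> by_; apply: (@bm_ext _ _ _ (fun s => (1 + dotp (y s) (y s)) `^ 2^-1)).
  by move=> s _; rewrite powR12_sqrt ?addr_ge0 ?dotpp_ge0// /japanese sqr_enorm.
apply: bm_powR; rewrite ?invr_ge0//.
  by apply: bmD (bm_cst _ _ _) (bm_dotp by_ by_).
by move=> s _; rewrite addr_ge0 ?dotpp_ge0.
Qed.

Lemma bm_japanese_pow t b r (y : R -> 'rV[R]_n) : vbm t b y -> 0 <= r ->
  bm t b (fun s => japanese (y s) `^ r).
Proof.
move=> hy r0; apply: bm_powR => //; first exact: bm_japanese.
by move=> s _; exact/ltW/japanese_gt0.
Qed.

Lemma time_mem t b s : 0 <= t -> b <= T -> t <= s <= b -> 0 <= s <= T.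
Proof. by move=> t0 bT /andP[ts sb]; rewrite (le_trans t0)//= (le_trans sb). Qed.

Lemma Linfty_mem m (U : set 'rV[R]_m) t b u s :
  Linfty_controls U t b u -> t <= s <= b -> U (u s).
Proof. by move=> [[_ h] _]; exact: h. Qed.

Lemma vbm_drift t b y u1 u2 : 0 <= t -> b <= T -> vbm t b y ->
  adm1 t b u1 -> adm2 t b u2 -> vbm t b (drift u1 u2 y).
Proof.
move=> t0 bT hy h1 h2 i.
apply: (@bm_dom _ _ _ _ (fun s => L * (japanese (y s) + enorm (u1 s) `^ sigma1
   + enorm (u2 s) `^ sigma2))).
- by apply: measurable_drift => //; [move=> j; case: (hy j) | case: h1 | case: h2].
- apply: bmZ; apply: bmD; last exact: (bm_control_pow h2 (sigma2_ge0 hG)).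
  by apply: bmD (bm_japanese hy) (bm_control_pow h1 (sigma1_ge0 hG)).
move=> s stb; apply: le_trans (coord_le_enorm _ _) _; apply: le_trans (ler_norm _).
apply: (dyn_growth hG); [exact: time_mem stb|exact: Linfty_mem stb|exact: Linfty_mem stb].
Qed.

Lemma bm_cost t b y u1 u2 : 0 <= t -> b <= T -> vbm t b y ->
  adm1 t b u1 -> adm2 t b u2 -> bm t b (cost u1 u2 y).
Proof.
move=> t0 bT hy h1 h2.
apply: (@bm_dom _ _ _ _ (fun s => L * (japanese (y s) `^ mu + enorm (u1 s) `^ rho1
   + enorm (u2 s) `^ rho2))).
- by apply: measurable_cost => //; [move=> j; case: (hy j) | case: h1 | case: h2].
- apply: bmZ; apply: bmD; last exact: (bm_control_pow h2 (ltW (rho2_gt0 hG))).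
  apply: bmD (bm_control_pow h1 (ltW (rho1_gt0 hG))).
  by apply: bm_japanese_pow => //; have := mu_ge1 hG; lra.
move=> s stb; apply: le_trans (ler_norm _).
have sT := time_mem t0 bT stb.
have u1s := Linfty_mem h1 stb; have u2s := Linfty_mem h2 stb.
have := running_lower hG (y s) sT u1s u2s; have := running_upper hG (y s) sT u1s u2s.
move=> g1 g2.
apply: (@norm_le_sandwich _ _ c); rewrite ?powR_ge0 ?(ltW L0) ?(ltW (c_gt0 hG))//.
Qed.

Lemma solution_vbm t b x u1 u2 y : 0 <= t -> b <= T ->
  adm1 t b u1 -> adm2 t b u2 -> solution t b x u1 u2 y ->
  vbm t b y /\ vbm t b (drift u1 u2 y).
Proof.
move=> t0 bT h1 h2 [cy _]; have hy := within_vbm cy.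
by split => //; exact: vbm_drift.
Qed.

Lemma solution_init t b x u1 u2 y : t <= b -> solution t b x u1 u2 y -> y t = x.
Proof.
move=> tb [_ h]; apply/rowP => i.
by rewrite (h t) ?lexx// int_set1 addr0.
Qed.

Lemma solution_incr t b x u1 u2 y : t <= b -> solution t b x u1 u2 y ->
  forall s, t <= s <= b -> forall i,
    y s 0 i = y t 0 i + int t s (fun r => drift u1 u2 y r 0 i).
Proof. by move=> tb h; rewrite (solution_init tb h); case: h. Qed.

Lemma solution_cat t b x u1 u2 y s : solution t b x u1 u2 y -> s <= b ->
  solution t s x u1 u2 y.
Proof.
move=> [cy h] sb; split.
  by apply: continuous_subspaceW cy; apply: subset_itvl; rewrite bnd_simp.
by move=> r /andP[tr rs] i; apply: h; rewrite tr (le_trans rs).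
Qed.

Lemma solution_shift t b x u1 u2 y s : 0 <= t -> b <= T -> adm1 t b u1 -> adm2 t b u2 ->
  solution t b x u1 u2 y -> t <= s <= b -> solution s b (y s) u1 u2 y.
Proof.
move=> t0 bT h1 h2 hs /andP[ts sb]; have [_ hd] := solution_vbm t0 bT h1 h2 hs.
have [cy h] := hs; split.
  by apply: continuous_subspaceW cy; apply: subset_itvr; rewrite bnd_simp.
move=> r /andP[sr rb] i; rewrite (h r) ?(le_trans ts)// (h s) ?ts//.
rewrite (@int_split _ t r s) ?ts//; last exact: bm_sub (lexx t) rb (hd i).
by rewrite addrA.
Qed.

Lemma solution_ae t b x u1 u2 v1 v2 y : 0 <= t -> b <= T ->
  adm1 t b u1 -> adm2 t b u2 -> adm1 t b v1 -> adm2 t b v2 ->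
  ae_eq_on t b u1 v1 -> ae_eq_on t b u2 v2 ->
  solution t b x u1 u2 y -> solution t b x v1 v2 y.
Proof.
move=> t0 bT h1 h2 h1' h2' e1 e2 hs; have [hy hd] := solution_vbm t0 bT h1 h2 hs.
have hd' := vbm_drift t0 bT hy h1' h2'.
have [cy h] := hs; split => // s /[dup] stb /andP[ts sb] i; rewrite (h s stb).
congr (_ + _); apply: int_ae.
- by case: (bm_sub (lexx t) sb (hd i)).
- by case: (bm_sub (lexx t) sb (hd' i)).
- apply: ae_mono2 e1 e2 => r e1 e2 /andP[tr rs].
  by rewrite /drift e1 ?e2// tr (le_trans rs).
Qed.

(** [path_compare] against the zero path with [k = 1], for which the compared quantity is
    [japanese (y s)]; the growth bound of the drift supplies [l = L] and [q]. *)
Lemma solution_growth t b x u1 u2 y : 0 <= t -> t <= b -> b <= T ->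
  adm1 t b u1 -> adm2 t b u2 -> solution t b x u1 u2 y ->
  forall s, t <= s <= b -> japanese (y s) <= expR (L * T) *
    (japanese x + L * int t b (fun r => enorm (u1 r) `^ sigma1 + enorm (u2 r) `^ sigma2)).
Proof.
move=> t0 tb bT h1 h2 hs s /[dup] stb /andP[ts sb].
have sT : s <= T := le_trans sb bT.
have hs' := solution_cat hs sb.
have h1' := Linfty_sub (lexx t) sb h1; have h2' := Linfty_sub (lexx t) sb h2.
have [hy hd] := solution_vbm t0 sT h1' h2' hs'.
have p1 := bm_control_pow h1 (sigma1_ge0 hG); have p2 := bm_control_pow h2 (sigma2_ge0 hG).
have bq' : bm t b (fun r => enorm (u1 r) `^ sigma1 + enorm (u2 r) `^ sigma2) by exact: bmD.
have bq := bm_sub (lexx t) sb bq'.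
have [cy _] := hs'.
have := @path_compare _ _ t s L 1 y (fun=> 0) (drift u1 u2 y) (fun=> 0)
  (fun r => L * (enorm (u1 r) `^ sigma1 + enorm (u2 r) `^ sigma2)) ts (ltW L0) ltr01 hd
  (vbm_cst _ _ _) (bmZ _ bq) cy (fun x => cvg_cst _) (solution_incr ts hs').
have pos1 r : 0 <= enorm (u1 r) `^ sigma1 + enorm (u2 r) `^ sigma2.
  by rewrite addr_ge0 ?powR_ge0.
move=> /(_ _ _ _)/= H; rewrite !subr0 in H.
have {}H := H _ _ _.
have {}H : japanese (y s) <= expR (L * (s - t)) *
   (japanese (y t) + int t s (fun r => L * (enorm (u1 r) `^ sigma1 + enorm (u2 r) `^ sigma2))).
  apply: H => [r /andP[tr _] i|r _|r /[dup] trs /andP[tr rs]].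
  - rewrite (@int_eq _ _ _ _ (fun=> 0)); last by move=> q _; rewrite mxE.
    by rewrite int_cst ?mul0r ?mxE ?addr0.
  - by rewrite mulr_ge0// ltW.
  - rewrite !subr0; have rT := time_mem t0 sT trs.
    have hf := dyn_growth hG (y r) rT (Linfty_mem h1' trs) (Linfty_mem h2' trs).
    rewrite -/(drift u1 u2 y r) in hf; have := dotp_le (drift u1 u2 y r) (y r).
    have jE := sqr_japanese (y r); rewrite -jE -/(japanese (y r)).
    have := enorm_le_japanese (y r); have := japanese_ge1 (y r).
    have := enorm_ge0 (y r); have := enorm_ge0 (drift u1 u2 y r).
    move=> d0 y0 j1 yj hdot; apply: (le_trans hdot).
    apply: (@le_trans _ _ (L * (japanese (y r) + enorm (u1 r) `^ sigma1
       + enorm (u2 r) `^ sigma2) * japanese (y r))).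
      by apply: ler_pM.
    rewrite sqrtr_sqr ger0_norm ?(ltW (japanese_gt0 _))// expr2.
    rewrite le_eqVlt; apply/orP; left; apply/eqP; ring.
apply: (le_trans H); rewrite (solution_init ts hs') intZ//.
have jx := japanese_gt0 x.
have i0 : 0 <= int t s (fun r => enorm (u1 r) `^ sigma1 + enorm (u2 r) `^ sigma2).
  exact: int_ge0.
have i1 : int t s (fun r => enorm (u1 r) `^ sigma1 + enorm (u2 r) `^ sigma2) <=
    int t b (fun r => enorm (u1 r) `^ sigma1 + enorm (u2 r) `^ sigma2).
  by apply: int_sub_le.
apply: ler_pM.
- exact: expR_ge0.
- by rewrite addr_ge0 ?(ltW jx)// mulr_ge0// ltW.
- by rewrite ler_expR ler_wpM2l ?(ltW L0)//; lra.
- by rewrite lerD2l ler_wpM2l// ltW.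
Qed.

(** The one-sided Lipschitz condition alone gives uniqueness, through [path_compare] with [q = 0]
    and [k = 2 ^ (- j)]. *)
Lemma solution_unique t b x u1 u2 y y' : 0 <= t -> b <= T ->
  adm1 t b u1 -> adm2 t b u2 -> solution t b x u1 u2 y -> solution t b x u1 u2 y' ->
  forall s, t <= s <= b -> y s = y' s.
Proof.
move=> t0 bT h1 h2 hs hz s /[dup] stb /andP[ts sb].
have sT : s <= T := le_trans sb bT.
have hs' := solution_cat hs sb; have hz' := solution_cat hz sb.
have h1' := Linfty_sub (lexx t) sb h1; have h2' := Linfty_sub (lexx t) sb h2.
have [_ hd] := solution_vbm t0 sT h1' h2' hs'.
have [_ hd'] := solution_vbm t0 sT h1' h2' hz'.
have [cy _] := hs'; have [cz _] := hz'.
apply/eqP; rewrite -subr_eq0; apply/eqP/enorm_eq0/eqP.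
rewrite -sqrf_eq0 eq_le sqr_ge0 andbT.
apply: (@le_geometric _ _ _ (expR (L * (s - t)) ^+ 2)) => j; rewrite add0r.
set k : R := 2^-1 ^+ j; have k0 : 0 < k by rewrite exprn_gt0// invr_gt0.
have := @path_compare _ _ t s L k y y' (drift u1 u2 y) (drift u1 u2 y') (fun=> 0)
  ts (ltW L0) k0 hd hd' (bm_cst _ _ _) cy cz (solution_incr ts hs') (solution_incr ts hz').
rewrite (solution_init ts hs') (solution_init ts hz') subrr enorm0 expr0n addr0.
rewrite int_cst// mul0r addr0 => H.
have {}H : Num.sqrt (k + enorm (y s - y' s) ^+ 2) <= expR (L * (s - t)) * Num.sqrt k.
  apply: H => // r trs; rewrite mul0r addr0.
  have := dyn_one_sided_lipschitz hG (y r) (y' r) (time_mem t0 sT trs)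
    (Linfty_mem h1' trs) (Linfty_mem h2' trs).
  rewrite /drift => /le_trans; apply; rewrite ler_wpM2l ?(ltW L0)// lerDr ltW//.
have e0 := expR_ge0 (L * (s - t)).
have {}H : k + enorm (y s - y' s) ^+ 2 <= expR (L * (s - t)) ^+ 2 * k.
  rewrite -[leLHS]sqr_sqrtr ?addr_ge0 ?sqr_ge0 ?(ltW k0)//.
  rewrite -[X in _ <= _ * X]sqr_sqrtr ?(ltW k0)// -exprMn.
  by rewrite ler_sqr ?nnegrE ?mulr_ge0 ?sqrtr_ge0.
by apply: le_trans H; rewrite lerDr ltW.
Qed.

(** The Lipschitz constant of the drift in the state grows with the state. The state is clamped at a
    radius [r], [picard] solves the clamped equation, and the a priori bound, which is the same for
    the clamped drift, shows that the clamp is never active. *)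
Lemma solution_exists_bounded t b M x u1 u2 : 0 <= t -> t <= b -> b <= T ->
  adm1 t b u1 -> adm2 t b u2 ->
  (forall s, enorm (u1 s) <= M) -> (forall s, enorm (u2 s) <= M) ->
  exists y, solution t b x u1 u2 y.
Proof.
move=> t0 tb bT h1 h2 M1 M2.
have M0 : 0 <= M by exact: le_trans (enorm_ge0 (u1 0)) (M1 0).
pose a1 := M `^ sigma1; pose a2 := M `^ sigma2.
have a10 : 0 <= a1 by exact: powR_ge0.
have a20 : 0 <= a2 by exact: powR_ge0.
have hu1 s : enorm (u1 s) `^ sigma1 <= a1.
  by apply: powR_ler => //; [exact: sigma1_ge0 hG | exact: enorm_ge0].
have hu2 s : enorm (u2 s) `^ sigma2 <= a2.
  by apply: powR_ler => //; [exact: sigma2_ge0 hG | exact: enorm_ge0].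
(* The growth bound that any solution with these controls obeys up to time [b]. *)
pose r := expR (L * (b - t)) * (japanese x + L * (a1 + a2) * (b - t)).
have jx := japanese_gt0 x.
have r0 : 0 <= r.
  rewrite /r mulr_ge0 ?expR_ge0// addr_ge0 ?(ltW jx)// mulr_ge0 ?subr_ge0//.
  by rewrite mulr_ge0 ?(ltW L0)// addr_ge0.
have hc (z w : 'rV[R]_n) := clamp_props z w r0.
pose F s z := dyn G s (clamp r z) (u1 s) (u2 s).
pose J : R := 1 + n%:R * r.
have J1 : 1 <= J by rewrite lerDl mulr_ge0.
have jc (z : 'rV[R]_n) : japanese (clamp r z) <= J.
  by apply: le_trans (japanese_le_enorm _) _; rewrite lerD2l; have [] := hc z 0.
pose B := L * (J + a1 + a2).
have B0 : 0 <= B by rewrite /B mulr_ge0 ?(ltW L0)//; lra.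
(* The exponents [mu0], [mu1], [mu2] may be negative; absolute values are harmless because the base
   is at least 1. *)
pose Lam := 1 + (J `^ `|mu0| + J `^ `|mu1| * a1 + J `^ `|mu2| * a2).
have Lam0 : 0 < Lam by rewrite /Lam ltr_pwDl// !addr_ge0 ?mulr_ge0 ?powR_ge0.
have mem s := @time_mem t b s t0 bT.
have [y [cy hy]] : exists y : R -> 'rV[R]_n, {within `[t, b], continuous y} /\
    forall s, t <= s <= b -> forall i,
      y s 0 i = x 0 i + int t s (fun r => F r (y r) 0 i).
  apply: (@picard _ _ _ _ Lam B) => //.
  - move=> y cy i; apply: (@measurable_drift t b (fun s => clamp r (y s))) => //.
    + move=> j; have [my _] := within_vbm cy j.
      rewrite (_ : (fun _ => _) = (fun s => clamp1 r (y s 0 j))); last first.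
        by apply/funext => s; rewrite mxE.
      rewrite /clamp1; apply: measurable_maxr => //; exact: measurable_minr.
    + by case: h1.
    + by case: h2.
  - move=> s z stb; have := dyn_growth hG (clamp r z) (mem _ stb)
      (Linfty_mem h1 stb) (Linfty_mem h2 stb).
    move=> /le_trans; apply; rewrite ler_wpM2l ?(ltW L0)//.
    by rewrite !lerD// jc.
  - move=> s z z' stb; have := dyn_lipschitz hG (clamp r z) (clamp r z') (mem _ stb)
      (Linfty_mem h1 stb) (Linfty_mem h2 stb).
    move=> /le_trans; apply.
    have jm1 := japanese_max_ge1 (clamp r z) (clamp r z').
    have jmJ := japanese_max_le (jc z) (jc z').
    set jm := japanese_max _ _ in jm1 jmJ *.
    have hp e : jm `^ e <= J `^ `|e|.
      apply: (@le_trans _ _ (jm `^ `|e|)); first by apply: ler_powR => //; exact: ler_norm.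
      by apply: powR_ler => //; lra.
    apply: ler_pM.
    + by rewrite !addr_ge0 ?mulr_ge0 ?powR_ge0.
    + exact: enorm_ge0.
    + apply: (@le_trans _ _ (J `^ `|mu0| + J `^ `|mu1| * a1 + J `^ `|mu2| * a2)); last first.
        by rewrite /Lam lerDr.
      by rewrite !lerD// ler_pM ?powR_ge0.
    + by have [] := hc z z'.
have hF : vbm t b (fun s => F s (y s)).
  move=> i; split.
    apply: (@measurable_drift t b (fun s => clamp r (y s))) => //; last by case: h2.
    - move=> j; have [my _] := within_vbm cy j.
      rewrite (_ : (fun _ => _) = (fun s => clamp1 r (y s 0 j))); last first.
        by apply/funext => s; rewrite mxE.
      rewrite /clamp1; apply: measurable_maxr => //; exact: measurable_minr.
    - by case: h1.
  exists B; apply: ae_true => s stb; apply: le_trans (coord_le_enorm _ _) _.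
  have := dyn_growth hG (clamp r (y s)) (mem _ stb) (Linfty_mem h1 stb) (Linfty_mem h2 stb).
  move=> /le_trans; apply; rewrite ler_wpM2l ?(ltW L0)//.
  by rewrite !lerD// jc.
have yt : y t = x.
  by apply/rowP => i; rewrite hy ?lexx// int_set1 addr0.
(* Clamping does not increase the norm, so the clamped drift has the growth of the original one and
   [path_compare] returns the radius [r]. *)
have yr s : t <= s <= b -> enorm (y s) <= r.
  move=> /[dup] stb /andP[ts sb].
  have cy' : {within `[t, s], continuous y}.
    by apply: continuous_subspaceW cy; apply: subset_itvl; rewrite bnd_simp.
  have hinc : forall q, t <= q <= s -> forall i,
      y q 0 i = y t 0 i + int t q (fun r => F r (y r) 0 i).
    by move=> q /andP[tq qs] i; rewrite yt hy// tq (le_trans qs).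
  have h0inc : forall q, t <= q <= s -> forall i,
     (fun=> 0 : 'rV[R]_n) q 0 i = (fun=> 0 : 'rV[R]_n) t 0 i +
      int t q (fun r => (fun=> 0 : 'rV[R]_n) r 0 i).
    move=> q /andP[tq _] i; rewrite (@int_eq _ _ _ _ (fun=> 0)); last by move=> p _; rewrite mxE.
    by rewrite int_cst ?mul0r ?mxE ?addr0.
  have := @path_compare _ _ t s L 1 y (fun=> 0) (fun s => F s (y s)) (fun=> 0)
    (fun=> L * (a1 + a2)) ts (ltW L0) ltr01 (vbm_sub (lexx t) sb hF)
    (vbm_cst _ _ _) (bm_cst _ _ _) cy' (fun x => cvg_cst _) hinc h0inc.
  rewrite int_cst// !subr0 -!/(japanese _) yt => H.
  have {}H : japanese (y s) <= expR (L * (s - t)) * (japanese x + L * (a1 + a2) * (s - t)).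
    apply: H => [q _|q /[dup] qts /andP[tq qs]].
      by rewrite mulr_ge0 ?(ltW L0)// addr_ge0.
    rewrite !subr0; have qtb : t <= q <= b by rewrite tq (le_trans qs).
    have hf := dyn_growth hG (clamp r (y q)) (mem _ qtb) (Linfty_mem h1 qtb) (Linfty_mem h2 qtb).
    rewrite -/(F q (y q)) in hf; have := dotp_le (F q (y q)) (y q).
    have jE := sqr_japanese (y q); rewrite -jE -/(japanese (y q)).
    have := enorm_le_japanese (y q); have := japanese_ge1 (y q).
    have := enorm_ge0 (y q); have := enorm_ge0 (F q (y q)).
    have jcl : japanese (clamp r (y q)) <= japanese (y q).
      by apply: le_japanese; have [] := hc (y q) 0.
    move=> d0 y0 j1 yj hdot; apply: (le_trans hdot).
    apply: (@le_trans _ _ (L * (japanese (y q) + a1 + a2) * japanese (y q))).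
      apply: ler_pM => //; apply: (le_trans hf).
      by rewrite ler_wpM2l ?(ltW L0)// !lerD.
    rewrite sqrtr_sqr ger0_norm ?(ltW (japanese_gt0 _))// expr2.
    rewrite le_eqVlt; apply/orP; left; apply/eqP; ring.
  apply: le_trans (enorm_le_japanese _) _; apply: (le_trans H).
  rewrite /r; apply: ler_pM.
  - exact: expR_ge0.
  - rewrite addr_ge0 ?(ltW jx)// mulr_ge0 ?subr_ge0//.
    by rewrite mulr_ge0 ?(ltW L0)// addr_ge0.
  - by rewrite ler_expR ler_wpM2l ?(ltW L0)//; lra.
  - rewrite lerD2l ler_wpM2l ?mulr_ge0 ?addr_ge0 ?(ltW L0)//; lra.
exists y; split => // s /[dup] stb /andP[ts sb] i; rewrite hy//; congr (_ + _).
apply: int_eq => q /andP[tq qs]; rewrite /F /drift.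
by have [_ _ _ ->] := hc (y q) 0 => //; apply: yr; rewrite tq (le_trans qs).
Qed.

Lemma solution_exists t b x u1 u2 : 0 <= t -> t <= b -> b <= T ->
  adm1 t b u1 -> adm2 t b u2 -> exists y, solution t b x u1 u2 y.
Proof.
move=> t0 tb bT h1 h2.
have [M1 M10 e1] := Linfty_bounded_repr h1; have [M2 M20 e2] := Linfty_bounded_repr h2.
have [m1' _] := h1; have [m2' _] := h2.
have h1' := Linfty_truncation (ctrl1_0 hG) M10 m1'.
have h2' := Linfty_truncation (ctrl2_0 hG) M20 m2'.
have [||y hy] := @solution_exists_bounded t b (Num.max M1 M2) x _ _ t0 tb bT h1' h2'.
- by move=> s; rewrite le_max truncation_le.
- by move=> s; rewrite le_max truncation_le// orbT.
exists y; apply: solution_ae hy => //; exact: ae_eq_on_sym.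
Qed.

(** [trajectory] is a choice whose default is the zero path. Existence makes the choice a genuine
    solution, and in [payoffE] uniqueness removes the dependence on it. *)
Lemma trajectory_solution t x u1 u2 : 0 <= t -> t <= T ->
  adm1 t T u1 -> adm2 t T u2 -> solution t T x u1 u2 (trajectory G t x u1 u2).
Proof.
move=> t0 tT h1 h2; have [y hy] := solution_exists x t0 tT (lexx T) h1 h2.
have : is_trajectory G t x u1 u2 (trajectory G t x u1 u2).
  apply: (@xgetPex _ _ [set y | is_trajectory G t x u1 u2 y]).
  exists y; have [_ hd] := solution_vbm t0 (lexx T) h1 h2 hy; have [cy h] := hy.
  split => // i; split; first exact: (bounded_measurable_integrable (hd i)).
  by move=> s stT; exact: h.
by move=> [cy h]; split => // s stT i; have [_ ->] := h i.
Qed.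

Lemma payoffE t x u1 u2 y : 0 <= t -> t <= T -> adm1 t T u1 -> adm2 t T u2 ->
  solution t T x u1 u2 y ->
  payoff G t x u1 u2 = int t T (cost u1 u2 y) + terminal G (y T).
Proof.
move=> t0 tT h1 h2 hy; rewrite /payoff.
have hs := trajectory_solution x t0 tT h1 h2.
have e := solution_unique t0 (lexx T) h1 h2 hs hy.
rewrite e ?tT ?lexx//; congr (_ + _); apply: int_eq => s stT.
by rewrite /cost e.
Qed.

End Trajectories.

(** * Energy estimates *)

Section Swap.
Context {R : realType} {n m1 m2 : nat} (G : game R n m1 m2).

Definition swap_game : game R n m2 m1 :=
  Game (horizon G) (ctrl2 G) (ctrl1 G) (fun t x u2 u1 => dyn G t x u1 u2)
    (fun t x u2 u1 => - running G t x u1 u2) (fun x => - terminal G x).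

Lemma swap_continuous (W : topologicalType)
    (F : R * 'rV[R]_n * 'rV[R]_m1 * 'rV[R]_m2 -> W) :
  {within game_domain G, continuous F} ->
  {within game_domain swap_game, continuous (fun z => F (z.1.1, z.2, z.1.2))}.
Proof.
move=> /subspace_continuousP cF; apply/subspace_continuousP => z hz.
have hz' : game_domain G (z.1.1, z.2, z.1.2) by case: hz.
move=> S /(cF _ hz') [[P Q] /= [[[P1 P2] /= [h1 h2] hP] hQ] hS].
exists (P1 `*` Q, P2); first by split => //=; exists (P1, Q).
move=> w /= [[w1 w3] w2] hw.
by apply: (hS (w.1.1, w.2, w.1.2)); [split => //; exact: hP | case: hw].
Qed.

Lemma swap_hypotheses (L c rho1 rho2 sigma1 sigma2 mu mu0 mu1 mu2 : R) :
  standing_hypotheses G L c rho1 rho2 sigma1 sigma2 mu mu0 mu1 mu2 ->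
  standing_hypotheses swap_game L c rho2 rho1 sigma2 sigma1 mu mu0 mu2 mu1.
Proof.
case=> H1 H2 H3 H4 H5 H6 H7 H8 H9 H10 H11 H12 H13 H14 H15 H16 H17 H18 H19 H20 H21 H22 H23 H24 H25.
split => //=.
- exact: (swap_continuous H13).
- by move=> t x u1 u2 ht h1 h2; rewrite addrAC; exact: H14.
- by move=> t x y u1 u2 ht h1 h2; rewrite addrAC; exact: H15.
- by move=> t x y u1 u2 ht h1 h2; exact: H16.
- move=> z; apply: cvgN; exact: (swap_continuous H17).
- by move=> t x u1 u2 ht h1 h2; rewrite lerNr opprB; exact: H19.
- by move=> t x u1 u2 ht h1 h2; rewrite lerNl opprB; exact: H18.
- by move=> t x y u1 u2 ht h1 h2; rewrite addrAC -opprD normrN; exact: H20.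
- by move=> x; exact: (cvgN (H21 x)).
- by move=> x y; rewrite -opprD normrN; exact: H22.
- by rewrite normrN.
Qed.

End Swap.

Section Energy.
Context {R : realType}.
Local Notation bm := bounded_measurable.
Local Notation int := integral_on.

Lemma int_jensen_le (a b m H : R) (f : R -> R) : 1 <= m -> a <= b -> b - a <= H ->
  bm a b f -> (forall s, a <= s <= b -> 0 <= f s) ->
  int a b f `^ m <= 2 `^ m * H `^ (m - 1) * int a b (fun s => f s `^ m).
Proof.
move=> m1 ab bH bf f0.
have P0 : 0 <= int a b (fun s => f s `^ m) by apply: int_ge0 => s _; exact: powR_ge0.
have [ab'|ba] := ltP a b.
  apply: le_trans (int_jensen m1 ab' bf f0) _.
  rewrite ler_wpM2r// ler_wpM2l ?powR_ge0// powR_ler//; lra.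
have -> : b = a by lra.
by rewrite !int_set1 powR0 ?mulr0//; lra.
Qed.

(** The first bound serves displacements, the second the power [mu] of the state. In the second the
    power stands outside the integral, so Jensen's inequality costs the factor [A] and the pointwise
    absorption is run with [e / (1 + A)]. *)
Lemma energy_absorb (s m r e H : R) : 0 <= s -> 1 <= m -> s * m < r -> 0 < e -> 0 <= H ->
  exists2 C, 0 <= C & forall (a b : R) (f : R -> R), a <= b -> b - a <= H ->
    bm a b f -> (forall q, a <= q <= b -> 0 <= f q) ->
    int a b (fun q => f q `^ s) <= e * int a b (fun q => f q `^ r) + C * (b - a) /\
    (int a b (fun q => f q `^ s)) `^ m <=
      e * int a b (fun q => f q `^ r) + C * (b - a).
Proof.
move=> s0 m1 smr e0 H0.
have r0 : 0 <= r by apply: ltW; apply: le_lt_trans smr; rewrite mulr_ge0//; lra.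
have sr1 : s * 1 < r by apply: le_lt_trans smr; rewrite ler_wpM2l.
have [C1 C10 h1] := absorb_powR s0 (lexx 1) sr1 e0.
have [A [A0 AE]] : exists A : R, 0 <= A /\ A = 2 `^ m * H `^ (m - 1).
  by eexists; split; [|reflexivity]; rewrite mulr_ge0 ?powR_ge0.
have e'0 : 0 < e / (1 + A) by rewrite divr_gt0//; lra.
have [C2 C20 h2] := absorb_powR s0 m1 smr e'0.
exists (C1 + A * C2); first by rewrite addr_ge0 ?mulr_ge0.
move=> a b f ab bH bf f0.
have bs : bm a b (fun q => f q `^ s) by exact: bm_powR.
have br : bm a b (fun q => f q `^ r) by exact: bm_powR.
have I0 : 0 <= int a b (fun q => f q `^ r) by apply: int_ge0 => *; exact: powR_ge0.
have ba : 0 <= b - a by lra.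
have main (k C : R) (g : R -> R) : bm a b g ->
    (forall q, a <= q <= b -> g q <= k * f q `^ r + C) ->
    int a b g <= k * int a b (fun q => f q `^ r) + C * (b - a).
  move=> bg hg; rewrite -intZ// -int_cst// -intD//; [|exact: bmZ|exact: bm_cst].
  by apply: int_le => //; apply: bmD; [exact: bmZ | exact: bm_cst].
split.
  apply: (@le_trans _ _ (e * int a b (fun q => f q `^ r) + C1 * (b - a))).
    by apply: main => // q hq; have := h1 _ (f0 q hq); rewrite powRr1 ?powR_ge0.
  by rewrite lerD2l ler_wpM2r// lerDl mulr_ge0.
apply: le_trans (int_jensen_le m1 ab bH bs _) _; first by move=> *; exact: powR_ge0.
rewrite -AE; apply: (@le_trans _ _ (A * (e / (1 + A) * int a b (fun q => f q `^ r) + C2 * (b - a)))).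
  rewrite ler_wpM2l//; apply: main => [|q hq]; last exact: h2 (f0 q hq).
  by apply: bm_powR => //; [lra | move=> *; exact: powR_ge0].
rewrite mulrDr; apply: lerD.
  have -> : A * (e / (1 + A) * int a b (fun q => f q `^ r)) =
     e * int a b (fun q => f q `^ r) * (A / (1 + A)) by ring.
  rewrite ler_piMr ?mulr_ge0 ?(ltW e0)// ler_pdivrMr ?mul1r; lra.
by rewrite mulrA ler_wpM2r// lerDr.
Qed.

Lemma powR3_le (a b d m : R) : 0 <= m -> 0 <= a -> 0 <= b -> 0 <= d ->
  (a + b + d) `^ m <= 4 `^ m * (a `^ m + b `^ m + d `^ m).
Proof.
move=> m0 a0 b0 d0.
have p2 : 1 <= 2 `^ m :> R.
  by apply: powR_ge1 => //; lra.
have -> : 4 `^ m = 2 `^ m * 2 `^ m :> R by rewrite -powRM//; congr powR; ring.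
apply: le_trans (powRD_le m0 _ d0) _; first by rewrite addr_ge0.
have := powRD_le m0 a0 b0; have pa := powR_ge0 a m; have pb := powR_ge0 b m.
have pd := powR_ge0 d m; move=> h.
rewrite -mulrA; apply: ler_wpM2l; first lra.
rewrite mulrDr lerD// ler_peMl//.
Qed.

End Energy.

(** [B] collects the effect of the state growth: [L * T] from the running cost and [2 * L] from the
    terminal cost, times the growth constant [A]. The part of it caused by Player 1 is absorbed in
    half of the coercive term. *)
Lemma payoff_bound_arith (R : realType)
    (L c A B C1 C2 t T e1 e2 s1 s2 X I h j : R) :
  0 <= L -> 0 <= c -> 0 <= A -> 0 <= C1 -> 0 <= C2 -> 0 <= t -> t <= T ->
  0 <= B -> B = (L * T + 2 * L) * A ->
  c * e1 - L * e2 - L * (A * (X + s1 + s2)) * (T - t) <= I ->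
  `|h| <= 2 * L * j -> j <= A * (X + s1 + s2) ->
  s1 <= c / 2 / (1 + B) * e1 + C1 * (T - t) -> s2 <= 1 * e2 + C2 * (T - t) ->
  1 <= X -> 0 <= e1 -> 0 <= e2 -> 0 <= s1 -> 0 <= s2 ->
  c / 2 * e1 - (L + B + B * (C1 + C2) * T) * (X + e2) <= I + h.
Proof.
move=> L0 c0 A0 C10 C20 t0 tT B0 BE hc hh hj q1 q2 jx1 E1 E2 s10 s20.
have B1 : 0 < 1 + B by lra.
have T0 : 0 <= T by exact: le_trans tT.
have CT0 : 0 <= B * (C1 + C2) * T by rewrite mulr_ge0// mulr_ge0 ?addr_ge0.
have [D DE] : exists D, D = A * (X + s1 + s2) by eexists.
rewrite -DE in hc hj.
have D0 : 0 <= D by rewrite DE mulr_ge0// !addr_ge0// (le_trans ler01).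
have h3 : L * D * (T - t) <= L * T * D.
  by rewrite mulrAC ler_wpM2r// ler_wpM2l//; lra.
have h4 : - (2 * L * D) <= h.
  have := ler_wpM2l (_ : 0 <= 2 * L) hj; rewrite mulr_ge0// => /(_ isT).
  by move: hh; rewrite ler_norml => /andP[]; lra.
have hB : (L * T + 2 * L) * D = B * (X + s1 + s2) by rewrite BE DE; ring.
have Tt : T - t <= T by lra.
have h5 : B * s1 <= c / 2 * e1 + B * C1 * T.
  apply: le_trans (ler_wpM2l B0 q1) _; rewrite mulrDr; apply: lerD.
    have -> : B * (c / 2 / (1 + B) * e1) = c / 2 * e1 * (B / (1 + B)) by field; rewrite gt_eqF.
    rewrite ler_piMr ?mulr_ge0 ?divr_ge0// ler_pdivrMr ?mul1r//; lra.
  by rewrite -mulrA !ler_wpM2l.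
have h6 : B * s2 <= B * e2 + B * C2 * T.
  apply: le_trans (ler_wpM2l B0 q2) _; rewrite mul1r mulrDr lerD2l.
  by rewrite -mulrA !ler_wpM2l.
have h7 : B * (C1 + C2) * T <= B * (C1 + C2) * T * X by rewrite ler_peMr.
have h8 := mulr_ge0 L0 (le_trans ler01 jx1).
have h9 := mulr_ge0 CT0 E2.
have h10 := mulr_ge0 B0 E2.
lra.
Qed.

Opaque integral_on japanese enorm dotp powR expR.

(** * Growth of states and coercivity of the payoff *)

Section Estimates.
Context {R : realType} {n m1 m2 : nat} (G : game R n m1 m2).
Context (L c rho1 rho2 sigma1 sigma2 mu mu0 mu1 mu2 : R).
Hypothesis hG : standing_hypotheses G L c rho1 rho2 sigma1 sigma2 mu mu0 mu1 mu2.
Local Notation bm := bounded_measurable.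
Local Notation int := integral_on.
Local Notation T := (horizon G).
Local Notation U1 := (ctrl1 G).
Local Notation U2 := (ctrl2 G).
Local Notation adm1 t b u := (Linfty_controls U1 t b u).
Local Notation adm2 t b u := (Linfty_controls U2 t b u).
Local Notation cost := (cost G).
Local Notation drift := (drift G).
Local Notation K0 := (expR (L * T)).

Definition energy m (r t b : R) (u : R -> 'rV[R]_m) : R :=
  int t b (fun s => enorm (u s) `^ r).

Lemma energyE m r t b (u : R -> 'rV[R]_m) :
  energy r t b u = int t b (fun s => enorm (u s) `^ r).
Proof. by []. Qed.

Lemma energy_ge0 m r t b (u : R -> 'rV[R]_m) : 0 <= energy r t b u.
Proof. by apply: int_ge0 => s _; exact: powR_ge0. Qed.

Opaque energy.

Let L0 : 0 < L. Proof. exact: L_gt0 hG. Qed.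
Let c0 : 0 < c. Proof. exact: c_gt0 hG. Qed.
Let T0 : 0 < T. Proof. exact: horizon_gt0 hG. Qed.
Let mu1le : 1 <= mu. Proof. exact: mu_ge1 hG. Qed.
Let mu_ge0 : 0 <= mu. Proof. exact: le_trans ler01 mu1le. Qed.
Let mum1 : 0 <= mu - 1. Proof. by rewrite subr_ge0. Qed.

Lemma terminal_growth x : `|terminal G x| <= 2 * L * japanese x `^ mu.
Proof.
have h := terminal_lipschitz hG x 0; have h0 := terminal_0 hG.
have j1 := japanese_ge1 x; have jp := japanese_gt0 x.
have e0 := enorm_ge0 x; have ej := enorm_le_japanese x.
rewrite subr0 in h.
have jm : japanese_max x 0 <= japanese x.
  by apply: japanese_max_le => //; apply: le_japanese; rewrite enorm0.
have jm0 := japanese_max_ge0 x 0.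
have h1 : L * japanese_max x 0 `^ (mu - 1) * enorm x <= L * japanese x `^ mu.
  rewrite -mulrA ler_wpM2l ?(ltW L0)// -(powR_mulB1 mu1le (ltW jp)).
  by apply: ler_pM => //; [exact: powR_ge0 | exact: powR_ler].
have p1 : 1 <= japanese x `^ mu.
  exact: powR_ge1.
have := ler_normD (terminal G x - terminal G 0) (terminal G 0); rewrite subrK.
have := ler_wpM2l (ltW L0) p1; lra.
Qed.

Lemma solution_pow_growth : exists2 A, 0 <= A & forall t b x u1 u2 y,
  0 <= t -> t <= b -> b <= T -> adm1 t b u1 -> adm2 t b u2 ->
  solution G t b x u1 u2 y -> forall s, t <= s <= b ->
  japanese (y s) `^ mu <=
    A * (japanese x `^ mu + energy sigma1 t b u1 `^ mu + energy sigma2 t b u2 `^ mu).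
Proof.
exists (K0 `^ mu * 4 `^ mu * (1 + L `^ mu)).
  by rewrite !mulr_ge0 ?powR_ge0 ?addr_ge0 ?powR_ge0.
move=> t b x u1 u2 y t0 tb bT h1 h2 hs s stb.
have p1 := bm_control_pow h1 (sigma1_ge0 hG); have p2 := bm_control_pow h2 (sigma2_ge0 hG).
have := solution_growth hG t0 tb bT h1 h2 hs stb.
rewrite intD// -!energyE.
set Q1 := energy _ _ _ _; set Q2 := energy _ _ _ _.
have Q10 : 0 <= Q1 by exact: energy_ge0.
have Q20 : 0 <= Q2 by exact: energy_ge0.
clearbody Q1 Q2; have jx := japanese_gt0 x; have jy := japanese_gt0 (y s).
move=> h; apply: le_trans (powR_ler mu_ge0 (ltW jy) h) _.
have l1 : 0 <= L * Q1 := mulr_ge0 (ltW L0) Q10.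
have l2 : 0 <= L * Q2 := mulr_ge0 (ltW L0) Q20.
have -> : K0 * (japanese x + L * (Q1 + Q2)) = K0 * (japanese x + L * Q1 + L * Q2) by ring.
have sum0 : 0 <= japanese x + L * Q1 + L * Q2 by rewrite !addr_ge0// ltW.
rewrite (powRM _ (expR_ge0 _) sum0) -!mulrA ler_wpM2l ?powR_ge0//.
apply: le_trans (powR3_le mu_ge0 (ltW jx) l1 l2) _.
rewrite ler_wpM2l ?powR_ge0// (powRM _ (ltW L0) Q10) (powRM _ (ltW L0) Q20).
have := powR_ge0 L mu; have := powR_ge0 (japanese x) mu.
have := powR_ge0 Q1 mu; have := powR_ge0 Q2 mu.
set a := L `^ mu; set b1 := Q1 `^ mu; set b2 := Q2 `^ mu; set b3 := japanese x `^ mu.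
move=> p4 p5 p6 p7; have := mulr_ge0 p7 p6; lra.
Qed.

Lemma energy_absorb1 e : 0 < e -> exists2 C, 0 <= C & forall t b u,
  0 <= t -> t <= b -> b <= T -> adm1 t b u ->
  energy sigma1 t b u <= e * energy rho1 t b u + C * (b - t) /\
  energy sigma1 t b u `^ mu <= e * energy rho1 t b u + C * (b - t).
Proof.
move=> e0; have [C C0 h] := energy_absorb (sigma1_ge0 hG) mu1le (sigma1_rho1 hG) e0 (ltW T0).
exists C => // t b u t0 tb bT hu; rewrite !energyE; apply: (h t b (fun s => enorm (u s))) => //.
- by lra.
- by apply: bm_enorm; exact: Linfty_vbm hu.
- by move=> *; exact: enorm_ge0.
Qed.

Lemma energy_absorb2 e : 0 < e -> exists2 C, 0 <= C & forall t b u,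
  0 <= t -> t <= b -> b <= T -> adm2 t b u ->
  energy sigma2 t b u <= e * energy rho2 t b u + C * (b - t) /\
  energy sigma2 t b u `^ mu <= e * energy rho2 t b u + C * (b - t).
Proof.
move=> e0; have [C C0 h] := energy_absorb (sigma2_ge0 hG) mu1le (sigma2_rho2 hG) e0 (ltW T0).
exists C => // t b u t0 tb bT hu; rewrite !energyE; apply: (h t b (fun s => enorm (u s))) => //.
- by lra.
- by apply: bm_enorm; exact: Linfty_vbm hu.
- by move=> *; exact: enorm_ge0.
Qed.

Lemma int_cost_lower t b x u1 u2 y D : 0 <= t -> t <= b -> b <= T ->
  adm1 t b u1 -> adm2 t b u2 -> solution G t b x u1 u2 y ->
  (forall s, t <= s <= b -> japanese (y s) `^ mu <= D) ->
  c * energy rho1 t b u1 - L * energy rho2 t b u2 - L * D * (b - t) <=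
    int t b (cost u1 u2 y).
Proof.
move=> t0 tb bT h1 h2 hs hD.
have [hy _] := solution_vbm hG t0 bT h1 h2 hs.
have p1 := bm_control_pow h1 (ltW (rho1_gt0 hG)).
have p2 := bm_control_pow h2 (ltW (rho2_gt0 hG)).
rewrite !energyE -(intZ c p1) -(intZ L p2) -int_cst// -intB; [|exact: bmZ|exact: bmZ].
rewrite -intB; [|exact: (bmB (bmZ _ p1) (bmZ _ p2))|exact: bm_cst].
apply: int_le.
- by apply: bmB (bmB (bmZ _ p1) (bmZ _ p2)) (bm_cst _ _ _).
- exact: (bm_cost hG).
move=> s stb; have := running_lower hG (y s) (time_mem t0 bT stb) (Linfty_mem h1 stb) (Linfty_mem h2 stb).
apply: le_trans; have := ler_wpM2l (ltW L0) (hD _ stb); lra.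
Qed.

(** A large control of Player 1 moves the state, but the [mu]-th power of that growth is of lower
    order than the energy spent, so half of the coercivity survives. Exchanging the players gives
    [payoff_upper_bound]. *)
Lemma payoff_lower_bound : exists2 C, 0 <= C & forall t x u1 u2,
  0 <= t <= T -> adm1 t T u1 -> adm2 t T u2 ->
  c / 2 * energy rho1 t T u1 - C * (japanese x `^ mu + energy rho2 t T u2) <=
    payoff G t x u1 u2.
Proof.
have [A A0 hA] := solution_pow_growth.
have [B [B0 BE]] : exists B, 0 <= B /\ B = (L * T + 2 * L) * A.
  eexists; split; [|reflexivity].
  by rewrite mulr_ge0// addr_ge0// mulr_ge0 ?(ltW L0) ?(ltW T0).
have B1 : 0 < 1 + B by lra.
(* Small enough for [B] times the absorbed term to stay below [c / 2] times the energy. *)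
have e0 : 0 < c / 2 / (1 + B) by rewrite !divr_gt0.
have [C1 C10 hC1] := energy_absorb1 e0.
have [C2 C20 hC2] := energy_absorb2 ltr01.
have CT0 : 0 <= B * (C1 + C2) * T by rewrite mulr_ge0 ?(ltW T0)// mulr_ge0 ?addr_ge0.
exists (L + B + B * (C1 + C2) * T); first by rewrite !addr_ge0 ?(ltW L0).
move=> t x u1 u2 /andP[t0 tT] h1 h2.
have hs := trajectory_solution hG x t0 tT h1 h2.
move: hs; move: (trajectory G t x u1 u2) => y hs.
rewrite (payoffE hG t0 tT h1 h2 hs).
have hD := hA _ _ _ _ _ _ t0 tT (lexx T) h1 h2 hs.
have hc := int_cost_lower t0 tT (lexx T) h1 h2 hs hD.
have TT : t <= T <= T by rewrite tT lexx.
have [_ q1] := hC1 t T u1 t0 tT (lexx T) h1.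
have [_ q2] := hC2 t T u2 t0 tT (lexx T) h2.
have jx1 : 1 <= japanese x `^ mu by apply: powR_ge1 => //; exact: japanese_ge1.
apply: (payoff_bound_arith (ltW L0) (ltW c0) A0 C10 C20 t0 tT B0 BE hc (terminal_growth (y T))
  (hD T TT) q1 q2 jx1); rewrite ?energy_ge0 ?powR_ge0//.
Qed.

End Estimates.

(** * Lipschitz dependence of the payoff *)

(* Generalizing the real atoms first spares [lra] costly conversion tests. *)
Ltac sign_hypothesis P := lazymatch P with
  | (0 < ?x)%R => first [is_var x | lazymatch x with horizon _ => idtac end]
  | (0 <= ?x)%R => is_var x
  | (1 <= ?x)%R => is_var x
  | (0 <= ?x - 1)%R => is_var x
  end.

Ltac clear_atoms := repeat match goal with
  | H : is_true ?P |- _ => first [sign_hypothesis P; fail 1 | clear H]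
  | H : _ = _ :> _ |- _ => clear H
  end.

Ltac atoms_lra := clear_atoms;
  repeat match goal with x := _ |- _ => clearbody x end;
  repeat match goal with
  | |- context [integral_on ?a ?b ?f] => generalize (integral_on a b f)
  | |- context [@energy ?R ?m ?r ?a ?b ?u] => generalize (@energy R m r a b u)
  | |- context [@running ?R ?n ?m ?p ?G ?a ?b ?u ?v] =>
      generalize (@running R n m p G a b u v)
  | |- context [@terminal ?R ?n ?m ?p ?G ?a] => generalize (@terminal R n m p G a)
  | |- context [@dotp ?R ?n ?a ?b] => generalize (@dotp R n a b)
  | |- context [@enorm ?R ?n ?a] => generalize (@enorm R n a)
  | |- context [@japanese ?R ?n ?a] => generalize (@japanese R n a)
  | |- context [@powR ?R ?a ?b] => generalize (@powR R a b)
  | |- context [@expR ?R ?a] => generalize (@expR R a)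
  | |- context [@horizon ?R ?n ?m ?p ?G] => generalize (@horizon R n m p G)
  end; intros; lra.

Section Displacement.
Context {R : realType} {n : nat}.
Local Notation bm := bounded_measurable.
Local Notation int := integral_on.

(** [path_compare] with [k = h ^ 2] and [h -> 0], using [d <= sqrt (h^2 + d^2) <= h + d]. *)
Lemma path_distance (t b l : R) (y z w v : R -> 'rV[R]_n) (q : R -> R) :
  t <= b -> 0 <= l -> vbm t b w -> vbm t b v -> bm t b q ->
  {within `[t, b], continuous y} -> {within `[t, b], continuous z} ->
  (forall s, t <= s <= b -> forall i, y s 0 i = y t 0 i + int t s (fun r => w r 0 i)) ->
  (forall s, t <= s <= b -> forall i, z s 0 i = z t 0 i + int t s (fun r => v r 0 i)) ->
  (forall s, t <= s <= b -> 0 <= q s) ->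
  (forall s, t <= s <= b -> dotp (w s - v s) (y s - z s) <=
     l * enorm (y s - z s) ^+ 2 + q s * enorm (y s - z s)) ->
  enorm (y b - z b) <= expR (l * (b - t)) * (enorm (y t - z t) + int t b q).
Proof.
move=> tb l0 bw bv bq cy cz hy hz q0 hq.
have sq k d : 0 <= d -> 0 <= k -> d <= Num.sqrt (k + d ^+ 2) :> R.
  move=> d0 k0; rewrite -[leLHS]ger0_norm// -sqrtr_sqr ler_sqrt ?lerDr//.
  by rewrite addr_ge0// sqr_ge0.
apply: (@le_geometric _ _ _ (expR (l * (b - t)))) => j.
set h : R := 2^-1 ^+ j; have h0 : 0 < h by rewrite exprn_gt0// invr_gt0.
have k0 : 0 < h ^+ 2 by rewrite exprn_gt0.
have H := @path_compare _ _ t b l (h ^+ 2) y z w v q tb l0 k0 bw bv bq cy cz hy hz q0.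
have {}H : Num.sqrt (h ^+ 2 + enorm (y b - z b) ^+ 2) <=
    expR (l * (b - t)) * (Num.sqrt (h ^+ 2 + enorm (y t - z t) ^+ 2) + int t b q).
  apply: H => s stb; apply: (le_trans (hq s stb)); apply: lerD.
    by rewrite ler_wpM2l// lerDr ltW.
  by rewrite ler_wpM2l ?q0// sq ?enorm_ge0 ?(ltW k0).
apply: le_trans (sq _ _ (enorm_ge0 _) (ltW k0)) _; apply: (le_trans H).
rewrite -mulrDr ler_wpM2l ?expR_ge0// addrAC lerD2r.
rewrite -[leRHS]ger0_norm ?addr_ge0 ?enorm_ge0 ?(ltW h0)// -sqrtr_sqr.
rewrite ler_sqrt ?sqr_ge0// sqrrD.
by have := mulr_ge0 (enorm_ge0 (y t - z t)) (ltW h0); atoms_lra.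
Qed.

End Displacement.

(** Final bookkeeping of [lip_core]: [P] is the energy at the bad times, [W] is
    [Z ^ (mu - 1) |y - x|], and [Dm], [ZD], [HD] stand for [D ^ mu], [Z ^ (mu - 1) D] and
    [H ^ (mu - 1) D] with [D] the distance of the paths. The last hypothesis lets [c * P] absorb
    every term in [e * P]. *)
Lemma lip_arith (R : realType) (L T c K0 c2 e P W Dm ZD HD a1 a2 a5 p q C1 kap I h : R) :
  0 <= L -> 0 <= T -> 0 <= C1 -> 0 <= p -> 0 <= a2 -> 0 <= q -> 0 <= P ->
  HD <= p * (q * ZD + Dm) ->
  ZD <= K0 * W + K0 * c2 * e * P ->
  Dm <= kap * W + a5 * e * P ->
  (c - a1 * e) * P - a2 * T * Dm - T * HD - 2 * T * ZD - C1 * ZD <= I ->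
  - (L * HD) <= h ->
  e * (a1 + (a2 * T + (T + L) * p) * a5 + ((T + L) * p * q + 2 * T + C1) * (K0 * c2)) <= c ->
  - (((a2 * T + (T + L) * p) * kap + ((T + L) * p * q + 2 * T + C1) * K0) * W) <= I + h.
Proof.
move=> L0 T0 C10 p0 a20 q0 P0 hHD hZD hDm hI hh he.
have b10 : 0 <= a2 * T + (T + L) * p by rewrite addr_ge0 ?mulr_ge0 ?addr_ge0.
have b20 : 0 <= (T + L) * p * q + 2 * T + C1 by rewrite !addr_ge0 ?mulr_ge0 ?addr_ge0.
have h1 := ler_wpM2l b20 hZD; have h2 := ler_wpM2l b10 hDm.
have h3 := ler_wpM2l (addr_ge0 T0 L0) hHD; have h4 := ler_wpM2r P0 he.
lra.
Qed.

Opaque integral_on japanese enorm dotp powR expR energy.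

Lemma driftE (R : realType) (n m1 m2 : nat) (G : game R n m1 m2) u1 u2 y s :
  drift G u1 u2 y s = dyn G s (y s) (u1 s) (u2 s).
Proof. by []. Qed.

Lemma costE (R : realType) (n m1 m2 : nat) (G : game R n m1 m2) u1 u2 y s :
  cost G u1 u2 y s = running G s (y s) (u1 s) (u2 s).
Proof. by []. Qed.

(** * Transfer of a response from one initial state to another *)

Section LipschitzCore.
Context {R : realType} {n m1 m2 : nat} (G : game R n m1 m2).
Context (L c rho1 rho2 sigma1 sigma2 mu mu0 mu1 mu2 : R).
Hypothesis hG : standing_hypotheses G L c rho1 rho2 sigma1 sigma2 mu mu0 mu1 mu2.
Local Notation bm := bounded_measurable.
Local Notation int := integral_on.
Local Notation T := (horizon G).
Local Notation U1 := (ctrl1 G).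
Local Notation U2 := (ctrl2 G).
Local Notation adm1 t b u := (Linfty_controls U1 t b u).
Local Notation adm2 t b u := (Linfty_controls U2 t b u).
Local Notation cost := (cost G).
Local Notation drift := (drift G).
Local Notation K0 := (expR (L * T)).

Let L0 : 0 < L. Proof. exact: L_gt0 hG. Qed.
Let c0 : 0 < c. Proof. exact: c_gt0 hG. Qed.
Let T0 : 0 < T. Proof. exact: horizon_gt0 hG. Qed.
Let mu1le : 1 <= mu. Proof. exact: mu_ge1 hG. Qed.
Let mu_ge0 : 0 <= mu. Proof. exact: le_trans ler01 mu1le. Qed.
Let mum1 : 0 <= mu - 1. Proof. by rewrite subr_ge0. Qed.

(** The value 1 is attained when [s = 0], by the convention for [0 ^ 0]; the exponents [sigma_i] may
    vanish. *)
Lemma enorm0_pow_le1 k (s : R) : enorm (0 : 'rV[R]_k) `^ s <= 1.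
Proof.
by rewrite enorm0; have [->|s0] := eqVneq s 0; rewrite ?powRr0 ?powR0.
Qed.

Lemma enorm0_pow k (s : R) : 0 < s -> enorm (0 : 'rV[R]_k) `^ s = 0.
Proof. by move=> s0; rewrite enorm0 powR0// gt_eqF. Qed.

(** The two paths share no control here, so the one-sided Lipschitz condition does not apply and
    only growth bounds are available. *)
Lemma bad_drift s x y u v : 0 <= s <= T -> U1 u -> U2 v ->
  dotp (dyn G s y u 0 - dyn G s x 0 v) (y - x) <= L * enorm (y - x) ^+ 2 +
    L * (2 * japanese x + 2 + enorm u `^ sigma1 + enorm v `^ sigma2) * enorm (y - x).
Proof.
move=> sT hu hv.
have f1 := dyn_growth hG y sT hu (ctrl2_0 hG).
have f2 := dyn_growth hG x sT (ctrl1_0 hG) hv.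
have d0 := enorm_ge0 (y - x); have jy := japanese_dist y x.
have z2 := @enorm0_pow_le1 m2 sigma2; have z1 := @enorm0_pow_le1 m1 sigma1.
apply: le_trans (dotp_le _ _) _; rewrite expr2 mulrA -mulrDl ler_wpM2r//.
apply: le_trans (ler_enormD _ _) _; rewrite enormN.
apply: (le_trans (lerD f1 f2)); rewrite -mulrDr -mulrDr.
apply: ler_wpM2l; first exact: ltW.
by move: jy z1 z2; atoms_lra.
Qed.

(** With equal controls the running costs differ by the Lipschitz bound, whose control terms
    [absorb_rootm] splits at the scale [Z]. *)
Lemma good_cost s x y u v d Z H : 0 <= s <= T -> U1 u -> U2 v -> 0 < Z ->
  enorm (y - x) <= d -> japanese_max y x <= H ->
  - ((H `^ (mu - 1) + 2 * Z `^ (mu - 1) +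
      Z^-1 * (enorm u `^ rho1 + enorm v `^ rho2)) * d) <=
    running G s y u v - running G s x u v.
Proof.
move=> sT hu hv Z0 hd hH.
have h := running_lipschitz hG y x sT hu hv.
have r1 := absorb_rootm rho1 mu1le Z0 (enorm_ge0 u).
have r2 := absorb_rootm rho2 mu1le Z0 (enorm_ge0 v).
have r3 := powR_ler mum1 (japanese_max_ge0 y x) hH.
have : - `|running G s y u v - running G s x u v| <= running G s y u v - running G s x u v.
  by rewrite lerNl -normrN ler_norm.
apply: le_trans; rewrite lerN2; apply: (le_trans h).
apply: ler_pM => //; first by rewrite !addr_ge0 ?powR_ge0.
  exact: enorm_ge0.
by move: r1 r2 r3; move: (Z^-1) => Zi; atoms_lra.
Qed.

(** The pair [(u, 0)] is bounded below by the coercivity in [u] and the pair [(0, v)] above by the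
    coercivity in [v], so the difference gains both energies. *)
Lemma bad_cost s x y u v H : 0 <= s <= T -> U1 u -> U2 v ->
  japanese x <= H -> japanese y <= H ->
  c * (enorm u `^ rho1 + enorm v `^ rho2) - 2 * L * H `^ mu <=
    running G s y u 0 - running G s x 0 v.
Proof.
move=> sT hu hv hx hy.
have h1 := running_lower hG y sT hu (ctrl2_0 hG).
have h2 := running_upper hG x sT (ctrl1_0 hG) hv.
rewrite (enorm0_pow _ (rho2_gt0 hG)) addr0 in h1.
rewrite (enorm0_pow _ (rho1_gt0 hG)) addr0 in h2.
have p1 := ler_wpM2l (ltW L0) (powR_ler mu_ge0 (ltW (japanese_gt0 x)) hx).
have p2 := ler_wpM2l (ltW L0) (powR_ler mu_ge0 (ltW (japanese_gt0 y)) hy).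
by move: p1 p2 h1 h2; atoms_lra.
Qed.

Lemma terminal_diff x y d H : enorm (y - x) <= d -> japanese_max y x <= H ->
  - (L * (H `^ (mu - 1) * d)) <= terminal G y - terminal G x.
Proof.
move=> hd hH; have h := terminal_lipschitz hG y x.
have : - `|terminal G y - terminal G x| <= terminal G y - terminal G x.
  by rewrite lerNl -normrN ler_norm.
apply: le_trans; rewrite lerN2; apply: (le_trans h).
rewrite -mulrA ler_wpM2l ?(ltW L0)//; apply: ler_pM => //.
- exact: powR_ge0.
- exact: enorm_ge0.
- by apply: powR_ler => //; exact: japanese_max_ge0.
Qed.

(* [bad] marks the times where [u] exceeds the truncation level. There the paths drift
   apart at a rate at most a small multiple of B = (|u|^rho1 + |v|^rho2)^(1/mu), and
   the running cost gained is at least of the order of B^mu. *)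
Lemma lip_core (C1 : R) : 0 <= C1 -> exists z K, [/\ 1 <= z, 0 <= K &
  forall (t X : R) (x y : 'rV[R]_n) (u ut : R -> 'rV[R]_m1) (v w : R -> 'rV[R]_m2)
    (bad : R -> bool),
  0 <= t <= T -> japanese x <= X -> japanese y <= X ->
  measurable_fun `[t, T] bad ->
  adm1 t T u -> adm1 t T ut -> adm2 t T v -> adm2 t T w ->
  (forall s, t <= s <= T -> if bad s
     then [/\ ut s = 0, w s = 0 & (z * X) `^ mu <= enorm (u s) `^ rho1]
     else u s = ut s /\ w s = v s) ->
  energy rho1 t T ut + energy rho2 t T v <= C1 * (z * X) `^ mu ->
  payoff G t x ut v - K * X `^ (mu - 1) * enorm (y - x) <= payoff G t y u w].
Proof.
move=> C10.
(* [c1 * (e * Z)] will bound [japanese] along the path from [x]. *)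
have [c1 [c10 c1E]] : exists c1, 0 <= c1 /\ c1 = K0 * (1 + L * (2 * T + C1)).
  eexists; split; [|reflexivity]; rewrite mulr_ge0 ?expR_ge0// addr_ge0//.
  by rewrite mulr_ge0 ?(ltW L0)// addr_ge0// mulr_ge0// ltW.
(* The bracket in [bad_drift] is at most [(2 c1 + 2 + 2 + 2) e B] at the bad times; [c2 * e * B]
   bounds the rate at which the paths drift apart. *)
have [c2 [c20 c2E]] : exists c2, 0 <= c2 /\ c2 = L * (2 * c1 + 6).
  by eexists; split; [|reflexivity]; rewrite mulr_ge0 ?(ltW L0)// addr_ge0// mulr_ge0.
have [p [p0 pE]] : exists p : R, 0 <= p /\ p = 2 `^ (mu - 1).
  by eexists; split; [|reflexivity]; exact: powR_ge0.
have [q [q0 qE]] : exists q : R, 0 <= q /\ q = c1 `^ (mu - 1).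
  by eexists; split; [|reflexivity]; exact: powR_ge0.
have [a2 [a20 a2E]] : exists a2, 0 <= a2 /\ a2 = 2 * L * 2 `^ mu.
  by eexists; split; [|reflexivity]; rewrite !mulr_ge0 ?powR_ge0// ltW.
have [a1 [a10 a1E]] : exists a1, 0 <= a1 /\ a1 = a2 * c1 `^ mu.
  by eexists; split; [|reflexivity]; rewrite mulr_ge0 ?powR_ge0.
have [kk [kk0 kkE]] : exists k : R, 0 <= k /\ k = K0 `^ mu * 2 `^ mu.
  by eexists; split; [|reflexivity]; rewrite mulr_ge0 ?powR_ge0.
have [a5 [a50 a5E]] : exists a5, 0 <= a5 /\
    a5 = kk * (c2 `^ mu * (2 `^ mu * T `^ (mu - 1))).
  by eexists; split; [|reflexivity]; rewrite !mulr_ge0 ?powR_ge0.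
have b10 : 0 <= a2 * T + (T + L) * p.
  by rewrite addr_ge0 ?mulr_ge0 ?addr_ge0 ?(ltW T0) ?(ltW L0).
have b20 : 0 <= (T + L) * p * q + 2 * T + C1.
  by rewrite !addr_ge0 ?mulr_ge0 ?addr_ge0 ?(ltW T0) ?(ltW L0).
have [a4 [a40 a4E]] : exists a4, 0 <= a4 /\ a4 = a1 + (a2 * T + (T + L) * p) * a5 +
    ((T + L) * p * q + 2 * T + C1) * (K0 * c2).
  eexists; split; [|reflexivity].
  by rewrite !addr_ge0// mulr_ge0// mulr_ge0 ?expR_ge0.
(* [a4] is the total coefficient of [e * P] in [lip_arith], and this [e] keeps it below [c]. All
   constants so far depend on the data and on [C1] only. *)
have [e [e0 e1 ea4]] : exists e, [/\ 0 < e, e <= 1 & e * a4 <= c].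
  exists (c / (c + a4)); have ca : 0 < c + a4 by rewrite ltr_pwDl.
  split; [by rewrite divr_gt0|by rewrite ler_pdivrMr// mul1r lerDl|].
  by rewrite mulrAC ler_pdivrMr// ler_wpM2l ?(ltW c0)// lerDr ltW.
have [Z1 Z11 hZ1] := scaled_absorb (sigma1_ge0 hG) mu1le (sigma1_rho1 hG) e0.
have [Z2 Z21 hZ2] := scaled_absorb (sigma2_ge0 hG) mu1le (sigma2_rho2 hG) e0.
have e10 : 0 < e^-1 by rewrite invr_gt0.
(* The truncation level is taken large: above the thresholds of [scaled_absorb], and with
   [z >= 1 / e] so that [X <= e * Z]. *)
have [z [z1 zZ1 zZ2 ze]] : exists z, [/\ 1 <= z, Z1 <= z, Z2 <= z & e^-1 <= z].
  exists (Z1 + Z2 + e^-1); move: Z11 Z21 e10; move: (e^-1) => ei *.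
  by split; lra.
have z0 : 0 < z := lt_le_trans ltr01 z1.
exists z, (((a2 * T + (T + L) * p) * (kk * p) +
   ((T + L) * p * q + 2 * T + C1) * K0) * z `^ (mu - 1)); split => //.
  by rewrite mulr_ge0 ?powR_ge0// addr_ge0 ?mulr_ge0 ?expR_ge0.
move=> t X x y u ut v w bad /andP[t0 tT] jx jy mbad hu hut hv hw hbad hE.
have X1 : 1 <= X by exact: le_trans (japanese_ge1 x) jx.
have X0 : 0 < X := lt_le_trans ltr01 X1.
have [Z [ZX ZE]] : exists Z, z * X <= Z /\ Z = z * X by exists (z * X); rewrite lexx.
rewrite -ZE in hbad hE.
have zZ : z <= Z by rewrite ZE ler_peMr// ltW.
have Z0 : 0 < Z := lt_le_trans z0 zZ.
have XeZ : X <= e * Z.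
  rewrite ZE mulrA ler_peMl ?(ltW X0)//; by rewrite -ler_pdivrMl// mulr1.
have eZ1 : 1 <= e * Z by exact: le_trans XeZ.
have XZ : X <= Z by rewrite ZE ler_peMl ?(ltW X0).
have hx := trajectory_solution hG x t0 tT hut hv; move: hx.
have hy := trajectory_solution hG y t0 tT hu hw; move: hy.
move: (trajectory G t x ut v) (trajectory G t y u w) => px py hy hx.
rewrite (payoffE hG t0 tT hut hv hx) (payoffE hG t0 tT hu hw hy).
have [vx dx] := solution_vbm hG t0 (lexx T) hut hv hx.
have [vy dy] := solution_vbm hG t0 (lexx T) hu hw hy.
have tTT : t <= T <= T by rewrite tT lexx.
have bu := bm_control_pow hu (ltW (rho1_gt0 hG)).
have but := bm_control_pow hut (ltW (rho1_gt0 hG)).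
have bv := bm_control_pow hv (ltW (rho2_gt0 hG)).
have Zm0 : 0 <= Z `^ (1 - mu) by exact: powR_ge0.
have ZZ : Z `^ (1 - mu) * Z `^ mu = Z.
  by rewrite -powRDp// subrK powRr1// ltW.
have gx s : t <= s <= T -> japanese (px s) <= c1 * (e * Z).
  move=> stT; apply: le_trans (solution_growth hG t0 tT (lexx T) hut hv hx stT) _.
  rewrite c1E -mulrA ler_wpM2l ?expR_ge0//.
  have b1 := bm_control_pow hut (sigma1_ge0 hG); have b2 := bm_control_pow hv (sigma2_ge0 hG).
  have Tt : T - t <= T by move: t0; atoms_lra.
  (* At the scale [Z] the energy bound [C1 * Z ^ mu] contributes only [C1 * e * Z], so this path
     stays of size [e * Z]. *)
  have hint : int t T (fun r => enorm (ut r) `^ sigma1 + enorm (v r) `^ sigma2) <=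
      int t T (fun r => 2 * (e * Z) + e * Z `^ (1 - mu) * (enorm (ut r) `^ rho1 + enorm (v r) `^ rho2)).
    apply: int_le; first exact: bmD.
      by apply: bmD; [exact: bm_cst | apply: bmZ; exact: bmD].
    move=> r _; have := hZ1 Z _ (le_trans zZ1 zZ) (enorm_ge0 (ut r)).
    have := hZ2 Z _ (le_trans zZ2 zZ) (enorm_ge0 (v r)); atoms_lra.
  have hE' : int t T (fun r => 2 * (e * Z) + e * Z `^ (1 - mu) *
        (enorm (ut r) `^ rho1 + enorm (v r) `^ rho2)) =
      2 * (e * Z) * (T - t) +
      e * Z `^ (1 - mu) * (energy rho1 t T ut + energy rho2 t T v).
    rewrite intD; [|exact: bm_cst|by apply: bmZ; exact: bmD].
    rewrite int_cst// intZ; last exact: bmD.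
    by rewrite intD// !energyE.
  rewrite hE' in hint.
  have h1 : e * Z `^ (1 - mu) * (energy rho1 t T ut + energy rho2 t T v) <= C1 * (e * Z).
    have := ler_wpM2l (mulr_ge0 (ltW e0) Zm0) hE.
    have -> // : C1 * (e * Z) = e * Z `^ (1 - mu) * (C1 * Z `^ mu).
    by rewrite -[in LHS]ZZ; ring.
  have h2 : 2 * (e * Z) * (T - t) <= 2 * (e * Z) * T by rewrite ler_wpM2l// mulr_ge0// mulr_ge0 ?(ltW e0) ?(ltW Z0).
  have h3 := ler_wpM2l (ltW L0) (le_trans hint (lerD h2 h1)).
  by move: h3; have := le_trans jx XeZ; atoms_lra.
pose B s := if bad s then (enorm (u s) `^ rho1 + enorm (v s) `^ rho2) `^ mu^-1 else 0.
have mu_gt0 : 0 < mu := lt_le_trans ltr01 mu1le.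
have bB : bm t T B.
  apply: bm_if => //; last exact: bm_cst.
  apply: bm_powR; rewrite ?invr_ge0//; first exact: bmD.
  by move=> s _; rewrite addr_ge0 ?powR_ge0.
have B0 s : 0 <= B s by rewrite /B; case: ifP => // _; exact: powR_ge0.
have Bm s : B s `^ mu = if bad s then enorm (u s) `^ rho1 + enorm (v s) `^ rho2 else 0.
  rewrite /B; case: ifP => _; last by rewrite powR0 ?gt_eqF.
  by rewrite -powRrM mulVf ?gt_eqF// powRr1// addr_ge0 ?powR_ge0.
have bBm : bm t T (fun s => B s `^ mu) by exact: bm_powR.
have BZ s : t <= s <= T -> bad s -> Z <= B s.
  move=> stT bs; have := hbad s stT; rewrite bs => -[_ _ h].
  rewrite /B bs -[leLHS](_ : (Z `^ mu) `^ mu^-1 = _).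
    apply: powR_ler; rewrite ?invr_ge0 ?powR_ge0//.
    by rewrite (le_trans h)// lerDl powR_ge0.
  by rewrite -powRrM divff ?gt_eqF// powRr1// ltW.
set I := int t T B; have I0 : 0 <= I by exact: int_ge0.
set P := int t T (fun s => B s `^ mu).
have P0 : 0 <= P by apply: int_ge0 => s _; exact: powR_ge0.
(* [B] is either 0 or at least [Z], so its integral is controlled by its energy with the favourable
   factor [Z ^ (mu - 1)]. *)
have ZI : Z `^ (mu - 1) * I <= P.
  rewrite /I -intZ//; apply: int_le => //; first exact: bmZ.
  move=> s stT; have [bs|bs] := boolP (bad s).
    rewrite -(powR_mulB1 mu1le (B0 s)) ler_wpM2r//.
    by apply: powR_ler; rewrite ?(ltW Z0)// BZ.
  by rewrite {1}/B (negbTE bs) mulr0 powR_ge0.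
have Im : I `^ mu <= 2 `^ mu * T `^ (mu - 1) * P.
  by apply: int_jensen_le => //; move: t0; atoms_lra.
(* Bound for the distance of the two paths: initial distance plus drift accumulated at the bad
   times. *)
pose D := K0 * (enorm (y - x) + c2 * e * I).
have c2e0 : 0 <= c2 * e by rewrite mulr_ge0// ltW.
have d00 := enorm_ge0 (y - x).
have D0 : 0 <= D by rewrite mulr_ge0 ?expR_ge0// addr_ge0// mulr_ge0.
have hD s : t <= s <= T -> enorm (py s - px s) <= D.
  move=> /[dup] stT /andP[ts sT].
  have hys := solution_cat hy sT; have hxs := solution_cat hx sT.
  have bBs := bm_sub (lexx t) sT bB.
  have := @path_distance _ _ t s L py px (drift u w py) (drift ut v px)
    (fun r => c2 * e * B r) ts (ltW L0) (vbm_sub (lexx t) sT dy) (vbm_sub (lexx t) sT dx)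
    (bmZ _ bBs) (proj1 hys) (proj1 hxs) (solution_incr ts hys) (solution_incr ts hxs).
  rewrite (solution_init ts hys) (solution_init ts hxs) intZ// => H.
  have {}H : enorm (py s - px s) <=
      expR (L * (s - t)) * (enorm (y - x) + c2 * e * int t s B).
    apply: H => [r _|r /andP[tr rs]]; first by rewrite mulr_ge0.
    have rtT : t <= r <= T by rewrite tr (le_trans rs).
    have rT := time_mem t0 (lexx T) rtT.
    have := hbad r rtT; have := BZ r rtT.
    case: (boolP (bad r)) => br.
      move=> /(_ isT) ZB [ut0 w0 _]; rewrite !driftE ut0 w0.
      have := bad_drift (px r) (py r) rT (Linfty_mem hu rtT) (Linfty_mem hv rtT).
      move=> /le_trans; apply; rewrite lerD2l ler_wpM2r ?enorm_ge0//.
      have Bp : 0 < B r by exact: lt_le_trans ZB.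
      have BB : B r `^ (1 - mu) * B r `^ mu = B r.
        by rewrite -powRDp// subrK powRr1// ltW.
      have hB := Bm r; rewrite br in hB.
      have i1 := powR_ge0 (enorm (u r)) rho1; have i2 := powR_ge0 (enorm (v r)) rho2.
      (* [scaled_absorb] is used at the level [B r], whose [mu]-th power already contains the energy
         density of [u]. *)
      have k1 : enorm (u r) `^ sigma1 <= e * (2 * B r).
        apply: le_trans (hZ1 (B r) _ (le_trans zZ1 (le_trans zZ ZB)) (enorm_ge0 _)) _.
        rewrite ler_wpM2l ?(ltW e0)//.
        have : B r `^ (1 - mu) * enorm (u r) `^ rho1 <= B r `^ (1 - mu) * B r `^ mu.
          by rewrite ler_wpM2l ?powR_ge0// hB lerDl.
        by rewrite BB; atoms_lra.
      have k2 : enorm (v r) `^ sigma2 <= e * (2 * B r).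
        apply: le_trans (hZ2 (B r) _ (le_trans zZ2 (le_trans zZ ZB)) (enorm_ge0 _)) _.
        rewrite ler_wpM2l ?(ltW e0)//.
        have : B r `^ (1 - mu) * enorm (v r) `^ rho2 <= B r `^ (1 - mu) * B r `^ mu.
          by rewrite ler_wpM2l ?powR_ge0// hB lerDr.
        by rewrite BB; atoms_lra.
      have eB := ler_wpM2l (ltW e0) ZB.
      have k3 := le_trans (gx r rtT) (ler_wpM2l c10 eB).
      rewrite c2E -!mulrA; apply: ler_wpM2l; first exact: ltW.
      by move: k1 k2 k3 eZ1 eB; atoms_lra.
    move=> _ [utE wE]; rewrite /B !driftE utE wE.
    rewrite (negbTE br) mulr0 mul0r addr0.
    exact: (dyn_one_sided_lipschitz hG _ _ rT (Linfty_mem hut rtT) (Linfty_mem hv rtT)).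
  apply: (le_trans H); apply: ler_pM.
  - exact: expR_ge0.
  - by rewrite addr_ge0// mulr_ge0// int_ge0.
  - by rewrite ler_expR ler_wpM2l ?(ltW L0)//; move: t0 sT; atoms_lra.
  - by rewrite lerD2l ler_wpM2l//; apply: int_sub_le.
pose H := c1 * (e * Z) + D.
have H0 : 0 <= H by rewrite addr_ge0// mulr_ge0// mulr_ge0 ?(ltW e0) ?(ltW Z0).
have hxH s : t <= s <= T -> japanese (px s) <= H.
  by move=> stT; rewrite (le_trans (gx s stT))// lerDl.
have hyH s : t <= s <= T -> japanese (py s) <= H.
  move=> stT; apply: le_trans (japanese_dist _ (px s)) _.
  by apply: lerD; [exact: gx | exact: hD].
have hjH s : t <= s <= T -> japanese_max (py s) (px s) <= H.
  by move=> stT; apply: japanese_max_le; [exact: hyH | exact: hxH].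
(* From [e <= 1]; it keeps all small terms linear in [e]. *)
have em : e `^ mu <= e.
  rewrite -[leRHS]powRr1 ?(ltW e0)//.
  by apply: ger_powR => //; rewrite e0 e1.
have Dm0 : 0 <= D `^ mu by exact: powR_ge0.
have hHm : 2 * L * H `^ mu <= a1 * e * Z `^ mu + a2 * D `^ mu.
  have ceZ : 0 <= c1 * (e * Z) by rewrite mulr_ge0// mulr_ge0 ?(ltW e0) ?(ltW Z0).
  have := powRD_le mu_ge0 ceZ D0; rewrite -/H (powRM _ c10) ?mulr_ge0 ?(ltW e0) ?(ltW Z0)//.
  rewrite (powRM _ (ltW e0) (ltW Z0)) => h.
  have h2 : c1 `^ mu * (e `^ mu * Z `^ mu) <= c1 `^ mu * (e * Z `^ mu).
    by rewrite ler_wpM2l ?powR_ge0// ler_wpM2r ?powR_ge0.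
  have h3 : 0 <= 2 * L by rewrite mulr_ge0 ?(ltW L0).
  have h4 := ler_wpM2l h3 h; have h5 := ler_wpM2l a20 h2.
  by rewrite a1E; move: h4 h5; rewrite a2E; atoms_lra.
(* One inequality for both kinds of times: at a good time [B] vanishes and the Lipschitz losses
   remain, at a bad time the gain pays for the size [H ^ mu] of the states. *)
have hcost s : t <= s <= T ->
   (c - a1 * e) * B s `^ mu - a2 * D `^ mu - (H `^ (mu - 1) + 2 * Z `^ (mu - 1)) * D
   - Z^-1 * D * (enorm (ut s) `^ rho1 + enorm (v s) `^ rho2) <=
   cost u w py s - cost ut v px s.
  move=> stT; have sT := time_mem t0 (lexx T) stT.
  have := hbad s stT; have := BZ s stT; rewrite Bm.
  have Zi0 : 0 <= Z^-1 by rewrite invr_ge0 ltW.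
  have r1 := powR_ge0 (enorm (ut s)) rho1; have r2 := powR_ge0 (enorm (v s)) rho2.
  have r3 := powR_ge0 H (mu - 1); have r4 := powR_ge0 Z (mu - 1).
  have r5 := mulr_ge0 (mulr_ge0 Zi0 D0) (addr_ge0 r1 r2).
  have r6 : 0 <= (H `^ (mu - 1) + 2 * Z `^ (mu - 1)) * D by rewrite mulr_ge0// addr_ge0// mulr_ge0.
  case: (boolP (bad s)) => bs.
    move=> /(_ isT) ZB [ut0 w0 hZu]; rewrite !costE ut0 w0.
    have := bad_cost sT (Linfty_mem hu stT) (Linfty_mem hv stT) (hxH s stT) (hyH s stT).
    rewrite ut0 in r5 *.
    have h2 : a1 * e * Z `^ mu <= a1 * e * (enorm (u s) `^ rho1 + enorm (v s) `^ rho2).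
      by rewrite ler_wpM2l ?mulr_ge0 ?(ltW e0)// (le_trans hZu)// lerDl.
    by move: hHm h2 r5 r6; move: (Z^-1) => Zi; atoms_lra.
  move=> _ [utE wE]; rewrite !costE utE wE mulr0.
  have := good_cost sT (Linfty_mem hut stT) (Linfty_mem hv stT) Z0 (hD s stT) (hjH s stT).
  have := mulr_ge0 a20 Dm0; move: (Z^-1) => Zi; atoms_lra.
have bcx := bm_cost hG t0 (lexx T) vx hut hv.
have bcy := bm_cost hG t0 (lexx T) vy hu hw.
have bsum := bmD but bv.
have Iint : (c - a1 * e) * P - a2 * D `^ mu * (T - t)
    - (H `^ (mu - 1) + 2 * Z `^ (mu - 1)) * D * (T - t)
    - Z^-1 * D * (energy rho1 t T ut + energy rho2 t T v) <=
    int t T (cost u w py) - int t T (cost ut v px).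
  rewrite -intB// !energyE -intD// -(intZ (Z^-1 * D) bsum) -(intZ (c - a1 * e) bBm).
  rewrite -!int_cst// -!intB//.
  all: try exact: bm_cst.
  all: try exact: bmZ.
  - apply: int_le => //.
      apply: bmB; last exact: bmZ.
      by apply: bmB; [apply: bmB; [exact: bmZ | exact: bm_cst]|exact: bm_cst].
    exact: bmB.
  - by apply: bmB; [apply: bmB; [exact: bmZ | exact: bm_cst]|exact: bm_cst].
  - by apply: bmB; [exact: bmZ | exact: bm_cst].
have hterm := terminal_diff (hD T tTT) (hjH T tTT).
have Zpow : Z^-1 * Z `^ mu = Z `^ (mu - 1).
  by rewrite powRDp// powR_inv1 ?(ltW Z0)// mulrC.
(* As [|y - x| <= 2 Z], the power [mu] reduces to the first power, which makes the final estimate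
   Lipschitz and not just of growth type. *)
have dZ : enorm (y - x) `^ mu <= p * (Z `^ (mu - 1) * enorm (y - x)).
  rewrite -(powR_mulB1 mu1le d00) mulrA ler_wpM2r// pE -(powRM _ _ (ltW Z0))//.
  apply: powR_ler => //; apply: le_trans (ler_enormD _ _) _; rewrite enormN.
  by have := enorm_le_japanese x; have := enorm_le_japanese y; move: jx jy XZ; atoms_lra.
have HDle : H `^ (mu - 1) * D <= p * (q * (Z `^ (mu - 1) * D) + D `^ mu).
  have ceZ : 0 <= c1 * Z by rewrite mulr_ge0// ltW.
  have HcZ : H <= c1 * Z + D.
    by rewrite lerD2r ler_wpM2l// ler_piMl// ltW.
  have h1 := le_trans (powR_ler mum1 H0 HcZ) (powRD_le mum1 ceZ D0).
  rewrite (powRM _ c10 (ltW Z0)) -pE -qE in h1.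
  apply: le_trans (ler_wpM2r D0 h1) _.
  by rewrite -mulrA ler_wpM2l// mulrDl -(mulrA q) (powR_mulB1 mu1le D0).
have ZDle : Z `^ (mu - 1) * D <=
    K0 * (Z `^ (mu - 1) * enorm (y - x)) + K0 * c2 * e * P.
  by have := ler_wpM2l (mulr_ge0 (expR_ge0 (L * T)) c2e0) ZI; rewrite /D; atoms_lra.
have Dmle : D `^ mu <= kk * p * (Z `^ (mu - 1) * enorm (y - x)) + a5 * e * P.
  rewrite /D (powRM _ (expR_ge0 _)) ?addr_ge0 ?mulr_ge0 ?(ltW e0)//.
  have h1 := powRD_le mu_ge0 d00 (mulr_ge0 c2e0 I0).
  rewrite (powRM _ c2e0 I0) (powRM _ c20 (ltW e0)) in h1.
  have h2 : c2 `^ mu * e `^ mu * I `^ mu <= c2 `^ mu * e * (2 `^ mu * T `^ (mu - 1) * P).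
    by apply: ler_pM; rewrite ?mulr_ge0 ?powR_ge0// ler_wpM2l ?powR_ge0.
  have h3 := le_trans h1 (ler_wpM2l (powR_ge0 2 mu) (lerD dZ h2)).
  by have := ler_wpM2l (powR_ge0 K0 mu) h3; rewrite a5E kkE; atoms_lra.
have W0 : 0 <= Z `^ (mu - 1) * enorm (y - x) by rewrite mulr_ge0 ?powR_ge0.
have h1 : a2 * D `^ mu * (T - t) <= a2 * T * D `^ mu.
  by rewrite mulrAC ler_wpM2r// ler_wpM2l//; move: t0; atoms_lra.
have HD0 : 0 <= H `^ (mu - 1) * D by rewrite mulr_ge0 ?powR_ge0.
have ZD0 : 0 <= Z `^ (mu - 1) * D by rewrite mulr_ge0 ?powR_ge0.
have h2 : (H `^ (mu - 1) + 2 * Z `^ (mu - 1)) * D * (T - t) <=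
    T * (H `^ (mu - 1) * D) + 2 * T * (Z `^ (mu - 1) * D).
  by have := mulr_ge0 t0 HD0; have := mulr_ge0 t0 ZD0; atoms_lra.
have h3 : Z^-1 * D * (energy rho1 t T ut + energy rho2 t T v) <= C1 * (Z `^ (mu - 1) * D).
  have Zi0 : 0 <= Z^-1 * D by rewrite mulr_ge0// invr_ge0 ltW.
  have := ler_wpM2l Zi0 hE; rewrite -Zpow; move: (Z^-1) => Zi; atoms_lra.
have hI : (c - a1 * e) * P - a2 * T * D `^ mu - T * (H `^ (mu - 1) * D)
   - 2 * T * (Z `^ (mu - 1) * D) - C1 * (Z `^ (mu - 1) * D) <=
   int t T (cost u w py) - int t T (cost ut v px).
  by move: Iint h1 h2 h3; move: (Z^-1) => Zi; atoms_lra.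
have he : e * (a1 + (a2 * T + (T + L) * p) * a5 + ((T + L) * p * q + 2 * T + C1) * (K0 * c2)) <= c.
  by rewrite -a4E.
have harith := lip_arith (ltW L0) (ltW T0) C10 p0 a20 q0 P0 HDle ZDle Dmle hI hterm he.
have ZmE : Z `^ (mu - 1) = z `^ (mu - 1) * X `^ (mu - 1).
  by rewrite ZE powRM ?(ltW X0) ?(ltW z0).
by move: harith; rewrite ZmE; atoms_lra.
Qed.

End LipschitzCore.

(** * Short-time estimates *)

Ltac nonneg := repeat first [assumption | (apply: ltW; assumption) | exact: ler01 | exact: ler0n
  | apply: addr_ge0 | apply: mulr_ge0 | exact: powR_ge0 | exact: expR_ge0
  | exact: energy_ge0 | exact: enorm_ge0].

Lemma short_time_arith (R : realType)
    (L c T tau E Q Qm X S D I w E2 N2 B1 B2 d dm A A0 A3 tm T1 e C1 : R) :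
  0 <= L -> 0 <= T -> 0 <= tau -> tau <= T -> 0 <= A0 -> 0 <= A -> 0 <= A3 ->
  0 <= B1 -> 0 <= B2 -> 0 <= E -> 0 <= Qm ->
  c * E - L * E2 - L * D * tau <= I -> E2 <= N2 * tau -> D = A0 * (X + Qm + S) ->
  - (B1 * d + B2 * dm) <= w -> d <= A * (tau + Q) -> dm <= A3 * (tm + Qm) ->
  tm <= T1 * tau -> Q <= e * E + C1 * tau -> Qm <= e * E + C1 * tau ->
  e * (B1 * A + B2 * A3 + L * A0 * T) <= c / 2 ->
  c / 2 * E - (L * N2 + L * A0 * (X + S) + L * A0 * T * C1 + B1 * A * (1 + C1) +
    B2 * A3 * (T1 + C1)) * tau <= I + w.
Proof.
move=> L0 T0 tau0 tauT A00 A1 A30 B10 B20 E0 Qm0 hI hE2 DE hw hd hdm htm hQ hQm he.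
have q1 := ler_wpM2l L0 hE2.
have q2 := ler_wpM2l (mulr_ge0 (mulr_ge0 L0 A00) Qm0) tauT.
have q3 := ler_wpM2l (mulr_ge0 (mulr_ge0 L0 A00) T0) hQm.
have q4 := ler_wpM2l B10 hd; have q5 := ler_wpM2l (mulr_ge0 B10 A1) hQ.
have q6 := ler_wpM2l B20 hdm.
have q7 := ler_wpM2l (mulr_ge0 B20 A30) (lerD htm hQm).
have q8 := ler_wpM2r E0 he.
by rewrite DE in hI; lra.
Qed.

Section ShortTime.
Context {R : realType} {n m1 m2 : nat} (G : game R n m1 m2).
Context (L c rho1 rho2 sigma1 sigma2 mu mu0 mu1 mu2 : R).
Hypothesis hG : standing_hypotheses G L c rho1 rho2 sigma1 sigma2 mu mu0 mu1 mu2.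
Local Notation bm := bounded_measurable.
Local Notation int := integral_on.
Local Notation T := (horizon G).
Local Notation U1 := (ctrl1 G).
Local Notation U2 := (ctrl2 G).
Local Notation adm1 t b u := (Linfty_controls U1 t b u).
Local Notation adm2 t b u := (Linfty_controls U2 t b u).
Local Notation K0 := (expR (L * T)).

Let L0 : 0 < L. Proof. exact: L_gt0 hG. Qed.
Let c0 : 0 < c. Proof. exact: c_gt0 hG. Qed.
Let T0 : 0 < T. Proof. exact: horizon_gt0 hG. Qed.
Let mu1le : 1 <= mu. Proof. exact: mu_ge1 hG. Qed.
Let mu_ge0 : 0 <= mu. Proof. exact: le_trans ler01 mu1le. Qed.
Let mum1 : 0 <= mu - 1. Proof. by rewrite subr_ge0. Qed.

Lemma energy_le m (U : set 'rV[R]_m) r t b N (u : R -> 'rV[R]_m) : 0 <= r -> t <= b ->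
  Linfty_controls U t b u -> (forall s, t <= s <= b -> enorm (u s) <= N) ->
  energy r t b u <= N `^ r * (b - t).
Proof.
move=> r0 tb hu hN; rewrite energyE -int_cst//; apply: int_le.
- exact: bm_control_pow hu r0.
- exact: bm_cst.
- by move=> s /hN h; apply: powR_ler => //; exact: enorm_ge0.
Qed.

(** The path is compared with the constant path [x] by [path_distance] with [l = 0], so its
    displacement is at most the integral of the speed. Only [u2] is bounded in advance; [u1] enters
    through its own integral. *)
Lemma displacement (x : 'rV[R]_n) (N : R) : exists2 A : R, 0 <= A &
  forall (t b : R) u1 u2 y, 0 <= t -> t <= b -> b <= T -> adm1 t b u1 -> adm2 t b u2 ->
  (forall s : R, t <= s <= b -> enorm (u2 s) <= N) -> solution G t b x u1 u2 y ->
  forall s : R, t <= s <= b -> enorm (y s - x) <= A * (b - t + energy sigma1 t b u1).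
Proof.
set N2 := N `^ sigma2; have N20 : 0 <= N2 by exact: powR_ge0.
have jx0 := japanese_gt0 x.
exists (L * (K0 * (japanese x + L * N2 * T) + N2 + K0 * L * T + 1)).
  by nonneg.
move=> t b u1 u2 y t0 tb bT h1 h2 hN hs s /[dup] stb /andP[ts sb].
have [vy vd] := solution_vbm hG t0 bT h1 h2 hs.
have p1 := bm_control_pow h1 (sigma1_ge0 hG); have p2 := bm_control_pow h2 (sigma2_ge0 hG).
have hN2 r : t <= r <= b -> enorm (u2 r) `^ sigma2 <= N2.
  by move=> /hN; apply: powR_ler; [exact: sigma2_ge0 hG | exact: enorm_ge0].
have tau0 : 0 <= b - t by rewrite subr_ge0.
have Q0 := energy_ge0 sigma1 t b u1.
have int0 : int t b (fun r => enorm (u1 r) `^ sigma1 + enorm (u2 r) `^ sigma2) <=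
    energy sigma1 t b u1 + N2 * (b - t).
  rewrite energyE -(int_cst N2 tb) -(intD p1 (bm_cst _ _ _)).
  apply: int_le; [exact: bmD | by apply: bmD => //; exact: bm_cst |].
  by move=> r /hN2; rewrite lerD2l.
have hg r : t <= r <= b -> japanese (y r) <=
    K0 * (japanese x + L * (energy sigma1 t b u1 + N2 * (b - t))).
  move=> /(solution_growth hG t0 tb bT h1 h2 hs) /le_trans; apply.
  by rewrite ler_wpM2l ?expR_ge0// lerD2l ler_wpM2l// ltW.
set D := K0 * _ in hg.
have vds := vbm_sub (lexx t) sb vd.
have hss := solution_cat hs sb.
have inc := solution_incr ts hss.
have cst_within : {within `[t, s], continuous (fun=> x)}.
  exact: continuous_subspaceT (fun z => cst_continuous (x := x) (x0 := z)).
have := @path_distance _ _ t s 0 y (fun=> x) (drift G u1 u2 y) (fun=> 0)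
  (fun r => enorm (drift G u1 u2 y r)) ts (lexx 0) vds (vbm_cst _ _ _) (bm_enorm vds)
  (proj1 hss) cst_within inc.
have z0 r i : x 0 i = x 0 i + int t r (fun=> (0 : 'rV[R]_n) 0 i).
  rewrite -[LHS]addr0; congr (_ + _).
  rewrite (_ : (fun=> _) = fun q => 0 * (fun=> 0) q); last by apply/funext => q; rewrite mxE mulr0.
  by rewrite (intZ _ (bm_cst _ _ _)) mul0r.
move=> H; apply: le_trans (_ : int t s (fun r => enorm (drift G u1 u2 y r)) <= _).
  have := H (fun r _ i => z0 r i) (fun r _ => enorm_ge0 _).
  rewrite mul0r expR0 mul1r (solution_init tb hs) subrr enorm0 add0r; apply.
  by move=> r _; rewrite mul0r add0r subr0; exact: dotp_le.
apply: le_trans (_ : int t b (fun r => enorm (drift G u1 u2 y r)) <= _).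
  by apply: int_sub_le => //; [exact: bm_enorm | move=> r _; exact: enorm_ge0].
apply: le_trans (_ : int t b (fun r => L * (D + N2 + enorm (u1 r) `^ sigma1)) <= _).
  apply: int_le; first exact: bm_enorm.
    by apply: bmZ; apply: bmD => //; exact: bm_cst.
  move=> r rtb; rewrite driftE.
  apply: le_trans (dyn_growth hG _ (time_mem t0 bT rtb) (Linfty_mem h1 rtb) (Linfty_mem h2 rtb)) _.
  by rewrite ler_wpM2l ?(ltW L0)//; move: (hg r rtb) (hN2 r rtb); atoms_lra.
rewrite intZ; last by apply: bmD => //; exact: bm_cst.
rewrite intD//; last exact: bm_cst.
rewrite int_cst// -energyE -!mulrA ler_wpM2l ?(ltW L0)//.
have tauT : b - t <= T by move: t0 bT; atoms_lra.
have k1 : K0 * L * (energy sigma1 t b u1) * (b - t) <= K0 * L * (energy sigma1 t b u1) * T.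
  by rewrite ler_wpM2l//; nonneg.
have k2 : K0 * L * N2 * (b - t) * (b - t) <= K0 * L * N2 * T * (b - t).
  by rewrite ler_wpM2r// ler_wpM2l//; nonneg.
have k3 : 0 <= K0 * L * T * (b - t) by nonneg.
have k4 : 0 <= K0 * (japanese x + L * N2 * T) * energy sigma1 t b u1.
  by nonneg.
have k5 := mulr_ge0 N20 Q0.
by move: k1 k2 k3 k4 k5 tau0; rewrite /D; atoms_lra.
Qed.

(** With a bounded control of Player 2, whatever Player 1 gains by moving the state is of lower
    order than the energy needed, up to [C * (b - t)]. The second bound says that a path can move
    far in a short time only by spending energy. [W] needs no other property than its Lipschitz
    estimate. *)
Lemma short_time (W : R -> 'rV[R]_n -> R) (K : R) (x : 'rV[R]_n) (N : R) : 0 <= K ->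
  (forall t x y, 0 <= t <= T ->
    `|W t x - W t y| <= K * japanese_max x y `^ (mu - 1) * enorm (x - y)) ->
  exists2 C : R, 0 <= C & forall (t b : R) u1 u2 y, 0 <= t -> t <= b -> b <= T ->
    adm1 t b u1 -> adm2 t b u2 ->
    (forall s : R, t <= s <= b -> enorm (u2 s) <= N) -> solution G t b x u1 u2 y ->
    c / 2 * energy rho1 t b u1 - C * (b - t) <=
      int t b (cost G u1 u2 y) + (W b (y b) - W b x) /\
    forall s : R, t <= s <= b -> enorm (y s - x) <= C * (b - t + energy rho1 t b u1).
Proof.
move=> K0' hW; have [A A_ge0 hA] := displacement x N.
have [A0 A00 hA0] := solution_pow_growth hG.
set p : R := 2 `^ (mu - 1); have p0 : 0 <= p by exact: powR_ge0.
set X := japanese x `^ (mu - 1); have X0 : 0 <= X by exact: powR_ge0.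
set A3 := A `^ mu * 2 `^ mu; have A30 : 0 <= A3 by rewrite mulr_ge0 ?powR_ge0.
have [B1 [B10 B1E]] : exists B, 0 <= B /\ B = K * p * X.
  by eexists; split; [|reflexivity]; rewrite !mulr_ge0.
have [B2 [B20 B2E]] : exists B, 0 <= B /\ B = K * p.
  by eexists; split; [|reflexivity]; rewrite !mulr_ge0.
have [a [a0 aE]] : exists a, 0 <= a /\ a = B1 * A + B2 * A3 + L * A0 * T.
  by eexists; split; [|reflexivity]; nonneg.
have a1 : 0 < 1 + a by rewrite ltr_pwDl.
have c20 : 0 < c / 2 by rewrite divr_gt0.
have e0 : 0 < c / 2 / (1 + a) by rewrite divr_gt0.
have [C1 C10 hC1] := energy_absorb1 hG e0.
have [C2 C20 hC2] := energy_absorb1 hG ltr01.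
set S := (N `^ sigma2 * T) `^ mu; have S0 : 0 <= S by exact: powR_ge0.
set T1 := T `^ (mu - 1); have T10 : 0 <= T1 by exact: powR_ge0.
set Xm := japanese x `^ mu; have Xm0 : 0 <= Xm by exact: powR_ge0.
set N2 := N `^ rho2; have N20 : 0 <= N2 by exact: powR_ge0.
set C := L * N2 + L * A0 * (Xm + S) + L * A0 * T * C1 + B1 * A * (1 + C1) + B2 * A3 * (T1 + C1).
have C0 : 0 <= C by rewrite /C; nonneg.
exists (C + A * (1 + C2)); first by rewrite addr_ge0// mulr_ge0// addr_ge0.
move=> t b u1 u2 y t0 tb bT h1 h2 hN hs.
have tau0 : 0 <= b - t by rewrite subr_ge0.
have tauT : b - t <= T by move: t0 bT; atoms_lra.
have E0 := energy_ge0 rho1 t b u1.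
have hd := hA t b u1 u2 y t0 tb bT h1 h2 hN hs.
have [hQ2 _] := hC2 t b u1 t0 tb bT h1; rewrite mul1r in hQ2.
have [hQ hQm] := hC1 t b u1 t0 tb bT h1.
have Q0 := energy_ge0 sigma1 t b u1.
split; last first.
  move=> s stb; apply: (le_trans (hd s stb)).
  have q1 := ler_wpM2l A_ge0 (lerD (lexx (b - t)) hQ2).
  have q2 : 0 <= C * (b - t + energy rho1 t b u1) by rewrite mulr_ge0// addr_ge0.
  have q3 : 0 <= A * C2 * energy rho1 t b u1 by rewrite !mulr_ge0.
  by apply: (le_trans q1); move: q2 q3; atoms_lra.
have tbb : t <= b <= b by rewrite tb lexx.
have bT' : 0 <= b <= T by rewrite (le_trans t0 tb).
set d := enorm (y b - x); have d0 : 0 <= d by exact: enorm_ge0.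
have hw : - (B1 * d + B2 * d `^ mu) <= W b (y b) - W b x.
  have : - `|W b (y b) - W b x| <= W b (y b) - W b x by rewrite lerNl -normrN ler_norm.
  apply: le_trans; rewrite lerN2; apply: le_trans (hW _ _ _ bT') _.
  rewrite -/d B1E B2E -(powR_mulB1 mu1le d0).
  rewrite (_ : K * p * X * d + _ = K * (p * (X + d `^ (mu - 1))) * d); last by ring.
  rewrite ler_wpM2r// ler_wpM2l//.
  apply: le_trans (powRD_le mum1 (ltW (japanese_gt0 x)) d0).
  apply: powR_ler => //; first exact: japanese_max_ge0.
  by apply: japanese_max_le; [exact: japanese_dist | rewrite lerDl].
have q0 : 0 <= b - t + energy sigma1 t b u1 by rewrite addr_ge0.
have hdm : d `^ mu <= A3 * ((b - t) `^ mu + energy sigma1 t b u1 `^ mu).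
  apply: le_trans (powR_ler mu_ge0 d0 (hd b tbb)) _; rewrite (powRM _ A_ge0 q0).
  by rewrite /A3 -mulrA ler_wpM2l ?powR_ge0// powRD_le.
have htm : (b - t) `^ mu <= T1 * (b - t).
  by rewrite -(powR_mulB1 mu1le tau0) ler_wpM2r// powR_ler.
have hE2 := energy_le (ltW (rho2_gt0 hG)) tb h2 hN.
have hS : energy sigma2 t b u2 `^ mu <= S.
  apply: powR_ler; [by []|exact: energy_ge0|].
  apply: le_trans (energy_le (sigma2_ge0 hG) tb h2 hN) _.
  by rewrite ler_wpM2l// powR_ge0.
have hD s : t <= s <= b ->
    japanese (y s) `^ mu <= A0 * (Xm + energy sigma1 t b u1 `^ mu + S).
  move=> stb; apply: le_trans (hA0 _ _ _ _ _ _ t0 tb bT h1 h2 hs s stb) _.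
  by rewrite ler_wpM2l// lerD2l.
have hI := int_cost_lower hG t0 tb bT h1 h2 hs hD.
have he : c / 2 / (1 + a) * (B1 * A + B2 * A3 + L * A0 * T) <= c / 2.
  by rewrite -aE mulrAC ler_pdivrMr// ler_wpM2l ?(ltW c20)// lerDr.
have := short_time_arith (ltW L0) (ltW T0) tau0 tauT A00 A_ge0 A30 B10 B20 E0
  (powR_ge0 _ _) hI hE2 erefl hw (hd b tbb) hdm htm hQ hQm he.
apply: le_trans; rewrite -/C lerB// ler_wpM2r// lerDl mulr_ge0// addr_ge0//.
Qed.

End ShortTime.

(** * Values and dynamic programming *)

Section Splice.
Context {R : realType} {m : nat}.
Variable U : set 'rV[R]_m.
Local Notation leb := (@lebesgue_measure R).
Implicit Types u v : R -> 'rV[R]_m.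

(** The time [s] belongs to the second control; agreement with the first one on the closed interval
    ending at [s] therefore holds almost everywhere only. *)
Definition splice (s : R) u v : R -> 'rV[R]_m := fun r => if r < s then u r else v r.

Lemma ae_neq (s : R) : {ae leb, forall r, r != s}.
Proof.
exists [set s]; split; [exact: measurable_set1 | exact: lebesgue_measure_set1 |].
by move=> r /= /negP; rewrite negbK => /eqP.
Qed.

Lemma spliceL s u v t : ae_eq_on t s (splice s u v) u.
Proof.
by apply: ae_mono (ae_neq s) => r rs /andP[_ r_le]; rewrite /splice lt_neqAle rs r_le.
Qed.

Lemma spliceR s u v r : s <= r -> splice s u v r = v r.
Proof. by rewrite /splice ltNge => ->. Qed.

Lemma spliceR_ae s u v b : ae_eq_on s b (splice s u v) v.
Proof. by apply: ae_true => r /andP[sr _]; exact: spliceR. Qed.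

Lemma ae_eq_on_cat (t s b : R) u v :
  ae_eq_on t s u v -> ae_eq_on s b u v -> ae_eq_on t b u v.
Proof.
apply: ae_mono2 => r h1 h2 /andP[tr rb].
by have [rs|sr] := leP r s; [apply: h1; rewrite tr | apply: h2; rewrite (ltW sr)].
Qed.

Lemma ae_eq_on_splice (t s b : R) u u' v v' : ae_eq_on t s u u' -> ae_eq_on s b v v' ->
  ae_eq_on t b (splice s u v) (splice s u' v').
Proof.
move=> hu hv; apply: ae_eq_on_cat.
  apply: ae_eq_on_trans (spliceL _ _ _ _) _; apply: ae_eq_on_trans hu _.
  exact/ae_eq_on_sym/spliceL.
apply: ae_eq_on_trans (spliceR_ae _ _ _ _) _; apply: ae_eq_on_trans hv _.
exact/ae_eq_on_sym/spliceR_ae.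
Qed.

Lemma measurable_control_splice (t s b : R) u v : measurable_control U t s u ->
  measurable_control U s b v -> measurable_control U t b (splice s u v).
Proof.
move=> [mu hu] [mv hv]; split.
  move=> i; rewrite (_ : (fun _ => _) = (fun r => if r < s then u r 0 i else v r 0 i)); last first.
    by apply/funext => r; rewrite /splice; case: ifP.
  have mP := @measurable_lt R t b s.
  apply: (@measurable_fun_if _ _ _ _ (fun r => u r 0 i) (fun r => v r 0 i) _ _ (fun r => r < s)) => //.
  - apply: measurable_funS (mu i) => // r [/= /mem_itvcc /andP[tr _] rs].
    by apply/mem_itvcc; rewrite tr ltW.
  - apply: measurable_funS (mv i) => // r [/= /mem_itvcc /andP[_ rb] /negbT].
    by rewrite -leNgt => sr; apply/mem_itvcc; rewrite sr.
move=> r /andP[tr rb]; rewrite /splice; case: (ltP r s) => rs.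
  by apply: hu; rewrite tr ltW.
by apply: hv; rewrite rs.
Qed.

Lemma Linfty_splice (t s b : R) u v : Linfty_controls U t s u ->
  Linfty_controls U s b v -> Linfty_controls U t b (splice s u v).
Proof.
move=> [mu [M hM]] [mv [N hN]]; split; first exact: measurable_control_splice.
exists (Num.max M N); apply: ae_mono2 hM hN => r hM hN /andP[tr rb].
rewrite le_max /splice; case: (ltP r s) => rs; first by rewrite hM// tr ltW.
by rewrite hN ?orbT// rs.
Qed.

Lemma L1_sub (t b s d : R) u : t <= s -> d <= b ->
  L1_controls U t b u -> L1_controls U s d u.
Proof.
move=> ts db [mu hu]; split; first exact: measurable_control_sub mu.
apply: le_lt_trans hu; apply: ge0_subset_integral => //.
- apply/measurable_EFinP; exact: measurable_enorm (proj1 mu).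
- by move=> r _; rewrite lee_fin enorm_ge0.
- by apply: subset_itv; rewrite bnd_simp.
Qed.

Lemma L1_splice (t s b : R) u v : t <= s <= b -> L1_controls U t s u ->
  L1_controls U s b v -> L1_controls U t b (splice s u v).
Proof.
move=> /andP[ts sb] [mu hu] [mv hv].
have mw := measurable_control_splice mu mv; split=> //.
have E : `[t, b]%classic = `[t, s[%classic `|` `[s, b]%classic.
  by rewrite -itv_bndbnd_setU ?bnd_simp.
have mE : measurable_fun `[t, b] (fun r => (enorm (splice s u v r))%:E).
  by apply/measurable_EFinP; exact: measurable_enorm (proj1 mw).
rewrite E ge0_integral_setU//=.
- apply: lte_add_pinfty.
    rewrite [ltLHS](_ : _ = \int[leb]_(r in `[t, s[) (enorm (u r))%:E)%E; last first.
      apply: eq_integral => r /set_mem /=.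
      by rewrite in_itv /= /splice => /andP[_ ->].
    apply: le_lt_trans hu; apply: ge0_subset_integral => //.
    + apply/measurable_EFinP; exact: measurable_enorm (proj1 mu).
    + by move=> r _; rewrite lee_fin enorm_ge0.
    + by apply: subset_itv; rewrite bnd_simp.
  rewrite [ltLHS](_ : _ = \int[leb]_(r in `[s, b]) (enorm (v r))%:E)%E//.
  apply: eq_integral => r /set_mem /=.
  by rewrite in_itv /= => /andP[/spliceR ->].
- by rewrite -E.
- by move=> r _; rewrite lee_fin enorm_ge0.
- by apply/disj_setPS => r [/=]; rewrite !in_itv /= => /andP[_ rs] /andP[]; rewrite leNgt rs.
Qed.

Lemma Linfty_ae (t b : R) u v : measurable_control U t b v -> ae_eq_on t b u v ->
  Linfty_controls U t b u -> Linfty_controls U t b v.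
Proof.
move=> mv uv [mu [M hM]]; split => //; exists M.
by apply: ae_mono2 uv hM => r h1 h2 rb; rewrite -h1// h2.
Qed.

End Splice.

(** * The payoff under changes of controls, restarting and exchange of the players *)

Section Payoff.
Context {R : realType} {n m1 m2 : nat} (G : game R n m1 m2).
Context (L c rho1 rho2 sigma1 sigma2 mu mu0 mu1 mu2 : R).
Hypothesis hG : standing_hypotheses G L c rho1 rho2 sigma1 sigma2 mu mu0 mu1 mu2.
Local Notation bm := bounded_measurable.
Local Notation int := integral_on.
Local Notation T := (horizon G).
Local Notation U1 := (ctrl1 G).
Local Notation U2 := (ctrl2 G).
Local Notation adm1 t b u := (Linfty_controls U1 t b u).
Local Notation adm2 t b u := (Linfty_controls U2 t b u).

Lemma int_cost_ae (t b : R) u1 u2 v1 v2 y : 0 <= t -> b <= T -> bounded_measurable_vec t b y ->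
  adm1 t b u1 -> adm2 t b u2 -> adm1 t b v1 -> adm2 t b v2 ->
  ae_eq_on t b u1 v1 -> ae_eq_on t b u2 v2 ->
  int t b (cost G u1 u2 y) = int t b (cost G v1 v2 y).
Proof.
move=> t0 bT vy h1 h2 k1 k2 e1 e2; apply: int_ae.
- exact: (proj1 (bm_cost hG t0 bT vy h1 h2)).
- exact: (proj1 (bm_cost hG t0 bT vy k1 k2)).
by apply: ae_mono2 e1 e2 => s e1 e2 stb; rewrite !costE e1// e2.
Qed.

Lemma payoff_ae (t : R) x u1 u2 v1 v2 : 0 <= t -> t <= T ->
  adm1 t T u1 -> adm2 t T u2 -> adm1 t T v1 -> adm2 t T v2 ->
  ae_eq_on t T u1 v1 -> ae_eq_on t T u2 v2 ->
  payoff G t x u1 u2 = payoff G t x v1 v2.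
Proof.
move=> t0 tT h1 h2 k1 k2 e1 e2.
have hs := trajectory_solution hG x t0 tT h1 h2.
have hs' := solution_ae hG t0 (lexx T) h1 h2 k1 k2 e1 e2 hs.
have [vy _] := solution_vbm hG t0 (lexx T) h1 h2 hs.
rewrite (payoffE hG t0 tT h1 h2 hs) (payoffE hG t0 tT k1 k2 hs').
by rewrite (int_cost_ae t0 (lexx T) vy h1 h2 k1 k2 e1 e2).
Qed.

Lemma payoff_split (t s : R) x u1 u2 y : 0 <= t -> t <= s -> s <= T ->
  adm1 t T u1 -> adm2 t T u2 -> solution G t T x u1 u2 y ->
  payoff G t x u1 u2 = int t s (cost G u1 u2 y) + payoff G s (y s) u1 u2.
Proof.
move=> t0 ts sT h1 h2 hs; have tT := le_trans ts sT; have s0 := le_trans t0 ts.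
have tsT : t <= s <= T by rewrite ts.
have [vy _] := solution_vbm hG t0 (lexx T) h1 h2 hs.
have hs' := solution_shift hG t0 (lexx T) h1 h2 hs tsT.
rewrite (payoffE hG t0 tT h1 h2 hs).
rewrite (payoffE hG s0 sT (Linfty_sub ts (lexx T) h1) (Linfty_sub ts (lexx T) h2) hs').
by rewrite addrA -(int_split tsT (bm_cost hG t0 (lexx T) vy h1 h2)).
Qed.

Lemma payoff_swap (t : R) x u1 u2 : 0 <= t -> t <= T -> adm1 t T u1 -> adm2 t T u2 ->
  payoff (swap_game G) t x u2 u1 = - payoff G t x u1 u2.
Proof.
move=> t0 tT h1 h2; have hs := trajectory_solution hG x t0 tT h1 h2.
have [vy _] := solution_vbm hG t0 (lexx T) h1 h2 hs.
rewrite (payoffE hG t0 tT h1 h2 hs).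
rewrite (payoffE (swap_hypotheses hG) t0 tT h2 h1 (y := trajectory G t x u1 u2) hs).
by rewrite opprD -(intN (bm_cost hG t0 (lexx T) vy h1 h2)).
Qed.

Lemma energy_zero m r (t b : R) : 0 < r -> energy r t b (fun=> 0 : 'rV[R]_m) = 0.
Proof.
move=> r0; rewrite energyE (_ : (fun _ => _) = fun s => 0 * (fun=> 0) s).
  by rewrite (intZ _ (bm_cst _ _ _)) mul0r.
by apply/funext => s; rewrite (enorm0_pow _ r0) mul0r.
Qed.

End Payoff.

(** * The upper value: finiteness, Lipschitz estimate, dynamic programming *)

Section Value.
Context {R : realType} {n m1 m2 : nat} (G : game R n m1 m2).
Context (L c rho1 rho2 sigma1 sigma2 mu mu0 mu1 mu2 : R).
Hypothesis hG : standing_hypotheses G L c rho1 rho2 sigma1 sigma2 mu mu0 mu1 mu2.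
Local Notation bm := bounded_measurable.
Local Notation int := integral_on.
Local Notation T := (horizon G).
Local Notation U1 := (ctrl1 G).
Local Notation U2 := (ctrl2 G).
Local Notation adm1 t b u := (Linfty_controls U1 t b u).
Local Notation adm2 t b u := (Linfty_controls U2 t b u).
Local Notation strat t b := (strategies U2 U1 t b).

Let L0 : 0 < L. Proof. exact: L_gt0 hG. Qed.
Let c0 : 0 < c. Proof. exact: c_gt0 hG. Qed.
Let T0 : 0 < T. Proof. exact: horizon_gt0 hG. Qed.
Let mu1le : 1 <= mu. Proof. exact: mu_ge1 hG. Qed.
Let mu_ge0 : 0 <= mu. Proof. exact: le_trans ler01 mu1le. Qed.
Let mum1 : 0 <= mu - 1. Proof. by rewrite subr_ge0. Qed.

Lemma payoff_upper_bound : exists2 C : R, 0 <= C & forall (t : R) x u1 u2,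
  0 <= t <= T -> adm1 t T u1 -> adm2 t T u2 ->
  payoff G t x u1 u2 <=
    C * (japanese x `^ mu + energy rho1 t T u1) - c / 2 * energy rho2 t T u2.
Proof.
have [C C0 h] := payoff_lower_bound (swap_hypotheses hG).
exists C => // t x u1 u2 tT h1 h2; have [t0 t1] := andP tT.
have := h t x u2 u1 tT h2 h1; rewrite (payoff_swap hG _ t0 t1 h1 h2).
by rewrite lerNr opprB.
Qed.

Definition value (t : R) (x : 'rV[R]_n) : R := fine (upper_value G t x).

Lemma zero_strategy (t b : R) : strat t b (fun _ _ => 0).
Proof.
split => [u _|*]; last exact: ae_eq_on_refl.
exact: Linfty_cst (ctrl2_0 hG).
Qed.

(** From below, the strategy that always plays 0; from above, the control 0 of Player 1 against any
    strategy. In both cases the coercive term has the favourable sign. *)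
Lemma value_bounds : exists2 C : R, 0 <= C & forall (t : R) x, 0 <= t <= T ->
  ((- (C * japanese x `^ mu))%:E <= upper_value G t x <= (C * japanese x `^ mu)%:E)%E.
Proof.
have [C1 C10 hl] := payoff_lower_bound hG.
have [C2 C20 hu] := payoff_upper_bound.
exists (C1 + C2) => [|t x tT]; first exact: addr_ge0.
have j0 : 0 <= japanese x `^ mu by exact: powR_ge0.
apply/andP; split.
  apply: le_ereal_sup_tmp; eexists; first by exists (fun _ _ => 0); [exact: zero_strategy|reflexivity].
  apply/ereal_infP => _ [u hu1 <-]; rewrite lee_fin.
  apply: le_trans (hl t x u _ tT hu1 (Linfty_cst _ _ (ctrl2_0 hG))).
  rewrite (energy_zero _ _ _ (rho2_gt0 hG)) addr0.
  have := mulr_ge0 C20 j0; have := energy_ge0 rho1 t T u.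
  have := mulr_ge0 (ltW (divr_gt0 c0 (ltr0Sn _ 1))) (energy_ge0 rho1 t T u).
  by atoms_lra.
apply/ereal_supP => _ [alpha [ha _] <-]; apply: ge_ereal_inf.
have h0 : adm1 t T (fun=> 0) by exact: Linfty_cst (ctrl1_0 hG).
eexists; first by exists (fun=> 0); [exact: h0|reflexivity].
have ha0 := ha _ (Linfty_L1 h0).
rewrite lee_fin; apply: le_trans (hu t x _ _ tT h0 ha0) _.
rewrite (energy_zero _ _ _ (rho1_gt0 hG)) addr0.
have := mulr_ge0 (ltW (divr_gt0 c0 (ltr0Sn _ 1))) (energy_ge0 rho2 t T (alpha (fun=> 0))).
by have := mulr_ge0 C10 j0; atoms_lra.
Qed.

Lemma upper_valueE (t : R) x : 0 <= t <= T -> upper_value G t x = (value t x)%:E.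
Proof.
move=> tT; have [C _ /(_ t x tT) /andP[h1 h2]] := value_bounds.
rewrite /value fineK// fin_numE; apply/andP; split.
  by apply: contraTneq h1 => ->.
by apply: contraTneq h2 => ->.
Qed.

Lemma value_growth : exists2 C : R, 0 <= C &
  forall (t : R) x, 0 <= t <= T -> `|value t x| <= C * japanese x `^ mu.
Proof.
have [C C0 h] := value_bounds; exists C => // t x tT.
by have := h t x tT; rewrite upper_valueE// !lee_fin ler_norml.
Qed.

(** Together with [value_strategy] and [value_control], this replaces the nested extended supremum
    and infimum by statements on real numbers. *)
Lemma value_ge (t : R) x a alpha : 0 <= t <= T -> strat t T alpha ->
  (forall u, adm1 t T u -> a <= payoff G t x u (alpha u)) -> a <= value t x.
Proof.
move=> tT ha h; rewrite -lee_fin -upper_valueE//; apply: le_ereal_sup_tmp.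
eexists; first by exists alpha; [exact: ha|reflexivity].
by apply/ereal_infP => _ [u hu <-]; rewrite lee_fin; exact: h.
Qed.

Lemma value_strategy (t : R) x e : 0 <= t <= T -> 0 < e -> exists2 alpha, strat t T alpha &
  forall u, adm1 t T u -> value t x - e <= payoff G t x u (alpha u).
Proof.
move=> tT e0.
have : ((value t x - e)%:E < upper_value G t x)%E.
  by rewrite upper_valueE// lte_fin ltrBlDr ltrDl.
move=> /ereal_sup_gtP[_ [alpha ha <-]] h; exists alpha => // u hu.
rewrite -lee_fin; apply: le_trans (ltW h) _.
by apply: ge_ereal_inf; eexists; [exists u; [exact: hu|reflexivity]|exact: lexx].
Qed.

Lemma value_control (t : R) x e alpha : 0 <= t <= T -> 0 < e -> strat t T alpha ->
  exists2 u, adm1 t T u & payoff G t x u (alpha u) <= value t x + e.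
Proof.
move=> tT e0 ha.
have : (upper_value G t x < (value t x + e)%:E)%E.
  by rewrite upper_valueE// lte_fin ltrDl.
move=> h; have /ereal_inf_lt[_ [u hu <-] h'] : (ereal_inf
    [set (payoff G t x u1 (alpha u1))%:E | u1 in Linfty_controls U1 t T] <
    (value t x + e)%:E)%E.
  apply: le_lt_trans h; apply: le_ereal_sup_tmp.
  by eexists; [exists alpha; [exact: ha|reflexivity]|exact: lexx].
by exists u => //; rewrite -lee_fin ltW.
Qed.

(** Truncation and test act at each time separately, so the modified map stays non-anticipating. *)
Lemma truncated_strategy (t b M : R) alpha : 0 <= M -> strat t b alpha ->
  strat t b (fun u s => if enorm (u s) <= M then alpha (truncation M u) s else 0).
Proof.
move=> M0 [ha1 ha2].
have tr u : L1_controls U1 t b u -> L1_controls U1 t b (truncation M u).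
  by move=> [mcu _]; apply: Linfty_L1; apply: Linfty_truncation => //; exact: ctrl1_0 hG.
split=> [u hu|u v s hu hv tsb uv].
  apply: Linfty_if; first exact: (measurable_enorm_le _ (proj1 hu)).
    exact/ha1/tr.
  exact: Linfty_cst (ctrl2_0 hG).
have huv : ae_eq_on t s (truncation M u) (truncation M v).
  by apply: ae_mono uv => r h rts; rewrite /truncation h.
have := ha2 _ _ s (tr _ hu) (tr _ hv) tsb huv.
by apply: ae_mono2 uv => r h1 h2 rts; rewrite h1// h2.
Qed.

Lemma value_lip_half : exists2 K : R, 0 <= K & forall (t : R) x y, 0 <= t <= T ->
  value t x - K * japanese_max y x `^ (mu - 1) * enorm (y - x) <= value t y.
Proof.
have [Cp Cp0 hp] := payoff_upper_bound; have [Cv Cv0 hv] := value_growth.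
have ci0 : 0 < 2 / c by rewrite divr_gt0.
(* [lip_core] produces [z] after [C1], so the energies are measured in units of [Zm = (z X) ^ mu]:
   the truncated control spends at most [Zm * T], and the rest bounds the energy of the answer. *)
have C10 : 0 <= T + 2 / c * (Cp * (1 + T) + Cv + 1) by nonneg.
have [z [K [z1 K0 core]]] := lip_core hG C10.
exists K => // t x y tT; have [t0 t1] := andP tT.
set X := japanese_max y x; apply/ler_addgt0Pr => e e0.
(* An error of at most 1 is at most [Zm]; thus near-optimality at [x] and [payoff_upper_bound] bound
   the energy of the answer. *)
have e'0 : 0 < Num.min e 1 by rewrite lt_min e0 ltr01.
have [alpha ha hal] := value_strategy x tT e'0.
have X1 : 1 <= X by exact: japanese_max_ge1.
have zX1 : 1 <= z * X by rewrite mulr_ege1.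
set Zm := (z * X) `^ mu; have Zm1 : 1 <= Zm by exact: powR_ge1.
have Zm0 : 0 <= Zm by exact: le_trans Zm1.
set M := Zm `^ (rho1^-1); have M0 : 0 <= M by exact: powR_ge0.
have r0 := rho1_gt0 hG.
have MZ : M `^ rho1 = Zm by rewrite -powRrM mulVf ?gt_eqF// powRr1.
have jx : japanese x <= X by rewrite le_max lexx orbT.
have jy : japanese y <= X by rewrite le_max lexx.
have jxZ : japanese x `^ mu <= Zm.
  apply: powR_ler => //; first exact: ltW (japanese_gt0 x).
  by rewrite (le_trans jx)// ler_peMl// (le_trans ler01).
suff : value t x - Num.min e 1 - K * X `^ (mu - 1) * enorm (y - x) <= value t y.
  have : Num.min e 1 <= e by rewrite ge_min lexx.
  by move: (Num.min e 1) => ee; atoms_lra.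
apply: (value_ge tT (truncated_strategy M0 ha)) => u hu.
have mu' := proj1 hu.
have hut : adm1 t T (truncation M u).
  by apply: Linfty_truncation => //; exact: ctrl1_0 hG.
have hv2 : adm2 t T (alpha (truncation M u)) by exact: (proj1 ha _ (Linfty_L1 hut)).
have hw := proj1 (truncated_strategy M0 ha) u (Linfty_L1 hu).
have hJ := hal _ hut.
apply: le_trans (lerB hJ (lexx _)) _.
apply: (core t X x y u (truncation M u) _ _ (fun s => M < enorm (u s)) tT jx jy) => //.
- apply: measurable_fun_ltr => //; exact: measurable_enorm (proj1 mu').
- move=> s stT; rewrite /truncation; case: (ltP M (enorm (u s))) => hM; last by [].
  by split => //; rewrite -/Zm -MZ; apply: powR_ler; [exact: ltW r0|exact: M0|exact: ltW hM].
have E1 : energy rho1 t T (truncation M u) <= Zm * (T - t).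
  rewrite -MZ; apply: energy_le (ltW r0) t1 hut _ => s _; exact: truncation_le.
have E1' : Zm * (T - t) <= Zm * T by rewrite ler_wpM2l// lerBlDr lerDl.
have := hp t x _ _ tT hut hv2; have := hv t x tT; rewrite ler_norml => /andP[vl _] pu.
set E2 := energy rho2 _ _ _ in pu *; set E := energy rho1 _ _ _ in E1 pu *.
set J := payoff _ _ _ _ _ in hJ pu.
have q1 : c / 2 * E2 <= Cp * (Zm + Zm * T) + Cv * Zm + Zm.
  have k1 : Cp * (japanese x `^ mu + E) <= Cp * (Zm + Zm * T).
    by rewrite ler_wpM2l// lerD// (le_trans E1).
  have k2 : Cv * japanese x `^ mu <= Cv * Zm by rewrite ler_wpM2l.
  have k3 : Num.min e 1 <= Zm by rewrite ge_min Zm1 orbT.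
  by move: k1 k2 k3 vl pu hJ; move: (Num.min e 1) => ee; atoms_lra.
have q2 : E2 <= 2 / c * (Cp * (Zm + Zm * T) + Cv * Zm + Zm).
  have := ler_wpM2l (ltW ci0) q1; rewrite [leLHS](_ : _ = E2)//; field.
  by rewrite gt_eqF.
apply: le_trans (lerD (le_trans E1 E1') q2) _.
by rewrite -/Zm le_eqVlt; apply/orP; left; apply/eqP; ring.
Qed.

Lemma value_lip : exists2 K : R, 0 < K & forall (t : R) x y, 0 <= t <= T ->
  `|value t x - value t y| <= K * japanese_max x y `^ (mu - 1) * enorm (x - y).
Proof.
have [K K0 h] := value_lip_half; exists (K + 1) => [|t x y tT]; first by rewrite ltr_wpDl.
have h1 := h t x y tT; have h2 := h t y x tT.
rewrite japanese_maxC enormBC in h1.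
have := mulr_ge0 (powR_ge0 (japanese_max x y) (mu - 1)) (enorm_ge0 (x - y)).
by rewrite ler_norml => p; apply/andP; split; move: h1 h2 p; atoms_lra.
Qed.

Lemma splice_strategy (t s : R) alpha u0 : t <= s <= T -> strat t T alpha -> adm1 t s u0 ->
  strat s T (fun u => alpha (splice s u0 u)).
Proof.
move=> /[dup] tsT /andP[ts sT] [ha1 ha2] h0.
split=> [u hu|u v b hu hv /[dup] sbT /andP[sb bT] uv].
  by apply: (Linfty_sub ts (lexx T)); apply: ha1; apply: L1_splice => //; exact: Linfty_L1.
have hc w : L1_controls U1 s T w -> L1_controls U1 t T (splice s u0 w).
  by move=> hw; apply: L1_splice => //; exact: Linfty_L1.
apply: (ae_eq_on_sub ts (lexx b)); apply: ha2; [exact: hc|exact: hc| |].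
  by rewrite (le_trans ts).
by apply: ae_eq_on_splice uv; exact: ae_eq_on_refl.
Qed.

(** A near-optimal strategy at time [t] remains a strategy from time [s] on, once the past of [u] is
    prefixed. Against it Player 1 has a continuation that costs at most the value at the reached
    state plus [e / 2], and the total is still nearly the value at [t]. *)
Lemma dpp_strategy (t s : R) x e : 0 <= t -> t <= s -> s <= T -> 0 < e ->
  exists2 alpha, strat t T alpha & forall u y, adm1 t T u ->
    solution G t s x u (alpha u) y ->
    value t x - e <= int t s (cost G u (alpha u) y) + value s (y s).
Proof.
move=> t0 ts sT e0; have tT : 0 <= t <= T by rewrite t0 (le_trans ts).
have sT' : 0 <= s <= T by rewrite sT (le_trans t0).
have tsT : t <= s <= T by rewrite ts.
have e2 : 0 < e / 2 by rewrite divr_gt0.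
have [alpha ha hal] := value_strategy x tT e2; exists alpha => // u y hu hy.
have hus := Linfty_sub (lexx t) sT hu.
have hb := splice_strategy tsT ha hus.
have [u' hu' hJ] := value_control (y s) sT' e2 hb.
set w := splice s u u' in hJ.
have hw : adm1 t T w by exact: Linfty_splice.
have haw := proj1 ha w (Linfty_L1 hw); have hau := proj1 ha u (Linfty_L1 hu).
have hJ' := hal w hw; have tT' := le_trans ts sT.
have hz := trajectory_solution hG x t0 tT' hw haw.
set z := trajectory _ _ _ _ _ in hz.
have wu : ae_eq_on t s w u by exact: spliceL.
have awu : ae_eq_on t s (alpha w) (alpha u).
  by apply: (proj2 ha) => //; exact: Linfty_L1.
have hws := Linfty_sub (lexx t) sT hw.
have haws := Linfty_sub (lexx t) sT haw; have haus := Linfty_sub (lexx t) sT hau.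
have hzs := solution_ae hG t0 sT hws haws hus haus wu awu (solution_cat hz sT).
have zy : forall r, t <= r <= s -> z r = y r by exact: (solution_unique hG t0 sT hus haus hzs hy).
have zsy : z s = y s by apply: zy; rewrite ts lexx.
have [vz _] := solution_vbm hG t0 sT hus haus hzs.
move: hJ'; rewrite (payoff_split hG t0 ts sT hw haw hz) zsy.
rewrite (int_cost_ae hG t0 sT vz hws haws hus haus wu awu).
rewrite (@int_eq _ t s _ (cost G u (alpha u) y)); last by move=> r rts; rewrite !costE zy.
rewrite (@payoff_ae _ _ _ _ G _ _ _ _ _ _ _ _ _ _ hG s (y s) w (alpha w) u' (alpha w)) //; last 1 first.
- exact: ae_eq_on_refl.
- by move: hJ; rewrite /w; atoms_lra.
- by case/andP: sT'.
- exact: Linfty_sub ts (lexx T) hw.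
- exact: Linfty_sub ts (lexx T) haw.
- exact: Linfty_sub ts (lexx T) haw.
- exact: spliceR_ae.
Qed.

(** Follow [beta] up to [s], then a near-optimal strategy for the state reached. These strategies
    are picked by choice for all states at once; no measurability in the state is required, since
    for a given control a single one of them is used. *)
Lemma dpp_ge (t s : R) x a beta : 0 <= t -> t <= s -> s <= T -> strat t T beta ->
  (forall u y, adm1 t T u -> solution G t s x u (beta u) y ->
    a <= int t s (cost G u (beta u) y) + value s (y s)) -> a <= value t x.
Proof.
move=> t0 ts sT hb h; have tT : 0 <= t <= T by rewrite t0 (le_trans ts).
have sT' : 0 <= s <= T by rewrite sT (le_trans t0).
have tsT : t <= s <= T by rewrite ts.
apply/ler_addgt0Pr => e e0.
have optimal z : exists alpha, strat s T alpha /\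
    forall u, adm1 s T u -> value s z - e <= payoff G s z u (alpha u).
  by have [al h1 h2] := value_strategy z sT' e0; exists al.
have [after afterP] := choice optimal.
(* The reached state only depends on [u] before time [s], hence the killed control. *)
pose kill (u : R -> 'rV[R]_m1) := splice s u (fun=> 0).
(* A strategy must also answer controls that are only integrable, for which no path has been
   constructed; those get the default state 0. Membership in the two cases depends only on [u] up to
   null sets before [s]. *)
pose reached u : 'rV[R]_n := if pselect (adm1 t T (kill u))
  then trajectory G t x (kill u) (beta (kill u)) s else 0.
have kill_ae u v : ae_eq_on t s u v -> ae_eq_on t T (kill u) (kill v).
  by move=> uv; apply: ae_eq_on_splice => //; exact: ae_eq_on_refl.
have mkill u : L1_controls U1 t T u -> measurable_control U1 t T (kill u).
  move=> [mcu _]; apply: measurable_control_splice.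
    exact: measurable_control_sub (lexx t) sT mcu.
  by case: (Linfty_cst s T (ctrl1_0 hG)).
have reachedP u : adm1 t T (kill u) -> forall v y, adm1 t T v -> ae_eq_on t s u v ->
    solution G t s x v (beta v) y -> reached u = y s.
  move=> hk v y hv uv hy; rewrite /reached; case: pselect => [hk'|//] /=.
  have hbk := proj1 hb _ (Linfty_L1 hk); have hbv := proj1 hb _ (Linfty_L1 hv).
  have hz := trajectory_solution hG x t0 (le_trans ts sT) hk hbk.
  have kv : ae_eq_on t s (kill u) v by exact: ae_eq_on_trans (spliceL _ _ _ _) uv.
  have bkv : ae_eq_on t s (beta (kill u)) (beta v).
    by apply: (proj2 hb) => //; exact: Linfty_L1.
  have hks := Linfty_sub (lexx t) sT hk; have hbks := Linfty_sub (lexx t) sT hbk.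
  have hvs := Linfty_sub (lexx t) sT hv; have hbvs := Linfty_sub (lexx t) sT hbv.
  have hzs := solution_ae hG t0 sT hks hbks hvs hbvs kv bkv (solution_cat hz sT).
  by apply: (solution_unique hG t0 sT hvs hbvs hzs hy); rewrite ts lexx.
pose alpha u := splice s (beta u) (after (reached u) u).
have ha : strat t T alpha.
  split=> [u hu|u v b hu hv /[dup] tbT /andP[tb bT] uv].
    apply: Linfty_splice; first exact: Linfty_sub (lexx t) sT (proj1 hb _ hu).
    exact: (proj1 (proj1 (afterP _)) _ (L1_sub ts (lexx T) hu)).
  have buv := proj2 hb u v b hu hv tbT uv.
  have [bs|sb] := leP b s.
    apply: ae_eq_on_trans (ae_eq_on_sub (lexx t) bs (spliceL s _ _ t)) _.
    apply: ae_eq_on_trans buv _; apply: ae_eq_on_sym.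
    exact: (ae_eq_on_sub (lexx t) bs (spliceL s _ _ t)).
  have uvs := ae_eq_on_sub (lexx t) (ltW sb) uv.
  (* Controls that agree up to [s] lead to the same reached state, hence to the same continuing
     strategy, whose own non-anticipation then applies. *)
  have -> : alpha v = splice s (beta v) (after (reached u) v).
    rewrite /alpha; congr (splice s (beta v) (after _ v)).
    rewrite {1}/reached; case: pselect => hkv /=.
      have hku : adm1 t T (kill u).
        by apply: (Linfty_ae (mkill u hu) _ hkv); apply/ae_eq_on_sym; exact: kill_ae.
      have hbk := proj1 hb _ (Linfty_L1 hkv).
      have hz := trajectory_solution hG x t0 (le_trans ts sT) hkv hbk.
      rewrite (reachedP u hku (kill v) _ hkv _ (solution_cat hz sT))//.
      by apply: ae_eq_on_trans uvs _; apply/ae_eq_on_sym; exact: spliceL.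
    rewrite /reached; case: pselect => [hku|//]; exfalso; apply: hkv.
    by apply: (Linfty_ae (mkill v hv) _ hku); exact: kill_ae.
  apply: ae_eq_on_splice; first exact: (ae_eq_on_sub (lexx t) (ltW sb) buv).
  apply: (proj2 (proj1 (afterP _))).
  - exact: L1_sub ts (lexx T) hu.
  - exact: L1_sub ts (lexx T) hv.
  - by rewrite (ltW sb).
  - exact: ae_eq_on_sub ts (lexx b) uv.
suff : a - e <= value t x by rewrite lerBlDr.
apply: (value_ge tT ha) => u hu.
have hau := proj1 ha u (Linfty_L1 hu); have hbu := proj1 hb u (Linfty_L1 hu).
have hy := trajectory_solution hG x t0 (le_trans ts sT) hu hau.
set y := trajectory _ _ _ _ _ in hy.
have hus := Linfty_sub (lexx t) sT hu; have haus := Linfty_sub (lexx t) sT hau.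
have hbus := Linfty_sub (lexx t) sT hbu.
have ab : ae_eq_on t s (alpha u) (beta u) by exact: spliceL.
have hys := solution_ae hG t0 sT hus haus hus hbus (ae_eq_on_refl _ _ _) ab (solution_cat hy sT).
have [vy _] := solution_vbm hG t0 sT hus hbus hys.
have hk : adm1 t T (kill u).
  by apply: Linfty_splice => //; exact: Linfty_cst (ctrl1_0 hG).
have ry := reachedP u hk u y hu (ae_eq_on_refl _ _ _) hys.
rewrite (payoff_split hG t0 ts sT hu hau hy).
rewrite (int_cost_ae hG t0 sT vy hus haus hus hbus (ae_eq_on_refl _ _ _) ab).
have hu's := Linfty_sub ts (lexx T) hu.
have [af1 af2] := afterP (y s).
have haf := proj1 af1 u (Linfty_L1 hu's).
rewrite (payoff_ae hG (y s) _ sT hu's (Linfty_sub ts (lexx T) hau) hu's haf); last 1 first.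
- by rewrite /alpha ry; exact: spliceR_ae.
- by have := h u y hu hys; have := af2 u hu's; atoms_lra.
- by case/andP: sT'.
- exact: ae_eq_on_refl.
Qed.

End Value.

(** * Viscosity inequalities *)

Section LocalContinuity.
Context {R : realType}.

Lemma within_ball (X : pseudoMetricType R) (Y : normedModType R) (A : set X) (F : X -> Y)
    (x : X) (e : R) :
  {within A, continuous F} -> A x -> 0 < e ->
  exists2 d : R, 0 < d & forall y, A y -> ball x d y -> `|F y - F x| < e.
Proof.
move=> /subspace_continuousP /(_ x) h Ax e0.
have /cvgrPdist_lt/(_ e e0) := h Ax; rewrite nearE /within /= => /nbhs_ballP[d /= d0 hd].
by exists d => // y Ay xy; rewrite distrC; exact: hd.
Qed.

Lemma ball_enorm n (x y : 'rV[R]_n) (d : R) : enorm (y - x) < d -> ball x d y.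
Proof.
by move=> h; rewrite -ball_normE /= distrC; exact: le_lt_trans (mxnorm_le_enorm _) h.
Qed.

Lemma ball_dist (x y d : R) : `|y - x| < d -> ball x d y.
Proof. by move=> h; rewrite -ball_normE /= distrC. Qed.

Lemma enorm_lt_ball n (x y : 'rV[R]_n) (d : R) : 0 < d ->
  ball x (d / n.+1%:R) y -> enorm (y - x) < d.
Proof.
move=> d0; rewrite -ball_normE /= distrC => h.
apply: le_lt_trans (enorm_le_mxnorm _) _.
have n0 : 0 < n.+1%:R :> R by rewrite ltr0n.
apply: le_lt_trans (_ : n.+1%:R * `|y - x| < d); last by rewrite mulrC -ltr_pdivlMr.
by rewrite ler_wpM2r// ler_nat.
Qed.

(** Heine's theorem for continuity relative to [A], from the formulation of compactness by near
    coverings; halving the radius leaves room for the triangle inequality. *)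
Lemma uniformly_continuous_compact (X : pseudoMetricType R) (Y : normedModType R) (A : set X)
    (F : X -> Y) (e : R) :
  compact A -> {within A, continuous F} -> 0 < e ->
  exists2 d : R, 0 < d & forall x y, A x -> A y -> ball x d y -> `|F y - F x| < e.
Proof.
move=> /compact_near_coveringP cA cF e0.
have e2 : 0 < e / 2 by rewrite divr_gt0.
have h : \forall d \near (0 : R)^'+, A `<=` [set x | A x -> forall y, A y -> ball x d y -> `|F y - F x| < e].
  apply: (cA _ _ (fun d x => A x -> forall y, A y -> ball x d y -> `|F y - F x| < e)) => x Ax.
  have [d d0 hd] := within_ball cF Ax e2.
  have d2 : 0 < d / 2 by rewrite divr_gt0.
  exists (ball x (d / 2), [set r | r < d / 2]).
    by split; [exact: nbhsx_ballx | exact: nbhs_right_lt].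
  move=> [x' r] /= [xx' rd] Ax' y Ay xy.
  have h1 : ball x d x' by apply: le_ball xx'; rewrite ler_pdivrMr// ler_peMr ?(ltW d0)// ler1n.
  have h2 : ball x d y.
    by rewrite [d]splitr; apply: ball_triangle xx' _; apply: le_ball xy; exact: ltW.
  rewrite -[F y](subrK (F x)) -addrA (splitr e).
  apply: le_lt_trans (ler_normD _ _) _; rewrite (distrC (F x)).
  by rewrite ltrD// hd.
have : \forall d \near (0 : R)^'+, 0 < d by exact: nbhs_right_gt.
move=> d0; have [d [d1 d2]] := filter_ex (filterI d0 h).
by exists d => // x y Ax; exact: d2.
Qed.

Lemma bounded_closed_ball_compact n (A : set 'rV[R]_n) (M : R) : closed A ->
  compact [set x | A x /\ enorm x <= M].
Proof.
move=> cA; apply: bounded_closed_compact.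
  exists M; split; first exact: num_real.
  move=> y My x [_ hx]; apply: le_trans (mxnorm_le_enorm _) _.
  by rewrite (le_trans hx) ?ltW.
apply: closedI => //.
apply: (@closed_comp _ _ (@enorm R n) [set r | r <= M]); last exact: closed_le.
move=> x _ S /nbhs_ballP[e /= e0 hS].
have n0 : 0 < n.+1%:R :> R by rewrite ltr0n.
apply/nbhs_ballP; exists (e / n.+1%:R) => /=; first by rewrite divr_gt0.
move=> y /(enorm_lt_ball e0) h; apply: hS; apply: ball_dist.
have := ler_enorm_dist y x; have := ler_enorm_dist x y; rewrite (enormBC x) => h1 h2.
by rewrite ltr_norml; move: h h1 h2; atoms_lra.
Qed.

End LocalContinuity.

Lemma generator_arith (R : realType) (P S L X C w1 w2 Xm Ym th th' c s1 E d g q : R) :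
  P + S * L * (X + C + w1) + L * (Xm + w2) + th' <= c / 2 * E ->
  - (S * (L * (X + s1 + w1))) <= d -> c * E - L * (Ym + w2) <= g -> L * Ym <= L * Xm ->
  S * L * s1 <= c / 2 * E + S * L * C -> - P <= q -> th <= th' -> th <= q + d + g.
Proof. lra. Qed.

(** * Selecting answers that keep the generator large *)

Section Selection.
Context {R : realType} {n m1 m2 : nat} (G : game R n m1 m2).
Context (L c rho1 rho2 sigma1 sigma2 mu mu0 mu1 mu2 : R).
Hypothesis hG : standing_hypotheses G L c rho1 rho2 sigma1 sigma2 mu mu0 mu1 mu2.
Local Notation T := (horizon G).
Local Notation U1 := (ctrl1 G).
Local Notation U2 := (ctrl2 G).
Local Notation V := (R * 'rV[R]_n)%type.
Variables (phi gt : V -> R) (gx : V -> 'rV[R]_n).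
Hypothesis hphi : C1_grad phi gt gx.

Let L0 : 0 < L. Proof. exact: L_gt0 hG. Qed.
Let c0 : 0 < c. Proof. exact: c_gt0 hG. Qed.
Let T0 : 0 < T. Proof. exact: horizon_gt0 hG. Qed.
Let mu1le : 1 <= mu. Proof. exact: mu_ge1 hG. Qed.
Let mu_ge0 : 0 <= mu. Proof. exact: le_trans ler01 mu1le. Qed.

(** The derivative of [phi] along the dynamics plus the running cost: integrated over a path it
    gives the increment of [phi] plus the cost. *)
Definition generator (r : R) (y : 'rV[R]_n) (v : 'rV[R]_m1) (w : 'rV[R]_m2) : R :=
  gt (r, y) + dotp (gx (r, y)) (dyn G r y v w) + running G r y v w.

Lemma generator_continuous : {within game_domain G, continuous
  (fun z : R * 'rV[R]_n * 'rV[R]_m1 * 'rV[R]_m2 => generator z.1.1.1 z.1.1.2 z.1.2 z.2)}.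
Proof.
have [cgt cgx _ _] := hphi.
have cproj : {within game_domain G, continuous
    (fun z : R * 'rV[R]_n * 'rV[R]_m1 * 'rV[R]_m2 => (z.1.1.1, z.1.1.2))}.
  apply: continuous_subspaceT => z.
  have -> : (fun z : R * 'rV[R]_n * 'rV[R]_m1 * 'rV[R]_m2 => (z.1.1.1, z.1.1.2)) =
      (fun z => z.1.1) by apply/funext => -[[[? ?] ?] ?].
  by apply: (@continuous_comp _ _ _ fst fst); exact: cvg_fst.
move=> z; apply: cvgD; last exact: (running_continuous hG).
apply: cvgD.
  by apply: (cvg_comp _ _ (cproj z)); exact: cgt.
apply: (@continuous_dotp R n (subspace (game_domain G))) => i z'.
  by apply: (cvg_comp _ _ (cproj z') (cgx i _)).
apply: (@continuous_comp (subspace (game_domain G)) _ _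
  (fun z => dyn G z.1.1.1 z.1.1.2 z.1.2 z.2) (fun M : 'rV[R]_n => M 0 i)).
  exact: (dyn_continuous hG).
exact: coord_continuous.
Qed.

(** Against the fixed answer [w0] the running cost grows like [|v| ^ rho1] and the drift only like
    [|v| ^ sigma1], with [sigma1 < rho1]. So one answer serves all large [v], uniformly near
    [(t0, x0)]. *)
Lemma generator_coercive (t0 : R) x0 w0 theta : U2 w0 -> exists M d : R, 0 < d /\
  forall r y v, U1 v -> 0 <= r <= T -> `|r - t0| < d -> enorm (y - x0) < d ->
    M <= enorm v -> theta <= generator r y v w0.
Proof.
move=> hw0; have [cgt cgx _ _] := hphi.
have s1r : sigma1 * 1 < rho1.
  by apply: le_lt_trans (sigma1_rho1 hG); rewrite ler_wpM2l// (sigma1_ge0 hG).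
have near_le (F : V -> R) : continuous F -> exists2 d : R, 0 < d &
    forall r y, `|r - t0| < d -> enorm (y - x0) < d -> `|F (r, y)| <= `|F (t0, x0)| + 1.
  move=> cF; have /cvgrPdist_lt/(_ 1 ltr01) := cF (t0, x0).
  rewrite nearE => /nbhs_ballP[d /= d0 hd]; exists d => // r y h1 h2.
  have /hd /= : ball (t0, x0) d (r, y) by split; [exact: ball_dist | exact: ball_enorm].
  by move=> h; have := ler_normB (F (t0, x0)) (F (t0, x0) - F (r, y)); rewrite subKr; lra.
have [d1 d10 hgt] := near_le _ cgt.
have cgx2 : continuous (fun z => dotp (gx z) (gx z)) by exact: continuous_dotp.
have [d2 d20 hgx] := near_le _ cgx2.
set P := `|gt (t0, x0)| + 1 in hgt; set Q := `|dotp (gx (t0, x0)) (gx (t0, x0))| + 1 in hgx.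
have Q0 : 0 <= Q by rewrite addr_ge0.
have c20 : 0 < c / 2 by rewrite divr_gt0.
set S := Num.sqrt Q; have S0 : 0 <= S by rewrite sqrtr_ge0.
have SL : 0 <= S * L by rewrite mulr_ge0 ?(ltW L0).
have e0 : 0 < c / 2 / (1 + S * L) by rewrite divr_gt0// ltr_pwDl.
have [C C0 hC] := absorb_powR (sigma1_ge0 hG) (lexx 1) s1r e0.
set X := japanese x0 + 1; have X0 : 0 <= X by rewrite addr_ge0// ltW// japanese_gt0.
set B := P + S * L * (X + C + enorm w0 `^ sigma2) + L * (X `^ mu + enorm w0 `^ rho2) + `|theta|.
have w1 : 0 <= enorm w0 `^ sigma2 by exact: powR_ge0.
have w2 : 0 <= enorm w0 `^ rho2 by exact: powR_ge0.
have P0 : 0 <= P by rewrite addr_ge0.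
have B0 : 0 <= B / (c / 2).
  by rewrite divr_ge0 ?(ltW c20)// /B; nonneg.
exists ((B / (c / 2)) `^ rho1^-1), (Num.min 1 (Num.min d1 d2)); split.
  by rewrite !lt_min ltr01 d10 d20.
move=> r y v hv rT; rewrite !lt_min => /and3P[_ r1 r2] /and3P[y0 y1 y2] Mv.
have rho0 := rho1_gt0 hG.
have E1 : B <= c / 2 * enorm v `^ rho1.
  rewrite mulrC -(ler_pdivrMr _ _ c20).
  rewrite -[leLHS](_ : ((B / (c / 2)) `^ rho1^-1) `^ rho1 = _); last first.
    by rewrite -powRrM mulVf ?gt_eqF// powRr1.
  by apply: powR_ler => //; [exact: ltW | exact: powR_ge0].
have g1 := hgt r y r1 y1; have g2 := hgx r y r2 y2.
have gxS : enorm (gx (r, y)) <= S.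
  rewrite -(ger0_norm (enorm_ge0 _)) -sqrtr_sqr sqr_enorm ler_sqrt//.
  exact: le_trans (ler_norm _) g2.
have jy : japanese y <= X by apply: le_trans (japanese_dist y x0) _; rewrite lerD2l ltW.
have fb := dyn_growth hG y rT hv hw0.
have hd : - (S * (L * (X + enorm v `^ sigma1 + enorm w0 `^ sigma2))) <=
    dotp (gx (r, y)) (dyn G r y v w0).
  rewrite lerNl -dotpNl; apply: le_trans (dotp_le _ _) _; rewrite enormN.
  apply: ler_pM => //; [exact: enorm_ge0 | exact: enorm_ge0 |].
  apply: le_trans fb _; rewrite (ler_wpM2l (ltW L0))//.
  by rewrite lerD2r lerD2r.
have gl := running_lower hG y rT hv hw0.
have jm : L * japanese y `^ mu <= L * X `^ mu.
  by rewrite ler_wpM2l ?(ltW L0)// powR_ler// ltW// japanese_gt0.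
have ab := hC (enorm v) (enorm_ge0 v); rewrite powRr1 ?powR_ge0// in ab.
have ab2 : S * L * enorm v `^ sigma1 <= c / 2 * enorm v `^ rho1 + S * L * C.
  apply: le_trans (ler_wpM2l SL ab) _; rewrite mulrDr lerD2r mulrA ler_wpM2r ?powR_ge0//.
  rewrite mulrCA ler_piMr ?(ltW c20)// ler_pdivrMr ?ltr_pwDl// mul1r.
  by rewrite lerDr.
have g1' : - P <= gt (r, y) by move: g1; rewrite ler_norml => /andP[].
have th := ler_norm theta.
exact: generator_arith E1 hd gl jm ab2 g1' th.
Qed.

(** For moderate [v], an answer good at one point is good in a neighbourhood by continuity, and
    finitely many neighbourhoods cover the compact set of such [v]; for large [v] the answer [w0]
    works by coercivity. *)
Lemma selection (t0 : R) x0 (A : set 'rV[R]_m2) w0 theta : 0 <= t0 <= T -> A `<=` U2 -> A w0 ->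
  (forall v, U1 v -> exists2 w, A w & theta < generator t0 x0 v w) ->
  exists (psi : 'rV[R]_m1 -> 'rV[R]_m2) (N d : R), [/\ 0 < d,
    forall v, A (psi v), forall v, enorm (psi v) <= N,
    forall (t b : R) u, measurable_control U1 t b u -> measurable_control U2 t b (psi \o u) &
    forall r y v, U1 v -> 0 <= r <= T -> `|r - t0| < d -> enorm (y - x0) < d ->
      theta <= generator r y v (psi v)].
Proof.
move=> t0T AU Aw0 hsel.
have [M [d0 [d00 hM]]] := generator_coercive t0 x0 theta (AU _ Aw0).
pose good v w (e : R) := [/\ A w, 0 < e & forall r y v', 0 <= r <= T -> U1 v' ->
  `|r - t0| < e -> enorm (y - x0) < e -> enorm (v' - v) < e -> theta <= generator r y v' w].
have hgood v : exists we : 'rV[R]_m2 * R, U1 v -> good v we.1 we.2.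
  have [Uv|nUv] := pselect (U1 v); last by exists (0, 0).
  have [w Aw hw] := hsel v Uv.
  have dom : game_domain G (t0, x0, v, w) by split => //=; exact: AU.
  have g0 : 0 < generator t0 x0 v w - theta by rewrite subr_gt0.
  have [e e0 he] := within_ball generator_continuous dom g0.
  exists (w, e) => _; split => // r y v' rT Uv' h1 h2 h3.
  have dom' : game_domain G (r, y, v', w) by split => //=; exact: AU.
  have /= := he _ dom'; rewrite distrC => hh.
  have {hh} /= h := hh _.
  have /h : ball (t0, x0, v, w) e (r, y, v', w).
    split; last exact: ballxx.
    split; last exact: ball_enorm.
    by split; [exact: ball_dist | exact: ball_enorm].
  move=> /(le_lt_trans (ler_norm _)); rewrite ltrD2l ltrN2; exact: ltW.
have [we hwe] := choice hgood.
pose K := [set v | U1 v /\ enorm v <= M].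
have cK : compact K by apply: bounded_closed_ball_compact; exact: ctrl1_closed hG.
rewrite compact_cover in cK.
(* The open balls are those of the sup norm; dividing by [m1 + 1] places them in the Euclidean balls
   of radius [(we v).2]. *)
have [|v [Uv]|D DK hD] := cK _ K (fun v => ball v ((we v).2 / m1.+1%:R)).
- by move=> v _; exact: ball_open.
- move=> Mv; exists v => //=; apply: ballxx; rewrite divr_gt0//.
  by have [_] := hwe v Uv.
have hDU v : v \in finmap.enum_fset D -> U1 v.
  by move=> vD; have := DK v vD; rewrite inE => -[].
(* Induction on the list of centres: each adds one test to a nested conditional, so [psi] takes
   finitely many values, is bounded and preserves measurability. *)
suff H (l : seq 'rV[R]_m1) : (forall v, v \in l -> U1 v) ->
    exists (psi : 'rV[R]_m1 -> 'rV[R]_m2) (N d : R), [/\ 0 < d,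
      forall v, A (psi v), forall v, enorm (psi v) <= N,
      forall (t b : R) u, measurable_control U1 t b u -> measurable_control U2 t b (psi \o u) &
      forall r y v, U1 v -> 0 <= r <= T -> `|r - t0| < d -> enorm (y - x0) < d ->
        (exists2 a, a \in l & enorm (v - a) < (we a).2) \/ M <= enorm v ->
        theta <= generator r y v (psi v)].
  have [psi [N [d [h1 h2 h3 h4 h5]]]] := H (finmap.enum_fset D) hDU; exists psi, N, d; split=> // r y v Uv rT rd yd.
  apply: h5 => //; have [vM|/ltW] := leP (enorm v) M; last by right.
  left; have [a /= aD va] := hD v (conj Uv vM); exists a => //.
  by apply: enorm_lt_ball va; have [_] := hwe a (hDU a aD).
elim: l => [_|a l IH al].
  exists (fun=> w0), (enorm w0), d0; split => //.
    by move=> t b u mcu; split => // *; exact: AU.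
  by move=> r y v Uv rT rd yd [[] //|]; exact: hM.
have [|psi [N [d [h1 h2 h3 h4 h5]]]] := IH.
  by move=> v vl; apply: al; rewrite inE vl orbT.
have Ua : U1 a by apply: al; rewrite inE eqxx.
have [Awa ea0 ha] := hwe a Ua.
exists (fun v => if enorm (v - a) < (we a).2 then (we a).1 else psi v).
exists (Num.max (enorm (we a).1) N), (Num.min d (we a).2); split.
- by rewrite lt_min h1 ea0.
- by move=> v; case: ifP.
- by move=> v; rewrite le_max; case: ifP; rewrite ?lexx ?h3 ?orbT.
- move=> t b u mcu; apply: measurable_control_if (h4 t b u mcu).
    apply: measurable_fun_ltr => //; apply: measurable_enorm => i.
    apply: (@eq_measurable_fun _ _ _ _ _ (fun s => u s 0 i - a 0 i)).
      by move=> s _; rewrite coordB.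
    by apply: measurable_funB => //; exact: (proj1 mcu).
  by split => // *; exact: AU.
move=> r y v Uv rT; rewrite !lt_min => /andP[r1 r2] /andP[y1 y2] hv.
case: ifPn => [va|va]; first exact: ha.
apply: h5 => //; case: hv => [[a' + h']|]; last by right.
rewrite inE => /orP[/eqP aa|]; last by left; exists a'.
by rewrite aa (negbTE va) in h'.
Qed.

End Selection.

(** An exit forces [E > d / C - h], and [c / 2] times this energy outweighs every term of order [h]
    when [h] is small against [d]. *)
Lemma exit_arith (R : realType) (c C Ct d h E th I w w0 : R) :
  0 < c -> 0 <= C -> d < C * (h + E) -> c / 2 * E - C * h <= I + w -> - (Ct * h) <= w0 ->
  h * (C * (c / 2 + C + Ct + th)) <= c / 2 * d -> 0 <= E -> 0 <= h -> 0 < d ->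
  th * h <= I + (w + w0).
Proof.
move=> c0 C0 hd hI hw hh E0 h0 d0.
have C1 : 0 < C by rewrite lt_neqAle C0 andbT; apply/eqP => CE; move: hd; rewrite -CE; lra.
have k : C * (th * h) <= C * (c / 2 * E - C * h - Ct * h).
  have c2 : 0 < c / 2 by lra.
  have := ler_wpM2l (ltW c2) (ltW hd); lra.
have := k; rewrite (ler_pM2l C1); lra.
Qed.

(** * A gain proportional to time near a local minimum *)

Section Progress.
Context {R : realType} {n m1 m2 : nat} (G : game R n m1 m2).
Context (L c rho1 rho2 sigma1 sigma2 mu mu0 mu1 mu2 : R).
Hypothesis hG : standing_hypotheses G L c rho1 rho2 sigma1 sigma2 mu mu0 mu1 mu2.
Local Notation int := integral_on.
Local Notation T := (horizon G).
Local Notation U1 := (ctrl1 G).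
Local Notation U2 := (ctrl2 G).
Local Notation V := (R * 'rV[R]_n)%type.

Let c0 : 0 < c. Proof. exact: c_gt0 hG. Qed.

Lemma local_min_ball (W : R -> 'rV[R]_n -> R) phi t0 x0 : local_min T W phi (t0, x0) ->
  exists2 d : R, 0 < d & forall (s : R) y, 0 <= s <= T -> `|s - t0| < d -> enorm (y - x0) < d ->
    W t0 x0 - phi (t0, x0) <= W s y - phi (s, y).
Proof.
rewrite /local_min nearE /within /= => /nbhs_ballP[d /= d0 hd]; exists d => // s y sT h1 h2.
apply: (hd (s, y)) => //; split; [exact: ball_dist | exact: ball_enorm].
Qed.

(* If a path stays near [x0], the generator is at least [theta] along it and the chain
   rule applies; if it leaves, the energy it spends pays for [theta * h]. *)
Lemma progress (W : R -> 'rV[R]_n -> R) (K Ct : R) phi gt gx (t0 : R) x0 A w0 theta :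
  0 <= K -> (forall (t : R) x y, 0 <= t <= T ->
    `|W t x - W t y| <= K * japanese_max x y `^ (mu - 1) * enorm (x - y)) ->
  0 <= Ct -> (forall s : R, t0 <= s <= T -> - (Ct * (s - t0)) <= W s x0 - W t0 x0) ->
  C1_grad phi gt gx -> 0 <= t0 -> t0 < T -> local_min T W phi (t0, x0) ->
  A `<=` U2 -> A w0 -> 0 < theta ->
  (forall v, U1 v -> exists2 w, A w & theta < generator G gt gx t0 x0 v w) ->
  exists psi : 'rV[R]_m1 -> 'rV[R]_m2, [/\ forall v, A (psi v),
    forall (t b : R) u, measurable_control U1 t b u -> Linfty_controls U2 t b (psi \o u) &
    exists h : R, [/\ 0 < h, t0 + h <= T & forall u1 u2 y,
      Linfty_controls U1 t0 (t0 + h) u1 -> Linfty_controls U2 t0 (t0 + h) u2 ->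
      (forall s : R, t0 <= s <= t0 + h -> u2 s = psi (u1 s)) ->
      solution G t0 (t0 + h) x0 u1 u2 y ->
      W t0 x0 + theta * h <= int t0 (t0 + h) (cost G u1 u2 y) + W (t0 + h) (y (t0 + h))]].
Proof.
move=> K0 hW Ct0 hCt hphi t00 t0T hmin AU Aw0 th0 hsel.
have t0T' : 0 <= t0 <= T by rewrite t00 ltW.
have [psi [N [d1 [d10 h1 h2 h3 h4]]]] := selection hG hphi t0T' AU Aw0 hsel.
have [d2 d20 hd2] := local_min_ball hmin.
have [C C0 hSE] := short_time hG x0 N K0 hW.
exists psi; split=> //.
  by move=> t b u mcu; split; [exact: h3|exists N; apply: ae_true => s _; exact: h2].
pose d := Num.min d1 d2; have d0 : 0 < d by rewrite lt_min d10.
have c20 : 0 < c / 2 by rewrite divr_gt0.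
have [a [a0 aE]] : exists a, 0 < a /\ a = (C + 1) * (c / 2 + (C + 1) + Ct + theta).
  eexists; split; [|reflexivity]; rewrite mulr_gt0// ?ltr_wpDl//.
  by nonneg.
(* The three terms keep the times within [d] of [t0], the end time within the horizon, and fulfil
   the smallness condition of [exit_arith]. That lemma is used with [d / 2] and [C + 1], which yield
   its strict inequality from a weak one. *)
pose h := Num.min (d / 4) (Num.min (T - t0) (c / 2 * (d / 2) / a)).
have h0 : 0 < h by rewrite !lt_min subr_gt0 t0T !divr_gt0// mulr_gt0// divr_gt0.
have hT : t0 + h <= T.
  by rewrite -lerBrDl /h !ge_min lexx orbT.
have hd : h < d.
  apply: le_lt_trans (_ : d / 4 < d); first by rewrite ge_min lexx.
  by rewrite ltr_pdivrMr// ltr_pMr// ltr1n.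
have ha : h * a <= c / 2 * (d / 2) by rewrite -ler_pdivlMr// /h !ge_min lexx !orbT.
exists h; split => // u1 u2 y hu1 hu2 hpsi hy.
set s := t0 + h in hT hu1 hu2 hpsi hy *.
have t0s : t0 <= s by rewrite lerDl ltW.
have sT : 0 <= s <= T by rewrite hT (le_trans t00).
have hN r : t0 <= r <= s -> enorm (u2 r) <= N by move=> /hpsi ->.
have [SE1 SE2] := hSE t0 s u1 u2 y t00 t0s hT hu1 hu2 hN hy.
have sh : s - t0 = h by rewrite /s addrC addKr.
have [vy vd] := solution_vbm hG t00 hT hu1 hu2 hy.
have sss : t0 <= s <= s by rewrite t0s lexx.
have [stay|/existsNP[r /not_implyP[rts /negP]]] :=
    pselect (forall r : R, t0 <= r <= s -> enorm (y r - x0) < d).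
  have near r : t0 <= r <= s -> [/\ 0 <= r <= T, `|r - t0| < d & enorm (y r - x0) < d].
    move=> /[dup] rts /andP[t0r rs]; split; [exact: time_mem t00 hT rts| |exact: stay].
    by rewrite ger0_norm ?subr_ge0//; apply: le_lt_trans hd; rewrite -sh lerD2r.
  have [bc ->] : bounded_measurable t0 s (fun r => gt (r, y r) + dotp (gx (r, y r)) (drift G u1 u2 y r)) /\
     theta * h = int t0 s (fun=> theta).
    by have [] := chain_rule t0s hphi vd (proj1 hy) (solution_incr t0s hy); rewrite int_cst// sh.
  have [_ ch] := chain_rule t0s hphi vd (proj1 hy) (solution_incr t0s hy).
  have bg := bm_cost hG t00 hT vy hu1 hu2.
  have gi : int t0 s (fun=> theta) <= int t0 s (fun r =>
      (gt (r, y r) + dotp (gx (r, y r)) (drift G u1 u2 y r)) + cost G u1 u2 y r).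
    apply: int_le; [exact: bm_cst|exact: bmD|] => r rts.
    have [rT r1 r2] := near r rts; rewrite driftE costE hpsi//.
    apply: h4 => //; first exact: Linfty_mem hu1 rts.
      by apply: lt_le_trans r1 _; rewrite ge_min lexx.
    by apply: lt_le_trans r2 _; rewrite ge_min lexx.
  rewrite intD// in gi.
  have [_ s1 s2] := near s sss.
  have mn : W t0 x0 - phi (t0, x0) <= W s (y s) - phi (s, y s).
    apply: hd2 => //; first by apply: lt_le_trans s1 _; rewrite ge_min lexx orbT.
    by apply: lt_le_trans s2 _; rewrite ge_min lexx orbT.
  rewrite (solution_init t0s hy) in ch.
  move: gi mn ch; move: (phi (t0, x0)) (phi (s, y s)) (W t0 x0) (W s (y s)) => a1 a2 a3 a4.
  by move=> gi mn /eqP; rewrite -subr_eq => /eqP; move: gi mn; atoms_lra.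
rewrite -leNgt => dr.
have E0 := energy_ge0 rho1 t0 s u1.
have dC : d / 2 < (C + 1) * (h + energy rho1 t0 s u1).
  apply: lt_le_trans (_ : d <= _); first by rewrite ltr_pdivrMr// ltr_pMr// ltr1n.
  rewrite (le_trans dr)// (le_trans (SE2 r rts))// sh ler_wpM2r ?lerDl//.
  by rewrite addr_ge0// ltW.
have SE1' : c / 2 * energy rho1 t0 s u1 - (C + 1) * h <=
    int t0 s (cost G u1 u2 y) + (W s (y s) - W s x0).
  rewrite sh in SE1; apply: le_trans SE1; rewrite lerD2l lerN2 mulrDl lerDl mul1r ltW//.
have st : t0 <= s <= T by rewrite t0s.
have hw := hCt s st; rewrite sh in hw.
have ha' : h * ((C + 1) * (c / 2 + (C + 1) + Ct + theta)) <= c / 2 * (d / 2) by rewrite -aE.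
have d2' : 0 < d / 2 by rewrite divr_gt0.
have C1 : 0 <= C + 1 by rewrite addr_ge0.
have := exit_arith c0 C1 dC SE1' hw ha' E0 (ltW h0) d2'.
move: (W s (y s)) (W s x0) (W t0 x0) => w1 w2 w3; atoms_lra.
Qed.

End Progress.

(** Extracts a real margin without assuming [H] finite, so that the later estimates take place in
    the reals. *)
Lemma ereal_margin_pos (R : realType) (a : R) (H : \bar R) : (0 < a%:E + H)%E ->
  exists2 th : R, 0 < th & ((th - a)%:E < H)%E.
Proof.
case: H => [r| |]; last by rewrite addeNy.
  rewrite -EFinD lte_fin => ar; exists ((a + r) / 2); first by rewrite divr_gt0.
  by rewrite lte_fin; lra.
by exists 1; rewrite ?ltry.
Qed.

Lemma ereal_margin_neg (R : realType) (a : R) (H : \bar R) : (a%:E + H < 0)%E ->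
  exists2 th : R, 0 < th & (H < (- th - a)%:E)%E.
Proof.
case: H => [r| |]; first 1 last.
- by rewrite addey.
- by exists 1; rewrite ?ltNyr.
rewrite -EFinD lte_fin => ar; exists (- (a + r) / 2); first by rewrite divr_gt0// oppr_gt0.
by rewrite lte_fin; lra.
Qed.

(** * The upper value solves the upper equation *)

Section ValueViscosity.
Context {R : realType} {n m1 m2 : nat} (G : game R n m1 m2).
Context (L c rho1 rho2 sigma1 sigma2 mu mu0 mu1 mu2 : R).
Hypothesis hG : standing_hypotheses G L c rho1 rho2 sigma1 sigma2 mu mu0 mu1 mu2.
Local Notation int := integral_on.
Local Notation T := (horizon G).
Local Notation U1 := (ctrl1 G).
Local Notation U2 := (ctrl2 G).
Local Notation V := (value G).

Lemma int_cost_swap (t b : R) x u1 u2 y : 0 <= t -> b <= T ->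
  Linfty_controls U1 t b u1 -> Linfty_controls U2 t b u2 -> solution G t b x u1 u2 y ->
  int t b (cost (swap_game G) u2 u1 y) = - int t b (cost G u1 u2 y).
Proof.
move=> t0 bT h1 h2 hy; have [vy _] := solution_vbm hG t0 bT h1 h2 hy.
exact: (intN (bm_cost hG t0 bT vy h1 h2)).
Qed.

(** The lower bound on [V t x] uses the zero strategy in [dpp_ge]; the upper bound uses the zero
    control of Player 1 against a near-optimal strategy. Each time one player is bounded and
    [short_time] applies, the second time to the exchanged game and [- V]. *)
Lemma value_time_lipschitz x : exists2 C : R, 0 <= C & forall t s : R,
  0 <= t -> t <= s -> s <= T -> `|V s x - V t x| <= C * (s - t).
Proof.
have [K K0 hK] := value_lip hG.
have [C1 C10 h1] := short_time hG x 0 (ltW K0) hK.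
have hK' (t : R) y z : 0 <= t <= T ->
    `|- V t y - - V t z| <= K * japanese_max y z `^ (mu - 1) * enorm (y - z).
  by move=> tT; rewrite -opprD normrN; exact: hK.
have [C2 C20 h2] := short_time (swap_hypotheses hG) (W := fun t z => - V t z) x 0 (ltW K0) hK'.
have zN m (r : R) : enorm ((fun=> 0 : 'rV[R]_m) r) <= 0 by rewrite enorm0.
have half (d : R) : 0 <= d -> 0 <= c / 2 * d.
  by move=> d0; rewrite mulr_ge0// divr_ge0 ?(ltW (c_gt0 hG)).
exists (C1 + C2) => [|t s t0 ts sT]; first exact: addr_ge0.
have tT := le_trans ts sT.
have k1 : V s x - C1 * (s - t) <= V t x.
  apply: (dpp_ge hG t0 ts sT (zero_strategy hG t T)) => u y hu hy.
  have hus := Linfty_sub (lexx t) sT hu.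
  have h0 := Linfty_cst t s (ctrl2_0 hG).
  have [q _] := h1 t s u _ y t0 ts sT hus h0 (fun r _ => zN m2 r) hy.
  move: q (half _ (energy_ge0 rho1 t s u)); move: (V s (y s)) (V s x) => v1 v2; atoms_lra.
have k2 : V t x <= V s x + C2 * (s - t).
  apply/ler_addgt0Pr => e e0; have [alpha ha hal] := dpp_strategy hG x t0 ts sT e0.
  have hu := Linfty_cst t T (ctrl1_0 hG); have hau := proj1 ha _ (Linfty_L1 hu).
  have hy := solution_cat (trajectory_solution hG x t0 tT hu hau) sT.
  have q1 := hal _ _ hu hy; move: hy q1; set y := trajectory _ _ _ _ _ => hy q1.
  have hus := Linfty_sub (lexx t) sT hu; have haus := Linfty_sub (lexx t) sT hau.
  have [q _] := h2 t s _ _ y t0 ts sT haus hus (fun r _ => zN m1 r) hy.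
  rewrite (int_cost_swap t0 sT hus haus hy) in q.
  move: q1 q (half _ (energy_ge0 rho2 t s (alpha (fun=> 0)))).
  move: (V s (y s)) (V s x) (V t x) => v1 v2 v3; atoms_lra.
have q1 : 0 <= C1 * (s - t) by rewrite mulr_ge0// subr_ge0.
have q2 : 0 <= C2 * (s - t) by rewrite mulr_ge0// subr_ge0.
rewrite ler_norml; apply/andP; split; move: k1 k2 q1 q2; move: (V s x) (V t x) => v1 v2; atoms_lra.
Qed.

Lemma value_continuous : continuous_on_slab T V.
Proof.
have [K K0 hK] := value_lip hG.
apply/subspace_continuousP => -[t x] /= tT; have [C C0 hC] := value_time_lipschitz x.
apply/cvgrPdist_le => e e0; rewrite nearE /within /=; apply/nbhs_ballP.
have e2 : 0 < e / 2 by rewrite divr_gt0.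
pose J := K * (japanese x + 1) `^ (mu - 1).
have J0 : 0 <= J by rewrite mulr_ge0 ?powR_ge0 ?(ltW K0).
pose d := Num.min 1 (Num.min (e / 2 / (1 + J)) (e / 2 / (1 + C))).
have J1 : 0 < 1 + J by rewrite ltr_pwDl. have C1 : 0 < 1 + C by rewrite ltr_pwDl.
have d0 : 0 < d by rewrite !lt_min ltr01 !divr_gt0.
have hd1 : d * (1 + J) <= e / 2 by rewrite -ler_pdivlMr// /d !ge_min lexx !orbT.
have hd2 : d * (1 + C) <= e / 2 by rewrite -ler_pdivlMr// /d !ge_min lexx !orbT.
have d1 : d <= 1 by rewrite ge_min lexx.
exists (d / n.+1%:R) => [|[s y] /= [bs by_] sT]; first by rewrite /= divr_gt0.
have st : `|s - t| <= d.
  move: bs; rewrite -ball_normE /= distrC => /ltW /le_trans; apply.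
  by rewrite ler_pdivrMr ?ltr0n// ler_peMr ?(ltW d0)// ler1n.
have yx : enorm (y - x) <= d by apply: ltW; exact: enorm_lt_ball by_.
have h1 : `|V s y - V s x| <= e / 2.
  apply: le_trans (hK _ _ _ sT) _; apply: le_trans hd1; rewrite mulrC.
  apply: ler_pM => //; first exact: enorm_ge0.
    by rewrite mulr_ge0 ?powR_ge0 ?(ltW K0).
  apply: le_trans (_ : J <= _); last by rewrite lerDr.
  rewrite ler_wpM2l ?(ltW K0)//; apply: powR_ler.
  - by rewrite subr_ge0; exact: mu_ge1 hG.
  - exact: japanese_max_ge0.
  - apply: japanese_max_le; last by rewrite lerDl.
    by apply: le_trans (japanese_dist y x) _; rewrite lerD2l (le_trans yx).
have h2 : `|V s x - V t x| <= e / 2.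
  apply: le_trans (_ : C * `|s - t| <= _).
    have [t0 t1] := andP tT; have [s0 s1] := andP sT.
    have [ts|/ltW st'] := leP t s; first by rewrite [`|s - t|]ger0_norm ?subr_ge0// hC.
    by rewrite distrC [`|s - t|]distrC [`|t - s|]ger0_norm ?subr_ge0// hC.
  apply: le_trans hd2; rewrite mulrC; apply: ler_pM => //.
  by rewrite lerDr.
have -> : V t x - V s y = - ((V s y - V s x) + (V s x - V t x)) by ring.
by rewrite normrN (le_trans (ler_normD _ _))// (splitr e) lerD.
Qed.

Lemma value_terminal x : V T x = terminal G x.
Proof.
have T0 := ltW (horizon_gt0 hG); have TT : 0 <= T <= T by rewrite T0 lexx.
have hp u1 u2 : Linfty_controls U1 T T u1 -> Linfty_controls U2 T T u2 ->
    payoff G T x u1 u2 = terminal G x.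
  move=> h1 h2; have hy := trajectory_solution hG x T0 (lexx T) h1 h2.
  rewrite (payoffE hG T0 (lexx T) h1 h2 hy) int_set1 add0r.
  by rewrite (solution_init (lexx T) hy).
apply/eqP; rewrite eq_le; apply/andP; split.
  apply/ler_addgt0Pr => e e0; have [alpha ha hal] := value_strategy hG x TT e0.
  have hu := Linfty_cst T T (ctrl1_0 hG).
  by have := hal _ hu; rewrite (hp _ _ hu (proj1 ha _ (Linfty_L1 hu))) lerBlDr.
apply: (value_ge hG TT (zero_strategy hG T T)) => u hu.
by rewrite (hp _ _ hu (Linfty_cst T T (ctrl2_0 hG))).
Qed.

(** If the inequality failed, every [v] would have an answer with generator above [th]. The
    resulting strategy [psi \o u] is memoryless, hence non-anticipating, and [progress] with
    [dpp_ge] would give [V + th * h <= V]. *)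
Lemma value_supersolution phi t0 x0 : C1 phi -> 0 <= t0 < T -> local_min T V phi (t0, x0) ->
  ((time_derivative phi (t0, x0))%:E
     + upper_hamiltonian G t0 x0 (space_gradient phi (t0, x0)) <= 0)%E.
Proof.
move=> /C1_C1_grad hphi /andP[t00 t0T] hmin; rewrite leNgt; apply/negP.
set a := time_derivative _ _; set p := space_gradient _ _.
set H := upper_hamiltonian _ _ _ _ => aH.
have [th th0 hth] : exists2 th : R, 0 < th & ((th - a)%:E < H)%E.
  exact: ereal_margin_pos.
have hsel v : U1 v -> exists2 w, U2 w &
    th < generator G (time_derivative phi) (space_gradient phi) t0 x0 v w.
  move=> Uv; have : ((th - a)%:E < ereal_sup
      [set (dotp p (dyn G t0 x0 v w) + running G t0 x0 v w)%:E | w in U2])%E.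
    by apply: lt_le_trans hth _; apply: ge_ereal_inf; eexists; [exists v; [exact: Uv|reflexivity]|exact: lexx].
  move=> /ereal_sup_gtP[_ [w Uw <-]]; rewrite lte_fin ltrBlDr => hw; exists w => //.
  by rewrite /generator -/a -/p; move: hw; move: (dotp _ _) (running _ _ _ _ _) => ? ?; lra.
have [K K0 hK] := value_lip hG; have [Ct Ct0 hCt] := value_time_lipschitz x0.
have hCt' s : t0 <= s <= T -> - (Ct * (s - t0)) <= V s x0 - V t0 x0.
  move=> /andP[ts sT]; have := hCt t0 s t00 ts sT.
  by rewrite ler_norml => /andP[].
have [psi [_ mpsi [h [h0 hT hh]]]] := progress hG (ltW K0) hK Ct0 hCt' hphi t00 t0T hmin
  (@subset_refl _ U2) (ctrl2_0 hG) th0 hsel.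
have hb : strategies U2 U1 t0 T (fun u => psi \o u).
  split=> [u [mu' _]|u v b _ _ _]; first exact: mpsi.
  by apply: ae_mono => r h1 /h1 /= ->.
have t0s : t0 <= t0 + h by rewrite lerDl ltW.
have : V t0 x0 + th * h <= V t0 x0.
  apply: (dpp_ge hG t00 t0s hT hb) => u y hu hy.
  have hus := Linfty_sub (lexx t0) hT hu.
  by apply: hh => //; apply: mpsi; exact: (proj1 hus).
by rewrite gerDl leNgt mulr_gt0.
Qed.

(** If the inequality failed, a single [v] would keep the generator negative against every [w]. In
    the exchanged game this [v] is the only allowed answer, so [psi] is constant and Player 1 plays
    the constant control [v]. *)
Lemma value_subsolution phi t0 x0 : C1 phi -> 0 <= t0 < T -> local_max T V phi (t0, x0) ->
  (0 <= (time_derivative phi (t0, x0))%:E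
     + upper_hamiltonian G t0 x0 (space_gradient phi (t0, x0)))%E.
Proof.
move=> /C1_C1_grad hphi /andP[t00 t0T] hmax; rewrite leNgt; apply/negP.
set a := time_derivative _ _; set p := space_gradient _ _.
set H := upper_hamiltonian _ _ _ _ => aH.
have [th th0 hth] : exists2 th : R, 0 < th & (H < (- th - a)%:E)%E.
  exact: ereal_margin_neg.
have [_ [v Uv <-] hv] := ereal_inf_lt hth.
have hsel w : U2 w -> exists2 v', [set v] v' &
    th < generator (swap_game G) (fun z => - time_derivative phi z)
      (fun z => - space_gradient phi z) t0 x0 w v'.
  move=> Uw; exists v => //.
  have : dotp p (dyn G t0 x0 v w) + running G t0 x0 v w < - th - a.
    rewrite -lte_fin; apply: le_lt_trans hv; apply: le_ereal_sup_tmp.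
    by eexists; [exists w; [exact: Uw|reflexivity]|exact: lexx].
  rewrite /generator /= -/a -/p dotpNl.
  by move: (dotp _ _) (running _ _ _ _ _) => ? ?; lra.
have [K K0 hK] := value_lip hG; have [Ct Ct0 hCt] := value_time_lipschitz x0.
have hK' (t : R) y z : 0 <= t <= T ->
    `|- V t y - - V t z| <= K * japanese_max y z `^ (mu - 1) * enorm (y - z).
  by move=> tT; rewrite -opprD normrN; exact: hK.
have hCt' (s : R) : t0 <= s <= T -> - (Ct * (s - t0)) <= - V s x0 - - V t0 x0.
  move=> /andP[ts sT]; have := hCt t0 s t00 ts sT.
  by rewrite ler_norml => /andP[_]; move: (V s x0) (V t0 x0) => v1 v2; atoms_lra.
have hmin : local_min T (fun t x => - V t x) (fun z => - phi z) (t0, x0).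
  by apply: filterS hmax => z; rewrite /= -!opprD lerN2.
have vU : [set v] `<=` U1 by move=> _ ->.
have [psi [psiE _ [h [h0 hT hh]]]] := progress (swap_hypotheses hG)
  (W := fun t x => - V t x) (ltW K0) hK' Ct0 hCt'
  (C1_gradN hphi) t00 t0T hmin vU (erefl v) th0 hsel.
have t0s : t0 <= t0 + h by rewrite lerDl ltW.
(* An optimality error of half the gain [th * h] still leaves a contradiction. *)
have e0 : 0 < th * h / 2 by rewrite divr_gt0// mulr_gt0.
have [alpha ha hal] := dpp_strategy hG x0 t00 t0s hT e0.
have hu := Linfty_cst t0 T Uv; have hau := proj1 ha _ (Linfty_L1 hu).
have hy := solution_cat (trajectory_solution hG x0 t00 (ltW t0T) hu hau) hT.
have q1 := hal _ _ hu hy; move: hy q1; set y := trajectory _ _ _ _ _ => hy q1.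
have hus := Linfty_sub (lexx t0) hT hu; have haus := Linfty_sub (lexx t0) hT hau.
have := hh _ _ y haus hus (fun s _ => esym (psiE _)) hy.
rewrite (int_cost_swap t00 hT hus haus hy) => q2.
have gap (v0 v1 I d : R) : v0 - d / 2 <= I + v1 -> 0 < d -> - v0 + d <= - I - v1 -> False.
  by lra.
exact: gap q1 (mulr_gt0 th0 h0) q2.
Qed.

Lemma value_viscosity : viscosity_solution T (upper_hamiltonian G) (terminal G) V.
Proof.
split; split.
- exact: value_continuous.
- by move=> x; rewrite value_terminal.
- by move=> phi hphi t0 x0; exact: value_subsolution.
- exact: value_continuous.
- by move=> x; rewrite value_terminal.
- by move=> phi hphi t0 x0; exact: value_supersolution.
Qed.

End ValueViscosity.

(** * Comparison principle *)

Section Penalization.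
Context {R : realType} {n : nat}.
Local Notation V := (R * 'rV[R]_n)%type.

Definition square_penalty (e : R) (z z' : V) : R :=
  (2 * e)^-1 * (dotp (z.2 - z'.2) (z.2 - z'.2) + (z.1 - z'.1) * (z.1 - z'.1)).

Lemma square_penaltyC e z z' : square_penalty e z z' = square_penalty e z' z.
Proof.
rewrite /square_penalty -[z'.2 - z.2]opprB dotpNl dotpNr opprK; congr (_ * (_ + _)); ring.
Qed.

Lemma C1_grad_square_penalty (e : R) z' : 0 < e -> C1_grad (fun z => square_penalty e z z')
  (fun z => e^-1 * (z.1 - z'.1)) (fun z => e^-1 *: (z.2 - z'.2)).
Proof.
move=> e0; have en : e != 0 by rewrite gt_eqF.
have ht := C1_gradD (@C1_grad_time R n) (C1_grad_cst (- z'.1)).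
apply: (C1_grad_ext (C1_gradZ (2 * e)^-1 (C1_gradD (C1_grad_sqdist z'.2) (C1_gradM ht ht)))).
- by move=> z; rewrite /square_penalty.
- by move=> z /=; field.
- move=> z /=; rewrite !addr0 !scaler0 !addr0 scalerA; congr (_ *: _); by field.
Qed.

(** The exponent is written [N.+1] so that differentiation leaves the natural power [N]. The time
    derivative is a negative multiple of the weight itself, with a factor that grows with [l]. *)
Definition weight (l : R) (N : nat) (z : V) : R := damped_norm l 1 z ^+ N.+1.

Definition weight_grad (l : R) (N : nat) (z : V) : 'rV[R]_n :=
  (N.+1%:R * damped_norm l 1 z ^+ N) *:
    ((expR (- l * z.1) / Num.sqrt (1 + dotp z.2 z.2)) *: z.2).

Lemma damped_normE l (z : V) : damped_norm l 1 z = expR (- l * z.1) * japanese z.2.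
Proof. by rewrite /damped_norm -sqr_enorm. Qed.

Lemma damped_norm_gt0 l (z : V) : 0 < damped_norm l 1 z.
Proof. by rewrite damped_normE mulr_gt0 ?expR_gt0 ?japanese_gt0. Qed.

Lemma C1_grad_weight (l : R) (N : nat) :
  C1_grad (weight l N) (fun z => - (l * N.+1%:R) * weight l N z) (weight_grad l N).
Proof.
have hd := @C1_grad_damped_norm R n l 1 ltr01.
have cd : continuous (@damped_norm R n l 1).
  by move=> z; have [_ _ d _] := hd; exact: differentiable_continuous.
have der (r : R) : is_derive r 1 (fun r : R => r ^+ N.+1) (N.+1%:R * r ^+ N).
  split; first exact: exprn_derivable.
  by rewrite exp_derive /= /GRing.scale /= mulr1.
have cf : continuous (fun z : V => N.+1%:R * damped_norm l 1 z ^+ N).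
  move=> z; apply: cvgM; first exact: cst_continuous.
  apply: (@continuous_comp _ _ _ (damped_norm l 1) (fun r => r ^+ N)); first exact: cd.
  exact: exprn_continuous.
apply: (C1_grad_ext (C1_grad_comp (f' := fun r => N.+1%:R * r ^+ N) hd (fun z => der (damped_norm l 1 z)) cf)) => // z /=.
by rewrite /weight exprS; ring.
Qed.

(** The gradient times [<x>] is of the order of the weight, so against a drift of linear growth it
    is dominated by the time derivative when [l] is large. *)
Lemma weight_grad_le l N (z : V) :
  enorm (weight_grad l N z) * japanese z.2 <= N.+1%:R * weight l N z.
Proof.
rewrite /weight_grad /weight; set d := damped_norm l 1 z.
have d0 := ltW (damped_norm_gt0 l z); have j0 := japanese_gt0 z.2.
have dN : 0 <= d ^+ N by exact: exprn_ge0.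
rewrite !enormZ -sqr_enorm (_ : Num.sqrt _ = japanese z.2)// ger0_norm ?mulr_ge0// ger0_norm; last first.
  by rewrite divr_ge0 ?expR_ge0// ltW.
rewrite [leLHS](_ : _ = N.+1%:R * (d ^+ N * (expR (- l * z.1) * enorm z.2))); last first.
  by field; rewrite gt_eqF.
rewrite ler_wpM2l// exprSr ler_wpM2l// /d damped_normE ler_wpM2l ?expR_ge0//.
exact: enorm_le_japanese.
Qed.

Lemma weight_ge (l T : R) N (z : V) : 0 <= l -> 0 <= z.1 <= T ->
  expR (- l * T) ^+ N.+1 * japanese z.2 ^+ N.+1 <= weight l N z.
Proof.
move=> l0 /andP[_ zT]; rewrite /weight damped_normE exprMn ler_wpM2r//.
  by rewrite exprn_ge0// ltW// japanese_gt0.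
by rewrite ler_pXn2r ?nnegrE ?expR_ge0// ler_expR !mulNr lerN2 ler_wpM2l.
Qed.

Lemma weight_continuous l N : continuous (weight l N).
Proof. by move=> z; have [_ _ d _] := C1_grad_weight l N; exact: differentiable_continuous. Qed.

End Penalization.

Section GrowthClass.
Context {R : realType} {n : nat}.
Local Notation V := (R * 'rV[R]_n)%type.

(** The conjunct [setT x] gives the second factor the shape treated by
    [bounded_closed_ball_compact]. *)
Definition slab_ball (T M : R) : set V := `[0, T]%classic `*` [set x | setT x /\ enorm x <= M].

Lemma slab_ballP (T M : R) (z : V) : slab_ball T M z <-> 0 <= z.1 <= T /\ enorm z.2 <= M.
Proof.
split; first by move=> [/mem_itvcc h [_ k]].
by move=> [h k]; split; [exact/mem_itvcc|split].
Qed.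

Lemma slab_ball_compact (T M : R) : compact (slab_ball T M).
Proof.
apply: compact_setX; first exact: segment_compact.
by apply: bounded_closed_ball_compact; exact: closedT.
Qed.

Lemma slab_ball_continuous T M (W : R -> 'rV[R]_n -> R) : continuous_on_slab T W ->
  {within slab_ball T M, continuous (fun z => W z.1 z.2)}.
Proof. by apply: continuous_subspaceW => z /slab_ballP[]. Qed.

Lemma growth_bound T mu (W : R -> 'rV[R]_n -> R) : 0 <= T -> 1 <= mu -> growth_class T mu W ->
  exists2 C : R, 0 <= C & forall (t : R) x, 0 <= t <= T -> `|W t x| <= C * japanese x `^ mu.
Proof.
move=> T0 mu1 [cW [K K0 hK]].
have cN : {within slab_ball T 0, continuous (fun z : V => `|W z.1 z.2|)}.
  move=> z; apply: (@continuous_comp (subspace (slab_ball T 0)) _ _ (fun z : V => W z.1 z.2) (fun r : R => `|r|)).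
    exact: slab_ball_continuous cW _.
  exact: norm_continuous.
have [|z _ hz] := compact_EVT_max _ (@slab_ball_compact T 0) cN.
  by exists (0, 0); apply/slab_ballP; rewrite /= lexx T0 enorm0.
exists (`|W z.1 z.2| + K) => [|t x tT]; first by rewrite addr_ge0// ltW.
have /hz /= h0 : (t, 0) \in slab_ball T 0 by rewrite inE; apply/slab_ballP; rewrite /= enorm0.
have hd := hK t x 0 tT; rewrite subr0 in hd.
have j1 := japanese_ge1 x; have jp := japanese_gt0 x.
have m1 : 0 <= mu - 1 by rewrite subr_ge0.
have jm : japanese_max x 0 <= japanese x.
  by apply: japanese_max_le => //; apply: le_japanese; rewrite enorm0 enorm_ge0.
have hK' : K * japanese_max x 0 `^ (mu - 1) * enorm x <= K * japanese x `^ mu.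
  rewrite -mulrA ler_wpM2l ?(ltW K0)// -(powR_mulB1 mu1 (ltW jp)).
  apply: ler_pM; [exact: powR_ge0|exact: enorm_ge0| |exact: enorm_le_japanese].
  by apply: powR_ler => //; exact: japanese_max_ge0.
have p1 : 1 <= japanese x `^ mu by apply: powR_ge1 => //; exact: le_trans mu1.
rewrite -[W t x](subrK (W t 0)) (le_trans (ler_normD _ _))// addrC mulrDl lerD//.
  by apply: (le_trans h0); rewrite ler_peMr.
exact: le_trans hd hK'.
Qed.

(** Step from [x] against the gradient [g]: [phi] drops by about [h |g|^2], and at a local maximum
    of [W - phi] this drop is at most that of [W], which is Lipschitz. The factor [2 ^ (mu - 1)]
    allows for the neighbouring point, the summand 1 for the error of the expansion. *)
Lemma gradient_bound T mu (W : R -> 'rV[R]_n -> R) (K : R) phi gt gx (t : R) x : 1 <= mu -> 0 <= K ->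
  (forall (t : R) x y, 0 <= t <= T ->
    `|W t x - W t y| <= K * japanese_max x y `^ (mu - 1) * enorm (x - y)) ->
  C1_grad phi gt gx -> 0 <= t <= T -> local_max T W phi (t, x) ->
  enorm (gx (t, x)) <= (K * 2 `^ (mu - 1) + 1) * japanese x `^ (mu - 1).
Proof.
move=> mu1 K0 hK hphi tT hmax; set g := gx (t, x).
have m1 : 0 <= mu - 1 by rewrite subr_ge0.
have jp := japanese_gt0 x; have j1 := japanese_ge1 x.
have [g0|gn0] := eqVneq (enorm g) 0.
  by rewrite g0 mulr_ge0 ?powR_ge0// addr_ge0// mulr_ge0 ?powR_ge0.
have gp : 0 < enorm g by rewrite lt_neqAle eq_sym gn0 enorm_ge0.
have [d d0 hd] := C1_grad_expansion (t, x) hphi ltr01.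
move: hmax; rewrite /local_max nearE /within /= => /nbhs_ballP[r /= r0 hr].
(* Normalised so that the step length [h |g|] is at most 1 and stays within both the expansion
   radius and the radius of the local maximum. *)
pose h := Num.min (d / 2) (Num.min (r / 2) 1) / enorm g.
have m0 : 0 < Num.min (d / 2) (Num.min (r / 2) 1) by rewrite !lt_min ltr01 !divr_gt0.
have h0 : 0 < h by rewrite divr_gt0.
have hg : h * enorm g = Num.min (d / 2) (Num.min (r / 2) 1) by rewrite mulfVK.
have half (a : R) : 0 < a -> a / 2 < a by move=> a0; rewrite ltr_pdivrMr// ltr_pMr// ltr1n.
have hgd : h * enorm g < d by apply: le_lt_trans (half _ d0); rewrite hg ge_min lexx.
have hgr : h * enorm g < r by apply: le_lt_trans (half _ r0); rewrite hg !ge_min lexx orbT.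
have hg1 : h * enorm g <= 1 by rewrite hg !ge_min lexx !orbT.
have en : enorm (- (h *: g)) = h * enorm g by rewrite enormN enormZ ger0_norm// ltW.
have q1 := hr (t, x - h *: g).
have {}q1 : W t (x - h *: g) - phi (t, x - h *: g) <= W t x - phi (t, x).
  apply: q1; last by [].
  split; first exact: ballxx.
  by apply: ball_enorm; rewrite /= addrC addKr en.
have q2 := hK t (x - h *: g) x tT.
rewrite addrAC subrr add0r en in q2.
have q3 := hd (0, - (h *: g)).
have nz : `|(0, - (h *: g)) : V| <= h * enorm g.
  rewrite -en prod_normE /= ge_max normr0 enorm_ge0 /=.
  exact: mxnorm_le_enorm.
have {}q3 := q3 (le_lt_trans nz hgd).
rewrite mul1r mulr0 add0r /= dotpNr dotpZr -sqr_enorm (_ : (t, x) + _ = (t, x - h *: g)) in q3; last first.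
  by congr (_, _); rewrite /= addr0.
have jm : japanese_max (x - h *: g) x `^ (mu - 1) <= 2 `^ (mu - 1) * japanese x `^ (mu - 1).
  rewrite -powRM ?(ltW jp)//; apply: powR_ler => //; first exact: japanese_max_ge0.
  apply: japanese_max_le; last by rewrite ler_peMl ?(ltW jp)// ler1n.
  apply: le_trans (japanese_dist _ x) _; rewrite addrAC subrr add0r en.
  by move: hg1 j1; move: (h * enorm g) => a; atoms_lra.
have P1 : 1 <= japanese x `^ (mu - 1) by exact: powR_ge1.
have hg0 : 0 < h * enorm g by rewrite mulr_gt0.
rewrite -(ler_pM2l hg0).
have q4 : K * japanese_max (x - h *: g) x `^ (mu - 1) * (h * enorm g) <=
   h * enorm g * (K * 2 `^ (mu - 1) * japanese x `^ (mu - 1)).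
  rewrite mulrC ler_wpM2l ?(ltW hg0)// -mulrA ler_wpM2l//.
have q5 : h * enorm g <= h * enorm g * japanese x `^ (mu - 1) by rewrite ler_peMr// ltW.
have := le_trans q3 nz; rewrite -/g.
have := le_trans q2 q4; move: q1 q5.
move: (W t x) (W t (x - h *: g)) (phi (t, x)) (phi (t, x - h *: g)) => w1 w2 p1 p2 q1 q5.
rewrite !ler_norml => /andP[k1 _] /andP[_ k2].
by move: q1 q5 k1 k2; move: (enorm g) (japanese x `^ _) (2 `^ _) => a b c'; rewrite expr2; atoms_lra.
Qed.

End GrowthClass.

(** [scaled_absorb] at the level [Z = Z0 * X], multiplied by [Z ^ (m - 1)]. It treats the product of
    a gradient of size [X ^ (m - 1)] with the control part of the drift. *)
Lemma gradient_absorb (R : realType) (s m r e : R) : 0 <= s -> 1 <= m -> s * m < r -> 0 < e ->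
  exists2 C : R, 0 <= C & forall X a, 1 <= X -> 0 <= a ->
    X `^ (m - 1) * a `^ s <= e * a `^ r + C * X `^ m.
Proof.
move=> s0 m1 smr e0; have [Z0 Z01 h] := scaled_absorb s0 m1 smr e0.
have Z0p := lt_le_trans ltr01 Z01.
exists (e * Z0 `^ m) => [|X a X1 a0]; first by rewrite mulr_ge0 ?powR_ge0// ltW.
have X0 := lt_le_trans ltr01 X1; set Z := Z0 * X.
have Zp : 0 < Z by rewrite mulr_gt0.
have hZ : Z0 <= Z by rewrite ler_peMr// ltW.
have XZ : X <= Z by rewrite ler_peMl// ltW.
apply: le_trans (_ : Z `^ (m - 1) * a `^ s <= _).
  by rewrite ler_wpM2r ?powR_ge0// powR_ler ?subr_ge0// ltW.
apply: le_trans (ler_wpM2l (powR_ge0 Z (m - 1)) (h Z a hZ a0)) _.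
have ZZ : Z `^ (m - 1) * Z `^ (1 - m) = 1.
  by rewrite -powRDp// (_ : m - 1 + (1 - m) = 0) ?powRr0//; ring.
have -> : Z `^ (m - 1) * (e * (Z + Z `^ (1 - m) * a `^ r)) =
    e * (Z `^ (m - 1) * Z) + e * (Z `^ (m - 1) * Z `^ (1 - m)) * a `^ r by ring.
rewrite ZZ mulr1 (powR_mulB1 m1 (ltW Zp)) /Z powRM ?(ltW Z0p) ?(ltW X0)//.
by rewrite addrC mulrA.
Qed.

Lemma ereal_opp_le (R : realType) (a : R) (H : \bar R) : (0 <= a%:E + H -> (- a)%:E <= H)%E.
Proof.
case: H => [r| |]; rewrite ?leey//.
by rewrite -EFinD !lee_fin -lerBlDl sub0r.
Qed.

Lemma ereal_opp_ge (R : realType) (a : R) (H : \bar R) : (a%:E + H <= 0 -> H <= (- a)%:E)%E.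
Proof.
case: H => [r| |]; rewrite ?leNye//.
by rewrite -EFinD !lee_fin -lerBrDl sub0r.
Qed.

(** * Reduction of the Hamiltonians to controls of bounded energy density *)

Section EffectiveControls.
Context {R : realType} {n m1 m2 : nat} (G : game R n m1 m2).
Context (L c rho1 rho2 sigma1 sigma2 mu mu0 mu1 mu2 : R).
Hypothesis hG : standing_hypotheses G L c rho1 rho2 sigma1 sigma2 mu mu0 mu1 mu2.
Local Notation T := (horizon G).
Local Notation U1 := (ctrl1 G).
Local Notation U2 := (ctrl2 G).

Let L0 : 0 < L. Proof. exact: L_gt0 hG. Qed.
Let c0 : 0 < c. Proof. exact: c_gt0 hG. Qed.
Let T0 : 0 < T. Proof. exact: horizon_gt0 hG. Qed.
Let mu1le : 1 <= mu. Proof. exact: mu_ge1 hG. Qed.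
Let mu_ge0 : 0 <= mu. Proof. exact: le_trans ler01 mu1le. Qed.

Definition hamiltonian_at (t : R) x p v w := dotp p (dyn G t x v w) + running G t x v w.

(** For gradients of the size permitted by the growth class, the drift term uses up at most half of
    the coercivity of the running cost in either control. *)
Lemma hamiltonian_bounds (K : R) : 0 <= K -> exists2 D : R, 0 <= D & forall (t : R) (x p : 'rV[R]_n) v w,
  0 <= t <= T -> U1 v -> U2 w -> enorm p <= K * japanese x `^ (mu - 1) ->
  c / 2 * enorm v `^ rho1 - D * enorm w `^ rho2 - D * japanese x `^ mu <= hamiltonian_at t x p v w /\
  hamiltonian_at t x p v w <= D * enorm v `^ rho1 - c / 2 * enorm w `^ rho2 + D * japanese x `^ mu.
Proof.
move=> K0; have KL0 : 0 <= K * L by nonneg.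
have KL1 : 0 < 1 + K * L by rewrite ltr_pwDl.
have e0 : 0 < c / 2 / (1 + K * L) by rewrite !divr_gt0.
have [C1 C10 h1] := gradient_absorb (sigma1_ge0 hG) mu1le (sigma1_rho1 hG) e0.
have [C2 C20 h2] := gradient_absorb (sigma2_ge0 hG) mu1le (sigma2_rho2 hG) e0.
set D := K * L * (1 + C1 + C2); have D0 : 0 <= D by rewrite /D; nonneg.
have c20 : 0 < c / 2 by rewrite divr_gt0.
exists (L + c / 2 + D) => [|t x p v w tT Uv Uw hp]; first by nonneg.
have j1 := japanese_ge1 x; have jp := japanese_gt0 x.
have X0 : 0 <= japanese x `^ mu by exact: powR_ge0.
have a0 := powR_ge0 (enorm v) rho1; have b0 := powR_ge0 (enorm w) rho2.
have pair : `|dotp p (dyn G t x v w)| <=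
    c / 2 * enorm v `^ rho1 + c / 2 * enorm w `^ rho2 + D * japanese x `^ mu.
  have : `|dotp p (dyn G t x v w)| <= enorm p * enorm (dyn G t x v w).
    by rewrite ler_norml dotp_le andbT lerNl -dotpNl; apply: le_trans (dotp_le _ _) _; rewrite enormN.
  move=> /le_trans; apply.
  apply: le_trans (ler_pM (enorm_ge0 _) (enorm_ge0 _) hp (dyn_growth hG x tT Uv Uw)) _.
  have k1 := ler_wpM2l KL0 (h1 _ _ j1 (enorm_ge0 v)).
  have k2 := ler_wpM2l KL0 (h2 _ _ j1 (enorm_ge0 w)).
  have kc : K * L * (c / 2 / (1 + K * L)) <= c / 2.
    by rewrite mulrCA mulrA ler_pdivrMr// mulrDr mulr1 ler_wpDl// ltW.
  have k3 := ler_wpM2r a0 kc; have k4 := ler_wpM2r b0 kc.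
  have := powR_mulB1 mu1le (ltW jp); set Y := japanese x `^ (mu - 1) in k1 k2 *.
  rewrite /D => <-; move: k1 k2 k3 k4; rewrite -(powR_mulB1 mu1le (ltW jp)) -/Y.
  by move: Y (c / 2 / (1 + K * L)) => Y cc; atoms_lra.
have gl := running_lower hG x tT Uv Uw; have gu := running_upper hG x tT Uv Uw.
have ca : 0 <= c / 2 * enorm v `^ rho1 by rewrite mulr_ge0// ltW.
have cb : 0 <= c / 2 * enorm w `^ rho2 by rewrite mulr_ge0// ltW.
have Da : 0 <= D * enorm v `^ rho1 by rewrite mulr_ge0.
have Db : 0 <= D * enorm w `^ rho2 by rewrite mulr_ge0.
have cX : 0 <= c / 2 * japanese x `^ mu by rewrite mulr_ge0// ltW.
move: pair; rewrite ler_norml /hamiltonian_at => /andP[p1 p2].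
by split; move: p1 p2 gl gu ca cb Da Db cX; atoms_lra.
Qed.

(** Energy density at most [C <x> ^ mu] and [sigma_i mu < rho_i] make the control part of the drift
    at most linear in [<x>], which is what the weight can dominate. *)
Lemma drift_linear (C : R) : 0 <= C -> exists2 D : R, 0 <= D & forall (t : R) (x : 'rV[R]_n) v w,
  0 <= t <= T -> U1 v -> U2 w -> enorm v `^ rho1 <= C * japanese x `^ mu ->
  enorm w `^ rho2 <= C * japanese x `^ mu -> enorm (dyn G t x v w) <= D * japanese x.
Proof.
move=> C0.
have pw (s r : R) : 0 <= s -> s * mu < r -> exists2 D : R, 0 <= D & forall X a : R, 1 <= X -> 0 <= a ->
    a `^ r <= C * X `^ mu -> a `^ s <= D * X.
  move=> s0 sr; have [Z0 Z01 h] := scaled_absorb s0 mu1le sr ltr01.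
  have Z0p := lt_le_trans ltr01 Z01.
  exists ((1 + C) * Z0) => [|X a X1 a0 ha]; first by nonneg.
  have X0 := lt_le_trans ltr01 X1; set Z := Z0 * X.
  have Zp : 0 < Z by rewrite mulr_gt0.
  have hZ : Z0 <= Z by rewrite ler_peMr// ltW.
  have XZ : X <= Z by rewrite ler_peMl// ltW.
  apply: le_trans (h Z a hZ a0) _; rewrite mul1r -mulrA mulrDl mul1r lerD2l.
  apply: le_trans (_ : Z `^ (1 - mu) * (C * Z `^ mu) <= _).
    rewrite ler_wpM2l ?powR_ge0// (le_trans ha)// ler_wpM2l// powR_ler// ltW//.
  by rewrite mulrCA -powRDp// subrK powRr1// ltW.
have [D1 D10 h1] := pw _ _ (sigma1_ge0 hG) (sigma1_rho1 hG).
have [D2 D20 h2] := pw _ _ (sigma2_ge0 hG) (sigma2_rho2 hG).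
exists (L * (1 + D1 + D2)) => [|t x v w tT Uv Uw hv hw]; first by nonneg.
apply: le_trans (dyn_growth hG x tT Uv Uw) _.
rewrite -mulrA ler_wpM2l ?(ltW L0)// !mulrDl mul1r.
by rewrite !lerD// ?h1 ?h2 ?japanese_ge1 ?enorm_ge0.
Qed.

(* The bounds on the controls make the two Hamiltonians comparable although U1 and
   U2 may be unbounded. *)
Lemma effective_controls (K : R) : 0 <= K -> exists2 C : R, 0 <= C &
  forall (t s : R) (x y p q : 'rV[R]_n) (a b k : R), 0 <= t <= T -> 0 <= s <= T -> enorm (x - y) <= 1 ->
  0 < k -> k <= 1 ->
  enorm p <= K * japanese x `^ (mu - 1) -> enorm q <= K * japanese y `^ (mu - 1) ->
  (0 <= a%:E + upper_hamiltonian G t x p)%E -> (b%:E + upper_hamiltonian G s y q <= 0)%E ->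
  exists v w, [/\ U1 v, U2 w,
    - a - k <= hamiltonian_at t x p v w /\ hamiltonian_at s y q v w <= - b + k,
    enorm v `^ rho1 <= C * japanese x `^ mu & enorm w `^ rho2 <= C * japanese x `^ mu].
Proof.
move=> K0; have [D D0 hD] := hamiltonian_bounds K0.
have c20 : 0 < c / 2 by rewrite divr_gt0.
have ci : 0 < (c / 2)^-1 by rewrite invr_gt0.
set C1 := (c / 2)^-1 * (2 * D + 1) * 2 `^ mu; have C10 : 0 <= C1 by rewrite /C1; nonneg.
set C2 := (c / 2)^-1 * (2 * D + 1 + D * C1); have C20 : 0 <= C2 by rewrite /C2; nonneg.
have cn : c / 2 != 0 by rewrite gt_eqF.
have C1E : c / 2 * C1 = (2 * D + 1) * 2 `^ mu by rewrite /C1 -(mulrA (c / 2)^-1) mulVKf.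
have C2E : c / 2 * C2 = 2 * D + 1 + D * C1 by rewrite /C2 mulVKf.
exists (C1 + C2) => [|t s x y p q a b k tT sT xy k0 k1 hp hq ha hb]; first exact: addr_ge0.
have U10 := ctrl1_0 hG; have U20 := ctrl2_0 hG.
have X0 : 0 <= japanese x `^ mu by exact: powR_ge0.
have Y1 : 1 <= japanese y `^ mu by apply: powR_ge1 => //; exact: japanese_ge1.
have X1 : 1 <= japanese x `^ mu by apply: powR_ge1 => //; exact: japanese_ge1.
have YX : japanese y `^ mu <= 2 `^ mu * japanese x `^ mu.
  rewrite -powRM ?(ltW (japanese_gt0 x))//; apply: powR_ler => //; first exact: ltW (japanese_gt0 y).
  apply: le_trans (japanese_dist y x) _; rewrite enormBC.
  apply: le_trans (lerD (lexx _) xy) _.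
  by rewrite mulr_natl mulr2n lerD2l; exact: japanese_ge1.
(* The infimum over [U1] at [(s, y, q)] is at most [- b] by the supersolution inequality and at most
   [D <y> ^ mu] by trying [v = 0]. A [v] within [k] of the smaller bound has its energy controlled
   by testing it against [w = 0]. *)
pose M := Num.min (- b) (D * japanese y `^ mu).
have [v Uv hv] : exists2 v, U1 v & forall w, U2 w -> hamiltonian_at s y q v w < M + k.
  have : (upper_hamiltonian G s y q < (M + k)%:E)%E.
    apply: le_lt_trans (_ : _ <= M%:E)%E _; last by rewrite lte_fin ltrDl.
    rewrite /M EFin_min le_min; apply/andP; split.
      exact: ereal_opp_ge.
    apply: ge_ereal_inf; eexists; first by exists 0; [exact: U10|reflexivity].
    apply/ereal_supP => _ [w Uw <-]; rewrite lee_fin.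
    have [_ ub] := hD s y q 0 w sT U10 Uw hq.
    rewrite (enorm0_pow _ (rho1_gt0 hG)) mulr0 in ub.
    have := mulr_ge0 (ltW c20) (powR_ge0 (enorm w) rho2).
    by move: ub; rewrite /hamiltonian_at; atoms_lra.
  move=> /ereal_inf_lt[_ [v Uv <-] hv]; exists v => // w Uw; rewrite -lte_fin.
  apply: le_lt_trans hv; apply: le_ereal_sup_tmp.
  by eexists; [exists w; [exact: Uw|reflexivity]|exact: lexx].
(* Now [v] is fixed and [w] is nearly optimal against it at [(t, x, p)]. The bound for [v] at
   [(s, y, q)] holds for every answer, so it holds for this [w], and one pair serves both
   equations. *)
pose M' := Num.max (- a) (- (D * japanese x `^ mu)).
have [w Uw hw] : exists2 w, U2 w & M' - k < hamiltonian_at t x p v w.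
  have : ((M' - k)%:E < ereal_sup
      [set (dotp p (dyn G t x v w) + running G t x v w)%:E | w in U2])%E.
    apply: lt_le_trans (_ : M'%:E <= _)%E; first by rewrite lte_fin gtrDl oppr_lt0.
    rewrite /M' EFin_max ge_max; apply/andP; split.
      apply: le_trans (ereal_opp_le ha) _.
      by apply: ge_ereal_inf; eexists; [exists v; [exact: Uv|reflexivity]|exact: lexx].
    apply: le_ereal_sup_tmp; eexists; first by exists 0; [exact: U20|reflexivity].
    have [lb _] := hD t x p v 0 tT Uv U20 hp.
    rewrite (enorm0_pow _ (rho2_gt0 hG)) mulr0 subr0 in lb.
    have := mulr_ge0 (ltW c20) (powR_ge0 (enorm v) rho1).
    by rewrite lee_fin; move: lb; rewrite /hamiltonian_at; atoms_lra.
  by move=> /ereal_sup_gtP[_ [w Uw <-]]; rewrite lte_fin => h; exists w.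
have Mb : M <= - b by rewrite ge_min lexx.
have MD : M <= D * japanese y `^ mu by rewrite ge_min lexx orbT.
have Ma : - a <= M' by rewrite le_max lexx.
have MD' : - (D * japanese x `^ mu) <= M' by rewrite le_max lexx orbT.
have hvw := hv w Uw.
have bv : enorm v `^ rho1 <= C1 * japanese x `^ mu.
  have h0 := hv 0 U20; have [lb _] := hD s y q v 0 sT Uv U20 hq.
  rewrite (enorm0_pow _ (rho2_gt0 hG)) mulr0 subr0 in lb.
  have e1 : c / 2 * enorm v `^ rho1 <= (2 * D + 1) * japanese y `^ mu.
    by move: lb h0 MD k1 Y1; atoms_lra.
  have D21 : 0 <= 2 * D + 1 by nonneg.
  rewrite -(ler_pM2l c20) [leRHS]mulrA C1E -[leRHS]mulrA.
  exact: le_trans e1 (ler_wpM2l D21 YX).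
have bw : enorm w `^ rho2 <= C2 * japanese x `^ mu.
  have [_ ub] := hD t x p v w tT Uv Uw hp.
  have e2 := ler_wpM2l D0 bv.
  have e1 : c / 2 * enorm w `^ rho2 <= (2 * D + 1 + D * C1) * japanese x `^ mu.
    by move: ub hw MD' k1 X1 e2; atoms_lra.
  by rewrite -(ler_pM2l c20) [leRHS]mulrA C2E.
exists v, w; split; [exact: Uv|exact: Uw| | |].
- by split; [move: hw Ma | move: hvw Mb]; atoms_lra.
- by apply: (le_trans bv); apply: (ler_wpM2r X0); rewrite lerDl; exact: C20.
- by apply: (le_trans bw); apply: (ler_wpM2r X0); rewrite lerDr; exact: C10.
Qed.

End EffectiveControls.

Lemma within_fst (X Y Z : topologicalType) (A : set X) (B : set Y) (F : X -> Z) :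
  {within A, continuous F} -> {within A `*` B, continuous (fun w => F w.1)}.
Proof.
move=> /subspace_continuousP cF; apply/subspace_continuousP => -[x y] [/= Ax _] S hS.
have h : nbhs x (fun x' => A x' -> S (F x')) := cF x Ax S hS.
exists (fun x' => A x' -> S (F x'), setT); first by split=> //; exact: filterT.
by move=> [x' y'] [/= k _] [Ax' _]; exact: k.
Qed.

Lemma within_snd (X Y Z : topologicalType) (A : set X) (B : set Y) (F : Y -> Z) :
  {within B, continuous F} -> {within A `*` B, continuous (fun w => F w.2)}.
Proof.
move=> /subspace_continuousP cF; apply/subspace_continuousP => -[x y] [/= _ By] S hS.
have h : nbhs y (fun y' => B y' -> S (F y')) := cF y By S hS.
exists (setT, fun y' => B y' -> S (F y')); first by split=> //; exact: filterT.
by move=> [x' y'] [/= _ k] [_ By']; exact: k.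
Qed.

Lemma coercive_arith (R : realType) (w1 w2 p b u u' q1 q2 v v' C j j' : R) :
  0 <= w1 - w2 - p - b * (u + u') -> w1 <= q1 -> - w2 <= q2 -> 0 <= p ->
  v <= b * u -> v' <= b * u' -> q1 - v <= C - j -> q2 - v' <= C - j' -> 0 < j -> 0 < j' ->
  j <= 2 * C /\ j' <= 2 * C.
Proof. by move=> *; split; lra. Qed.

(** * Doubling of variables *)

Section PenalizedMaximum.
Context {R : realType} {n : nat}.
Local Notation V := (R * 'rV[R]_n)%type.

(** Where [k * a >= B + 1] the higher power wins with room for [- a]; elsewhere [a] is bounded by
    [(B + 1) / k]. *)
Lemma coercive_gap (B k m : R) (N : nat) : 0 <= B -> 0 < k -> 1 <= m -> m + 1 <= N.+1%:R ->
  exists2 C : R, 0 <= C & forall a, 1 <= a -> B * a `^ m - k * a ^+ N.+1 <= C - a.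
Proof.
move=> B0 k0 m1 mN; have m0 : 0 <= m by exact: le_trans m1.
exists ((B + 1) * ((B + 1) / k) `^ m) => [|a a1]; first by rewrite mulr_ge0 ?powR_ge0 ?addr_ge0.
have a0 := lt_le_trans ltr01 a1.
have am : a <= a `^ m by rewrite -[leLHS]powRr1 ?(ltW a0)// ler_powR.
have aN : a `^ m * a <= a ^+ N.+1.
  by rewrite -[X in _ * X <= _]powRr1 ?(ltW a0)// -powRDp// -powR_mulrn ?(ltW a0)// ler_powR.
have p0 := powR_ge0 a m.
have h1 : B * a `^ m + a <= (B + 1) * a `^ m by rewrite mulrDl mul1r lerD2l.
have kN := ler_wpM2l (ltW k0) aN.
have C0 : 0 <= (B + 1) * ((B + 1) / k) `^ m by rewrite mulr_ge0 ?powR_ge0 ?addr_ge0.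
have [ka|ka] := leP (B + 1) (k * a).
  have := ler_wpM2r p0 ka; move: h1 kN C0.
  by move: (a ^+ N.+1) ((_ / k) `^ m) (a `^ m) => x y z; lra.
have : (B + 1) * a `^ m <= (B + 1) * ((B + 1) / k) `^ m.
  rewrite ler_wpM2l ?addr_ge0// powR_ler ?(ltW a0)//.
  by rewrite ler_pdivlMr// mulrC ltW.
have : 0 <= k * a ^+ N.+1 by rewrite mulr_ge0 ?exprn_ge0 ?(ltW a0) ?(ltW k0).
move: h1; move: (a ^+ N.+1) ((_ / k) `^ m) (a `^ m) => x y z; lra.
Qed.

Definition doubled (W1 W2 : R -> 'rV[R]_n -> R) (l : R) (N : nat) (b e : R) (w : V * V) : R :=
  W1 w.1.1 w.1.2 - W2 w.2.1 w.2.2 - square_penalty e w.1 w.2 -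
  b * (weight l N w.1 + weight l N w.2).

Lemma square_penalty_continuous e : continuous (fun w : V * V => square_penalty e w.1 w.2).
Proof.
have c1 : continuous (fun w : V * V => w.1.1).
  by move=> w; apply: (@continuous_comp _ _ _ fst fst); exact: cvg_fst.
have c2 : continuous (fun w : V * V => w.2.1).
  by move=> w; apply: (@continuous_comp _ _ _ snd fst); [exact: cvg_snd | exact: cvg_fst].
have cd i : continuous (fun w : V * V => (w.1.2 - w.2.2) 0 i).
  rewrite (_ : (fun _ => _) = fun w : V * V => w.1.2 0 i - w.2.2 0 i); last first.
    by apply/funext => w; rewrite coordB.
  have d1 : continuous (fun w : V * V => w.1.2 0 i).
    move=> w; apply: (@continuous_comp _ _ _ (fun w : V * V => w.1.2) (fun M : 'rV[R]_n => M 0 i)).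
      by apply: (@continuous_comp _ _ _ fst snd); [exact: cvg_fst | exact: cvg_snd].
    exact: coord_continuous.
  have d2 : continuous (fun w : V * V => w.2.2 0 i).
    move=> w; apply: (@continuous_comp _ _ _ (fun w : V * V => w.2.2) (fun M : 'rV[R]_n => M 0 i)).
      by apply: (@continuous_comp _ _ _ snd snd); exact: cvg_snd.
    exact: coord_continuous.
  by move=> w; apply: cvgB; [exact: d1 | exact: d2].
move=> w; apply: cvgM; first exact: cst_continuous.
apply: cvgD; first exact: (continuous_dotp cd cd).
by apply: cvgM; apply: cvgB; [exact: c1 | exact: c2 | exact: c1 | exact: c2].
Qed.

Lemma doubled_continuous T M W1 W2 l N b e : continuous_on_slab T W1 -> continuous_on_slab T W2 ->
  {within slab_ball T M `*` slab_ball T M, continuous (@doubled W1 W2 l N b e)}.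
Proof.
move=> h1 h2.
have k1 := @within_fst _ _ _ _ (slab_ball T M : set V) _ (slab_ball_continuous (M := M) h1).
have k2 := @within_snd _ _ _ (slab_ball T M : set V) _ _ (slab_ball_continuous (M := M) h2).
have k3 := @continuous_subspaceT _ _ (slab_ball T M `*` slab_ball T M) _ (@square_penalty_continuous e).
have k4 : continuous (fun w : V * V => b * (weight l N w.1 + weight l N w.2)).
  move=> w; apply: cvgM; first exact: cst_continuous.
  apply: cvgD.
    by apply: (@continuous_comp _ _ _ fst (weight l N)); [exact: cvg_fst | exact: weight_continuous].
  by apply: (@continuous_comp _ _ _ snd (weight l N)); [exact: cvg_snd | exact: weight_continuous].
have {}k4 := @continuous_subspaceT _ _ (slab_ball T M `*` slab_ball T M) _ k4.
by move=> w; exact: (cvgB (cvgB (cvgB (k1 w) (k2 w)) (k3 w)) (k4 w)).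
Qed.

Lemma square_penalty_diag e (z : V) : square_penalty e z z = 0.
Proof. by rewrite /square_penalty !subrr dotp0l mul0r addr0 mulr0. Qed.

Lemma square_penalty_ge0 e (z w : V) : 0 < e -> 0 <= square_penalty e z w.
Proof.
move=> e0; rewrite /square_penalty mulr_ge0 ?invr_ge0 ?mulr_ge0 ?(ltW e0)//.
by rewrite addr_ge0 ?dotpp_ge0// -expr2 sqr_ge0.
Qed.

(** The weight outgrows the class, so the maximum exists and lies in a fixed ball. The coefficient
    [b], the radius [M] and the level [s0] do not depend on [e]; that uniformity is what allows [e]
    to be chosen last. *)
Lemma penalized_max (T mu B l : R) (N : nat) W1 W2 (t1 : R) x1 : 0 <= T -> 1 <= mu -> 0 <= l ->
  mu + 1 <= N.+1%:R -> continuous_on_slab T W1 -> continuous_on_slab T W2 -> 0 <= B ->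
  (forall (t : R) x, 0 <= t <= T -> `|W1 t x| <= B * japanese x `^ mu) ->
  (forall (t : R) x, 0 <= t <= T -> `|W2 t x| <= B * japanese x `^ mu) ->
  0 <= t1 <= T -> W2 t1 x1 < W1 t1 x1 ->
  exists b M s0 : R, [/\ 0 < b, 0 < s0 & forall e : R, 0 < e -> exists z z' : V,
    [/\ slab T z /\ slab T z', japanese z.2 <= M /\ japanese z'.2 <= M,
      forall w w', slab T w -> slab T w' ->
        doubled W1 W2 l N b e (w, w') <= doubled W1 W2 l N b e (z, z') &
      s0 <= doubled W1 W2 l N b e (z, z')]].
Proof.
move=> T0 mu1 l0 muN c1 c2 B0 g1 g2 t1T lt12.
pose g := W1 t1 x1 - W2 t1 x1; have g0 : 0 < g by rewrite subr_gt0.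
pose wt := weight l N (t1, x1).
have wt0 : 0 < wt by rewrite exprn_gt0// damped_norm_gt0.
(* At the diagonal point [(t1, x1)] the two weights remove exactly half of the gap [g]. *)
pose b := g / (4 * wt); have b0 : 0 < b by rewrite divr_gt0// mulr_gt0.
have k0 : 0 < b * expR (- l * T) ^+ N.+1 by rewrite mulr_gt0// exprn_gt0// expR_gt0.
have [C C0 hC] := coercive_gap B0 k0 mu1 muN.
exists b, (2 * C), (g / 2); split => //; first by rewrite divr_gt0.
move=> e e0; set F := doubled W1 W2 l N b e.
have F1 : F ((t1, x1), (t1, x1)) = g / 2.
  rewrite /F /doubled /= square_penalty_diag -/wt -/g /b; field.
  by rewrite gt_eqF.
have inside w w' : slab T w -> slab T w' -> 0 <= F (w, w') ->
    japanese w.2 <= 2 * C /\ japanese w'.2 <= 2 * C.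
  move=> sw sw'; rewrite /F /doubled /= => Fw.
  have q1 : W1 w.1 w.2 <= B * japanese w.2 `^ mu by exact: le_trans (ler_norm _) (g1 _ _ sw).
  have q2 : - W2 w'.1 w'.2 <= B * japanese w'.2 `^ mu.
    by apply: le_trans (g2 _ _ sw'); rewrite -normrN ler_norm.
  have q3 := square_penalty_ge0 w w' e0.
  have q4 := ler_wpM2l (ltW b0) (weight_ge N l0 sw).
  have q5 := ler_wpM2l (ltW b0) (weight_ge N l0 sw').
  have q6 := hC _ (japanese_ge1 w.2); have q7 := hC _ (japanese_ge1 w'.2).
  have j1 := japanese_gt0 w.2; have j2 := japanese_gt0 w'.2.
  rewrite !mulrA in q4 q5.
  exact: coercive_arith Fw q1 q2 q3 q4 q5 q6 q7 j1 j2.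
have in_ball (w : V) : slab T w -> japanese w.2 <= 2 * C -> slab_ball T (2 * C) w.
  by move=> sw jw; apply/slab_ballP; split=> //; exact: le_trans (enorm_le_japanese _) jw.
have s1 : slab T (t1, x1) by [].
have F10 : 0 <= F ((t1, x1), (t1, x1)) by rewrite F1 ltW// divr_gt0.
pose A : set (V * V) := slab_ball T (2 * C) `*` slab_ball T (2 * C).
have A1 : A ((t1, x1), (t1, x1)).
  by have [i1 i2] := inside _ _ s1 s1 F10; split; exact: in_ball.
have cA : compact A by apply: compact_setX; exact: slab_ball_compact.
have [|[z z'] zA hz] := compact_EVT_max _ cA (@doubled_continuous T (2 * C) W1 W2 l N b e c1 c2).
  by eexists; exact: A1.
have m1 : F ((t1, x1), (t1, x1)) <= F (z, z') by apply: hz; rewrite inE.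
move: zA; rewrite inE => -[/= /slab_ballP[sz _] /slab_ballP[sz' _]].
exists z, z'; split=> //.
- by apply: inside => //; exact: le_trans m1.
- move=> w w' sw sw'; have [Fw|/ltW Fw] := leP 0 (F (w, w')).
    apply: hz; rewrite inE; have [i1 i2] := inside _ _ sw sw' Fw.
    by split; exact: in_ball.
  exact: le_trans Fw (le_trans F10 m1).
- by rewrite -F1.
Qed.

End PenalizedMaximum.

(** Subtracting the two inequalities cancels the penalty. With [l = 2 D + 1] the time derivative of
    the weights exceeds the drift term by [b * S * N1 >= 2 b e0], while the four errors add up to at
    most [b e0]. *)
Lemma comparison_arith (R : realType) (b l N1 S k pf qf g g' tau e0 D h h' dq dr : R) (eta eta' : R) :
  - (tau - b * (l * N1 * eta)) - k <= h -> h' <= - (tau + b * (l * N1 * eta')) + k ->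
  h = pf + g -> h' = qf + g' -> pf - qf = dq + dr -> l = 2 * D + 1 -> S = eta + eta' ->
  dq <= 2 * (b * D * N1) * S -> dr <= b * e0 / 4 -> g - g' <= b * e0 / 4 ->
  k <= b * e0 / 4 -> 1 <= N1 -> e0 <= eta -> e0 <= eta' -> 0 < b -> 0 < e0 -> False.
Proof.
move=> H1 H2 hE h'E pqE lE SE H3 H4 H5 H6 N11 e1 e2 b0 e00.
have be0 := mulr_gt0 b0 e00.
have bS : 2 * (b * e0) <= b * S by rewrite mulrCA ler_wpM2l ?(ltW b0)// SE; lra.
have bS0 : 0 <= b * S by lra.
have NS := ler_wpM2l bS0 N11.
have key : b * S * N1 <= 2 * k + b * e0 / 4 + b * e0 / 4.
  rewrite lE in H1 H2; rewrite SE in H3 *; lra.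
lra.
Qed.

Section DoublingArithmetic.
Variable R : realType.
Implicit Types b s w h p u q v : R.

Lemma gap_drop s w1 w2 p u : s <= w1 - w2 - p - u -> 0 <= p -> 0 <= u -> s <= w1 - w2.
Proof. by move=> *; lra. Qed.

Lemma penalty_lt s w1 w2 p u q : s <= w1 - w2 - p - u -> 0 < s -> w1 <= q -> - w2 <= q ->
  0 <= u -> p < 2 * q + 1.
Proof. by move=> *; lra. Qed.

Lemma terminal_gap_l s w1 w2 w3 h : s <= w1 - w3 -> w1 <= h -> h <= w2 -> `|w2 - w3| < s -> False.
Proof. by move=> ? ? ? /(le_lt_trans (ler_norm _)) ?; lra. Qed.

Lemma terminal_gap_r s w1 w2 w3 h : s <= w3 - w2 -> w1 <= h -> h <= w2 -> `|w3 - w1| < s -> False.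
Proof. by move=> ? ? ? /(le_lt_trans (ler_norm _)) ?; lra. Qed.

Lemma freeze_l b w1 w1' w2 p p' u u' v :
  w1 - w2 - p - b * (u + v) <= w1' - w2 - p' - b * (u' + v) ->
  w1 - (p + b * u) <= w1' - (p' + b * u').
Proof. by move=> *; lra. Qed.

Lemma freeze_r b w1 w2 w2' p p' u u' v :
  w1 - w2 - p - b * (v + u) <= w1 - w2' - p' - b * (v + u') ->
  - w2 - (p + b * u) <= - w2' - (p' + b * u').
Proof. by move=> *; lra. Qed.

Lemma weight_arith (g g' j j' N u u' D : R) : g * j <= N * u -> g' * j' <= N * u' ->
  j <= 2 * j' -> 0 <= D -> 0 <= g' -> 0 <= N -> 0 <= u ->
  (g + g') * (D * j) <= 2 * D * N * (u + u').
Proof.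
move=> h1 h2 h3 D0 g0 N0 u0; have k1 := ler_wpM2l D0 h1; have k2 := ler_wpM2l D0 h2.
have k3 := ler_wpM2l D0 (ler_wpM2l g0 h3); have k4 := mulr_ge0 D0 (mulr_ge0 N0 u0).
lra.
Qed.

End DoublingArithmetic.

(** * The comparison principle *)

Section Comparison.
Context {R : realType} {n m1 m2 : nat} (G : game R n m1 m2).
Context (L c rho1 rho2 sigma1 sigma2 mu mu0 mu1 mu2 : R).
Hypothesis hG : standing_hypotheses G L c rho1 rho2 sigma1 sigma2 mu mu0 mu1 mu2.
Local Notation T := (horizon G).
Local Notation U1 := (ctrl1 G).
Local Notation U2 := (ctrl2 G).
Local Notation V := (R * 'rV[R]_n)%type.

Let T0 : 0 < T. Proof. exact: horizon_gt0 hG. Qed.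
Let mu1le : 1 <= mu. Proof. exact: mu_ge1 hG. Qed.
Let mu_ge0 : 0 <= mu. Proof. exact: le_trans ler01 mu1le. Qed.

(** Takes the place of continuity of the Hamiltonians: the effective controls lie in fixed balls, so
    [f] and [g] need to be uniformly continuous on a compact set only. *)
Lemma data_uniformly_continuous (M R1 R2 e : R) : 0 < e -> exists2 d : R, 0 < d &
  forall (z z' : V) v w, 0 <= z.1 <= T -> 0 <= z'.1 <= T -> enorm z.2 <= M -> enorm z'.2 <= M ->
  U1 v -> U2 w -> enorm v <= R1 -> enorm w <= R2 -> ball z d z' ->
  enorm (dyn G z.1 z.2 v w - dyn G z'.1 z'.2 v w) <= e /\
  running G z.1 z.2 v w - running G z'.1 z'.2 v w <= e.
Proof.
move=> e0; have n0 : 0 < n.+1%:R :> R by rewrite ltr0n.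
pose A : set (V * 'rV[R]_m1 * 'rV[R]_m2) := slab_ball T M `*` [set v | U1 v /\ enorm v <= R1] `*` [set w | U2 w /\ enorm w <= R2].
have cA : compact A.
  apply: compact_setX; first (apply: compact_setX; first exact: slab_ball_compact).
    by apply: bounded_closed_ball_compact; exact: ctrl1_closed hG.
  by apply: bounded_closed_ball_compact; exact: ctrl2_closed hG.
have AG : A `<=` game_domain G by move=> z [[/= /slab_ballP[zT _] [Uv _]] [Uw _]]; split.
have cf := continuous_subspaceW AG (dyn_continuous hG).
have cg := continuous_subspaceW AG (running_continuous hG).
have en : 0 < e / n.+1%:R by rewrite divr_gt0.
have [d1 d10 h1] := uniformly_continuous_compact cA cf en.
have [d2 d20 h2] := uniformly_continuous_compact cA cg e0.
exists (Num.min d1 d2) => [|z z' v w zT zT' zM zM' Uv Uw vR wR zz']; first by rewrite lt_min d10.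
have A1 : A (z, v, w) by split; [split; [exact/slab_ballP|]|].
have A2 : A (z', v, w) by split; [split; [exact/slab_ballP|]|].
have b1 : ball (z, v, w) d1 (z', v, w).
  split; last exact: ballxx; split; last exact: ballxx.
  by apply: le_ball zz'; rewrite ge_min lexx.
have b2 : ball (z, v, w) d2 (z', v, w).
  split; last exact: ballxx; split; last exact: ballxx.
  by apply: le_ball zz'; rewrite ge_min lexx orbT.
split.
  apply: le_trans (enorm_le_mxnorm _) _; have /= := h1 _ _ A1 A2 b1; rewrite distrC => /ltW h.
  apply: le_trans (_ : n.+1%:R * (e / n.+1%:R) <= _); last by rewrite mulrC mulfVK// gt_eqF.
  by apply: ler_pM => //; rewrite ler_nat.
by have /= := h2 _ _ A1 A2 b2; rewrite distrC => /ltW; apply: le_trans; exact: ler_norm.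
Qed.

Lemma slab_ball_modulus (W : R -> 'rV[R]_n -> R) (M e : R) : continuous_on_slab T W -> 0 < e ->
  exists2 d : R, 0 < d & forall z z' : V, 0 <= z.1 <= T -> 0 <= z'.1 <= T -> enorm z.2 <= M ->
    enorm z'.2 <= M -> ball z d z' -> `|W z'.1 z'.2 - W z.1 z.2| < e.
Proof.
move=> cW e0; have [d d0 h] := uniformly_continuous_compact (@slab_ball_compact R n T M)
  (slab_ball_continuous (M := M) cW) e0.
by exists d => // z z' zT zT' zM zM'; apply: h; exact/slab_ballP.
Qed.

Lemma comparison (W1 W2 : R -> 'rV[R]_n -> R) : growth_class T mu W1 -> growth_class T mu W2 ->
  viscosity_subsolution T (upper_hamiltonian G) (terminal G) W1 ->
  viscosity_supersolution T (upper_hamiltonian G) (terminal G) W2 ->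
  forall (t : R) x, 0 <= t <= T -> W1 t x <= W2 t x.
Proof.
move=> gc1 gc2 [cW1 WT1 sub] [cW2 WT2 sup] t1 x1 t1T; rewrite leNgt; apply/negP => lt12.
have [B1 B10 hB1] := growth_bound (ltW T0) mu1le gc1.
have [B2 B20 hB2] := growth_bound (ltW T0) mu1le gc2.
have [_ [K1 K10 hK1]] := gc1; have [_ [K2 K20 hK2]] := gc2.
(* Large enough for [gradient_bound] applied to [W1] and to [- W2]. *)
set K := (K1 + K2) * 2 `^ (mu - 1) + 1; have K0 : 0 <= K by rewrite /K; nonneg.
have [C C0 eff] := effective_controls hG K0; have [D D0 lin] := drift_linear hG C0.
pose N := Num.bound (mu + 1).
have muN : mu + 1 <= N.+1%:R.
  apply: le_trans (ltW (archi_boundP _)) _; first by rewrite addr_ge0.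
  by rewrite ler_nat.
(* [2 D] beats the drift acting on both weights, one [D] for each and a factor 2 for evaluating the
   drift at [z] instead of [z']; the remaining 1 produces the contradiction. *)
pose l := 2 * D + 1; have l0 : 0 <= l by rewrite /l; nonneg.
have B0 : 0 <= B1 + B2 by rewrite addr_ge0.
have hB1' (t : R) x : 0 <= t <= T -> `|W1 t x| <= (B1 + B2) * japanese x `^ mu.
  by move=> /(hB1 t x) /le_trans; apply; rewrite ler_wpM2r ?powR_ge0// lerDl.
have hB2' (t : R) x : 0 <= t <= T -> `|W2 t x| <= (B1 + B2) * japanese x `^ mu.
  by move=> /(hB2 t x) /le_trans; apply; rewrite ler_wpM2r ?powR_ge0// lerDr.
have [b [M [s0 [b0 s00 hmax]]]] :=
  penalized_max (ltW T0) mu1le l0 muN cW1 cW2 B0 hB1' hB2' t1T lt12.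
set B := B1 + B2 in B0 hB1' hB2'.
have M1 : 1 <= M.
  by have [z [_ [_ [jz _] _ _]]] := hmax 1 ltr01; exact: le_trans (japanese_ge1 _) jz.
have M0 : 0 <= M by exact: le_trans M1.
(* A lower bound for the weight on the whole slab, hence for the strict gain. *)
pose e0 := expR (- l * T) ^+ N.+1; have e00 : 0 < e0 by rewrite exprn_gt0// expR_gt0.
have be0 : 0 < b * e0 / 4 by rewrite divr_gt0// mulr_gt0.
have rho10 := rho1_gt0 hG; have rho20 := rho2_gt0 hG.
have CM0 : 0 <= C * M `^ mu by rewrite mulr_ge0 ?powR_ge0.
(* Bounds the gradients at the maximum, whatever [e] is; dividing the tolerance for [f] by [Q] makes
   gradient times drift error small. *)
pose Q := 1 + K * M `^ (mu - 1).
have Q0 : 0 < Q by rewrite ltr_pwDl// mulr_ge0 ?powR_ge0.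
have Q1 : 1 <= Q by rewrite lerDl mulr_ge0 ?powR_ge0.
have eQ : 0 < b * e0 / 4 / Q by rewrite divr_gt0.
have [d1 d10 hd1] := data_uniformly_continuous M ((C * M `^ mu) `^ rho1^-1)
  ((C * M `^ mu) `^ rho2^-1) eQ.
have [d2 d20 hd2] := slab_ball_modulus M cW1 s00; have [d3 d30 hd3] := slab_ball_modulus M cW2 s00.
pose d := Num.min 1 (Num.min d1 (Num.min d2 d3)).
have d0 : 0 < d by rewrite !lt_min ltr01 d10 d20.
have dd1 : d <= d1 by rewrite !ge_min lexx !orbT.
have dd2 : d <= d2 by rewrite !ge_min lexx !orbT.
have dd3 : d <= d3 by rewrite !ge_min lexx !orbT.
have dd4 : d <= 1 by rewrite ge_min lexx.
pose Bm := 2 * (B * M `^ mu) + 1.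
have Bm0 : 0 < Bm by rewrite ltr_wpDl// mulr_ge0// mulr_ge0 ?powR_ge0.
(* The penalty at the maximum is below [Bm] for every [e]; this [e] turns that bound into distance
   less than [d] between [z] and [z']. *)
pose e := d ^+ 2 / (2 * Bm); have ep : 0 < e by rewrite divr_gt0 ?exprn_gt0// mulr_gt0.
have [z [z' [[sz sz'] [jz jz'] zmax zs]]] := hmax e ep.
have enz : enorm z.2 <= M by exact: le_trans (enorm_le_japanese _) jz.
have enz' : enorm z'.2 <= M by exact: le_trans (enorm_le_japanese _) jz'.
have eta0 := weight_ge N l0 sz; have eta0' := weight_ge N l0 sz'.
have etaz : e0 <= weight l N z.
  by apply: le_trans eta0; rewrite ler_peMr ?(ltW e00)// exprn_ege1// japanese_ge1.
have etaz' : e0 <= weight l N z'.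
  by apply: le_trans eta0'; rewrite ler_peMr ?(ltW e00)// exprn_ege1// japanese_ge1.
have pen0 := square_penalty_ge0 z z' ep.
have bw0 : 0 <= b * (weight l N z + weight l N z').
  by rewrite mulr_ge0 ?(ltW b0)// addr_ge0// (le_trans (ltW e00)).
have W12 : s0 <= W1 z.1 z.2 - W2 z'.1 z'.2.
  exact: gap_drop zs pen0 bw0.
have pen : square_penalty e z z' < Bm.
  have q1 : W1 z.1 z.2 <= B * M `^ mu.
    apply: le_trans (ler_norm _) _; apply: le_trans (hB1' _ _ sz) _.
    by rewrite ler_wpM2l// powR_ler// ltW// japanese_gt0.
  have q2 : - W2 z'.1 z'.2 <= B * M `^ mu.
    apply: le_trans (ler_norm _) _; rewrite normrN; apply: le_trans (hB2' _ _ sz') _.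
    by rewrite ler_wpM2l// powR_ler// ltW// japanese_gt0.
  exact: penalty_lt zs s00 q1 q2 bw0.
have dist : dotp (z.2 - z'.2) (z.2 - z'.2) + (z.1 - z'.1) * (z.1 - z'.1) < d ^+ 2.
  have e2 : 0 < 2 * e by rewrite mulr_gt0.
  move: pen; rewrite /square_penalty mulrC (ltr_pdivrMr _ _ e2).
  by rewrite [X in _ < X -> _](_ : _ = d ^+ 2)// /e; field; rewrite gt_eqF.
have dx : enorm (z.2 - z'.2) < d.
  rewrite -(@ltr_pXn2r _ 2) ?nnegrE ?enorm_ge0 ?(ltW d0)// sqr_enorm.
  by apply: le_lt_trans dist; rewrite lerDl -expr2 sqr_ge0.
have dt : `|z.1 - z'.1| < d.
  rewrite -(@ltr_pXn2r _ 2) ?nnegrE ?(ltW d0)// real_normK ?num_real// expr2.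
  by apply: le_lt_trans dist; rewrite lerDr dotpp_ge0.
have zz' : ball z d z'.
  split; first by apply: ball_dist; rewrite distrC.
  by apply: ball_enorm; rewrite enormBC.
have z'z : ball z' d z by exact: ball_sym.
have [z10 z1T] := andP sz; have [z10' z1T'] := andP sz'.
(* At the terminal time [W1 <= h <= W2] at the same point, and the modulus of continuity makes the
   gap smaller than [s0]. *)
have z1 : z.1 < T.
  rewrite lt_neqAle z1T andbT; apply/eqP => zT.
  have hW := hd3 z' z sz' sz enz' enz (le_ball dd3 z'z); rewrite zT in hW W12.
  exact: terminal_gap_l W12 (WT1 _) (WT2 _) hW.
have z1' : z'.1 < T.
  rewrite lt_neqAle z1T' andbT; apply/eqP => zT.
  have hW := hd2 z' z sz' sz enz' enz (le_ball dd2 z'z); rewrite zT in hW W12.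
  exact: terminal_gap_r W12 (WT1 _) (WT2 _) hW.
have hphi1 := C1_gradD (C1_grad_square_penalty z' ep) (C1_gradZ b (C1_grad_weight l N)).
have hphi2 := C1_gradD (C1_grad_square_penalty z ep) (C1_gradZ b (C1_grad_weight l N)).
have max1 : local_max T W1 (fun w => square_penalty e w z' + b * weight l N w) (z.1, z.2).
  rewrite /local_max nearE /within /=; apply: filterE => w sw.
  by rewrite -surjective_pairing; exact: freeze_l (zmax w z' sw sz').
(* [gradient_bound] speaks of maxima, so [W2] is treated through its negative. *)
have max2 : local_max T (fun t x => - W2 t x)
    (fun w => square_penalty e w z + b * weight l N w) (z'.1, z'.2).
  rewrite /local_max nearE /within /=; apply: filterE => w sw.
  rewrite -surjective_pairing ![square_penalty e _ z]square_penaltyC.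
  exact: freeze_r (zmax z w sz sw).
have min2 : local_min T W2 (fun w => - (square_penalty e w z + b * weight l N w)) (z'.1, z'.2).
  by apply: filterS max2 => w /=; rewrite -!opprD !opprK lerN2.
have [C1phi1 gt1 gx1] := C1_gradP hphi1.
have [C1phi2 gt2 gx2] := C1_gradP (C1_gradN hphi2).
have sz1 : 0 <= z.1 < T by rewrite z10. have sz1' : 0 <= z'.1 < T by rewrite z10'.
have := sub _ C1phi1 z.1 z.2 sz1 max1; rewrite gt1 gx1 => hsub.
have := sup _ C1phi2 z'.1 z'.2 sz1' min2; rewrite gt2 gx2 => hsup.
have hp := gradient_bound mu1le (ltW K10) hK1 hphi1 sz max1.
have hK2' (t : R) x y : 0 <= t <= T ->
    `|- W2 t x - - W2 t y| <= K2 * japanese_max x y `^ (mu - 1) * enorm (x - y).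
  by move=> tT; rewrite -opprD normrN; exact: hK2.
have hq := gradient_bound (W := fun t x => - W2 t x) mu1le (ltW K20) hK2' hphi2 sz' max2.
rewrite -!surjective_pairing in hsub hsup hp hq.
set p := (_ + _ : 'rV[R]_n) in hsub hp; set q' := (_ + _ : 'rV[R]_n) in hsup hq.
have Kp (Ki : R) (j : R) : 0 <= Ki -> Ki <= K1 + K2 ->
    (Ki * 2 `^ (mu - 1) + 1) * j `^ (mu - 1) <= K * j `^ (mu - 1).
  by move=> Ki0 KiK; rewrite ler_wpM2r ?powR_ge0// lerD2r ler_wpM2r ?powR_ge0.
have hp' : enorm p <= K * japanese z.2 `^ (mu - 1).
  by apply: (le_trans hp); apply: Kp; rewrite ?lerDl ltW.
have hq' : enorm (- q') <= K * japanese z'.2 `^ (mu - 1).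
  by rewrite enormN; apply: (le_trans hq); apply: Kp; rewrite ?lerDr ltW.
pose k := Num.min 1 (b * e0 / 4); have k0 : 0 < k by rewrite lt_min ltr01.
have k1 : k <= 1 by rewrite ge_min lexx.
have xy1 : enorm (z.2 - z'.2) <= 1 by exact: le_trans (ltW dx) dd4.
have [v [w [Uv Uw [hv hw] bv bw]]] := eff _ _ _ _ _ _ _ _ _ sz sz' xy1 k0 k1 hp' hq' hsub hsup.
have size (r a : R) : 0 < r -> 0 <= a -> a `^ r <= C * japanese z.2 `^ mu ->
    a <= (C * M `^ mu) `^ r^-1.
  move=> r0 a0 h; rewrite -[leLHS](_ : (a `^ r) `^ r^-1 = _); last first.
    by rewrite -powRrM mulfV ?gt_eqF// powRr1.
  apply: powR_ler; rewrite ?invr_ge0 ?(ltW r0) ?powR_ge0//; apply: (le_trans h).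
  by rewrite ler_wpM2l// powR_ler// ltW// japanese_gt0.
have [ff gg] := hd1 z z' v w sz sz' enz enz' Uv Uw (size _ _ rho10 (enorm_ge0 v) bv)
  (size _ _ rho20 (enorm_ge0 w) bw) (le_ball dd1 zz').
have flin := lin _ _ _ _ sz Uv Uw bv bw.
(* The gradients of the quadratic penalty at [z] and [z'] are opposite; only the gradients of the
   weights are left. *)
have pq : p + q' = b *: (weight_grad l N z + weight_grad l N z').
  rewrite /p /q' addrACA -scalerDr [X in e^-1 *: X](_ : _ = 0) ?scaler0 ?add0r -?scalerDr//.
  by rewrite -[z'.2 - z.2]opprB subrr.
(* [dq] is the effect of the weights on a common drift, [dr] that of the difference of the drifts at
   the two points. *)
pose dq := dotp (p + q') (dyn G z.1 z.2 v w).
pose dr := - dotp q' (dyn G z.1 z.2 v w - dyn G z'.1 z'.2 v w).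
have wz := weight_grad_le l N z; have wz' := weight_grad_le l N z'.
have jzz : japanese z.2 <= 2 * japanese z'.2.
  apply: le_trans (japanese_dist _ _) _; apply: le_trans (lerD (lexx _) xy1) _.
  by rewrite mulr_natl mulr2n lerD2l japanese_ge1.
have hdq : dq <= 2 * (b * D * N.+1%:R) * (weight l N z + weight l N z').
  rewrite /dq pq dotpZl.
  apply: le_trans (ler_wpM2l (ltW b0) (dotp_le _ _)) _.
  rewrite [leRHS](_ : _ = b * (2 * D * N.+1%:R * (weight l N z + weight l N z'))); last by ring.
  rewrite ler_wpM2l ?(ltW b0)//.
  apply: le_trans (ler_pM (enorm_ge0 _) (enorm_ge0 _) (ler_enormD _ _) flin) _.
  exact: weight_arith wz wz' jzz D0 (enorm_ge0 _) (ler0n _ _) (le_trans (ltW e00) etaz).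
have hdr : dr <= b * e0 / 4.
  rewrite /dr -dotpNl; apply: le_trans (dotp_le _ _) _.
  apply: le_trans (ler_pM (enorm_ge0 _) (enorm_ge0 _) (lexx _) ff) _.
  rewrite mulrC -[leRHS](divfK (lt0r_neq0 Q0)) ler_wpM2l ?(ltW eQ)//.
  apply: (le_trans hq'); rewrite -[leLHS]add0r /Q lerD// ler_wpM2l// powR_ler//.
    by rewrite subr_ge0.
  by rewrite ltW// japanese_gt0.
have hgg : running G z.1 z.2 v w - running G z'.1 z'.2 v w <= b * e0 / 4.
  by apply: (le_trans gg); rewrite ler_pdivrMr// ler_peMr// ltW.
have pqE : dotp p (dyn G z.1 z.2 v w) - dotp (- q') (dyn G z'.1 z'.2 v w) = dq + dr.
  rewrite /dq /dr dotpDl dotpNl opprK dotpBr; ring.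
have kb : k <= b * e0 / 4 by rewrite ge_min lexx orbT.
have N1 : 1 <= N.+1%:R :> R by rewrite ler1n.
have A1 : - (e^-1 * (z.1 - z'.1) - b * (l * N.+1%:R * weight l N z)) - k <=
    hamiltonian_at G z.1 z.2 p v w.
  by apply: le_trans hv; rewrite mulNr mulrN.
have A2 : hamiltonian_at G z'.1 z'.2 (- q') v w <=
    - (e^-1 * (z.1 - z'.1) + b * (l * N.+1%:R * weight l N z')) + k.
  apply: (le_trans hw); rewrite lerD2r -[z'.1 - z.1]opprB mulrN mulNr mulrN.
  by rewrite opprK opprD.
exact: comparison_arith A1 A2 erefl erefl pqE erefl erefl hdq hdr hgg kb N1 etaz etaz' b0 e00.
Qed.

End Comparison.

(** * The lower value *)

Lemma ereal_sub_ge0 (R : realType) (a : R) (H : \bar R) :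
  ((- a)%:E + H <= 0 -> 0 <= a%:E - H)%E.
Proof.
move=> /ereal_opp_ge; rewrite opprK; case: H => [r| |] //; last by move=> _; exact: leey.
by rewrite -EFinB !lee_fin subr_ge0.
Qed.

Lemma ereal_sub_le0 (R : realType) (a : R) (H : \bar R) :
  (0 <= (- a)%:E + H -> a%:E - H <= 0)%E.
Proof.
move=> /ereal_opp_le; rewrite opprK; case: H => [r| |] //; last by move=> _; exact: leNye.
by rewrite -EFinB !lee_fin subr_le0.
Qed.

Section Negation.
Context {R : realType} {n : nat}.
Implicit Types (W : R -> 'rV[R]_n -> R) (H : R -> 'rV[R]_n -> 'rV[R]_n -> \bar R).

Lemma growth_class_opp (T mu : R) W : growth_class T mu W -> growth_class T mu (fun t x => - W t x).
Proof.
move=> [cW [K K0 hK]]; split; first by move=> z; apply: cvgN; exact: cW.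
by exists K => // t x y tT; rewrite -opprD normrN; exact: hK.
Qed.

(** A test function touching [- W] from one side is the negative of one touching [W] from the other
    side, so subsolutions and supersolutions change places. *)
Lemma viscosity_solution_opp (T : R) H H' (h : 'rV[R]_n -> R) W :
  (forall (t : R) x p, 0 <= t <= T -> H' t x (- p) = (- H t x p)%E) ->
  viscosity_solution T H h W -> viscosity_solution T H' (fun x => - h x) (fun t x => - W t x).
Proof.
move=> HH [[cW s1 sub] [_ s2 sup]].
have cW' : continuous_on_slab T (fun t x => - W t x) by move=> z; apply: cvgN; exact: cW.
have opp_grad (phi : R * 'rV[R]_n -> R) z : C1 phi -> [/\ C1 (fun z => - phi z),
    time_derivative (fun z => - phi z) z = - time_derivative phi z &
    space_gradient (fun z => - phi z) z = - space_gradient phi z].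
  by move=> /C1_C1_grad /C1_gradN /C1_gradP[h1 h2 h3]; split.
have mem (t : R) : 0 <= t < T -> 0 <= t <= T by move=> /andP[-> /ltW ->].
split; split => //.
- by move=> x; rewrite lerN2.
- move=> phi C1phi t0 x0 t0T hmax.
  have [C1n gtn gxn] := opp_grad phi (t0, x0) C1phi.
  have /(sup _ C1n t0 x0 t0T) : local_min T W (fun z => - phi z) (t0, x0).
    by apply: filterS hmax => z /=; rewrite -!opprD lerN2 !opprK.
  rewrite gtn gxn -[space_gradient phi _]opprK HH ?mem// opprK.
  exact: ereal_sub_ge0.
- by move=> x; rewrite lerN2.
- move=> phi C1phi t0 x0 t0T hmin.
  have [C1n gtn gxn] := opp_grad phi (t0, x0) C1phi.
  have /(sub _ C1n t0 x0 t0T) : local_max T W (fun z => - phi z) (t0, x0).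
    by apply: filterS hmin => z /=; rewrite -!opprD lerN2 !opprK.
  rewrite gtn gxn -[space_gradient phi _]opprK HH ?mem// opprK.
  exact: ereal_sub_le0.
Qed.

End Negation.

Section Main.
Context {R : realType} {n : nat}.

Lemma upper_value_solution (m1 m2 : nat) (G : game R n m1 m2)
    (L c rho1 rho2 sigma1 sigma2 mu mu0 mu1 mu2 : R) :
  standing_hypotheses G L c rho1 rho2 sigma1 sigma2 mu mu0 mu1 mu2 ->
  unique_viscosity_solution (horizon G) (upper_hamiltonian G) (terminal G) mu (upper_value G).
Proof.
move=> hG; exists (value G).
have gV : growth_class (horizon G) mu (value G).
  by split; [exact: value_continuous hG | exact: value_lip hG].
have sV := value_viscosity hG; split => //.
  by move=> t x tT; rewrite (upper_valueE hG).
move=> W gW [subW supW] t x tT; have [subV supV] := sV; apply/eqP; rewrite eq_le.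
apply/andP; split; first exact: (comparison hG gW gV subW supV).
exact: (comparison hG gV gW subV supW).
Qed.

Variables (m1 m2 : nat) (G : game R n m1 m2).
Context (L c rho1 rho2 sigma1 sigma2 mu mu0 mu1 mu2 : R).
Hypothesis hG : standing_hypotheses G L c rho1 rho2 sigma1 sigma2 mu mu0 mu1 mu2.
Local Notation T := (horizon G).

(** Equality holds payoff by payoff: a strategy answers an essentially bounded control by another
    one, which is the setting of [payoff_swap]. *)
Lemma upper_value_swap (t : R) x : 0 <= t <= T ->
  upper_value (swap_game G) t x = (- lower_value G t x)%E.
Proof.
move=> /andP[t0 tT]; rewrite /lower_value ereal_infEN oppeK /upper_value image_comp.
congr ereal_sup; apply: eq_imagel => alpha [ha _] /=.
rewrite ereal_infEN image_comp; congr (- ereal_sup _)%E.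
apply: eq_imagel => u hu /=.
by rewrite (payoff_swap hG x t0 tT (ha _ (Linfty_L1 hu)) hu) opprK.
Qed.

Lemma upper_hamiltonian_swap (t : R) x p :
  upper_hamiltonian (swap_game G) t x (- p) = (- lower_hamiltonian G t x p)%E.
Proof.
rewrite /lower_hamiltonian ereal_supEN oppeK /upper_hamiltonian image_comp.
congr ereal_inf; apply: eq_imagel => u2 _ /=.
rewrite ereal_supEN image_comp; congr (- ereal_inf _)%E.
by apply: eq_imagel => u1 _ /=; rewrite dotpNl opprD !opprK.
Qed.

Lemma lower_value_solution :
  unique_viscosity_solution T (lower_hamiltonian G) (terminal G) mu (lower_value G).
Proof.
have [W [hW gW sW uW]] := upper_value_solution (swap_hypotheses hG).
exists (fun t x => - W t x); split.
- by move=> t x tT; have := hW t x tT; rewrite upper_value_swap// EFinN => <-; rewrite oppeK.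
- exact: growth_class_opp.
- have := @viscosity_solution_opp _ _ T (upper_hamiltonian (swap_game G)) (lower_hamiltonian G)
    (terminal (swap_game G)) W _ sW.
  rewrite (_ : (fun x => - terminal (swap_game G) x) = terminal G); last first.
    by apply/funext => x /=; rewrite opprK.
  by apply=> t x p tT; rewrite -{2}[p]opprK upper_hamiltonian_swap oppeK.
- move=> W' gW' sW' t x tT.
  have sW'' := @viscosity_solution_opp _ _ T (lower_hamiltonian G) (upper_hamiltonian (swap_game G))
    (terminal G) W' (fun t x p _ => upper_hamiltonian_swap t x p) sW'.
  by rewrite -(uW _ (growth_class_opp gW') sW'' t x tT) opprK.
Qed.

Lemma viscosity_solution_eq H H' h (W : R -> 'rV[R]_n -> R) :
  (forall (t : R) x p, 0 <= t <= T -> H t x p = H' t x p) ->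
  viscosity_solution T H h W -> viscosity_solution T H' h W.
Proof.
have mem (t : R) : 0 <= t < T -> 0 <= t <= T by move=> /andP[-> /ltW ->].
move=> HH [[cW s1 sub] [_ s2 sup]]; split; split => // phi C1phi t0 x0 t0T hm.
  by rewrite -HH ?mem//; exact: sub.
by rewrite -HH ?mem//; exact: sup.
Qed.

End Main.

Theorem theorem5p8 (R : realType) (n m1 m2 : nat) (G : game R n m1 m2)
    (L c rho1 rho2 sigma1 sigma2 mu mu0 mu1 mu2 : R)
    (hG : standing_hypotheses G L c rho1 rho2 sigma1 sigma2 mu mu0 mu1 mu2) :
  [/\ unique_viscosity_solution (horizon G) (upper_hamiltonian G) (terminal G)
        mu (upper_value G),
      unique_viscosity_solution (horizon G) (lower_hamiltonian G) (terminal G)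
        mu (lower_value G)
    & isaacs_condition G ->
      forall (t : R) (x : 'rV[R]_n), 0 <= t <= horizon G ->
        upper_value G t x = lower_value G t x].
Proof.
have up := upper_value_solution hG; have low := lower_value_solution hG.
split => // isaacs t x tT; have [W [hW _ _ uW]] := up; have [W' [hW' gW' sW' _]] := low.
(* Under the Isaacs condition the lower value solves the upper equation in the same class, and
   uniqueness there identifies the two values. *)
rewrite hW// hW'//; congr _%:E; apply/esym/uW => //.
by apply: viscosity_solution_eq sW' => s y p sT; rewrite isaacs.
Qed.
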